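(* Let $d\ge2$ and let $\underline{\mathcal V}$ be an unscaled wave profile with $\underline{\mathcal V}\cdot\underline{\mathcal V}_x\not\equiv0$. Assume that $\Sigma_t$ is non singular and that $\omega_0$ is a real eigenvalue of $(\Sigma_t)^{-1}$ of algebraic multiplicity $r_0$. If either $$r_0\ge3\quad\text{and}\quad\delta_{(1,2,1)}+\delta_{(2,1,1)}\omega_0+\delta_{(3,0,1)}\omega_0^2\neq0,$$ or $$r_0=2\quad\text{and}\quad\frac{\delta_{(1,2,1)}+\delta_{(2,1,1)}\omega_0+\delta_{(3,0,1)}\omega_0^2}{\frac1{r_0!}\partial_\lambda^{r_0}\Delta_0(\omega_0,1,0)}<0,$$ then the corresponding wave is spectrally unstable.
   Context: Let $\kappa,W:[0,\infty)\to\mathbb R$ be smooth with $\kappa$ positive and bounded away from $0$, and $J=\begin{pmatrix}0&1\\-1&0\end{pmatrix}$. For $U=U(t,x,y)\in\mathbb R^2$, $(x,y)\in\mathbb R\times\mathbb R^{d-1}$, consider $\partial_tU=J\,\delta\mathscr H_0[U]$ with $\mathscr H_0[U]=\frac12\kappa(\|U\|^2)\|\nabla U\|^2+W(\|U\|^2)$. For a functional density $\mathcal A(U,\nabla U)$, $\delta\mathcal A=\nabla_U\mathcal A-\mathrm{div}(\nabla_{\nabla U}\mathcal A)$ and $\mathrm{Hess}\,\mathcal A$ is the linearization of $\delta\mathcal A$. Set $\mathscr M[U]=\frac12\|U\|^2$, $\mathscr Q_1[U]=\frac12JU\cdot\partial_xU$. Unscaled wave profiles: given $(\omega_\phi,c_x)$,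 a smooth $\mathcal V:\mathbb R\to\mathbb R^2$, function of $x$, with $\delta(\mathscr H_0-\omega_\phi\mathscr M+c_x\mathscr Q_1)[\mathcal V]=0$ and $\mathcal V(\cdot+X_x)=e^{\xi_\phi J}\mathcal V$; when $\mathcal V\cdot\mathcal V_x\not\equiv0$, $X_x$ is the fundamental period of $\|\mathcal V\|^2$ and $\xi_\phi=\int_0^{X_x}\|\mathcal V\|^{-2}J\mathcal V\cdot\mathcal V_x$. Constants of integration: $\mu_\phi=\kappa(\|\mathcal V\|^2)J\mathcal V\cdot\mathcal V_x+\frac{c_x}2\|\mathcal V\|^2$, $\mu_x=\frac12\kappa(\|\mathcal V\|^2)\|\mathcal V_x\|^2-W(\|\mathcal V\|^2)+\frac{\omega_\phi}2\|\mathcal V\|^2$. Up to rotations and translations, nearby profiles are smoothly parametrized by $(\omega_\phi,c_x,\mu_\phi,\mu_x)$. With $k_x=1/X_x$, $k_\phi=\xi_\phi/X_x$, the scaled $1$-periodic profile $\mathcal U$ is given by $\mathcal V(x)=e^{k_\phi xJ}\mathcal U(k_xx)$. With $\mathscr H[V]=\mathscr H_0(V,(\underline k_x\partial_x+\underline k_\phi J)V,\nabla_yV)-\underline\omega_\phi\mathscr M[V]+\underline c_x\mathscr Q_1(V,(\underline k_x\partial_x+\underline k_\phi J)V)$, let $\mathcal L=J\,\mathrm{Hess}\,\mathscr H[\underline{\mathcal U}]$ on $L^2(\mathbb R^d;\mathbb C^2)$; the wave is spectrally unstable if the spectrum of $\mathcal L$ contains points of positive real part. Polynomial $\Delta_0$: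 $\Delta_0(\lambda,z,\zeta)=\det\big(\lambda\Sigma_t-z\,\mathrm I_4+\frac{\zeta^2}{\lambda}\Sigma_y\big)$, a real homogeneous polynomial of degree $4$ (extended by continuity to $\lambda=0$), where, with evaluation at the parameters of $\underline{\mathcal V}$, $\Sigma_t$ is the Jacobian matrix with respect to $(\omega_\phi,c_x,\mu_\phi,\mu_x)$ of $\big(\xi_\phi,\;X_x,\;\int_0^{X_x}\mathscr M[\mathcal V],\;\int_0^{X_x}\mathscr Q_1[\mathcal V]\big)^{\sf T}$ and $$\Sigma_y=\begin{pmatrix}0&0&0&0\\ 0&0&0&0\\ \sigma_1&-\sigma_2&0&0\\ \sigma_2&-\sigma_3&0&0\end{pmatrix},\quad\sigma_1=\int_0^{\underline X_x}\kappa(\|\underline{\mathcal V}\|^2)\|\underline{\mathcal V}\|^2,\ \sigma_2=\int_0^{\underline X_x}\kappa(\|\underline{\mathcal V}\|^2)J\underline{\mathcal V}\cdot\underline{\mathcal V}_x,\ \sigma_3=\int_0^{\underline X_x}\kappa(\|\underline{\mathcal V}\|^2)\|\underline{\mathcal V}_x\|^2 .$$ The coefficients $\delta_{(m,n,p)}$ are defined by $$\Delta_0(\lambda,z,\zeta)=\sum_{0\le m,n,p\le4,\ m+n+p=4,\ p\le m}\delta_{(m,n,p)}\,\lambda^{m-p}z^n\zeta^{2p}.$$ *)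

(* Defs.v *)
From HB Require Import structures.
From mathcomp Require Import all_boot all_order all_algebra.
From mathcomp Require Import all_classical all_reals all_analysis.
From mathcomp Require Import complex.
Import Order.TTheory GRing.Theory Num.Theory.
Import numFieldNormedType.Exports.

Set Implicit Arguments.
Unset Strict Implicit.
Unset Printing Implicit Defensive.

Local Open Scope classical_set_scope.
Local Open Scope ring_scope.

(** Space points (x, y_1, ..., y_n) are row vectors of 'rV[R]_n.+1, with x the
    coordinate of index 0 and n = d - 1.  A state U is a column vector of
    'cV[R]_2, and a gradient is a 2 x (n+1) matrix whose j-th column is the
    derivative of U along the j-th coordinate.  The library's norm on matrices
    is the sup norm, so Euclidean quantities go through [dot] and [sqnorm]. *)

Section Algebra.
Variable R : realType.

Definition seq_mx m n (s : seq (seq R)) : 'M[R]_(m, n) :=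
  \matrix_(i, j) nth 0 (nth [::] s i) j.

Definition Jmx : 'M[R]_2 := seq_mx 2 2
  [:: [:: 0; 1];
      [:: -1; 0] ].

Definition dot (u v : 'cV[R]_2) : R := \sum_i u i 0 * v i 0.

Definition sqnorm m n (A : 'M[R]_(m, n)) : R := \sum_i \sum_j A i j ^+ 2.

(** The exponential of a J: as J^2 = - I, it is cos a I + sin a J. *)
Definition expJ (a : R) : 'M[R]_2 := (cos a)%:M + sin a *: Jmx.

End Algebra.

Section Smoothness.
Variable R : realType.

(** C^oo on an open set O: every iterated directional derivative is
    (Frechet) differentiable at every point of O. *)
Definition smooth_on (E F : normedModType R) (O : set E) (f : E -> F) : Prop :=
  forall (vs : seq E) (x : E), O x ->
    differentiable (foldr (fun v (g : E -> F) => 'D_v g) f vs) x.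

(** Smoothness up to the boundary of a function on [0, +oo[, whose values at
    negative arguments are irrelevant. *)
Definition smooth_halfline (f : R -> R) : Prop :=
  exists2 g : R -> R, smooth_on setT g & forall r, 0 <= r -> f r = g r.

End Smoothness.

Section Variational.
Variables (R : realType) (n : nat).

Definition density := 'cV[R]_2 -> 'M[R]_(2, n.+1) -> R.

Implicit Types (A : density) (U : 'cV[R]_2) (G : 'M[R]_(2, n.+1)).
Implicit Types V : 'rV[R]_n.+1 -> 'cV[R]_2.

Definition nabla V (z : 'rV[R]_n.+1) : 'M[R]_(2, n.+1) :=
  \matrix_(i, j) ('D_(delta_mx 0 j) V z) i 0.

Definition grad_state A U G : 'cV[R]_2 :=
  \col_i 'D_(delta_mx i 0) (A ^~ G) U.

Definition grad_grad A U G : 'M[R]_(2, n.+1) :=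
  \matrix_(i, j) 'D_(delta_mx i j) (A U) G.

Definition divergence (F : 'rV[R]_n.+1 -> 'M[R]_(2, n.+1)) (z : 'rV[R]_n.+1)
    : 'cV[R]_2 :=
  \sum_j 'D_(delta_mx 0 j) (fun w => col j (F w)) z.

(** delta A [V] = nabla_U A - div (nabla_{nabla U} A), at (V, nabla V) *)
Definition euler_lagrange A V (z : 'rV[R]_n.+1) : 'cV[R]_2 :=
  grad_state A (V z) (nabla V z)
  - divergence (fun w => grad_grad A (V w) (nabla V w)) z.

(** The linearization of V |-> delta A [V] at V, in the direction h. *)
Definition Hess A V (h : 'rV[R]_n.+1 -> 'cV[R]_2) (z : 'rV[R]_n.+1)
    : 'cV[R]_2 :=
  derive1 (fun s : R => euler_lagrange A (fun w => V w + s *: h w) z) 0.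

Variables kappa W : R -> R.

Definition H0 : density := fun U G =>
  2^-1 * kappa (sqnorm U) * sqnorm G + W (sqnorm U).

Definition Mass : density := fun U _ => 2^-1 * sqnorm U.

Definition Q1 : density := fun U G => 2^-1 * dot (Jmx R *m U) (col 0 G).

(** Replaces the x-column G_0 of the gradient by k_x G_0 + k_phi J U. *)
Definition twist (kx kphi : R) U G : 'M[R]_(2, n.+1) :=
  \matrix_(i, j)
    if j == 0 then kx * G i j + kphi * (Jmx R *m U) i 0 else G i j.

Definition unscaled_density (omega c : R) : density := fun U G =>
  H0 U G - omega * Mass U G + c * Q1 U G.

Definition scaled_density (kx kphi omega c : R) : density := fun U G =>
  unscaled_density omega c U (twist kx kphi U G).

(** A function of x seen as a function of (x, y). *)
Definition lift_x (v : R -> 'cV[R]_2) : 'rV[R]_n.+1 -> 'cV[R]_2 :=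
  fun z => v (z 0 0).

End Variational.

Section Profiles.
Variables (R : realType) (n : nat) (kappa W : R -> R).
Implicit Types v : R -> 'cV[R]_2.

Local Notation leb := (@lebesgue_measure R).

Definition variable_modulus v : Prop := exists x, dot (v x) (derive1 v x) != 0.

Definition fundamental_period (X : R) (f : R -> R) : Prop :=
  [/\ 0 < X, (forall x, f (x + X) = f x) &
      forall T, 0 < T < X -> ~ (forall x, f (x + T) = f x)].

Definition phase_shift v (X : R) : R :=
  Rintegral leb `[0, X]
    (fun x => (sqnorm (v x))^-1 * dot (Jmx R *m v x) (derive1 v x)).

Record wave_profile (omega c mu_phi mu_x : R) v (X xi : R) : Prop :=
  WaveProfile {
    profile_smooth : smooth_on setT v ;
    profile_equation :
      forall z, euler_lagrange (unscaled_density (n:=n) kappa W omega c)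
                  (lift_x v) z = 0 ;
    profile_X_gt0 : 0 < X ;
    profile_shift : forall x, v (x + X) = expJ xi *m v x ;
    profile_period : variable_modulus v ->
      fundamental_period X (fun x => sqnorm (v x)) /\ xi = phase_shift v X ;
    profile_mu_phi : forall x,
      mu_phi = kappa (sqnorm (v x)) * dot (Jmx R *m v x) (derive1 v x)
               + c / 2 * sqnorm (v x) ;
    profile_mu_x : forall x,
      mu_x = 2^-1 * kappa (sqnorm (v x)) * sqnorm (derive1 v x)
             - W (sqnorm (v x)) + omega / 2 * sqnorm (v x)
  }.

(** A smooth parametrization of wave profiles, defined for the parameters
    p = (omega_phi, c_x, mu_phi, mu_x) in an open set O. *)
Record profile_family (O : set 'rV[R]_4) (V : 'rV[R]_4 -> R -> 'cV[R]_2)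
    (X xi : 'rV[R]_4 -> R) : Prop := ProfileFamily {
  family_open : open O ;
  family_profile : forall p, O p ->
    wave_profile (p 0 0) (p 0 1) (p 0 2) (p 0 3) (V p) (X p) (xi p) ;
  family_smooth :
    smooth_on [set q : 'rV[R]_4 * R | O q.1] (fun q => V q.1 q.2) ;
  family_X_smooth : smooth_on O X ;
  family_xi_smooth : smooth_on O xi
}.

Definition mass_integral v (X : R) : R :=
  Rintegral leb `[0, X] (fun x => 2^-1 * sqnorm (v x)).

Definition Q1_integral v (X : R) : R :=
  Rintegral leb `[0, X] (fun x => 2^-1 * dot (Jmx R *m v x) (derive1 v x)).

(** Row i is the gradient in p = (omega_phi, c_x, mu_phi, mu_x) of the i-th
    component of (xi_phi, X_x, int M[V], int Q1[V]). *)
Definition Sigma_t (V : 'rV[R]_4 -> R -> 'cV[R]_2) (X xi : 'rV[R]_4 -> R)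
    (p0 : 'rV[R]_4) : 'M[R]_4 :=
  \matrix_(i, j) 'D_(delta_mx 0 j)
    (fun p => nth 0 [:: xi p; X p; mass_integral (V p) (X p);
                        Q1_integral (V p) (X p)] i) p0.

Definition Sigma_y v (X : R) : 'M[R]_4 :=
  let s1 := Rintegral leb `[0, X]
    (fun x => kappa (sqnorm (v x)) * sqnorm (v x)) in
  let s2 := Rintegral leb `[0, X]
    (fun x => kappa (sqnorm (v x)) * dot (Jmx R *m v x) (derive1 v x)) in
  let s3 := Rintegral leb `[0, X]
    (fun x => kappa (sqnorm (v x)) * sqnorm (derive1 v x)) in
  seq_mx 4 4 [:: [:: 0;  0;    0; 0];
                 [:: 0;  0;    0; 0];
                 [:: s1; - s2; 0; 0];
                 [:: s2; - s3; 0; 0] ].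

(** The polynomial Delta_0 written on its coefficients. *)
Definition Delta0 (delta : nat -> nat -> nat -> R) (lambda z zeta : R) : R :=
  \sum_(m < 5) \sum_(k < 5) \sum_(p < 5 | (m + k + p == 4)%N && (p <= m)%N)
    delta m k p * lambda ^+ (m - p) * z ^+ k * zeta ^+ (2 * p).

(** The determinant is not defined at lambda = 0; there Delta_0 is its
    continuous extension.  This determines delta_(m, k, p) for
    m + k + p = 4 and p <= m, the only values that [Delta0] uses. *)
Definition Delta0_coefficients (St Sy : 'M[R]_4)
    (delta : nat -> nat -> nat -> R) : Prop :=
  forall lambda z zeta : R, lambda != 0 ->
    \det (lambda *: St - z%:M + (zeta ^+ 2 / lambda) *: Sy)
    = Delta0 delta lambda z zeta.

End Profiles.

Section LebesgueRn.
Variable R : realType.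

Definition cons_tuple n (p : R * n.-tuple R) : n.+1.-tuple R :=
  [tuple of p.1 :: p.2].

Lemma measurable_cons_tuple n : measurable_fun setT (@cons_tuple n).
Proof. by apply: measurable_cons; [exact: measurable_fst|exact: measurable_snd].
Qed.

Definition lebesgue_step n (mu : {measure set (n.-tuple R) -> \bar R})
    : {measure set (n.+1.-tuple R) -> \bar R} :=
  measure_function_pushforward__canonical__measure_function_Measure
    (@lebesgue_measure R \x^ mu)%E (@measurable_cons_tuple n).

(** Lebesgue measure on R^n, as an iterated product measure: each step is the
    image under [cons_tuple] of the product with the measure on R. *)
Fixpoint lebesgue_tuple n : {measure set (n.-tuple R) -> \bar R} :=
  if n is m.+1 then lebesgue_step (lebesgue_tuple m)
  else dirac ([tuple] : 0.-tuple R).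

End LebesgueRn.

Section Spectrum.
Variables (R : realType) (n : nat).
Local Notation C := (R[i]).
Local Notation space := 'rV[R]_n.+1.
Local Notation field := (space -> 'cV[C]_2).
Local Notation mu := (lebesgue_tuple R n.+1).

Definition tuple_row (t : n.+1.-tuple R) : space := \row_i tnth t i.

Definition Re_field (u : field) (z : space) : 'cV[R]_2 :=
  map_mx (@complex.Re R) (u z).
Definition Im_field (u : field) (z : space) : 'cV[R]_2 :=
  map_mx (@complex.Im R) (u z).

Definition in_L2 (u : field) : Prop := forall i,
  (fun t => Re_field u (tuple_row t) i 0) \in Lfun mu 2%:E /\
  (fun t => Im_field u (tuple_row t) i 0) \in Lfun mu 2%:E.

Definition L2norm (u : field) : \bar R :=
  Lnorm mu 2%:E (fun t =>
    (Num.sqrt (sqnorm (Re_field u (tuple_row t))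
               + sqnorm (Im_field u (tuple_row t))))%:E).

Definition test_field (u : field) : Prop :=
  [/\ smooth_on setT (Re_field u), smooth_on setT (Im_field u) &
      exists M : R, forall z, M < `|z| -> u z = 0].

(** J Hess A [V], extended by C-linearity to complex-valued fields. *)
Definition linearized (A : density R n) (V : space -> 'cV[R]_2) (u : field)
    : field := fun z =>
  \col_i (Complex ((Jmx R *m Hess A V (Re_field u) z) i 0)
                  ((Jmx R *m Hess A V (Im_field u) z) i 0)).

(** The operators of interest are second-order elliptic with smooth bounded
    coefficients.  On L^2, with domain H^2, such an operator is the closure of
    its restriction to compactly supported smooth fields; the relation below
    is the graph of this closure. *)
Definition graph_closure (L : field -> field) (u f : field) : Prop :=
  [/\ in_L2 u, in_L2 f &
   exists phi : nat -> field,
   [/\ forall k, test_field (phi k),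
       L2norm (fun z => phi k z - u z) @[k --> \oo] --> 0%E &
       L2norm (fun z => L (phi k) z - f z) @[k --> \oo] --> 0%E] ].

(** lambda - L is a bijection from its domain onto L^2 with bounded inverse.
    Fields are identified when they agree almost everywhere, whence the norms
    in place of equalities. *)
Definition in_resolvent_set (L : field -> field) (lambda : C) : Prop :=
  (exists K : R, forall u f, graph_closure L u f ->
     (L2norm u <= K%:E * L2norm (fun z => (lambda *: u z - f z)%R))%E) /\
  (forall g, in_L2 g -> exists u f, graph_closure L u f /\
     L2norm (fun z => lambda *: u z - f z - g z) = 0%E).

Definition in_spectrum (L : field -> field) (lambda : C) : Prop :=
  ~ in_resolvent_set L lambda.

Definition spectrally_unstable (kappa W : R -> R) (omega c X xi : R)
    (u : R -> 'cV[R]_2) : Prop :=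
  exists2 lambda : C, 0 < complex.Re lambda &
    in_spectrum
      (linearized (scaled_density kappa W (X^-1) (xi / X) omega c)
                  (lift_x u)) lambda.

End Spectrum.

(* Main.v *)
(** Modes e^(lambda t + i eta y) v(x) of the linearized equation satisfy, in the
    unscaled frame, Hess v + eta^2 kappa v + lambda J v = 0, an ODE in x.  We look
    for Bloch solutions v(x + X) = e^(i eps) e^(xi J) v(x) with lambda = eps z and
    eta^2 = eps^2 z2.  At eps = 0 the solutions are known explicitly: J V and V_x,
    together with the derivatives of the profile family along the parameters; two
    coordinates of the jump v(x + X) - e^(i eps) e^(xi J) v(x) are controlled by
    the differentials of the constants of integration, which are conserved to first
    order.  Dividing out powers of eps, the Bloch condition becomes
      det (z Sigma_t - i I + (z2 / z) Sigma_y) + O(eps) = 0.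
    Setting z = i (omega0 + rho nu) and z2 = rho^r0 for a small rho, the leading
    part in nu is a nu^r0 - N, with a and N as in the hypotheses: when r0 >= 3, or
    r0 = 2 and N / a < 0, some root nu makes Re z > 0, and Newton's method makes it
    persist for small rho and eps.  Finally the bounded Bloch wave, multiplied by a
    cutoff of radius k, is a Weyl sequence: its residual is O(1/k) while its L^2
    norm grows like k^(d/2), so lambda lies in the spectrum. *)

Require Import Defs.
From HB Require Import structures.
From mathcomp Require Import all_boot all_order all_algebra.
From mathcomp Require Import all_classical all_reals all_analysis.
From mathcomp Require Import measurable_realfun complex ring lra.
Import Order.TTheory GRing.Theory Num.Theory.
Import numFieldNormedType.Exports.
Set Implicit Arguments.
Unset Strict Implicit.
Unset Printing Implicit Defensive.
Local Open Scope classical_set_scope.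
Local Open Scope ring_scope.
Import Normc.

(** * Real calculus and linear differential equations *)

(** The modes [v0] (J V, - V_x, 0, 0) and the parameter derivatives [Q] of the profile are paired so
    that Hess Q_a = - J v0_a. Hence v0_a + eps z Q_a solves the equation up to order eps^2, and only
    a remainder with zero initial data is left to Gronwall's inequality. The differentials of mu_phi
    and mu_x vanish on J V and V_x; in coordinates where they come last, the last two rows of the
    jump start at order eps^2, and their leading part integrates the source against J V and V_x.
    This is how the mass, the momentum and the sigma_i enter. Dependence on z is never
    differentiated. Remainders are kept bounded and Lipschitz in z, uniformly in eps; this class is
    stable under sums, products and determinants, and suffices for a Newton iteration with a frozen
    slope. The choice z2 = rho^r0 balances the factor (rho nu)^r0 of the determinant at a root of
    multiplicity r0. With z = i mu it enters as - rho^r0 / mu, so the identity defining Delta_0,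
    which involves squares zeta^2, is first extended to all real values and to complex mu. *)

Section DerivativeRules.
Context {R : realType} {E : normedModType R}.
Implicit Types f g : E -> R.

(** Restated for functions written pointwise, the syntactic form on which the tactic [deriv]
    dispatches. *)
Lemma is_derive_fD f g x v df dg : is_derive x v f df -> is_derive x v g dg ->
  is_derive x v (fun y => f y + g y) (df + dg).
Proof. exact: is_deriveD. Qed.

Lemma is_derive_fB f g x v df dg : is_derive x v f df -> is_derive x v g dg ->
  is_derive x v (fun y => f y - g y) (df - dg).
Proof. exact: is_deriveB. Qed.

Lemma is_derive_fN f x v df : is_derive x v f df ->
  is_derive x v (fun y => - f y) (- df).
Proof. exact: is_deriveN. Qed.

Lemma is_derive_fM f g x v df dg : is_derive x v f df -> is_derive x v g dg ->
  is_derive x v (fun y => f y * g y) (df * g x + f x * dg).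
Proof.
move=> Df Dg; have D := is_deriveM Df Dg; apply: (is_derive_eq D).
by rewrite /= addrC /GRing.scale /= mulrC [X in _ + X]mulrC mulrC [g x * df]mulrC.
Qed.

Lemma is_derive_fX f n x v df : is_derive x v f df ->
  is_derive x v (fun y => f y ^+ n) (n%:R * f x ^+ n.-1 * df).
Proof.
move=> Df; elim: n => [|n IH].
  by rewrite !mul0r; exact: (is_derive_cst (1 : R)).
apply: (is_derive_eq (f' := df * f x ^+ n + f x * (n%:R * f x ^+ n.-1 * df))).
  rewrite (_ : (fun y => _) = (fun y => f y * f y ^+ n)); last first.
    by apply: funext => y; rewrite exprS.
  exact: is_derive_fM.
case: n {IH} => [|n] /=; first by rewrite expr0; ring.
by rewrite exprS -[n.+2%:R]natr1; ring.
Qed.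

Lemma is_derive_fcst (c : R) x v : is_derive x v (fun _ : E => c) 0.
Proof. exact: is_derive_cst. Qed.

(** Along a line a directional derivative becomes an ordinary one; this carries one-variable
    results, such as the chain rule below, over to functions on a normed space. *)
Lemma derive_line (F : normedModType R) (g : E -> F) x v :
  'D_1 (fun h : R => g (h *: v + x)) 0 = 'D_v g x.
Proof.
rewrite /derive.
have -> // : (fun h : R => h^-1 *: (((fun k : R => g (k *: v + x)) \o shift 0)
    (h *: 1) - g (0 *: v + x))) =
  (fun h : R => h^-1 *: ((g \o shift x) (h *: v) - g x)).
by apply: funext => h /=; rewrite addr0 scale0r add0r [h *: 1]mulr1.
Qed.

Lemma is_derive_line (F : normedModType R) (g : E -> F) x v b :
  is_derive x v g b <-> is_derive (0 : R) 1 (fun h : R => g (h *: v + x)) b.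
Proof.
by split=> -[d <-]; apply: DeriveDef; rewrite ?derive_line//; by [apply/derivable1P|move/derivable1P: d].
Qed.

Lemma is_derive_fcomp (f : R -> R) g x v a b :
  is_derive (g x) 1 f a -> is_derive x v g b ->
  is_derive x v (fun y => f (g y)) (a * b).
Proof.
move=> Df Dg; apply/is_derive_line.
apply: (is_derive1_comp (f := f) (g := fun h : R => g (h *: v + x))).
  by rewrite scale0r add0r.
exact/is_derive_line.
Qed.

End DerivativeRules.

(** Derivatives of the atoms are looked up in the context, so the proofs state them there before
    calling [derivE]. What [derivE] leaves is the equality between the computed value and the
    announced one. *)
Ltac deriv1 := first
  [ eassumption
  | exact: is_derive_fcst
  | (lazymatch goal with
     | |- is_derive _ _ (fun y => _ + - _) _ => notypeclasses refine (is_derive_fB _ _)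
     | |- is_derive _ _ (fun y => _ + _) _ => notypeclasses refine (is_derive_fD _ _)
     | |- is_derive _ _ (fun y => - _) _ => notypeclasses refine (is_derive_fN _)
     | |- is_derive _ _ (fun y => _ * _) _ => notypeclasses refine (is_derive_fM _ _)
     | |- is_derive _ _ (fun y => _ ^+ _) _ => notypeclasses refine (is_derive_fX _ _)
     end)
  | solve [eauto 2]
  | exact: is_derive_id ].
Ltac deriv := repeat deriv1.
Ltac derivE := notypeclasses refine (is_derive_eq _ _); [deriv|].

(** * Primitives and mean value inequalities *)

Section Antiderivative.
Variable R : realType.
Implicit Types f g F G : R -> R.
Local Notation leb := (@lebesgue_measure R).

Lemma is_derive_continuous F f x :
  is_derive x (1 : R) F (f x) -> {for x, continuous F}.
Proof. by case=> d _; apply/differentiable_continuous/derivable1_diffP. Qed.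

Lemma integrable_continuous f a b : continuous f ->
  leb.-integrable `[a, b] (EFin \o f).
Proof.
move=> cf; apply: continuous_compact_integrable; first exact: segment_compact.
exact/continuous_subspaceT.
Qed.

Lemma Rintegral_split f a b c : continuous f -> a <= b -> b <= c ->
  Rintegral leb `[a, c] f = Rintegral leb `[a, b] f + Rintegral leb `[b, c] f.
Proof.
move=> cf ab bc; apply/eqP; rewrite addrC -subr_eq; apply/eqP.
rewrite Rintegral_itvB//=; last exact: integrable_continuous.
rewrite Rintegral_itv_obnd_cbnd//.
by apply: integrableS (integrable_continuous b c cf) => //; exact: subset_itv_oc_cc.
Qed.

Lemma ex_antiderivative f : continuous f ->
  exists F, F 0 = 0 /\ forall x, is_derive x (1 : R) F (f x).
Proof.
move=> cf.
pose I (a x : R) := Rintegral leb `[- a, x] f.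
(* Integrals run over segments with ordered endpoints, so the base point is placed to the left of
   both 0 and x. By [IE] the difference is the same for all such base points, and in a neighbourhood
   of x a fixed one can be used. *)
pose F (x : R) := I (`|x| + 1) x - I (`|x| + 1) 0.
have IE (a b x : R) : 0 < b -> b <= a -> - b <= x -> I a x - I a 0 = I b x - I b 0.
  move=> b0 ba bx; have ab : - a <= - b by rewrite lerN2.
  rewrite /I (Rintegral_split cf ab bx) (@Rintegral_split f (- a) (- b) 0)//.
    by ring.
  by rewrite lerNl oppr0 ltW.
have FE (x a : R) : `|x| + 1 <= a -> F x = I a x - I a 0.
  move=> xa; rewrite /F (IE a (`|x| + 1))//;
    by have := normr_ge0 x; have := ler_norm (- x); rewrite normrN; lra.
exists F; split=> [|x]; first by rewrite /F subrr.
pose a := `|x| + 2.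
have xa : - a < x.
  by have := ler_norm (- x); rewrite normrN /a; lra.
have [dI I'] := continuous_FTC1_closed (ltr_pwDr ltr01 (lexx x))
   (integrable_continuous (- a) (x + 1) cf) xa (cf x).
have DI : is_derive x (1 : R) (fun y => I a y - I a 0) (f x).
  apply: (is_derive_eq (f' := f x - 0)); last by rewrite subr0.
  apply: (is_derive_fB (f := I a) (g := fun=> I a 0)).
    by split; [exact: dI | rewrite -derive1E; exact: I'].
apply: (near_eq_is_derive _ DI).
near=> y; rewrite (FE y a)// /a.
have : `|x - y| < 1 by near: y; exact: (@nbhsx_ballx _ R x 1 ltr01).
by have := ler_normD (y - x) x; rewrite subrK (distrC y x); lra.
Unshelve. all: by end_near. Qed.

Lemma Rintegral_antiderivative f F a b : a < b -> continuous f ->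
  (forall x, is_derive x (1 : R) F (f x)) ->
  Rintegral leb `[a, b] f = F b - F a.
Proof.
move=> ab cf DF.
have cF x : {for x, continuous F} by exact: is_derive_continuous (DF x).
rewrite /Rintegral (continuous_FTC2 ab (F := F))//.
- exact/continuous_subspaceT.
- split=> [x _||]; first exact: (@ex_derive _ _ _ _ _ _ _ (DF x)).
    exact/cvg_at_right_filter/cF.
  exact/cvg_at_left_filter/cF.
- by move=> x _; rewrite derive1E (@derive_val _ _ _ _ _ _ _ (DF x)).
Qed.

(** The mean value theorem for G - F. Most estimates of integrals below take this form, through
    primitives. *)
Lemma mean_value_le F G f g (a b : R) : a <= b ->
  (forall x : R, a <= x <= b -> is_derive x (1 : R) F (f x)) ->
  (forall x : R, a <= x <= b -> is_derive x (1 : R) G (g x)) ->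
  (forall x : R, a <= x <= b -> f x <= g x) -> F b - F a <= G b - G a.
Proof.
move=> ab DF DG fg.
have DH (x : R) : a <= x <= b -> is_derive x (1 : R) (fun y => G y - F y) (g x - f x).
  by move=> xab; apply: is_derive_fB; [exact: DG|exact: DF].
have cH : {within `[a, b], continuous (fun y => G y - F y)}.
  apply: derivable_within_continuous => x; rewrite in_itv => xab.
  exact: (@ex_derive _ _ _ _ _ _ _ (DH x xab)).
have [x /[!in_itv] xab|c /[!in_itv] /fg + E] := @MVT_segment R (fun y => G y - F y) (fun x => g x - f x) a b ab _ cH.
  by apply: DH; case/andP: xab => /ltW -> /ltW ->.
rewrite -subr_ge0 => /mulr_ge0/(_ (_ : 0 <= b - a)).
rewrite subr_ge0 => /(_ ab); move: E => /= <-; lra.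
Qed.

Lemma mean_value_norm F G f g (a b : R) : a <= b ->
  (forall x : R, a <= x <= b -> is_derive x (1 : R) F (f x)) ->
  (forall x : R, a <= x <= b -> is_derive x (1 : R) G (g x)) ->
  (forall x : R, a <= x <= b -> `|f x| <= g x) -> `|F b - F a| <= G b - G a.
Proof.
move=> ab DF DG fg; rewrite ler_norml; apply/andP; split.
  rewrite lerNl opprB -[F a - _]opprB opprB.
  have := @mean_value_le (fun x => - F x) G (fun x => - f x) g a b ab.
  rewrite opprK [- F b + _]addrC; apply=> // x xab.
    exact/is_derive_fN/DF.
  by rewrite (le_trans _ (fg x xab))// -normrN ler_norm.
apply: (mean_value_le ab DF DG) => x xab.
by rewrite (le_trans _ (fg x xab))// ler_norm.
Qed.

End Antiderivative.

(** * Picard iteration for linear systems with bounded coefficients *)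

Section Growth.
Variable R : realType.
Implicit Types f F : R -> R.

Lemma continuous_fsum (T : topologicalType) (J : Type) (r : seq J)
    (F : J -> T -> R) : (forall j, continuous (F j)) ->
  continuous (fun x => \sum_(j <- r) F j x).
Proof.
move=> cF; elim: r => [|j r IH] x.
  by rewrite (_ : (fun _ => _) = cst 0); [exact: cvg_cst|
    apply: funext => y; rewrite big_nil].
rewrite (_ : (fun _ => _) = (fun x => F j x + \sum_(j <- r) F j x)).
  by apply: continuousD; [exact: cF|exact: IH].
by apply: funext => y; rewrite big_cons.
Qed.

Lemma continuous_bounded f (T : R) : 0 < T -> continuous f ->
  exists2 C : R, 0 <= C & forall x, `|x| <= T -> `|f x| <= C.
Proof.
move=> T0 cf.
have cn : {within `[- T, T], continuous (fun x => `|f x|)}.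
  apply: continuous_subspaceT => x.
  exact: (continuous_comp (cf x) (@norm_continuous _ R _)).
have [c _ hc] := EVT_max (ge0_cp (ltW T0)).2 cn.
exists `|f c| => // x; rewrite ler_norml => xT; apply: hc.
by rewrite in_itv.
Qed.

(** Integrating the weight [expR (L * |x|)] gains a factor 1 / L. In the norm with this weight, the
    Picard map contracts on intervals of any length. *)
Lemma growth_antiderivative F f (L c T : R) : 0 < T -> F 0 = 0 ->
  (forall x : R, is_derive x (1 : R) F (f x)) -> 0 <= c -> 0 < L ->
  (forall x : R, `|x| <= T -> `|f x| <= c * L * expR (L * `|x|)) ->
  forall x : R, `|x| <= T -> `|F x| <= c * expR (L * `|x|).
Proof.
move=> T0 F0 DF c0 L0 fb x xT.
have key (G g : R -> R) (y : R) : 0 <= y -> y <= T -> G 0 = 0 ->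
    (forall z : R, is_derive z (1 : R) G (g z)) ->
    (forall z, 0 <= z <= y -> `|g z| <= c * L * expR (L * z)) ->
    `|G y| <= c * expR (L * y).
  move=> y0' yT G0 DG gb.
  have := @mean_value_norm R G (fun z => c * expR (L * z)) g
    (fun z => c * L * expR (L * z)) 0 y y0' (fun z _ => DG z).
  rewrite G0 subr0 mulr0 expR0 mulr1 => /(_ _ gb) h.
  apply: le_trans (h _) _; last by rewrite lerBlDr lerDl.
  move=> z _; apply: is_derive_eq.
  by rewrite /GRing.scale /= mulr1; ring.
have [x0|x0] := leP 0 x.
  have xE : `|x| = x by rewrite ger0_norm.
  rewrite xE; apply: (key F f) => //; first by rewrite -xE.
  move=> z /andP[z0 zx]; have zE : `|z| = z by rewrite ger0_norm.
  by rewrite -{2}zE; apply: fb; rewrite zE (le_trans zx)// -xE.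
have xE : `|x| = - x by rewrite ltr0_norm.
rewrite xE -[x in `|F x|]opprK.
apply: (key (fun z => F (- z)) (fun z => - f (- z))).
- by rewrite oppr_ge0 ltW.
- by rewrite -xE.
- by rewrite oppr0.
- by move=> z; apply: (is_derive_eq (f' := f (- z) * -1)); rewrite mulrN1.
- move=> z /andP[z0 zx]; have zE : `|- z| = z by rewrite normrN ger0_norm.
  by rewrite normrN -{2}zE; apply: fb; rewrite zE (le_trans zx)// -xE.
Qed.

Definition antider (f : R -> R) : R -> R :=
  xget (fun=> 0) [set F | F 0 = 0 /\ forall x : R, is_derive x (1 : R) F (f x)].

Lemma antiderP f : continuous f ->
  antider f 0 = 0 /\ forall x : R, is_derive x (1 : R) (antider f) (f x).
Proof.
move=> cf; rewrite /antider; case: xgetP => //= h.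
by have [F hF] := ex_antiderivative cf; have := h F.
Qed.

End Growth.

Section LinearODE.
Variables (R : realType) (I : finType).
Variables (A : I -> I -> R -> R) (b : I -> R -> R) (y0 : I -> R) (M : R).
Hypothesis A_cont : forall i j, continuous (A i j).
Hypothesis b_cont : forall i, continuous (b i).
Hypothesis M_ge0 : 0 <= M.
Hypothesis A_bound : forall i j x, `|A i j x| <= M.

(** With this exponent #|I| M <= L / 2, so one Picard step at least halves the weighted distance. *)
Let L : R := 2 * (#|I|%:R * M + 1).

Let rhs (Y : I -> R -> R) i : R -> R := fun x => \sum_j A i j x * Y j x + b i x.
Let step (Y : I -> R -> R) : I -> R -> R :=
  fun i x => y0 i + antider (rhs Y i) x.
Let Y n : I -> R -> R := iter n step (fun i _ => y0 i).

Lemma ode_rhsB Z Z' i x :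
  rhs Z i x - rhs Z' i x = \sum_j A i j x * (Z j x - Z' j x).
Proof.
rewrite /rhs opprD addrACA subrr addr0 -sumrB.
by apply: eq_bigr => j _; rewrite mulrBr.
Qed.

Lemma ode_rhs_cont Z i : (forall j, continuous (Z j)) -> continuous (rhs Z i).
Proof.
move=> cZ x; apply: continuousD; last exact: b_cont.
by apply: continuous_fsum => j z; apply: continuousM; [exact: A_cont|exact: cZ].
Qed.

Lemma ode_step_derive Z i (x : R) : (forall j, continuous (Z j)) ->
  is_derive x (1 : R) (step Z i) (rhs Z i x).
Proof.
move=> cZ; have [_ D] := antiderP (@ode_rhs_cont _ i cZ).
apply: (is_derive_eq (f' := 0 + rhs Z i x)); last by rewrite add0r.
Qed.

Lemma ode_step_cont Z i : (forall j, continuous (Z j)) -> continuous (step Z i).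
Proof. by move=> cZ x; apply: is_derive_continuous (@ode_step_derive _ i x cZ). Qed.

Lemma ode_step0 Z i : (forall j, continuous (Z j)) -> step Z i 0 = y0 i.
Proof.
by move=> cZ; rewrite /step; have [-> _] := antiderP (@ode_rhs_cont _ i cZ); rewrite addr0.
Qed.

Lemma ode_Y_cont n i : continuous (Y n i).
Proof.
elim: n i => [|n IH] i; first by move=> x; exact: cst_continuous.
exact: ode_step_cont.
Qed.

Lemma ode_Y_diff (T : R) : 0 < T -> exists2 C : R, 0 <= C & forall n i (x : R),
  `|x| <= T -> `|Y n.+1 i x - Y n i x| <= C * 2^-1 ^+ n * expR (L * `|x|).
Proof.
move=> T0.
have L0 : 0 < L by rewrite /L mulr_gt0// ltr_wpDl// mulr_ge0.
have Ci i : exists C : R, 0 <= C /\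
    forall x, `|x| <= T -> `|Y 1 i x - Y 0 i x| <= C.
  have [C C0 hC] := @continuous_bounded R (fun x => Y 1 i x - Y 0 i x) T T0
    (fun x => continuousB (@ode_Y_cont 1 i x) (@ode_Y_cont 0 i x)).
  by exists C.
have [C hC] := choice Ci.
have C0 i : 0 <= C i by have [] := hC i.
exists (\sum_i C i); first exact: sumr_ge0.
elim=> [|n IH] i x xT.
  rewrite expr0 mulr1; apply: (@le_trans _ _ (C i * 1)).
    by rewrite mulr1; have [_ ->] := hC i.
  apply: ler_pM => //; first by rewrite (bigD1 i)//= lerDl sumr_ge0.
  by rewrite -expR0 ler_expR mulr_ge0// ltW.
have cY m j := @ode_Y_cont m j.
have [a1 D1] := antiderP (@ode_rhs_cont _ i (cY n.+1)).
have [a0 D0] := antiderP (@ode_rhs_cont _ i (cY n)).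
rewrite [Y n.+2 i x]/(step (Y n.+1) i x) [Y n.+1 i x]/(step (Y n) i x) /step.
rewrite [y0 i + _]addrC addrKA.
apply: (growth_antiderivative (f := fun x => rhs (Y n.+1) i x - rhs (Y n) i x)
  (F := fun x => antider (rhs (Y n.+1) i) x - antider (rhs (Y n) i) x) T0) => //.
- by rewrite a1 a0 subrr.
- by rewrite mulr_ge0 ?sumr_ge0// exprn_ge0.
move=> z zT; rewrite ode_rhsB (le_trans (ler_norm_sum _ _ _))//.
pose e := \sum_i C i * 2^-1 ^+ n * expR (L * `|z|).
apply: (@le_trans _ _ (\sum_(j : I)
    M * ((\sum_i C i) * 2^-1 ^+ n * expR (L * `|z|)))).
  apply: ler_sum => j _; rewrite normrM.
  by apply: ler_pM => //; exact: IH.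
rewrite sumr_const -[_ *+ _]mulr_natl exprS.
set S := \sum_i C i; set h := 2^-1 ^+ n; set E := expR _.
have : 0 <= S * h * E.
  by rewrite !mulr_ge0 ?expR_ge0 ?sumr_ge0 ?exprn_ge0.
rewrite [#|xpredT|](_ : _ = #|I|)//; rewrite /L.
set q := #|I|%:R : R => P.
have -> : q * (M * (S * h * E)) = (q * M) * (S * h * E) by ring.
have -> : S * (2^-1 * h) * (2 * (q * M + 1)) * E = (q * M + 1) * (S * h * E) by field.
by apply: ler_wpM2r => //; rewrite lerDl.
Qed.

(** The increments decay geometrically in the weighted norm, hence locally uniformly. The explicit
    rate is kept because it yields both the continuity of the limit and the fixed point equation. *)
Lemma ode_Y_lim : exists Z : I -> R -> R, forall T : R, 0 < T ->
  exists2 C : R, 0 <= C & forall n i (x : R), `|x| <= T ->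
    `|Z i x - Y n i x| <= C * 2^-1 ^+ n.
Proof.
have L0 : 0 < L by rewrite /L mulr_gt0// ltr_wpDl// mulr_ge0.
have h1 : `|2^-1 : R| < 1 by rewrite ger0_norm//; lra.
have cv i x : cvgn (fun n => Y n i x).
  have T0 : 0 < `|x| + 1 by have := normr_ge0 x; lra.
  have [C C0 hC] := ode_Y_diff T0.
  have : cvgn (series (fun n => Y n.+1 i x - Y n i x)).
    apply: normed_cvg; apply: (@series_le_cvg R _
      (geometric (C * expR (L * `|x|)) 2^-1)) => //=.
    - by move=> n; rewrite !mulr_ge0 ?expR_ge0 ?exprn_ge0.
    - by move=> n; rewrite mulrAC hC// lerDl.
    - exact: is_cvg_geometric_series.
  rewrite (_ : series _ = (fun n => Y n i x - Y 0 i x)); last first.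
    by apply: funext => n; rewrite /series /= telescope_sumr.
  move=> c; rewrite (_ : (fun n => Y n i x) =
    (fun n => (Y n i x - Y 0 i x) + Y 0 i x)); last first.
    by apply: funext => n; rewrite subrK.
  by apply: is_cvgD => //; exact: is_cvg_cst.
exists (fun i x => limn (fun n => Y n i x)) => T T0.
have [C C0 hC] := ode_Y_diff T0.
exists (2 * C * expR (L * T)); first by rewrite !mulr_ge0 ?expR_ge0.
move=> n i x xT.
have hk k : `|Y (k + n) i x - Y n i x| <=
    2 * C * expR (L * T) * (2^-1 ^+ n - 2^-1 ^+ (k + n)).
  elim: k => [|k IH]; first by rewrite add0n !subrr normr0 mulr0.
  rewrite addSn.
  have -> : Y (k + n).+1 i x - Y n i x =
    (Y (k + n).+1 i x - Y (k + n) i x) + (Y (k + n) i x - Y n i x).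
    by rewrite addrA subrK.
  apply: le_trans (ler_normD _ _) _.
  have hx : `|Y (k + n).+1 i x - Y (k + n) i x| <=
      C * 2^-1 ^+ (k + n) * expR (L * T).
    apply: le_trans (hC _ _ _ xT) _; apply: ler_wpM2l.
      by rewrite mulr_ge0 ?exprn_ge0.
    by rewrite ler_expR ler_pM2l.
  apply: le_trans (lerD hx IH) _; rewrite exprS.
  by rewrite le_eqVlt; apply/orP; left; apply/eqP; field.
apply/ler_addgt0Pr => e e0.
have /cvgrPdist_lt/(_ _ e0)[m _ hm] := cv i x.
have := hm (m + n)%N (leq_addr _ _); have := hk m.
set l := limn _; set y := Y (m + n) i x => h2 h3.
have : `|l - Y n i x| <= `|l - y| + `|y - Y n i x|.
  by rewrite -{1}(subrK y l) -addrA ler_normD.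
have : 0 <= 2 * C * expR (L * T) * 2^-1 ^+ (m + n).
  by rewrite !mulr_ge0 ?expR_ge0 ?exprn_ge0.
by move: h2 h3; rewrite mulrBr; lra.
Qed.

Lemma ode_exists : exists Z : I -> R -> R, (forall i, Z i 0 = y0 i) /\
  forall i (x : R), is_derive x (1 : R) (Z i) (\sum_j A i j x * Z j x + b i x).
Proof.
have [Z hZ] := ode_Y_lim.
have small (C e : R) : 0 <= C -> 0 < e -> exists n, C * 2^-1 ^+ n < e.
  move=> C0 e0.
  have : (geometric C (2^-1 : R)) @ \oo --> (0 : R).
    by apply: cvg_geometric; rewrite ger0_norm//; lra.
  move=> /cvgrPdist_lt/(_ _ e0)[n _ /(_ n (leqnn n))] /=.
  rewrite sub0r normrN ger0_norm ?mulr_ge0 ?exprn_ge0// => h.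
  by exists n.
have cZ i : continuous (Z i).
  move=> x; apply/cvgrPdist_lt => e e0.
  have T0 : 0 < `|x| + 1 by have := normr_ge0 x; lra.
  have [C C0 hC] := hZ _ T0.
  have e30 : 0 < e / 3 by rewrite divr_gt0.
  have [n hn] := small C (e / 3) C0 e30.
  have /cvgrPdist_lt/(_ _ e30) cY := @ode_Y_cont n i x.
  near=> y.
  have hy : `|y| <= `|x| + 1.
    have : `|x - y| < 1 by near: y; exact: (@nbhsx_ballx _ R x 1 ltr01).
    by have := ler_normD (y - x) x; rewrite subrK (distrC y x); lra.
  have h1 := hC n i y hy.
  have h2 := hC n i x (ltac:(by rewrite lerDl)).
  have h3 : `|Y n i x - Y n i y| < e / 3 by near: y.
  have -> : Z i x - Z i y = (Z i x - Y n i x) + (Y n i x - Y n i y)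
     - (Z i y - Y n i y) by ring.
  have := ler_normB (Z i x - Y n i x + (Y n i x - Y n i y)) (Z i y - Y n i y).
  have := ler_normD (Z i x - Y n i x) (Y n i x - Y n i y).
  lra.
(* The limit is a fixed point: [step] sends Z and [Y n] to values at distance of order 2^-n, and the
   image of [Y n] is [Y n.+1], itself that close to Z. *)
have ZE i x : Z i x = step Z i x.
  apply/eqP; rewrite -subr_eq0 -normr_le0; apply/ler_addgt0Pr => e e0.
  have T0 : 0 < `|x| + 1 by have := normr_ge0 x; lra.
  have [C C0 hC] := hZ _ T0.
  have L0 : 0 < L by rewrite /L mulr_gt0// ltr_wpDl// mulr_ge0.
  have C1 : 0 <= C * (1 + expR (L * (`|x| + 1))).
    by rewrite mulr_ge0// addr_ge0 ?expR_ge0.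
  have [n hn] := small _ _ C1 e0.
  have xT : `|x| <= `|x| + 1 by rewrite lerDl.
  have h1 := hC n.+1 i x xT.
  have [a1 D1] := antiderP (@ode_rhs_cont _ i cZ).
  have [a0 D0] := antiderP (@ode_rhs_cont _ i (fun j => @ode_Y_cont n j)).
  have h2 : `|antider (rhs Z i) x - antider (rhs (Y n) i) x| <=
      C * 2^-1 ^+ n * expR (L * `|x|).
    apply: (growth_antiderivative (f := fun x => rhs Z i x - rhs (Y n) i x)
      (F := fun x => antider (rhs Z i) x - antider (rhs (Y n) i) x) T0) => //.
    - by rewrite a1 a0 subrr.
    - by rewrite mulr_ge0 ?exprn_ge0.
    move=> z zT; rewrite ode_rhsB (le_trans (ler_norm_sum _ _ _))//.
    apply: (@le_trans _ _ (\sum_(j : I) M * (C * 2^-1 ^+ n))).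
      apply: ler_sum => j _; rewrite normrM.
      by apply: ler_pM => //; exact: hC.
    rewrite sumr_const -[_ *+ _]mulr_natl.
    have P : 0 <= C * 2^-1 ^+ n by rewrite mulr_ge0 ?exprn_ge0.
    rewrite [#|xpredT|](_ : _ = #|I|)//.
    have -> : #|I|%:R * (M * (C * 2^-1 ^+ n)) = C * 2^-1 ^+ n * (#|I|%:R * M) by ring.
    rewrite -[leRHS]mulrA; apply: ler_wpM2l => //.
    rewrite -[leLHS]mulr1; apply: ler_pM => //; first by rewrite mulr_ge0.
      by have : 0 <= #|I|%:R * M; [rewrite mulr_ge0|rewrite /L; lra].
    by rewrite -expR0 ler_expR mulr_ge0// ltW.
  have h3 : expR (L * `|x|) <= expR (L * (`|x| + 1)) by rewrite ler_expR ler_pM2l.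
  have -> : Z i x - step Z i x = (Z i x - Y n.+1 i x) -
      (antider (rhs Z i) x - antider (rhs (Y n) i) x).
    have -> : Y n.+1 i x = y0 i + antider (rhs (Y n) i) x by [].
    have -> : step Z i x = y0 i + antider (rhs Z i) x by [].
    by move: (antider _ _) (antider _ _) => u v; ring.
  apply: le_trans (ler_normB _ _) _; rewrite add0r.
  apply: le_trans (lerD h1 h2) _; apply: ltW; apply: le_lt_trans hn.
  have P : 0 <= C * 2^-1 ^+ n by rewrite mulr_ge0 ?exprn_ge0.
  have := ler_wpM2l P h3; rewrite exprS.
  move: P; set h := 2^-1 ^+ n; set E := expR (L * (_ + _)) => P Q.
  rewrite mulrDr mulr1 mulrDl -mulrA -[C * E * h]mulrA [E * h]mulrC !mulrA.
  by rewrite mulrAC; move: Q P; rewrite mulrAC; lra.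
exists Z; split=> [i|i x]; first by rewrite ZE ode_step0.
by rewrite (_ : Z i = step Z i); [exact: ode_step_derive|apply: funext].
Unshelve. all: by end_near. Qed.

End LinearODE.

Lemma is_derive_fsum (R : realType) (E : normedModType R) (J : Type) (r : seq J)
    (f : J -> E -> R) (df : J -> R) x v :
  (forall j, is_derive x v (f j) (df j)) ->
  is_derive x v (fun y => \sum_(j <- r) f j y) (\sum_(j <- r) df j).
Proof.
move=> Df; elim: r => [|j r IH].
  rewrite big_nil (_ : (fun _ => _) = cst 0); first exact: is_derive_cst.
  by apply: funext => y; rewrite big_nil.
rewrite big_cons (_ : (fun _ => _) =
  (fun y => f j y + \sum_(j <- r) f j y)); first exact: is_derive_fD.
by apply: funext => y; rewrite big_cons.
Qed.

(** * Gronwall's inequality and uniqueness *)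

Section Gronwall.
Variables (R : realType) (I : finType).

(** The constant is chosen before the system: it depends only on M, T and the number of unknowns.
    This is what later gives bounds uniform in the small parameter. The proof is an energy estimate
    for the sum of squares. *)
Lemma gronwall (M T : R) : 0 <= M -> 0 < T -> exists2 C : R, 0 <= C &
  forall (A : I -> I -> R -> R) (y b : I -> R -> R) (m : R),
  (forall i j (x : R), 0 <= x <= T -> `|A i j x| <= M) ->
  (forall i, y i 0 = 0) ->
  (forall i (x : R), 0 <= x <= T ->
     is_derive x (1 : R) (y i) (\sum_j A i j x * y j x + b i x)) ->
  (forall i (x : R), 0 <= x <= T -> `|b i x| <= m) -> 0 <= m ->
  forall i (x : R), 0 <= x <= T -> `|y i x| <= C * m.
Proof.
(* From 2 |y_i| |A_ij| |y_j| <= M (y_i^2 + y_j^2) and 2 y_i b_i <= y_i^2 + m^2, the energy satisfies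
   E' <= K E + N m^2. *)
move=> M0 T0; pose N : R := #|I|%:R; pose K := 2 * N * M + 1.
have N0 : 0 <= N by [].
have K0 : 0 < K by rewrite /K ltr_wpDl ?mulr_ge0.
(* The added 1 gives C <= C^2, so that the bound C m^2 on the square of y is also at most (C
   m)^2. *)
pose C := expR (K * T) * N * T + 1.
have C1 : 1 <= C by rewrite lerDr !mulr_ge0 ?expR_ge0// ltW.
exists C; first by apply: le_trans C1.
move=> A y b m hA y0 Dy hb m0 i x xT.
pose E t := \sum_i y i t ^+ 2.
pose E' t := \sum_i 2 * y i t * (\sum_j A i j t * y j t + b i t).
have E_ge0 t : 0 <= E t by apply: sumr_ge0 => j _; exact: sqr_ge0.
have DE t : 0 <= t <= T -> is_derive t (1 : R) E (E' t).
  move=> tT; rewrite /E /E'.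
  apply: is_derive_fsum => j.
  by have := is_derive_fX 2 (Dy j t tT); rewrite expr1.
have amgm (u v : R) : 2 * u * v <= u ^+ 2 + v ^+ 2.
  by have := sqr_ge0 (u - v); rewrite sqrrB; lra.
have hE t : 0 <= t <= T -> E' t <= K * E t + N * m ^+ 2.
  move=> tT; pose e j := y j t ^+ 2.
  apply: (@le_trans _ _ (\sum_i ((\sum_j M * (e i + e j)) + (e i + m ^+ 2)))).
    apply: ler_sum => j _; rewrite mulrDr mulr_sumr; apply: lerD.
      apply: ler_sum => k _; apply: le_trans (ler_norm _) _.
      rewrite !normrM [`|2|]ger0_norm// mulrCA; apply: ler_pM => //.
        exact: hA.
      have := amgm `|y j t| `|y k t|.
      by rewrite !real_normK ?num_real.
    apply: le_trans (amgm _ _) _; rewrite lerD2l.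
    by rewrite -[b j t ^+ 2]real_normK ?num_real// lerXn2r ?nnegrE// hb.
  rewrite big_split /= big_split /= sumr_const exchange_big /=.
  have -> : \sum_j \sum_i M * (e i + e j) = 2 * N * M * E t.
    rewrite (eq_bigr (fun j => M * E t + N * M * e j)); last first.
      move=> j _; rewrite -mulr_sumr big_split /= sumr_const.
      rewrite -[_ *+ _]mulr_natl [#|xpredT|](_ : _ = #|I|)//.
      by rewrite -/(E t) mulrDr mulrCA mulrA.
    rewrite big_split /= sumr_const -mulr_sumr -/(E t).
    by rewrite -[_ *+ _]mulr_natl [#|xpredT|](_ : _ = #|I|)// -/N; ring.
  rewrite -/(E t) -[_ *+ _]mulr_natl [#|xpredT|](_ : _ = #|I|)// -/N.
  by rewrite /K; lra.
have h : E x * expR (- K * x) <= N * m ^+ 2 * x.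
  have := @mean_value_le R (fun t => E t * expR (- K * t)) (fun t => N * m ^+ 2 * t)
    (fun t => (E' t - K * E t) * expR (- K * t)) (fun=> N * m ^+ 2) 0 x.
  have -> : E 0 = 0.
    by rewrite /E big1// => j _; rewrite y0 expr0n.
  rewrite !mulr0 mul0r !subr0; apply.
  - by case/andP: xT.
  - move=> t /andP[t0 tx]; have tT : 0 <= t <= T.
      by rewrite t0 (le_trans tx)//; case/andP: xT.
    have De : is_derive t (1 : R) (fun t => expR (- K * t)) (- K * expR (- K * t)).
      apply: is_derive_eq; rewrite /GRing.scale /= mulr1; ring.
    have D := is_derive_fM (DE t tT) De; apply: (is_derive_eq D); ring.
  - move=> t _; apply: is_derive_eq; rewrite /GRing.scale /= mulr1; ring.
  move=> t /andP[t0 tx]; have tT : 0 <= t <= T.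
    by rewrite t0 (le_trans tx)//; case/andP: xT.
  rewrite -[leRHS]mulr1; have := hE t tT.
  rewrite -lerBlDl => h; apply: le_trans (ler_wpM2r (expR_ge0 _) h) _.
  apply: ler_wpM2l; first by rewrite mulr_ge0// sqr_ge0.
  by rewrite -expR0 ler_expR mulNr oppr_le0 mulr_ge0// ltW.
have hy : y i x ^+ 2 <= (C * m) ^+ 2.
  have e1 : expR (- K * x) * expR (K * x) = 1 by rewrite -expRD mulNr addNr expR0.
  apply: (@le_trans _ _ (E x)).
    by rewrite /E (bigD1 i)//= lerDl sumr_ge0// => j _; exact: sqr_ge0.
  rewrite -[E x]mulr1 -e1 mulrA.
  apply: le_trans (ler_wpM2r (expR_ge0 _) h) _.
  case/andP: xT => x0 xT.
  apply: (@le_trans _ _ (N * m ^+ 2 * T * expR (K * T))).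
    apply: ler_pM; rewrite ?mulr_ge0 ?sqr_ge0 ?expR_ge0//.
      by rewrite ler_wpM2l// mulr_ge0// sqr_ge0.
    by rewrite ler_expR ler_pM2l.
  rewrite exprMn; have -> : N * m ^+ 2 * T * expR (K * T) = (expR (K * T) * N * T) * m ^+ 2 by ring.
  apply: ler_wpM2r; first exact: sqr_ge0.
  apply: (@le_trans _ _ C); first by rewrite lerDl.
  by rewrite -[leLHS]mulr1 expr2 ler_pM// (le_trans ler01).
rewrite -[C * m]ger0_norm; last by rewrite mulr_ge0// (le_trans ler01).
by rewrite -(@ler_pXn2r _ 2)// ?nnegrE// !real_normK// num_real.
Qed.

Lemma ode_unique (A : I -> I -> R -> R) (M : R) (y : I -> R -> R) :
  0 <= M -> (forall i j (x : R), `|A i j x| <= M) ->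
  (forall i, y i 0 = 0) ->
  (forall i (x : R), is_derive x (1 : R) (y i) (\sum_j A i j x * y j x)) ->
  forall i x, y i x = 0.
Proof.
move=> M0 hA y0 Dy i x.
have T0 : 0 < `|x| + 1 by have := normr_ge0 x; lra.
have [C C0 hC] := gronwall M0 T0.
have [x0|x0] := leP 0 x.
  apply/eqP; rewrite -normr_le0.
  rewrite -(mulr0 C); apply: (hC A y (fun _ _ => 0)) => //.
  - by move=> j t _; apply: is_derive_eq; rewrite addr0.
  - by move=> j t _; rewrite normr0.
  - by rewrite x0 (le_trans (ler_norm x))// lerDl.
(* For negative x the direction is reversed: y (- t) solves the system with matrix - A (- t). *)
apply/eqP; rewrite -normr_le0.
rewrite -(mulr0 C) -[x]opprK.
apply: (hC (fun i j t => - A i j (- t)) (fun i t => y i (- t)) (fun _ _ => 0)) => //.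
- by move=> j k t _; rewrite normrN.
- by move=> j; rewrite oppr0.
- move=> j t _.
  have D := is_derive_fcomp (Dy j (- t)) (is_derive_fN (is_derive_id t 1)).
  apply: (is_derive_eq D); rewrite addr0 mulrN1 -sumrN.
  by apply: eq_bigr => k _; rewrite mulNr.
- by move=> j t _; rewrite normr0.
- by rewrite oppr_ge0 (ltW x0)/= (le_trans (ler_norm _))// normrN lerDl.
Qed.

End Gronwall.

(** * Complex-valued functions of a real variable *)

Section ComplexCalculus.
Variable R : realType.
Local Notation C := R[i].
Local Notation Re := (@complex.Re R).
Local Notation Im := (@complex.Im R).
Implicit Types (z w : C) (f g : R -> C).

Lemma ReD z w : Re (z + w) = Re z + Re w. Proof. by case: z w => ? ? []. Qed.
Lemma ImD z w : Im (z + w) = Im z + Im w. Proof. by case: z w => ? ? []. Qed.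
Lemma ReN z : Re (- z) = - Re z. Proof. by case: z. Qed.
Lemma ImN z : Im (- z) = - Im z. Proof. by case: z. Qed.
Lemma ReM z w : Re (z * w) = Re z * Re w - Im z * Im w.
Proof. by case: z w => ? ? []. Qed.
Lemma ImM z w : Im (z * w) = Re z * Im w + Im z * Re w.
Proof. by case: z w => ? ? []. Qed.
Lemma Re_sum (J : Type) (r : seq J) (F : J -> C) :
  Re (\sum_(j <- r) F j) = \sum_(j <- r) Re (F j).
Proof. by elim: r => [|j r IH]; rewrite ?big_nil// !big_cons ReD IH. Qed.
Lemma Im_sum (J : Type) (r : seq J) (F : J -> C) :
  Im (\sum_(j <- r) F j) = \sum_(j <- r) Im (F j).
Proof. by elim: r => [|j r IH]; rewrite ?big_nil// !big_cons ImD IH. Qed.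
Lemma complex_eqP z w : Re z = Re w -> Im z = Im w -> z = w.
Proof. by case: z w => ? ? [] ? ? /= -> ->. Qed.

Lemma norm_Re_le z : `|Re z| <= normc z.
Proof.
case: z => a b /=; rewrite -sqrtr_sqr ler_wsqrtr// lerDl; exact: sqr_ge0.
Qed.

Lemma norm_Im_le z : `|Im z| <= normc z.
Proof.
case: z => a b /=; rewrite -sqrtr_sqr ler_wsqrtr// lerDr; exact: sqr_ge0.
Qed.

Lemma normc_le z : normc z <= `|Re z| + `|Im z|.
Proof.
case: z => a b /=; rewrite -[leRHS]ger0_norm ?addr_ge0// -sqrtr_sqr.
apply: ler_wsqrtr; rewrite sqrrD !real_normK ?num_real//.
by have : 0 <= `|a| * `|b| := mulr_ge0 (normr_ge0 _) (normr_ge0 _); lra.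
Qed.

Lemma normc_ge0 z : 0 <= normc z.
Proof. by case: z => a b; exact: sqrtr_ge0. Qed.

Lemma normc_real (a : R) : normc a%:C%C = `|a|.
Proof. by rewrite /= expr0n addr0 sqrtr_sqr. Qed.

(** Stated on real and imaginary parts, so that the real calculus and the real solver apply
    directly. *)
Definition cderiv f (x : R) z : Prop :=
  is_derive x (1 : R) (fun t => Re (f t)) (Re z) /\
  is_derive x (1 : R) (fun t => Im (f t)) (Im z).

Lemma cderiv_eq f x z w : cderiv f x z -> z = w -> cderiv f x w.
Proof. by move=> h <-. Qed.

Lemma cderivD f g x z w : cderiv f x z -> cderiv g x w ->
  cderiv (fun t => f t + g t) x (z + w).
Proof.
move=> [f1 f2] [g1 g2]; split; rewrite ?ReD ?ImD.
- by under [X in is_derive _ _ X]eq_fun do rewrite ReD; exact: is_derive_fD f1 g1.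
- by under [X in is_derive _ _ X]eq_fun do rewrite ImD; exact: is_derive_fD f2 g2.
Qed.

Lemma cderivN f x z : cderiv f x z -> cderiv (fun t => - f t) x (- z).
Proof.
move=> [f1 f2]; split; rewrite ?ReN ?ImN.
- by under [X in is_derive _ _ X]eq_fun do rewrite ReN; exact: is_derive_fN f1.
- by under [X in is_derive _ _ X]eq_fun do rewrite ImN; exact: is_derive_fN f2.
Qed.

Lemma cderivM f g x z w : cderiv f x z -> cderiv g x w ->
  cderiv (fun t => f t * g t) x (z * g x + f x * w).
Proof.
move=> [f1 f2] [g1 g2]; split; rewrite ?ReD ?ImD ?ReM ?ImM.
- under [X in is_derive _ _ X]eq_fun do rewrite ReM.
  have D := is_derive_fB (is_derive_fM f1 g1) (is_derive_fM f2 g2).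
  by apply: (is_derive_eq D); ring.
- under [X in is_derive _ _ X]eq_fun do rewrite ImM.
  have D := is_derive_fD (is_derive_fM f1 g2) (is_derive_fM f2 g1).
  by apply: (is_derive_eq D); ring.
Qed.

Lemma cderiv_cst z x : cderiv (fun=> z) x 0.
Proof. by split; exact: is_derive_fcst. Qed.

Lemma cderiv_real (f : R -> R) x (l : R) : is_derive x (1 : R) f l ->
  cderiv (fun t => (f t)%:C%C) x l%:C%C.
Proof. by move=> D; split => //=; exact: is_derive_fcst. Qed.

Lemma cderiv_sum (J : Type) (r : seq J) (f : J -> R -> C) (df : J -> C) x :
  (forall j, cderiv (f j) x (df j)) ->
  cderiv (fun t => \sum_(j <- r) f j t) x (\sum_(j <- r) df j).
Proof.
move=> Df; split; rewrite ?Re_sum ?Im_sum.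
- under [X in is_derive _ _ X]eq_fun do rewrite Re_sum.
  by apply: is_derive_fsum => j; have [] := Df j.
- under [X in is_derive _ _ X]eq_fun do rewrite Im_sum.
  by apply: is_derive_fsum => j; have [] := Df j.
Qed.

Lemma cderiv_comp f (g : R -> R) x z (l : R) : cderiv f (g x) z ->
  is_derive x (1 : R) g l -> cderiv (fun t => f (g t)) x (z * l%:C%C).
Proof.
move=> [f1 f2] Dg; split; rewrite ?ReM ?ImM /= mulr0 ?subr0 ?add0r.
- exact: is_derive_fcomp f1 Dg.
- exact: is_derive_fcomp f2 Dg.
Qed.

(** The factor 2 comes from bounding the real and imaginary parts separately. *)
Lemma cmean_value f (df : R -> C) (a b m : R) : a <= b ->
  (forall x, a <= x <= b -> cderiv f x (df x)) ->
  (forall x, a <= x <= b -> normc (df x) <= m) ->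
  normc (f b - f a) <= 2 * m * (b - a).
Proof.
move=> ab Df dfm; apply: le_trans (normc_le _) _.
rewrite ReD ImD ReN ImN; set u := `|_|; set v := `|_|.
suff [hu hv] : u <= m * (b - a) /\ v <= m * (b - a) by lra.
have Dm (x : R) : is_derive x (1 : R) (fun t => m * t) m.
  by apply: is_derive_eq; rewrite /GRing.scale /= mulr1.
rewrite mulrBr; split.
- apply: (@mean_value_norm R (fun t => Re (f t)) (fun t => m * t)
    (fun t => Re (df t)) (fun=> m) a b ab) => x xab.
  + by have [] := Df x xab.
  + exact: le_trans (norm_Re_le _) (dfm _ xab).
- apply: (@mean_value_norm R (fun t => Im (f t)) (fun t => m * t)
    (fun t => Im (df t)) (fun=> m) a b ab) => x xab.
  + by have [] := Df x xab.
  + exact: le_trans (norm_Im_le _) (dfm _ xab).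
Qed.

Definition ccontinuous f : Prop :=
  continuous (fun t => Re (f t)) /\ continuous (fun t => Im (f t)).

(** Coordinates of C over R indexed by booleans; [unit_of] is the corresponding basis.
    Multiplication by a has the matrix [part c (a * unit_of d)], so a complex system over [I]
    becomes a real one over [I * bool]. *)
Definition part (c : bool) z : R := if c then Re z else Im z.
Definition unit_of (c : bool) : C := if c then 1 else Complex 0 1.

Lemma part_le c z : `|part c z| <= normc z.
Proof. by case: c; [exact: norm_Re_le|exact: norm_Im_le]. Qed.

Lemma partD c z w : part c (z + w) = part c z + part c w.
Proof. by case: c; [exact: ReD|exact: ImD]. Qed.

Lemma part_sum c (J : Type) (r : seq J) (F : J -> C) :
  part c (\sum_(j <- r) F j) = \sum_(j <- r) part c (F j).
Proof. by case: c; [exact: Re_sum|exact: Im_sum]. Qed.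

Lemma partM c z w : part c (z * w) =
  \sum_(d : bool) part c (z * unit_of d) * part d w.
Proof.
rewrite big_bool /=; case: z w => a b [u v]; case: c => /=; ring.
Qed.

Lemma normc_unit_of c : normc (unit_of c) = 1.
Proof. by case: c; rewrite /= ?expr0n ?expr1n ?addr0 ?add0r sqrtr1. Qed.

Variable I : finType.

Lemma part_mulsum c (a z : I -> C) (w : C) :
  part c (\sum_j a j * z j + w) =
  \sum_(p : I * bool) part c (a p.1 * unit_of p.2) * part p.2 (z p.1) + part c w.
Proof.
rewrite partD part_sum; congr (_ + _).
rewrite -(pair_big predT predT (fun j d => part c (a j * unit_of d) * part d (z j))) /=.
by apply: eq_bigr => j _; rewrite partM.
Qed.

Lemma code_exists (A : I -> I -> R -> C) (b : I -> R -> C) (y0 : I -> C) (M : R) :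
  0 <= M -> (forall i j, ccontinuous (A i j)) -> (forall i, ccontinuous (b i)) ->
  (forall i j x, normc (A i j x) <= M) ->
  exists y : I -> R -> C, (forall i, y i 0 = y0 i) /\
    forall i x, cderiv (y i) x (\sum_j A i j x * y j x + b i x).
Proof.
move=> M0 cA cb hA.
have [| | | |Z [Z0 DZ]] := @ode_exists R (I * bool)%type
  (fun p q x => part p.2 (A p.1 q.1 x * unit_of q.2))
  (fun p x => part p.2 (b p.1 x)) (fun p => part p.2 (y0 p.1)) M.
- move=> [i c] [j d] /=; have [a1 a2] := cA i j; case: c; case: d.
  + by rewrite /part /=; under eq_fun do rewrite mulr1.
  + rewrite /part /=; under eq_fun do rewrite ReM /= mulr0 mulr1 sub0r.
    by move=> x; apply: continuousN; exact: a2.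
  + by rewrite /part /=; under eq_fun do rewrite mulr1.
  + by rewrite /part /=; under eq_fun do rewrite ImM /= mulr0 mulr1 addr0.
- by move=> [i []] /=; have [] := cb i.
- exact: M0.
- move=> [i c] [j d] x /=; apply: le_trans (part_le _ _) _.
  by rewrite normcM normc_unit_of mulr1.
exists (fun i x => Complex (Z (i, true) x) (Z (i, false) x)); split=> [i|i x].
  by rewrite !Z0; case: (y0 i).
have E c : part c (\sum_j A i j x *
    Complex (Z (j, true) x) (Z (j, false) x) + b i x) =
  \sum_(q : I * bool) part c (A i q.1 x * unit_of q.2) * Z q x + part c (b i x).
  rewrite part_mulsum; congr (_ + _); apply: eq_bigr => -[j []] _ //.
split.
- by have := DZ (i, true) x; rewrite /= -(E true).
- by have := DZ (i, false) x; rewrite /= -(E false).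
Qed.

Lemma cgronwall (M T : R) : 0 <= M -> 0 < T -> exists2 K : R, 0 <= K &
  forall (A : I -> I -> R -> C) (y b : I -> R -> C) (m : R),
  (forall i j (x : R), 0 <= x <= T -> normc (A i j x) <= M) ->
  (forall i, y i 0 = 0) ->
  (forall i (x : R), 0 <= x <= T ->
     cderiv (y i) x (\sum_j A i j x * y j x + b i x)) ->
  (forall i (x : R), 0 <= x <= T -> normc (b i x) <= m) -> 0 <= m ->
  forall i (x : R), 0 <= x <= T -> normc (y i x) <= K * m.
Proof.
move=> M0 T0; have [K K0 hK] := gronwall (I * bool)%type M0 T0.
exists (2 * K); first by rewrite mulr_ge0.
move=> A y b m hA y0 Dy hb m0 i x xT.
have h c : `|part c (y i x)| <= K * m.
  apply: (hK (fun p q x => part p.2 (A p.1 q.1 x * unit_of q.2))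
    (fun p x => part p.2 (y p.1 x)) (fun p x => part p.2 (b p.1 x)) m _ _ _ _ m0 (i, c) x xT).
  - move=> [k d] [j e] t tT /=; apply: le_trans (part_le _ _) _.
    by rewrite normcM normc_unit_of mulr1 hA.
  - by move=> [j []]; rewrite /= y0.
  - move=> [j d] t tT; rewrite -(@part_mulsum d (fun k => A j k t) (fun k => y k t)).
    by have [] := Dy j t tT; case: d.
  - by move=> [j d] t tT; apply: le_trans (part_le _ _) (hb _ _ tT).
apply: le_trans (normc_le _) _.
by have := h true; have := h false; rewrite /=; lra.
Qed.

Lemma code_unique (A : I -> I -> R -> C) (M : R) (y : I -> R -> C) :
  0 <= M -> (forall i j x, normc (A i j x) <= M) -> (forall i, y i 0 = 0) ->
  (forall i x, cderiv (y i) x (\sum_j A i j x * y j x)) ->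
  forall i x, y i x = 0.
Proof.
move=> M0 hA y0 Dy i x.
have h c : part c (y i x) = 0.
  apply: (@ode_unique R (I * bool)%type
    (fun p q x => part p.2 (A p.1 q.1 x * unit_of q.2)) M
    (fun p x => part p.2 (y p.1 x)) M0 _ _ _ (i, c) x).
  - move=> [k d] [j e] t /=; apply: le_trans (part_le _ _) _.
    by rewrite normcM normc_unit_of mulr1 hA.
  - by move=> [j []]; rewrite /= y0.
  - move=> [j d] t /=.
    have := @part_mulsum d (fun k => A j k t) (fun k => y k t) 0.
    rewrite addr0 (_ : part d 0 = 0); last by case: d.
    by rewrite addr0 => <-; have [] := Dy j t; case: d.
by apply: complex_eqP; [exact: h true|exact: h false].
Qed.

End ComplexCalculus.

(** * Iterated directional derivatives and derivatives along curves *)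

Section Smooth.
Variables (R : realType) (E : normedModType R).
Implicit Types (O : set E) (u v : E).

Definition iterD (F : normedModType R) (vs : seq E) (f : E -> F) : E -> F :=
  foldr (fun v (g : E -> F) => 'D_v g) f vs.

Lemma is_derive_coord m n (f : E -> 'M[R]_(m, n)) x v (l : 'M[R]_(m, n)) i j :
  is_derive x v f l -> is_derive x v (fun y => f y i j) (l i j).
Proof.
move=> [df <-]; have dfij := (derivable_mxP f x v).1 df.
by split=> //; rewrite derive_mx// mxE.
Qed.

Lemma is_derive_mx m n (f : E -> 'M[R]_(m, n)) x v (l : 'M[R]_(m, n)) :
  (forall i j, is_derive x v (fun y => f y i j) (l i j)) -> is_derive x v f l.
Proof.
move=> Df; have df : derivable f x v.
  by apply/derivable_mxP => i j; have [] := Df i j.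
split=> //; rewrite derive_mx//; apply/matrixP => i j; rewrite mxE.
by have [] := Df i j.
Qed.

Section Coordinates.
Variables (m n : nat) (O : set E) (f : E -> 'M[R]_(m, n)).
Hypothesis sf : smooth_on O f.

(** The head of [vs] is the direction of the derivative taken last. *)
Definition coordD vs (i : 'I_m) (j : 'I_n) : E -> R := fun x => iterD vs f x i j.

Lemma coordD_differentiable vs i j x : O x -> differentiable (coordD vs i j) x.
Proof.
move=> Ox; apply: (differentiable_comp (f := iterD vs f) (g := fun M => M i j)).
  exact: sf.
exact: differentiable_coord.
Qed.

Lemma coordD_is_derive vs i j x v : O x ->
  is_derive x v (coordD vs i j) (coordD (v :: vs) i j x).
Proof.
move=> Ox; apply: is_derive_coord; split=> //.
exact/diff_derivable/sf.
Qed.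

Lemma coordD_continuous vs i j x : O x -> {for x, continuous (coordD vs i j)}.
Proof. by move=> Ox; apply/differentiable_continuous/coordD_differentiable. Qed.

End Coordinates.

Lemma is_derive_linear (f : E -> R) x u v (a b l m : R) :
  differentiable f x -> is_derive x u f l -> is_derive x v f m ->
  is_derive x (a *: u + b *: v) f (a * l + b * m).
Proof.
move=> df [_ <-] [_ <-]; split; first exact: diff_derivable.
by rewrite !deriveE// linearD !linearZ.
Qed.

Lemma is_derive_curve (f : E -> R) (g : R -> E) (t : R) w l :
  differentiable f (g t) -> is_derive t (1 : R) g w -> is_derive (g t) w f l ->
  is_derive t (1 : R) (fun s => f (g s)) l.
Proof.
move=> df [dg gw] [_ <-].
have dgt : differentiable g t by exact/derivable1_diffP.
have dfg : differentiable (f \o g) t by exact: differentiable_comp.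
split; first exact: diff_derivable.
have -> : 'D_1 (fun s => f (g s)) t = 'd (f \o g) t 1 by rewrite -deriveE.
by rewrite diff_comp// deriveE//= -gw deriveE.
Qed.

Lemma is_derive_shift_line (f : E -> R) x v (s : R) l :
  is_derive (x + s *: v) v f l -> is_derive s (1 : R) (fun h => f (x + h *: v)) l.
Proof.
move=> /is_derive_line D.
have D1 : is_derive (s - s) (1 : R) (fun h : R => f (h *: v + (x + s *: v))) l.
  by rewrite subrr.
have D2 : is_derive s (1 : R) (fun h : R => h - s) 1.
  by apply: is_derive_eq; rewrite subr0.
have := @is_derive_fcomp R R (fun h : R => f (h *: v + (x + s *: v)))
  (fun h => h - s) s 1 l 1 D1 D2.
rewrite mulr1.
congr (is_derive _ _ _ _); apply: funext => h.
by rewrite addrCA -scalerDl subrK.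
Qed.

Lemma is_derive_near (f g : E -> R) x v l : (\near x, f x = g x) ->
  is_derive x v f l -> is_derive x v g l.
Proof. exact: near_eq_is_derive. Qed.

Lemma line_continuous (x v : E) (s : R) :
  {for s, continuous (fun h : R => x + h *: v)}.
Proof.
apply: continuousD; first exact: cst_continuous.
by apply: continuousZl.
Qed.

End Smooth.

Lemma MVT_closed (R : realType) (f df : R -> R) (a b : R) : a <= b ->
  (forall x : R, a <= x <= b -> is_derive x (1 : R) f (df x)) ->
  exists2 c, a <= c <= b & f b - f a = df c * (b - a).
Proof.
move=> ab Df; have cf : {within `[a, b], continuous f}.
  apply: derivable_within_continuous => x; rewrite in_itv => xab.
  exact: (@ex_derive _ _ _ _ _ _ _ (Df x xab)).
have [x /[!in_itv] xab|c /[!in_itv] cab E] := @MVT_segment R f df a b ab _ cf.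
  by apply: Df; case/andP: xab => /ltW -> /ltW ->.
by exists c.
Qed.

(** * Symmetry of second derivatives *)

Section Schwarz.
Variables (R : realType) (E : normedModType R).

(** Two mean value theorems, along u and then along v, evaluate the second difference over a
    parallelogram. Exchanging u and v evaluates the same difference through the other mixed
    derivative. *)
Lemma second_difference (O : set E) (x u v : E) (G Gu Gvu : E -> R) (h : R) :
  0 < h ->
  (forall s t : R, 0 <= s <= h -> 0 <= t <= h -> O (x + s *: u + t *: v)) ->
  (forall y, O y -> is_derive y u G (Gu y)) ->
  (forall y, O y -> is_derive y v Gu (Gvu y)) ->
  exists s t : R, [/\ 0 <= s <= h, 0 <= t <= h &
    G (x + h *: u + h *: v) - G (x + h *: u) - G (x + h *: v) + G x =
    h ^+ 2 * Gvu (x + s *: u + t *: v)].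
Proof.
move=> h0 hO DG DGu.
have h00 : 0 <= (0 : R) <= h by rewrite lexx ltW.
have hhh : 0 <= h <= h by rewrite lexx ltW.
have hO0 s : 0 <= s <= h -> O (x + s *: u).
  by move=> hs; have := hO s 0 hs h00; rewrite scale0r addr0.
have D1 (s : R) : 0 <= s <= h -> is_derive s (1 : R)
    (fun s => G (x + h *: v + s *: u) - G (x + s *: u))
    (Gu (x + h *: v + s *: u) - Gu (x + s *: u)).
  move=> hs; apply: is_derive_fB; apply: is_derive_shift_line; apply: DG.
    by rewrite addrAC; exact: hO.
  exact: hO0.
have [s hs E1] := MVT_closed (ltW h0) D1.
have D2 (t : R) : 0 <= t <= h -> is_derive t (1 : R)
    (fun t => Gu (x + s *: u + t *: v)) (Gvu (x + s *: u + t *: v)).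
  by move=> ht; apply: is_derive_shift_line; apply: DGu; exact: hO.
have [t ht E2] := MVT_closed (ltW h0) D2.
exists s, t; split=> //; move: E1 E2; rewrite /= !scale0r !addr0 !subr0.
rewrite (addrAC x (h *: v) (s *: u)) => E1 E2.
rewrite E2 in E1; rewrite (addrAC x (h *: u)).
by move: E1; set a := G (_ + _ + _); set b := G x; rewrite expr2; lra.
Qed.

Lemma schwarz (O : set E) (x u v : E) (G Gu Gv Gvu Guv : E -> R) :
  open O -> O x ->
  (forall y, O y -> is_derive y u G (Gu y)) ->
  (forall y, O y -> is_derive y v G (Gv y)) ->
  (forall y, O y -> is_derive y v Gu (Gvu y)) ->
  (forall y, O y -> is_derive y u Gv (Guv y)) ->
  {for x, continuous Gvu} -> {for x, continuous Guv} -> Gvu x = Guv x.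
Proof.
move=> oO Ox DGu DGv DGvu DGuv c1 c2.
apply/eqP; rewrite -subr_eq0 -normr_le0; apply/ler_addgt0Pr => e e0.
have e20 : 0 < e / 2 by rewrite divr_gt0.
have /cvgrPdist_lt/(_ _ e20) n1 := c1.
have /cvgrPdist_lt/(_ _ e20) n2 := c2.
have n3 := open_nbhs_nbhs (conj oO Ox).
have [d /= d0 hd] := (nbhs_ballP _ _).1 (filterI n1 (filterI n2 n3)).
pose N := `|u| + `|v| + 1.
have N0 : 0 < N by rewrite /N; have := normr_ge0 u; have := normr_ge0 v; lra.
(* Small enough for the whole parallelogram to stay in the ball of radius d. *)
pose h := d / (2 * N).
have h0 : 0 < h by rewrite divr_gt0// mulr_gt0.
have hb (s t : R) : 0 <= s <= h -> 0 <= t <= h -> ball x d (x + s *: u + t *: v).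
  move=> /andP[s0 sh] /andP[t0 th]; rewrite -ball_normE /ball_ /=.
  rewrite -addrA opprD addNKr normrN.
  apply: le_lt_trans (ler_normD _ _) _; rewrite !normrZ !ger0_norm//.
  have a1 : s * `|u| <= h * `|u| by exact: ler_wpM2r.
  have a2 : t * `|v| <= h * `|v| by exact: ler_wpM2r.
  have a3 : h * N = d / 2 by rewrite /h; field; rewrite gt_eqF.
  have a4 : h * N = h * `|u| + h * `|v| + h by rewrite /N; ring.
  by lra.
have [s1 [t1 [hs1 ht1 E1]]] := second_difference h0
  (fun s t hs ht => (hd _ (hb s t hs ht)).2.2) DGu DGvu.
have [t2 [s2 [ht2 hs2 E2]]] := second_difference (u := v) (v := u) h0
  (fun t s ht hs => ltac:(rewrite addrAC; exact: (hd _ (hb s t hs ht)).2.2)) DGv DGuv.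
have [b1 _] := hd _ (hb s1 t1 hs1 ht1).
have [_ [b2 _]] := hd _ (hb s2 t2 hs2 ht2).
have EE : Gvu (x + s1 *: u + t1 *: v) = Guv (x + s2 *: u + t2 *: v).
  apply: (mulfI (x := h ^+ 2)); first by rewrite expf_neq0// gt_eqF.
  rewrite -E1 [x + s2 *: u + _]addrAC -E2 (addrAC x (h *: v)).
  by ring.
have := ler_normD (Gvu x - Gvu (x + s1 *: u + t1 *: v))
  (Guv (x + s2 *: u + t2 *: v) - Guv x).
rewrite (distrC _ (Guv x)) -EE addrA subrK; move: b1 b2; rewrite -EE add0r.
by lra.
Qed.

End Schwarz.

(** * Derivative of an integral with varying endpoint and integrand *)

Section Leibniz.
Variable R : realType.
Local Notation leb := (@lebesgue_measure R).

(** The integral splits into a part over the fixed segment, differentiated under the integral sign,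
    and a thin part between L 0 and L s, treated by a mean value in x and the joint continuity of f
    at (0, L 0). *)
Lemma leibniz (f f1 : R -> R -> R) (L : R -> R) (L' r M : R) :
  0 < r -> 0 < L 0 ->
  (forall s : R, `|s| <= r -> continuous (f s)) ->
  (forall s x : R, `|s| <= r -> is_derive s (1 : R) (f ^~ x) (f1 s x)) ->
  (forall s x : R, `|s| <= r -> 0 <= x <= L 0 + 1 -> `|f1 s x| <= M) ->
  {for (0 : R, L 0), continuous (fun q : R * R => f q.1 q.2)} ->
  is_derive (0 : R) (1 : R) L L' ->
  is_derive (0 : R) (1 : R) (fun s => Rintegral leb `[0, L s] (f s))
    (Rintegral leb `[0, L 0] (f1 0) + L' * f 0 (L 0)).
Proof.
move=> r0 L0 cf Df bf1 cf2 DL.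
pose A s := Rintegral leb `[0, L 0] (f s).
have M0 : 0 <= M.
  apply: le_trans (bf1 0 0 _ _) => //; first by rewrite normr0 ltW.
  by apply/andP; split; lra.
have mseg : measurable `[0, L 0]%classic by exact: measurable_itv.
have Is (s : R) : `]- r, r[%classic s -> `|s| <= r.
  by rewrite /= in_itv /= ler_norml => /andP[/ltW -> /ltW ->].
have i0 : `]- r, r[%classic (0 : R) by rewrite /= in_itv /= oppr_lt0 r0.
have p1 (s x : R) : `|s| <= r -> partial1of2 f s x = f1 s x.
  by move=> hs; rewrite partial1of2E; have [_] := Df s x hs.
have DA : is_derive (0 : R) (1 : R) A (Rintegral leb `[0, L 0] (f1 0)).
  have a1 x : `]- r, r[%classic x -> leb.-integrable `[0, L 0] (EFin \o f x).
    by move=> /Is hx; apply: integrable_continuous; exact: cf.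
  have a2 x y : `]- r, r[%classic x -> `[0, L 0]%classic y -> derivable (f ^~ y) x 1.
    by move=> /Is hx _; have [] := Df x y hx.
  have a3 x y : `]- r, r[%classic x -> `[0, L 0]%classic y ->
      `|partial1of2 f x y| <= (fun=> M) y.
    move=> /Is hx; rewrite /= in_itv /= => /andP[y0 yL]; rewrite p1//.
    by apply: bf1 => //; rewrite y0/= (le_trans yL)// lerDl.
  have iM : leb.-integrable `[0, L 0] (EFin \o (fun=> M : R)).
    by apply: integrable_continuous => z; exact: cst_continuous.
  have dA := @derivable_under_integral R _ _ leb f _ mseg 0 (- r) r i0 a1 a2
    (fun=> M) (fun=> M0) iM a3.
  split; first exact: dA.
  rewrite -derive1E (@differentiation_under_integral R _ _ leb f _ mseg 0 (- r) r
    i0 a1 a2 (fun=> M) (fun=> M0) iM a3).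
  by apply: eq_Rintegral => y _; rewrite p1// normr0 ltW.
pose B (s : R) := Rintegral leb `[0, L s] (f s) - A s.
suff DB : is_derive (0 : R) (1 : R) B (L' * f 0 (L 0)).
  have := is_derive_fD DA DB; congr (is_derive _ _ _ _).
  by apply: funext => s; rewrite /B addrC subrK.
(* B s = (L s - L 0) * f s c for some c between L 0 and L s. *)
have cL : {for 0, continuous L}.
  by case: DL => /derivable1_diffP/differentiable_continuous.
have hB : \forall s \near (0 : R), exists c, [/\ `|c - L 0| <= `|L s - L 0| &
    B s = (L s - L 0) * f s c].
  have nL : \forall s \near (0 : R), `|L 0 - L s| < L 0.
    by move/cvgrPdist_lt : cL => /(_ _ L0).
  near=> s.
  have sr : `|s| <= r.
    apply: ltW; have : ball (0 : R) r s by near: s; exact: nbhsx_ballx.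
    by rewrite -ball_normE /ball_ /= sub0r normrN.
  have Ls : `|L 0 - L s| < L 0 by near: s.
  have [F [_ DF]] := ex_antiderivative (cf s sr).
  have Ls0 : 0 < L s by move: Ls; rewrite ltr_norml; lra.
  have BE : B s = F (L s) - F (L 0).
    rewrite /B /A !(Rintegral_antiderivative _ _ DF)//; first by ring.
      exact: cf.
    exact: cf.
  have [LL|LL] := leP (L 0) (L s).
    have [c /andP[c1 c2] E1] := MVT_closed LL (fun x _ => DF x).
    exists c; split.
      by rewrite !ger0_norm ?subr_ge0// lerD2r.
    by rewrite BE E1 mulrC.
  have [c /andP[c1 c2] E1] := MVT_closed (ltW LL) (fun x _ => DF x).
    exists c; split.
    by rewrite !ler0_norm ?subr_le0 ?lerN2 ?lerD2r// ltW.
  by rewrite BE; move: E1; lra.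
have B0 : B 0 = 0 by rewrite /B /A subrr.
have lim : (fun h : R => h^-1 *: (B (h + 0) - B 0)) @ 0^' --> L' * f 0 (L 0).
  have [c hc] : exists c : R -> R, \forall s \near (0 : R),
      `|c s - L 0| <= `|L s - L 0| /\ B s = (L s - L 0) * f s (c s).
    pose P s c := `|c - L 0| <= `|L s - L 0| /\ B s = (L s - L 0) * f s c.
    exists (fun s => xget 0 (P s)); apply: filterS hB => s [c [c1 c2]].
    by apply: (@xgetPex _ 0 (P s)); exists c.
  have Lc : c @ (0 : R) --> L 0.
    apply/cvgrPdist_lt => e e0; move/cvgrPdist_lt : cL => /(_ _ e0) h.
    near=> s; rewrite distrC.
    apply: (@le_lt_trans _ _ `|L s - L 0|).
      by have [] : `|c s - L 0| <= `|L s - L 0| /\ B s = (L s - L 0) * f s (c s) by near: s.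
    by rewrite distrC; near: s.
  have Lf : (fun s : R => f s (c s)) @ (0 : R) --> f 0 (L 0).
    have : (fun s : R => (s, c s)) @ (0 : R) --> (0 : R, L 0).
      exact: (@cvg_pair _ _ _ (nbhs (0 : R)) (nbhs (0 : R)) (nbhs (L 0)) _ _ _
        id c cvg_id Lc).
    by move=> /(cvg_comp _ _)/(_ cf2).
  have LL : (fun h : R => h^-1 *: (L (h + 0) - L 0)) @ 0^' --> L'.
    have [dL LE] := DL; move: dL; rewrite /derivable => /cvg_ex[l hl].
    have := hl; rewrite -LE /derive; move/cvg_lim => -> //.
    apply: cvg_trans hl; apply: near_eq_cvg; near=> h.
    by rewrite /= [h *: 1]mulr1.
  have : (fun h : R => (h^-1 *: (L (h + 0) - L 0)) * f h (c h)) @ 0^' -->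
      L' * f 0 (L 0).
    by apply: cvgM => //; apply: cvg_trans Lf; apply: cvg_app; exact: nbhs_dnbhs.
  apply: cvg_trans; apply: near_eq_cvg.
  have hc' : \forall s \near 0^', `|c s - L 0| <= `|L s - L 0| /\
     B s = (L s - L 0) * f s (c s) by exact: nbhs_dnbhs.
  near=> h; rewrite B0 subr0 addr0.
  have [_ ->] : `|c h - L 0| <= `|L h - L 0| /\ B h = (L h - L 0) * f h (c h).
    by near: h.
  by rewrite /GRing.scale /= mulrA.
have lim' : (fun h : R => h^-1 *: ((B \o shift 0) (h *: 1) - B 0)) @ 0^' -->
    L' * f 0 (L 0).
  apply: cvg_trans lim; apply: near_eq_cvg; near=> h.
  by rewrite /= [h *: 1]mulr1.
split; first by apply/cvg_ex; exists (L' * f 0 (L 0)).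
by apply: cvg_lim lim'.
Unshelve. all: by end_near. Qed.

End Leibniz.

(** * The Euler-Lagrange expression and its linearization *)

Section Formulas.
Variable T : comNzRingType.
Implicit Types (u v : T * T).

Definition vdot u v : T := u.1 * v.1 + u.2 * v.2.
Definition vJ u : T * T := (u.2, - u.1).

(* The one-dimensional Euler-Lagrange expression, with k, k1, w1 standing for
   kappa, kappa', W' at |u|^2, and u1, u2 for the derivatives of u. *)
Definition prof (k k1 w1 om c : T) u u1 u2 : T * T :=
  let F ui u1i u2i ju1i :=
    k1 * vdot u1 u1 * ui + 2 * w1 * ui - om * ui - c * ju1i - k * u2i
    - 2 * k1 * vdot u u1 * u1i in
  (F u.1 u1.1 u2.1 (vJ u1).1, F u.2 u1.2 u2.2 (vJ u1).2).

(** The linearization of [prof] without [- k * v2], its only term in second derivatives of v: the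
    linearized equation can then be solved for v2. *)
Definition hess0 (k1 k2 w1 w2 om c : T) V V1 V2 v v1 : T * T :=
  let F Vi V1i V2i vi v1i jv1i :=
    2 * k2 * vdot V v * vdot V1 V1 * Vi + 2 * k1 * vdot V1 v1 * Vi
    + k1 * vdot V1 V1 * vi + 4 * w2 * vdot V v * Vi + 2 * w1 * vi - om * vi
    - c * jv1i - 2 * k1 * vdot V v * V2i
    - 4 * k2 * vdot V v * vdot V V1 * V1i
    - 2 * k1 * (vdot v V1 + vdot V v1) * V1i - 2 * k1 * vdot V V1 * v1i in
  (F V.1 V1.1 V2.1 v.1 v1.1 (vJ v1).1, F V.2 V1.2 V2.2 v.2 v1.2 (vJ v1).2).

Definition hess (k k1 k2 w1 w2 om c : T) V V1 V2 v v1 v2 : T * T :=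
  let H := hess0 k1 k2 w1 w2 om c V V1 V2 v v1 in
  (H.1 - k * v2.1, H.2 - k * v2.2).

(** The differential of mu_phi at V in the direction v, the parameters being fixed; [dmux] is that
    of mu_x. *)
Definition dmuphi (k k1 c : T) V V1 v v1 : T :=
  2 * k1 * vdot V v * vdot (vJ V) V1 + k * (vdot (vJ v) V1 + vdot (vJ V) v1)
  + c * vdot V v.

Definition dmux (k k1 w1 om : T) V V1 v v1 : T :=
  k1 * vdot V v * vdot V1 V1 + k * vdot V1 v1 - 2 * w1 * vdot V v
  + om * vdot V v.

(** With co = cos t and si = sin t this is the exponential of t J. Over a ring, the relation co^2 +
    si^2 = 1 replaces the angle. *)
Definition rot (co si : T) u : T * T :=
  (co * u.1 + si * u.2, co * u.2 - si * u.1).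

(** Rotations preserve [vdot] and commute with [vJ], and [hess] is built from these. *)
Lemma hess_rot (co si k k1 k2 w1 w2 om c : T) V V1 V2 v v1 v2 :
  co ^+ 2 + si ^+ 2 = 1 ->
  hess k k1 k2 w1 w2 om c (rot co si V) (rot co si V1) (rot co si V2)
    (rot co si v) (rot co si v1) (rot co si v2) =
  rot co si (hess k k1 k2 w1 w2 om c V V1 V2 v v1 v2).
Proof.
move=> cs.
have D x y : vdot (rot co si x) (rot co si y) = vdot x y.
  rewrite /vdot /rot /= -[RHS]mul1r -cs; ring.
have JE x : vJ (rot co si x) = rot co si (vJ x).
  by rewrite /vJ /rot /=; congr (_, _); ring.
rewrite /hess /hess0 !D !JE /rot /=; congr (_, _); ring.
Qed.

End Formulas.

Section ProfileDerivative.
Variable R : realType.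
Variables (K K1 K2 W1 W2 : R -> R).
Hypothesis DK : forall x : R, is_derive x (1 : R) K (K1 x).
Hypothesis DK1 : forall x : R, is_derive x (1 : R) K1 (K2 x).
Hypothesis DW1 : forall x : R, is_derive x (1 : R) W1 (W2 x).
Variables (a b a1 b1 a2 b2 om c : R -> R) (t : R).
Variables (a' b' a1' b1' a2' b2' om' c' : R).
Hypothesis (Da : is_derive t (1 : R) a a') (Db : is_derive t (1 : R) b b').
Hypothesis (Da1 : is_derive t (1 : R) a1 a1') (Db1 : is_derive t (1 : R) b1 b1').
Hypothesis (Da2 : is_derive t (1 : R) a2 a2') (Db2 : is_derive t (1 : R) b2 b2').
Hypothesis (Dom : is_derive t (1 : R) om om') (Dc : is_derive t (1 : R) c c').

Let rho s := a s ^+ 2 + b s ^+ 2.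

Lemma is_derive_rho (f f1 : R -> R) : (forall x : R, is_derive x (1 : R) f (f1 x)) ->
  is_derive t (1 : R) (fun s => f (a s ^+ 2 + b s ^+ 2))
    (f1 (rho t) * (2 * (a t * a' + b t * b'))).
Proof.
move=> Df; have Dr : is_derive t (1 : R) rho (2 * (a t * a' + b t * b')).
  by rewrite /rho; derivE; rewrite /= !expr1; ring.
exact: is_derive_fcomp (Df _) Dr.
Qed.

(** The parameters vary too. Their derivatives contribute - om' V - c' J V1, which become the
    sources in the equations for the parameter derivatives of the family. *)
Lemma is_derive_prof :
  let r := rho t in
  let P s := prof (K (a s ^+ 2 + b s ^+ 2)) (K1 (a s ^+ 2 + b s ^+ 2))
    (W1 (a s ^+ 2 + b s ^+ 2)) (om s) (c s) (a s, b s) (a1 s, b1 s) (a2 s, b2 s) in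
  let H := hess (K r) (K1 r) (K2 r) (W1 r) (W2 r) (om t) (c t)
    (a t, b t) (a1 t, b1 t) (a2 t, b2 t) (a', b') (a1', b1') (a2', b2') in
  is_derive t (1 : R) (fun s => (P s).1) (H.1 - om' * a t - c' * b1 t) /\
  is_derive t (1 : R) (fun s => (P s).2) (H.2 - om' * b t + c' * a1 t).
Proof.
have e1 := is_derive_rho DK; have e2 := is_derive_rho DK1.
have e3 := is_derive_rho DW1.
rewrite /prof /hess /hess0 /vdot /vJ /=; split; derivE.
  rewrite /=; ring.
rewrite /=; ring.
Qed.

Lemma is_derive_muphi :
  let r := rho t in
  is_derive t (1 : R) (fun s => K (a s ^+ 2 + b s ^+ 2) * vdot (vJ (a s, b s)) (a1 s, b1 s)
     + c s / 2 * (a s ^+ 2 + b s ^+ 2))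
    (dmuphi (K r) (K1 r) (c t) (a t, b t) (a1 t, b1 t) (a', b') (a1', b1')
     + c' / 2 * r).
Proof.
have e1 := is_derive_rho DK.
rewrite /dmuphi /vdot /vJ /=; derivE; by rewrite /= !expr1 /rho; field.
Qed.

Lemma is_derive_mux (W : R -> R) :
  (forall x : R, is_derive x (1 : R) W (W1 x)) ->
  let r := rho t in
  is_derive t (1 : R) (fun s => 2^-1 * K (a s ^+ 2 + b s ^+ 2) *
     (a1 s ^+ 2 + b1 s ^+ 2) - W (a s ^+ 2 + b s ^+ 2)
     + om s / 2 * (a s ^+ 2 + b s ^+ 2))
    (dmux (K r) (K1 r) (W1 r) (om t) (a t, b t) (a1 t, b1 t) (a', b') (a1', b1')
     + om' / 2 * r).
Proof.
move=> DW; have e1 := is_derive_rho DK; have e2 := is_derive_rho DW.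
rewrite /dmux /vdot /vJ /=; derivE; by rewrite /= !expr1 /rho; field.
Qed.

End ProfileDerivative.

Section Conservation.
Variable T : comNzRingType.
Variables (k k1 k2 w1 w2 om c : T) (V V1 V2 v v1 v2 : T * T).

(* The derivatives of [dmuphi] and [dmux] along x, with k' = 2 k1 V.V1, etc. *)
Definition dmuphi' : T :=
  2 * (2 * k2 * vdot V V1) * vdot V v * vdot (vJ V) V1
  + 2 * k1 * (vdot V1 v + vdot V v1) * vdot (vJ V) V1
  + 2 * k1 * vdot V v * vdot (vJ V) V2
  + 2 * k1 * vdot V V1 * (vdot (vJ v) V1 + vdot (vJ V) v1)
  + k * (vdot (vJ v1) V1 + vdot (vJ v) V2 + vdot (vJ V1) v1 + vdot (vJ V) v2)
  + c * (vdot V1 v + vdot V v1).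

Definition dmux' : T :=
  2 * k2 * vdot V V1 * vdot V v * vdot V1 V1
  + k1 * (vdot V1 v + vdot V v1) * vdot V1 V1
  + k1 * vdot V v * (2 * vdot V1 V2)
  + 2 * k1 * vdot V V1 * vdot V1 v1 + k * (vdot V2 v1 + vdot V1 v2)
  - 2 * (2 * w2 * vdot V V1) * vdot V v - 2 * w1 * (vdot V1 v + vdot V v1)
  + om * (vdot V1 v + vdot V v1).

Let N := prof k k1 w1 om c V V1 V2.
Let H := hess k k1 k2 w1 w2 om c V V1 V2 v v1 v2.

(** Noether's identity for rotations, linearized: the linearized equation is paired with the
    generator J V. In [dmux_conservation] the symmetry is translation and the generator V1. The
    second term vanishes when V solves the profile equation. *)
Lemma dmuphi_conservation : dmuphi' = - vdot (vJ V) H - vdot (vJ v) N.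
Proof. by rewrite /dmuphi' /H /N /hess /hess0 /prof /vdot /vJ /=; ring. Qed.

Lemma dmux_conservation : dmux' = - vdot V1 H - vdot v1 N.
Proof. by rewrite /dmux' /H /N /hess /hess0 /prof /vdot /vJ /=; ring. Qed.

(* A dependence relation between the tangent vectors (J V, J V1), (V1, V2)
   yields one between the differentials of the constants of integration. *)
Lemma dmu_dependence (p q : T) :
  N = (0, 0) ->
  p * (vJ V).1 + q * V1.1 = 0 -> p * (vJ V).2 + q * V1.2 = 0 ->
  p * (vJ V1).1 + q * V2.1 = 0 -> p * (vJ V1).2 + q * V2.2 = 0 ->
  p * dmuphi k k1 c V V1 v v1 + q * dmux k k1 w1 om V V1 v v1 = 0.
Proof.
case=> n1 n2 h1 h2 h3 h4.
suff -> : p * dmuphi k k1 c V V1 v v1 + q * dmux k k1 w1 om V V1 v v1 =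
   - q * ((N.1) * v.1 + (N.2) * v.2)
   + (k * v1.1 + c * v.2 + 2 * k1 * vdot V v * V1.1) * (p * (vJ V).1 + q * V1.1)
   + (k * v1.2 - c * v.1 + 2 * k1 * vdot V v * V1.2) * (p * (vJ V).2 + q * V1.2)
   - k * v.1 * (p * (vJ V1).1 + q * V2.1) - k * v.2 * (p * (vJ V1).2 + q * V2.2)
   - 2 * k1 * vdot V1 v * (V.1 * (p * (vJ V).1 + q * V1.1) + V.2 * (p * (vJ V).2 + q * V1.2)).
  by rewrite [N]surjective_pairing /= n1 n2 h1 h2 h3 h4; ring.
rewrite /N /dmuphi /dmux /prof /vdot /vJ /=; ring.
Qed.

End Conservation.

Lemma ord2_ind (P : 'I_2 -> Prop) : P 0 -> P 1 -> forall i, P i.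
Proof.
by move=> P0 P1 [[|[|//]] hi]; [move: P0|move: P1]; congr P; apply: val_inj.
Qed.

Section EulerLagrange.
Variables (R : realType) (n : nat).
Local Notation space := 'rV[R]_n.+1.
Local Notation e j := (delta_mx 0 j : space).

Definition pair_of (u : 'cV[R]_2) : R * R := (u 0 0, u 1 0).
Definition sel (i : 'I_2) (p : R * R) : R := if i == 0 then p.1 else p.2.

Lemma sum_ord2 (F : 'I_2 -> R) : \sum_i F i = F 0 + F 1.
Proof. by rewrite big_ord_recl big_ord1; congr (_ + F _); apply: val_inj. Qed.

Lemma dotE (u v : 'cV[R]_2) : dot u v = vdot (pair_of u) (pair_of v).
Proof. by rewrite /dot sum_ord2. Qed.

Lemma sqnormE (u : 'cV[R]_2) : sqnorm u = u 0 0 ^+ 2 + u 1 0 ^+ 2.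
Proof. by rewrite /sqnorm sum_ord2 !big_ord1. Qed.

Lemma sqnorm_mxE (G : 'M[R]_(2, n.+1)) :
  sqnorm G = \sum_j (G 0 j ^+ 2 + G 1 j ^+ 2).
Proof. by rewrite /sqnorm sum_ord2 -big_split. Qed.

Lemma Jmx0 (u : 'cV[R]_2) : (Jmx R *m u) 0 0 = u 1 0.
Proof. by rewrite mxE sum_ord2 !mxE /= mul0r mul1r add0r. Qed.

Lemma Jmx1 (u : 'cV[R]_2) : (Jmx R *m u) 1 0 = - u 0 0.
Proof. by rewrite mxE sum_ord2 !mxE /= mul0r mulN1r addr0. Qed.

Variables (K K1 Wf W1 : R -> R).
Hypothesis DK : forall x : R, is_derive x (1 : R) K (K1 x).
Hypothesis DW : forall x : R, is_derive x (1 : R) Wf (W1 x).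
Variables (kx kphi om c : R).

Local Notation A := (@scaled_density R n K Wf kx kphi om c).
Local Notation tw := (@twist R n kx kphi).

Lemma twist_affine (h : R) dU U dG G i j :
  tw (h *: dU + U) (h *: dG + G) i j = h * tw dU dG i j + tw U G i j.
Proof.
rewrite !mxE; case: ifP => _; rewrite ?mxE//.
by elim/ord2_ind: i; rewrite !sum_ord2 !mxE /=; ring.
Qed.

(** A single expansion along a line in (U, G); both partial gradients are read off from it by taking
    dU or dG equal to 0. *)
Lemma is_derive_density (dU U : 'cV[R]_2) (dG G : 'M[R]_(2, n.+1)) :
  let r := U 0 0 ^+ 2 + U 1 0 ^+ 2 in
  let UdU := U 0 0 * dU 0 0 + U 1 0 * dU 1 0 in
  let T := tw U G in let dT := tw dU dG in
  is_derive (0 : R) (1 : R) (fun h : R => A (h *: dU + U) (h *: dG + G))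
  (K1 r * UdU * (\sum_j (T 0 j ^+ 2 + T 1 j ^+ 2))
   + K r * (\sum_j (T 0 j * dT 0 j + T 1 j * dT 1 j))
   + 2 * W1 r * UdU - om * UdU
   + c / 2 * (dU 1 0 * T 0 0 - dU 0 0 * T 1 0 + U 1 0 * dT 0 0 - U 0 0 * dT 1 0)).
Proof.
move=> r UdU T dT; rewrite /scaled_density /unscaled_density /H0 /Mass /Q1.
have Dr : is_derive (0 : R) (1 : R)
    (fun h : R => (h * dU 0 0 + U 0 0) ^+ 2 + (h * dU 1 0 + U 1 0) ^+ 2) (2 * UdU).
  by derivE; rewrite /= !mul0r !add0r /UdU; ring.
have r0 : (0 * dU 0 0 + U 0 0) ^+ 2 + (0 * dU 1 0 + U 1 0) ^+ 2 = r.
  by rewrite !mul0r !add0r.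
have DKr : is_derive (0 : R) (1 : R) (fun h : R =>
    K ((h * dU 0 0 + U 0 0) ^+ 2 + (h * dU 1 0 + U 1 0) ^+ 2)) (K1 r * (2 * UdU)).
  by apply: is_derive_fcomp Dr; rewrite r0.
have DWr : is_derive (0 : R) (1 : R) (fun h : R =>
    Wf ((h * dU 0 0 + U 0 0) ^+ 2 + (h * dU 1 0 + U 1 0) ^+ 2)) (W1 r * (2 * UdU)).
  by apply: is_derive_fcomp Dr; rewrite r0.
have DS : is_derive (0 : R) (1 : R) (fun h : R =>
    \sum_j ((h * dT 0 j + T 0 j) ^+ 2 + (h * dT 1 j + T 1 j) ^+ 2))
    (\sum_j 2 * (T 0 j * dT 0 j + T 1 j * dT 1 j)).
  apply: is_derive_fsum => j; derivE; rewrite /= !mul0r !add0r; ring.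
have -> : (fun h : R => 2^-1 * K (sqnorm (h *: dU + U)) *
      sqnorm (tw (h *: dU + U) (h *: dG + G)) + Wf (sqnorm (h *: dU + U)) -
      om * (2^-1 * sqnorm (h *: dU + U)) +
      c * (2^-1 * dot (Jmx R *m (h *: dU + U))
        (col 0 (tw (h *: dU + U) (h *: dG + G))))) =
  (fun h : R => 2^-1 * K ((h * dU 0 0 + U 0 0) ^+ 2 + (h * dU 1 0 + U 1 0) ^+ 2) *
      (\sum_j ((h * dT 0 j + T 0 j) ^+ 2 + (h * dT 1 j + T 1 j) ^+ 2)) +
      Wf ((h * dU 0 0 + U 0 0) ^+ 2 + (h * dU 1 0 + U 1 0) ^+ 2) -
      om * (2^-1 * ((h * dU 0 0 + U 0 0) ^+ 2 + (h * dU 1 0 + U 1 0) ^+ 2)) +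
      c * (2^-1 * ((h * dU 1 0 + U 1 0) * (h * dT 0 0 + T 0 0) -
                   (h * dU 0 0 + U 0 0) * (h * dT 1 0 + T 1 0)))).
  apply: funext => h; rewrite sqnormE sqnorm_mxE.
  rewrite (eq_bigr (fun j => (h * dT 0 j + T 0 j) ^+ 2 + (h * dT 1 j + T 1 j) ^+ 2)).
    rewrite dotE /vdot /pair_of /= Jmx0 Jmx1 ![col _ _ _ _]mxE !twist_affine.
    have dUE i : (h *: dU + U) i 0 = h * dU i 0 + U i 0 by rewrite !mxE.
    by rewrite !dUE mulNr.
  by move=> j _; rewrite !twist_affine.
derivE; rewrite /= r0 !mul0r !add0r -mulr_sumr -/T -/dT.
under eq_bigr do rewrite !mul0r !add0r.
by field.
Qed.

Lemma grad_gradE U G i j : grad_grad A U G i j =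
  (if j == 0 then kx else 1) * (K (U 0 0 ^+ 2 + U 1 0 ^+ 2) * tw U G i j
    + if j == 0 then c / 2 * (Jmx R *m U) i 0 else 0).
Proof.
rewrite mxE -derive_line.
have [_] := is_derive_density 0 U (delta_mx i j) G.
rewrite (_ : (fun h : R => A (h *: 0 + U) (h *: delta_mx i j + G)) =
  (fun h : R => A U (h *: delta_mx i j + G))); last first.
  by apply: funext => h; rewrite scaler0 add0r.
move=> ->.
have d k l : tw 0 (delta_mx i j) k l =
    (if l == 0 then kx else 1) * ((k == i) && (l == j))%:R.
  rewrite mxE mulmx0 !mxE mulr0 addr0; case: ifP => //; by rewrite mul1r.
have z0 k : (0 : 'cV[R]_2) k 0 = 0 by rewrite mxE.
rewrite !z0 !(mulr0, mul0r, addr0, add0r, subr0) (eq_bigr (fun l => (tw U G i l *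
    (if l == 0 then kx else 1)) * (l == j)%:R)); last first.
  move=> l _; rewrite !d {d}; elim/ord2_ind: i => /=; ring.
rewrite (bigD1 j)//= big1 ?addr0; last by move=> l /negPf ->; rewrite mulr0.
rewrite eqxx !d {d}.
have [->|j0] := eqVneq j 0.
  by elim/ord2_ind: i; rewrite ?Jmx0 ?Jmx1 /=; ring.
by elim/ord2_ind: i; rewrite /= ?(eq_sym 0 j) ?(negPf j0) /=; ring.
Qed.

Lemma grad_stateE U G i : grad_state A U G i 0 =
  let r := U 0 0 ^+ 2 + U 1 0 ^+ 2 in
  let T := tw U G in
  let jt := sel i (vJ (T 0 0, T 1 0)) in
  K1 r * U i 0 * (\sum_j (T 0 j ^+ 2 + T 1 j ^+ 2)) - K r * kphi * jt
  + 2 * W1 r * U i 0 - om * U i 0 + c / 2 * (kphi * U i 0 - jt).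
Proof.
rewrite mxE -derive_line /=.
have [_] := is_derive_density (delta_mx i 0) U 0 G.
rewrite (_ : (fun h : R => A (h *: delta_mx i 0 + U) (h *: 0 + G)) =
  (fun h : R => A (h *: delta_mx i 0 + U) G)); last first.
  by apply: funext => h; rewrite scaler0 add0r.
move=> ->.
have d k l : tw (delta_mx i 0) 0 k l =
    (if l == 0 then kphi else 0) * sel k (vJ ((i == 0)%:R, (i == 1)%:R)).
  rewrite /sel /vJ mxE; case: ifP => _; last by rewrite mxE mul0r.
  rewrite mxE mulr0 add0r; congr (_ * _).
  by elim/ord2_ind: k; rewrite ?Jmx0 ?Jmx1 mxE /= ?andbT eq_sym.
have d' k : (delta_mx i 0 : 'cV[R]_2) k 0 = (k == i)%:R by rewrite mxE eqxx andbT.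
rewrite (bigD1 (0 : 'I_n.+1) (F := fun j => _ * tw (delta_mx i 0) _ _ _ + _))//=.
rewrite [X in K _ * (_ + X)]big1 ?addr0; last first.
  by move=> l /negPf l0; rewrite !d l0 !mul0r !mulr0 addr0.
by rewrite !d !d' {d d'} eqxx; elim/ord2_ind: i; rewrite /sel /vJ /=; field.
Qed.

Section Fields.
Variable f : space -> 'cV[R]_2.
Hypothesis sf : smooth_on setT f.

Definition pd (g : space -> 'cV[R]_2) j (i : 'I_2) : space -> R :=
  coordD g [:: e j] i 0.
Definition pdd (g : space -> 'cV[R]_2) j (i : 'I_2) : space -> R :=
  coordD g [:: e j; e j] i 0.

Lemma is_derive_comp_field i j z : is_derive z (e j) (fun w => f w i 0) (pd f j i z).
Proof. exact: (coordD_is_derive sf [::] i 0 (e j) I). Qed.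

Lemma is_derive_pd i j z : is_derive z (e j) (pd f j i) (pdd f j i z).
Proof. exact: (coordD_is_derive sf [:: e j] i 0 (e j) I). Qed.

(* (k_x d_x + k_phi J) f and its iterate *)
Definition twd (g : space -> 'cV[R]_2) z : R * R :=
  (kx * pd g 0 0 z + kphi * g z 1 0, kx * pd g 0 1 z - kphi * g z 0 0).
Definition twdd (g : space -> 'cV[R]_2) z : R * R :=
  (kx ^+ 2 * pdd g 0 0 z + 2 * kx * kphi * pd g 0 1 z - kphi ^+ 2 * g z 0 0,
   kx ^+ 2 * pdd g 0 1 z - 2 * kx * kphi * pd g 0 0 z - kphi ^+ 2 * g z 1 0).

Lemma twist_nabla z i j : tw (f z) (nabla f z) i j =
  if j == 0 then sel i (twd f z) else pd f j i z.
Proof.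
rewrite !mxE; case: eqP => [->|_] //.
rewrite (_ : ('D_(e 0) f z) i 0 = pd f 0 i z)// /sel /twd.
by elim/ord2_ind: i; rewrite !sum_ord2 !mxE /=; ring.
Qed.

(** The terms in kphi come from the gradient in the state and those in kx from the divergence; they
    recombine into k_x d_x + k_phi J. Hence the x-part is the one-dimensional expression [prof] with
    twisted derivatives as arguments, and the sum collects the transverse directions. *)
Lemma euler_lagrangeE z i : euler_lagrange A f z i 0 =
  let r := f z 0 0 ^+ 2 + f z 1 0 ^+ 2 in
  sel i (prof (K r) (K1 r) (W1 r) om c (pair_of (f z)) (twd f z) (twdd f z))
  + \sum_(j | j != 0) (K1 r * (pd f j 0 z ^+ 2 + pd f j 1 z ^+ 2) * f z i 0
      - K r * pdd f j i z
      - 2 * K1 r * (f z 0 0 * pd f j 0 z + f z 1 0 * pd f j 1 z) * pd f j i z).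
Proof.
set r := _ + _ => /=; rewrite /euler_lagrange /divergence mxE [in X in _ + X]mxE summxE.
pose q j := 2 * (f z 0 0 * pd f j 0 z + f z 1 0 * pd f j 1 z).
pose dv i j := if j == 0 then
   kx * (K1 r * q 0 * sel i (twd f z)
      + K r * (kx * pdd f 0 i z + kphi * sel i (vJ (pd f 0 0 z, pd f 0 1 z)))
      + c / 2 * sel i (vJ (pd f 0 0 z, pd f 0 1 z)))
   else K1 r * q j * pd f j i z + K r * pdd f j i z.
have Dr j : is_derive z (e j) (fun w => f w 0 0 ^+ 2 + f w 1 0 ^+ 2) (q j).
  have d0 := is_derive_comp_field 0 j z; have d1 := is_derive_comp_field 1 j z.
  by derivE; rewrite /q /= !expr1; ring.
have DKr j : is_derive z (e j) (fun w => K (f w 0 0 ^+ 2 + f w 1 0 ^+ 2)) (K1 r * q j).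
  by apply: is_derive_fcomp (Dr j).
have Ddv j : is_derive z (e j)
    (fun w => col j (grad_grad A (f w) (nabla f w))) (\col_i dv i j).
  apply: is_derive_mx => k l; rewrite mxE.
  rewrite (_ : (fun _ => _) = (fun w => (if j == 0 then kx else 1) *
    (K (f w 0 0 ^+ 2 + f w 1 0 ^+ 2) * (if j == 0 then sel k (twd f w) else pd f j k w)
    + if j == 0 then c / 2 * sel k (vJ (f w 0 0, f w 1 0)) else 0))); last first.
    apply: funext => w; rewrite mxE grad_gradE twist_nabla; congr (_ * (_ + _)).
    case: ifP => // _; congr (_ * _).
    by elim/ord2_ind: k; rewrite ?Jmx0 ?Jmx1.
  have dk := DKr j; rewrite /dv.
  have d0 := is_derive_comp_field 0 j z; have d1 := is_derive_comp_field 1 j z.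
  have dp0 := is_derive_pd 0 j z; have dp1 := is_derive_pd 1 j z.
  case: eqP => [j0|_].
    subst j; elim/ord2_ind: k; rewrite /sel /twd /vJ /=; derivE;
      rewrite /= -/r; ring.
  have dpk := is_derive_pd k j z.
  by derivE; rewrite /= -/r; ring.
under [X in _ - X]eq_bigr => j _ do rewrite (@derive_val _ _ _ _ _ _ _ (Ddv j)) mxE.
rewrite (bigD1 (0 : 'I_n.+1))//= /dv eqxx.
rewrite grad_stateE /= -/r (bigD1 (0 : 'I_n.+1))//= !twist_nabla eqxx.
rewrite (eq_bigr (fun j => pd f j 0 z ^+ 2 + pd f j 1 z ^+ 2)); last first.
  by move=> j /negPf j0; rewrite !twist_nabla j0.
rewrite [X in _ - (_ + X)](eq_bigr (fun j => K1 r * q j * pd f j i z + K r * pdd f j i z)); last first.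
  by move=> j /negPf ->.
rewrite [X in _ = _ + X](eq_bigr (fun j =>
    K1 r * f z i 0 * (pd f j 0 z ^+ 2 + pd f j 1 z ^+ 2)
    - (K1 r * q j * pd f j i z + K r * pdd f j i z))); last first.
  by move=> j _; rewrite /q; ring.
rewrite sumrB -mulr_sumr; set S := \sum_(j | _) _; set S' := \sum_(j | _) _.
clearbody S S'; rewrite /q {q dv Dr DKr Ddv}.
by elim/ord2_ind: i; rewrite /sel /prof /twd /twdd /pair_of /vdot /vJ /=; field.
Qed.

End Fields.

End EulerLagrange.

Section SmoothLinear.
Variables (R : realType) (E F : normedModType R).
Implicit Types f g : E -> F.

Lemma iterD_affine (s : R) f g vs : smooth_on setT f -> smooth_on setT g ->
  iterD vs (fun w => f w + s *: g w) = (fun w => iterD vs f w + s *: iterD vs g w).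
Proof.
move=> sf sg; elim: vs => [|v vs IH] //=; rewrite -/(iterD _ _) IH.
apply: funext => w.
have df : is_derive w v (iterD vs f) ('D_v (iterD vs f) w).
  by split=> //; apply/diff_derivable/sf.
have dg : is_derive w v (iterD vs g) ('D_v (iterD vs g) w).
  by split=> //; apply/diff_derivable/sg.
have D := is_deriveD df (is_deriveZ s dg).
exact: (@derive_val _ _ _ _ _ _ _ D).
Qed.

Lemma smooth_on_affine (s : R) f g : smooth_on setT f -> smooth_on setT g ->
  smooth_on setT (fun w => f w + s *: g w).
Proof.
move=> sf sg vs x _; rewrite -/(iterD vs _) iterD_affine//.
apply: differentiableD; first exact: sf.
by apply: differentiableZ; exact: sg.
Qed.

End SmoothLinear.

Section Hessian.
Variables (R : realType) (n : nat).
Local Notation space := 'rV[R]_n.+1.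
Variables (K K1 K2 Wf W1 W2 : R -> R).
Hypothesis DK : forall x : R, is_derive x (1 : R) K (K1 x).
Hypothesis DK1 : forall x : R, is_derive x (1 : R) K1 (K2 x).
Hypothesis DW : forall x : R, is_derive x (1 : R) Wf (W1 x).
Hypothesis DW1 : forall x : R, is_derive x (1 : R) W1 (W2 x).
Variables (kx kphi om c : R).
Local Notation A := (@scaled_density R n K Wf kx kphi om c).
Variables V h : space -> 'cV[R]_2.
Hypotheses (sV : smooth_on setT V) (sh : smooth_on setT h).

Lemma pd_affine (s : R) j i z :
  pd (fun w => V w + s *: h w) j i z = pd V j i z + s * pd h j i z.
Proof. by rewrite /pd /coordD iterD_affine// !mxE. Qed.

Lemma pdd_affine (s : R) j i z :
  pdd (fun w => V w + s *: h w) j i z = pdd V j i z + s * pdd h j i z.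
Proof. by rewrite /pdd /coordD iterD_affine// !mxE. Qed.

(** The transverse derivatives of V vanish at z, so along V + s h every transverse term is of order
    s^2, except the one linear in the second derivatives of h. *)
Lemma HessE z i : (forall j k, j != 0 -> pd V j k z = 0) ->
  (forall j k, j != 0 -> pdd V j k z = 0) ->
  Hess A V h z i 0 =
  let r := V z 0 0 ^+ 2 + V z 1 0 ^+ 2 in
  sel i (hess (K r) (K1 r) (K2 r) (W1 r) (W2 r) om c (pair_of (V z))
    (twd kx kphi V z) (twdd kx kphi V z) (pair_of (h z)) (twd kx kphi h z)
    (twdd kx kphi h z))
  - \sum_(j | j != 0) K r * pdd h j i z.
Proof.
move=> V0 V00; set r := _ + _ => /=.
pose H k := sel k (hess (K r) (K1 r) (K2 r) (W1 r) (W2 r) om c (pair_of (V z))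
    (twd kx kphi V z) (twdd kx kphi V z) (pair_of (h z)) (twd kx kphi h z)
    (twdd kx kphi h z)) - \sum_(j | j != 0) K r * pdd h j k z.
suff D : is_derive (0 : R) (1 : R)
    (fun s : R => euler_lagrange A (fun w => V w + s *: h w) z) (\col_k H k).
  by rewrite /Hess derive1E (@derive_val _ _ _ _ _ _ _ D) mxE.
apply: is_derive_mx => k l; rewrite ord1 mxE {l}.
have fE (s : R) j : (V z + s *: h z) j 0 = V z j 0 + s * h z j 0 by rewrite !mxE.
pose lin (p q : R) (s : R) : R := p + s * q.
have Dl p q : is_derive (0 : R) (1 : R) (lin p q) q.
  by rewrite /lin; derivE; rewrite /=; ring.
have l0 p q : lin p q 0 = p by rewrite /lin mul0r addr0.
pose a := lin (V z 0 0) (h z 0 0); pose b := lin (V z 1 0) (h z 1 0).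
pose a1 := lin (twd kx kphi V z).1 (twd kx kphi h z).1.
pose b1 := lin (twd kx kphi V z).2 (twd kx kphi h z).2.
pose a2 := lin (twdd kx kphi V z).1 (twdd kx kphi h z).1.
pose b2 := lin (twdd kx kphi V z).2 (twdd kx kphi h z).2.
pose rs s := a s ^+ 2 + b s ^+ 2.
have rs0 : rs 0 = r by rewrite /rs /a /b !l0.
pose P s := prof (K (a s ^+ 2 + b s ^+ 2)) (K1 (a s ^+ 2 + b s ^+ 2))
    (W1 (a s ^+ 2 + b s ^+ 2)) om c (a s, b s) (a1 s, b1 s) (a2 s, b2 s).
have twdE s : twd kx kphi (fun w => V w + s *: h w) z = (a1 s, b1 s).
  by rewrite /twd !pd_affine !fE /a1 /b1 /lin /=; congr (_, _); ring.
have twddE s : twdd kx kphi (fun w => V w + s *: h w) z = (a2 s, b2 s).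
  rewrite /twdd !pdd_affine !pd_affine !fE /a2 /b2 /lin /=.
  move: (pdd V 0 0 z) (pdd h 0 0 z) (pdd V 0 1 z) (pdd h 0 1 z) => p1 p2 p3 p4.
  move: (pd V 0 0 z) (pd h 0 0 z) (pd V 0 1 z) (pd h 0 1 z) => p5 p6 p7 p8.
  by congr (_, _); ring.
pose S j s := K1 (rs s) * ((s * pd h j 0 z) ^+ 2 + (s * pd h j 1 z) ^+ 2) *
     lin (V z k 0) (h z k 0) s
   - K (rs s) * lin 0 (pdd h j k z) s
   - 2 * K1 (rs s) * (a s * (s * pd h j 0 z) + b s * (s * pd h j 1 z)) *
     (s * pd h j k z).
have -> : (fun s : R => euler_lagrange A (fun w => V w + s *: h w) z k 0) =
  (fun s => sel k (P s) + \sum_(j | j != 0) S j s).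
  apply: funext => s; rewrite (euler_lagrangeE DK DW)//; last exact: smooth_on_affine.
  rewrite twdE twddE /pair_of !fE /=; congr (_ + _).
  apply: eq_bigr => j j0; rewrite !pd_affine !pdd_affine !V0// V00//.
  by rewrite /S /lin !add0r.
have [D1 D2] := @is_derive_prof R K K1 K2 W1 W2 DK DK1 DW1 a b a1 b1 a2 b2
  (fun=> om) (fun=> c) 0 _ _ _ _ _ _ 0 0 (Dl _ _) (Dl _ _) (Dl _ _) (Dl _ _)
  (Dl _ _) (Dl _ _) (is_derive_fcst _ _ _) (is_derive_fcst _ _ _).
have DS j : is_derive (0 : R) (1 : R) (S j) (- (K r * pdd h j k z)).
  have e1 := is_derive_rho (Dl (V z 0 0) (h z 0 0)) (Dl (V z 1 0) (h z 1 0)) DK.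
  have e2 := is_derive_rho (Dl (V z 0 0) (h z 0 0)) (Dl (V z 1 0) (h z 1 0)) DK1.
  rewrite -/a -/b in e1 e2.
  have dk := Dl (V z k 0) (h z k 0); have dp := Dl 0 (pdd h j k z).
  have da := Dl (V z 0 0) (h z 0 0); have db := Dl (V z 1 0) (h z 1 0).
  rewrite -/a in da; rewrite -/b in db.
  by rewrite /S /rs; derivE; rewrite /= -/(rs 0) !l0 rs0; ring.
have sumE : (fun s => sel k (P s) + \sum_(j | j != 0) S j s) =
   (fun s => sel k (P s) + \sum_j (if j != 0 then S j s else 0)).
  by apply: funext => s; rewrite big_mkcond.
have DSum : is_derive (0 : R) (1 : R) (fun s => \sum_j (if j != 0 then S j s else 0))
   (\sum_j (if j != 0 then - (K r * pdd h j k z) else 0)).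
  by apply: is_derive_fsum => j; case: ifP => _ //; exact: is_derive_fcst.
have HE : H k = sel k (hess (K r) (K1 r) (K2 r) (W1 r) (W2 r) om c (pair_of (V z))
    (twd kx kphi V z) (twdd kx kphi V z) (pair_of (h z)) (twd kx kphi h z)
    (twdd kx kphi h z)) + \sum_j (if j != 0 then - (K r * pdd h j k z) else 0).
  by rewrite /H -big_mkcond sumrN.
rewrite sumE HE; move: D1 D2; rewrite -/(rs 0) rs0 /a /b /a1 /b1 /a2 /b2 !l0.
rewrite !mul0r !subr0 addr0 => D1 D2.
apply: is_derive_fD DSum; rewrite /P /a /b /a1 /b1 /a2 /b2 /pair_of.
rewrite -!surjective_pairing in D1 D2 *.
by elim/ord2_ind: k {S sumE HE DS} => /=.
Qed.

End Hessian.

(** The tool for differentiating identities along the family: both sides agree near the point, so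
    their derivatives, computed separately, coincide. *)
Lemma is_derive_unique_near (R : realType) (E : normedModType R) (f g : E -> R)
  x v df dg : (\near x, f x = g x) -> is_derive x v f df -> is_derive x v g dg ->
  df = dg.
Proof.
by move=> fg Df [_ <-]; have [_ <-] := near_eq_is_derive fg Df.
Qed.

Lemma is_derive_unique (R : realType) (E : normedModType R) (f g : E -> R)
  x v df dg : f =1 g -> is_derive x v f df -> is_derive x v g dg -> df = dg.
Proof. by move=> /funext -> [_ <-] [_ <-]. Qed.

Section RealSmooth.
Variables (R : realType) (g : R -> R).
Hypothesis sg : smooth_on setT g.

Definition rD k : R -> R := iterD (nseq k (1 : R)) g.

Lemma is_derive_rD k (x : R) : is_derive x (1 : R) (rD k) (rD k.+1 x).
Proof. by split=> //; apply/diff_derivable/sg. Qed.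

End RealSmooth.

Section LiftX.
Variables (R : realType) (n : nat) (v : R -> 'cV[R]_2).
Hypothesis sv : smooth_on setT v.

(** On functions of x alone, the derivative in the direction u acts as u_0 d/dx; whence the product
    of first coordinates. *)
Lemma iterD_lift (vs : seq 'rV[R]_n.+1) : iterD vs (lift_x v) =
  fun z => (\prod_(u <- vs) u 0 0) *: iterD (nseq (size vs) (1 : R)) v (z 0 0).
Proof.
elim: vs => [|u vs IH] /=.
  by apply: funext => z; rewrite big_nil scale1r.
rewrite -/(iterD _ _) IH; apply: funext => z; rewrite big_cons.
set w := iterD _ v; set p := \prod_(_ <- _) _.
have Dw : is_derive (z 0 0) (1 : R) w ('D_1 w (z 0 0)).
  by split=> //; apply/diff_derivable/sv.
suff D : is_derive z u (fun z => p *: w (z 0 0)) ((u 0 0 * p) *: 'D_1 w (z 0 0)).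
  exact: (@derive_val _ _ _ _ _ _ _ D).
apply: is_derive_mx => i j; rewrite mxE.
have Dij := is_derive_coord i j Dw.
have Dz : is_derive z u (fun z : 'rV[R]_n.+1 => z 0 0) (u 0 0).
  by apply: is_derive_coord; exact: is_derive_id.
rewrite (_ : (fun _ => _) = (fun z : 'rV[R]_n.+1 => p * w (z 0 0) i j)); last first.
  by apply: funext => y; rewrite mxE.
have D := is_derive_fM (is_derive_fcst p z u)
  (is_derive_fcomp (f := fun x => w x i j) (g := fun z : 'rV[R]_n.+1 => z 0 0) Dij Dz).
by apply: (is_derive_eq D); ring.
Qed.

Lemma smooth_on_lift : smooth_on setT (@lift_x R n v).
Proof.
move=> vs z _; rewrite -/(iterD _ _) iterD_lift; apply: differentiableZ.
apply: (differentiable_comp (f := fun z : 'rV[R]_n.+1 => z 0 0)).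
  exact: differentiable_coord.
exact: sv.
Qed.

Lemma pd_lift j i z : pd (@lift_x R n v) j i z =
  if j == 0 then coordD v [:: 1] i 0 (z 0 0) else 0.
Proof.
rewrite /pd /coordD iterD_lift big_seq1 mxE mxE eqxx andTb eq_sym.
by case: (j == 0); rewrite ?mul1r ?mul0r.
Qed.

Lemma pdd_lift j i z : pdd (@lift_x R n v) j i z =
  if j == 0 then coordD v [:: 1; 1] i 0 (z 0 0) else 0.
Proof.
rewrite /pdd /coordD iterD_lift big_cons big_seq1 mxE mxE eqxx andTb eq_sym.
by case: (j == 0); rewrite ?mul1r ?mul0r.
Qed.

End LiftX.

Section Densities.
Variables (R : realType) (n : nat) (kappa W g w : R -> R).
Hypothesis kappaE : forall r, 0 <= r -> kappa r = g r.
Hypothesis WE : forall r, 0 <= r -> W r = w r.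

Lemma sqnorm_ge0 m k (A : 'M[R]_(m, k)) : 0 <= sqnorm A.
Proof. by apply: sumr_ge0 => i _; apply: sumr_ge0 => j _; exact: sqr_ge0. Qed.

(** kappa and W are evaluated only at squared norms, hence may be replaced by functions smooth on
    the whole line, for which derivatives make sense everywhere. *)
Lemma scaled_densityE kx kphi om c :
  scaled_density (n := n) kappa W kx kphi om c = scaled_density g w kx kphi om c.
Proof.
apply: funext => U; apply: funext => G.
by rewrite /scaled_density /unscaled_density /H0 kappaE ?WE ?sqnorm_ge0.
Qed.

Lemma unscaled_densityE om c :
  unscaled_density (n := n) kappa W om c = scaled_density g w 1 0 om c.
Proof.
rewrite -scaled_densityE; apply: funext => U; apply: funext => G.
rewrite /scaled_density; congr (unscaled_density _ _ _ _ _ _).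
by apply/matrixP => i j; rewrite mxE mul1r mul0r addr0 if_same.
Qed.

End Densities.

(** * The profile family and its derivatives along the parameters *)

Section Family.
Variables (R : realType) (n : nat) (kappa W g w : R -> R).
Hypothesis sg : smooth_on setT g.
Hypothesis sw : smooth_on setT w.
Hypothesis kappaE : forall r, 0 <= r -> kappa r = g r.
Hypothesis WE : forall r, 0 <= r -> W r = w r.
Variables (O : set 'rV[R]_4) (V : 'rV[R]_4 -> R -> 'cV[R]_2).
Variables (X xi : 'rV[R]_4 -> R) (p0 : 'rV[R]_4).
Hypothesis fam : profile_family n kappa W O V X xi.
Hypothesis Op0 : O p0.

Local Notation K k := (rD g k).
Local Notation Wd k := (rD w k).
Let F (q : 'rV[R]_4 * R) := V q.1 q.2.
Let OR : set ('rV[R]_4 * R) := [set q | O q.1].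
Let ex : 'rV[R]_4 * R := (0, 1).
Let ea a : 'rV[R]_4 * R := (delta_mx 0 a, 0).

(** The k-th x-derivative of the i-th coordinate of V p; [Va a k i] is its derivative along the a-th
    parameter at p0. Both are taken on the function of (p, x) jointly, the one whose smoothness is
    given, so that mixed derivatives can be exchanged. *)
Definition Vx k (p : 'rV[R]_4) i x : R := coordD F (nseq k ex) i 0 (p, x).
Definition Va a k i x : R := coordD F (ea a :: nseq k ex) i 0 (p0, x).
Definition xi_a a : R := 'D_(delta_mx 0 a) xi p0.
Definition X_a a : R := 'D_(delta_mx 0 a) X p0.

Lemma family_smooth_F : smooth_on OR F. Proof. by case: fam. Qed.

Lemma family_open_OR : open OR.
Proof.
apply: open_comp; last by case: fam.
by move=> x _; exact: cvg_fst.
Qed.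

Lemma is_derive_Vx k p i x : O p -> is_derive x (1 : R) (Vx k p i) (Vx k.+1 p i x).
Proof.
move=> Op.
have E y : (p, y) = (p, 0) + y *: ex :> _ * _.
  by rewrite /ex /= -[RHS]/(p + y *: 0, 0 + y *: 1) scaler0 addr0 add0r [y *: 1]mulr1.
rewrite /Vx (_ : (fun x => _) = (fun y => coordD F (nseq k ex) i 0 ((p, 0) + y *: ex))).
  rewrite [in X in is_derive _ _ _ X]E; apply: is_derive_shift_line.
  by apply: (coordD_is_derive family_smooth_F); rewrite -E.
by apply: funext => y; rewrite E.
Qed.

Lemma derive1_V p x i : O p -> derive1 (V p) x i 0 = Vx 1 p i x.
Proof.
move=> Op.
have D : is_derive x (1 : R) (V p) (\col_k Vx 1 p k x).
  apply: is_derive_mx => k l; rewrite ord1 mxE; exact: (is_derive_Vx 0 k x Op).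
by rewrite derive1E (@derive_val _ _ _ _ _ _ _ D) mxE.
Qed.

Lemma curve_in_O a : \forall s \near (0 : R), O (p0 + s *: delta_mx 0 a).
Proof.
have oO : open O by case: fam.
have c := @line_continuous R _ p0 (delta_mx 0 a) 0.
apply: c; rewrite scale0r addr0; exact: open_nbhs_nbhs.
Qed.

Lemma is_derive_Va a k i x : is_derive (0 : R) (1 : R)
  (fun s : R => Vx k (p0 + s *: delta_mx 0 a) i x) (Va a k i x).
Proof.
have E s : (p0 + s *: delta_mx 0 a, x) = (p0, x) + s *: ea a :> _ * _.
  by rewrite /ea -[RHS]/(p0 + s *: delta_mx 0 a, x + s *: 0) scaler0 addr0.
rewrite /Vx (_ : (fun s => _) = (fun s => coordD F (nseq k ex) i 0 ((p0, x) + s *: ea a))).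
  apply: is_derive_shift_line; rewrite scale0r addr0.
  exact: (coordD_is_derive family_smooth_F).
by apply: funext => y; rewrite E.
Qed.

(** In [Va] the parameter derivative is taken last; Schwarz's theorem lets the x-derivative pass
    under it. *)
Lemma is_derive_Va_x a k i x : is_derive x (1 : R) (Va a k i) (Va a k.+1 i x).
Proof.
have E y : (p0, y) = (p0, 0) + y *: ex :> _ * _.
  by rewrite /ex /= -[RHS]/(p0 + y *: 0, 0 + y *: 1) scaler0 addr0 add0r [y *: 1]mulr1.
have D : is_derive x (1 : R) (Va a k i)
    (coordD F (ex :: ea a :: nseq k ex) i 0 (p0, x)).
  rewrite /Va (_ : (fun x => _) =
      (fun y => coordD F (ea a :: nseq k ex) i 0 ((p0, 0) + y *: ex))).
    rewrite [in X in is_derive _ _ _ X]E; apply: is_derive_shift_line.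
    by apply: (coordD_is_derive family_smooth_F); rewrite -E.
  by apply: funext => y; rewrite E.
apply: (is_derive_eq D); rewrite /Va.
have cD vs v q : OR q -> is_derive q v (coordD F vs i 0) (coordD F (v :: vs) i 0 q).
  exact: (coordD_is_derive family_smooth_F).
have cC vs : {for (p0, x), continuous (coordD F vs i 0)}.
  by apply: (coordD_continuous family_smooth_F).
apply: (@schwarz R _ OR (p0, x) (ea a) ex (coordD F (nseq k ex) i 0)
  (coordD F (ea a :: nseq k ex) i 0) (coordD F (ex :: nseq k ex) i 0)
  (coordD F (ex :: ea a :: nseq k ex) i 0)
  (coordD F (ea a :: ex :: nseq k ex) i 0)) => //.
exact: family_open_OR.
Qed.

Lemma is_derive_scalar_p (f : 'rV[R]_4 -> R) a : smooth_on O f ->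
  is_derive (0 : R) (1 : R) (fun s : R => f (p0 + s *: delta_mx 0 a))
    ('D_(delta_mx 0 a) f p0).
Proof.
move=> sf; apply: is_derive_shift_line; rewrite scale0r addr0.
by split=> //; apply/diff_derivable; exact: (sf [::] _ Op0).
Qed.

Lemma is_derive_coord_p k a :
  is_derive (0 : R) (1 : R) (fun s : R => (p0 + s *: delta_mx 0 a : 'rV[R]_4) 0 k)
    (k == a)%:R.
Proof.
rewrite (_ : (fun s => _) = (fun s => p0 0 k + s * (k == a)%:R)).
  by derivE; rewrite /=; ring.
by apply: funext => s; rewrite !mxE eqxx.
Qed.

Definition Vp k p x : R * R := (Vx k p 0 x, Vx k p 1 x).
Definition Vap a k x : R * R := (Va a k 0 x, Va a k 1 x).
Definition rho p x : R := Vx 0 p 0 x ^+ 2 + Vx 0 p 1 x ^+ 2.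

Lemma profile_ode p x : O p ->
  prof (K 0 (rho p x)) (K 1 (rho p x)) (Wd 1 (rho p x)) (p 0 0) (p 0 1)
    (Vp 0 p x) (Vp 1 p x) (Vp 2 p x) = (0, 0).
Proof.
move=> Op; have [_ wp _ _ _] := fam.
have [sV EL _ _ _ _ _] := wp _ Op.
(* Derivatives of the curve V p in x agree with the partial derivatives of the joint function. *)
have cE k i y : coordD (V p) (nseq k (1 : R)) i 0 y = Vx k p i y.
  elim: k i y => [|k IH] i y //.
  have D1 : is_derive y (1 : R) (coordD (V p) (nseq k (1 : R)) i 0)
      (coordD (V p) (nseq k.+1 (1 : R)) i 0 y).
    exact: (coordD_is_derive sV).
  have D2 := is_derive_Vx k i y Op.
  rewrite -(_ : coordD (V p) (nseq k (1 : R)) i 0 = Vx k p i) in D2; last first.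
    by apply: funext => t; exact: IH.
  by rewrite -(@derive_val _ _ _ _ _ _ _ D1) (@derive_val _ _ _ _ _ _ _ D2).
pose z : 'rV[R]_n.+1 := \row_j x.
have zx : z 0 0 = x by rewrite mxE.
have := EL z; rewrite (unscaled_densityE _ kappaE WE) => EL0.
have E i := @euler_lagrangeE R n (K 0) (K 1) (Wd 0) (Wd 1) (is_derive_rD sg 0)
   (is_derive_rD sw 0) 1 0 (p 0 0) (p 0 1) _ (@smooth_on_lift R n (V p) sV) z i.
rewrite EL0 in E.
have twE : twd 1 0 (lift_x (V p)) z = Vp 1 p x.
  rewrite /twd !pd_lift// !eqxx !mul1r !mul0r subr0 addr0 zx.
  by rewrite /Vp -!(cE 1%N).
have twwE : twdd 1 0 (lift_x (V p)) z = Vp 2 p x.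
  rewrite /twdd !pd_lift// !pdd_lift// !eqxx zx /Vp -!(cE 2%N) /=.
  by congr (_, _); ring.
have sum0 i : \sum_(j | j != 0) (K 1 (rho p x) * (pd (@lift_x R n (V p)) j 0 z ^+ 2 +
    pd (@lift_x R n (V p)) j 1 z ^+ 2) * lift_x (V p) z i 0
    - K 0 (rho p x) * pdd (lift_x (V p)) j i z
    - 2 * K 1 (rho p x) * (lift_x (V p) z 0 0 * pd (lift_x (V p)) j 0 z
       + lift_x (V p) z 1 0 * pd (lift_x (V p)) j 1 z) * pd (lift_x (V p)) j i z) = 0.
  rewrite big1// => j /negPf j0; rewrite !pd_lift// !pdd_lift// j0; ring.
have rE : lift_x (V p) z 0 0 ^+ 2 + lift_x (V p) z 1 0 ^+ 2 = rho p x.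
  by rewrite /lift_x zx.
have pE : pair_of (lift_x (V p) z) = Vp 0 p x by rewrite /lift_x zx.
have E0 := E 0; have E1 := E 1.
rewrite /= rE twE twwE pE sum0 addr0 mxE /sel /= in E0.
rewrite /= rE twE twwE pE sum0 addr0 mxE /sel /= in E1.
by rewrite [LHS]surjective_pairing /= -E0 -E1.
Qed.

(** The profile equation differentiated along the a-th parameter. It contains omega_phi and c_x
    explicitly, whence the sources V and J V_x; the derivatives along mu_phi and mu_x are in the
    kernel. *)
Lemma Va_hess a x :
  hess (K 0 (rho p0 x)) (K 1 (rho p0 x)) (K 2 (rho p0 x)) (Wd 1 (rho p0 x))
    (Wd 2 (rho p0 x)) (p0 0 0) (p0 0 1) (Vp 0 p0 x) (Vp 1 p0 x) (Vp 2 p0 x)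
    (Vap a 0 x) (Vap a 1 x) (Vap a 2 x) =
  ((a == 0)%:R * Vx 0 p0 0 x + (a == 1)%:R * Vx 1 p0 1 x,
   (a == 0)%:R * Vx 0 p0 1 x - (a == 1)%:R * Vx 1 p0 0 x).
Proof.
pose c s : 'rV[R]_4 := p0 + s *: delta_mx 0 a.
have c0 : c 0 = p0 by rewrite /c scale0r addr0.
have D k i := is_derive_Va a k i x.
have Dp j : is_derive (0 : R) (1 : R) (fun s => c s 0 j) (a == j)%:R.
  by rewrite eq_sym; exact: is_derive_coord_p.
have [D1 D2] := is_derive_prof (is_derive_rD sg 0) (is_derive_rD sg 1)
  (is_derive_rD sw 1) (D 0%N 0) (D 0%N 1) (D 1%N 0) (D 1%N 1) (D 2%N 0) (D 2%N 1)
  (Dp 0) (Dp 1).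
pose P s := prof (K 0 (rho (c s) x)) (K 1 (rho (c s) x))
    (Wd 1 (rho (c s) x)) (c s 0 0) (c s 0 1)
    (Vp 0 (c s) x) (Vp 1 (c s) x) (Vp 2 (c s) x).
have Z1 : \forall s \near (0 : R), (P s).1 = 0.
  by apply: filterS (curve_in_O a) => s Os; rewrite /P profile_ode.
have Z2 : \forall s \near (0 : R), (P s).2 = 0.
  by apply: filterS (curve_in_O a) => s Os; rewrite /P profile_ode.
have D0 : is_derive (0 : R) (1 : R) (fun=> 0 : R) 0 by exact: is_derive_fcst.
have F1 := is_derive_unique_near Z1 D1 D0.
have F2 := is_derive_unique_near Z2 D2 D0.
rewrite -/(c 0) c0 in F1 F2.
rewrite /Vap /Vp /rho; move: F1 F2.
by case: (hess _ _ _ _ _ _ _ _ _ _ _ _ _) => h1 h2 /= H1 H2; congr (_, _); lra.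
Qed.

(** The formula for mu_phi differentiated along the family: the first term is the derivative of the
    parameter mu_phi itself, the second that of the explicit c_x. *)
Lemma Va_dmuphi a x :
  dmuphi (K 0 (rho p0 x)) (K 1 (rho p0 x)) (p0 0 1) (Vp 0 p0 x) (Vp 1 p0 x)
    (Vap a 0 x) (Vap a 1 x) = (a == 2)%:R - (a == 1)%:R / 2 * rho p0 x.
Proof.
pose c s : 'rV[R]_4 := p0 + s *: delta_mx 0 a.
have c0 : c 0 = p0 by rewrite /c scale0r addr0.
have D k i := is_derive_Va a k i x.
have Dp j : is_derive (0 : R) (1 : R) (fun s => c s 0 j) (a == j)%:R.
  by rewrite eq_sym; exact: is_derive_coord_p.
have D1 := is_derive_muphi (is_derive_rD sg 0) (D 0%N 0) (D 0%N 1) (D 1%N 0) (D 1%N 1) (Dp 1).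
have Z : \forall s \near (0 : R), c s 0 2 = K 0 (rho (c s) x) *
    vdot (vJ (Vp 0 (c s) x)) (Vp 1 (c s) x) + c s 0 1 / 2 * rho (c s) x.
  apply: filterS (curve_in_O a) => s Os; have [_ wp _ _ _] := fam.
  have [_ _ _ _ _ mp _] := wp _ Os; rewrite -/(c s) (mp x) dotE sqnormE /pair_of.
  by rewrite Jmx0 Jmx1 !derive1_V// kappaE// addr_ge0// sqr_ge0.
have F1 := is_derive_unique_near Z (Dp 2) D1.
rewrite -/(c 0) c0 in F1.
by rewrite F1 /Vap /Vp /rho addrK.
Qed.

Lemma Va_dmux a x :
  dmux (K 0 (rho p0 x)) (K 1 (rho p0 x)) (Wd 1 (rho p0 x)) (p0 0 0)
    (Vp 0 p0 x) (Vp 1 p0 x) (Vap a 0 x) (Vap a 1 x) =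
  (a == 3)%:R - (a == 0)%:R / 2 * rho p0 x.
Proof.
pose c s : 'rV[R]_4 := p0 + s *: delta_mx 0 a.
have c0 : c 0 = p0 by rewrite /c scale0r addr0.
have D k i := is_derive_Va a k i x.
have Dp j : is_derive (0 : R) (1 : R) (fun s => c s 0 j) (a == j)%:R.
  by rewrite eq_sym; exact: is_derive_coord_p.
have D1 := is_derive_mux (is_derive_rD sg 0) (D 0%N 0) (D 0%N 1) (D 1%N 0) (D 1%N 1)
  (Dp 0) (is_derive_rD sw 0).
have Z : \forall s \near (0 : R), c s 0 3 = 2^-1 * K 0 (rho (c s) x) *
    (Vx 1 (c s) 0 x ^+ 2 + Vx 1 (c s) 1 x ^+ 2) - Wd 0 (rho (c s) x)
    + c s 0 0 / 2 * rho (c s) x.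
  apply: filterS (curve_in_O a) => s Os; have [_ wp _ _ _] := fam.
  have [_ _ _ _ _ _ mp] := wp _ Os; rewrite -/(c s) (mp x) !sqnormE.
  by rewrite !derive1_V// kappaE ?WE// addr_ge0// sqr_ge0.
have F1 := is_derive_unique_near Z (Dp 3) D1.
rewrite -/(c 0) c0 in F1.
by rewrite F1 /Vap /Vp /rho addrK.
Qed.

Lemma pair_of_expJ (t : R) (u : 'cV[R]_2) :
  pair_of (expJ t *m u) = rot (cos t) (sin t) (pair_of u).
Proof.
rewrite /expJ mulmxDl mul_scalar_mx -scalemxAl /pair_of /rot.
have E (a b : R) (v1 v2 : 'cV[R]_2) i :
    (a *: v1 + b *: v2) i 0 = a * v1 i 0 + b * v2 i 0 by rewrite !mxE.
by rewrite !E Jmx0 Jmx1 mulrN.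
Qed.

Lemma Vx_shift k p x : O p ->
  Vp k p (x + X p) = rot (cos (xi p)) (sin (xi p)) (Vp k p x).
Proof.
move=> Op; have [_ wp _ _ _] := fam; have [_ _ _ sh _ _ _] := wp _ Op.
elim: k x => [|k IH] x; first by rewrite -pair_of_expJ -sh.
have DX : is_derive x (1 : R) (fun y => y + X p) 1.
  by derivE; rewrite addr0.
have D i := @is_derive_fcomp R R (Vx k p i) (fun y => y + X p) x 1 _ _
  (is_derive_Vx k i (x + X p) Op) DX.
have D0 := is_derive_Vx k 0 x Op; have D1 := is_derive_Vx k 1 x Op.
have E0 : is_derive x (1 : R) (fun y => cos (xi p) * Vx k p 0 y + sin (xi p) * Vx k p 1 y)
  (cos (xi p) * Vx k.+1 p 0 x + sin (xi p) * Vx k.+1 p 1 x).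
  by derivE; rewrite /=; ring.
have E1 : is_derive x (1 : R) (fun y => cos (xi p) * Vx k p 1 y - sin (xi p) * Vx k p 0 y)
  (cos (xi p) * Vx k.+1 p 1 x - sin (xi p) * Vx k.+1 p 0 x).
  by derivE; rewrite /=; ring.
have Z0 y : Vx k p 0 (y + X p) = cos (xi p) * Vx k p 0 y + sin (xi p) * Vx k p 1 y.
  exact: (congr1 fst (IH y)).
have Z1 y : Vx k p 1 (y + X p) = cos (xi p) * Vx k p 1 y - sin (xi p) * Vx k p 0 y.
  exact: (congr1 snd (IH y)).
have := is_derive_unique Z0 (D 0) E0; have := is_derive_unique Z1 (D 1) E1.
by rewrite /Vp /rot /= !mulr1 => -> ->.
Qed.

Lemma is_derive_pair (E1 E2 : normedModType R) (f : R -> E1) (h : R -> E2) (t : R) d1 d2 :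
  is_derive t (1 : R) f d1 -> is_derive t (1 : R) h d2 ->
  is_derive t (1 : R) (fun s => (f s, h s)) (d1, d2).
Proof.
move=> [df f1] [dh h1].
have df' : differentiable f t by exact/derivable1_diffP.
have dh' : differentiable h t by exact/derivable1_diffP.
have dp : differentiable (fun s => (f s, h s)) t by exact: differentiable_pair.
split; first exact/derivable1_diffP.
by rewrite deriveE// diff_pair// -!deriveE// f1 h1.
Qed.

(** The relation V (x + X) = exp (xi J) V x differentiated along a parameter. The derivative of the
    profile fails to be quasi-periodic by xi_a J V - X_a V_x, and these coefficients form the first
    two rows of Sigma_t. *)
Lemma Va_shift a k x : Vap a k (x + X p0) =
  rot (cos (xi p0)) (sin (xi p0))
    ((Vap a k x).1 + xi_a a * (Vp k p0 x).2 - X_a a * (Vp k.+1 p0 x).1,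
     (Vap a k x).2 - xi_a a * (Vp k p0 x).1 - X_a a * (Vp k.+1 p0 x).2).
Proof.
pose c s : 'rV[R]_4 := p0 + s *: delta_mx 0 a.
have c0 : c 0 = p0 by rewrite /c scale0r addr0.
have [_ _ _ sX sxi] := fam.
have DX : is_derive (0 : R) (1 : R) (fun s => X (c s)) (X_a a).
  exact: is_derive_scalar_p.
have Dxi : is_derive (0 : R) (1 : R) (fun s => xi (c s)) (xi_a a).
  exact: is_derive_scalar_p.
have Dc : is_derive (0 : R) (1 : R) c (delta_mx 0 a).
  apply: is_derive_mx => i j; rewrite ord1 mxE eqxx /=; exact: is_derive_coord_p.
have D i : is_derive (0 : R) (1 : R) (fun s => Vx k (c s) i (x + X (c s)))
    (Va a k i (x + X p0) + X_a a * Vx k.+1 p0 i (x + X p0)).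
  have Dg : is_derive (0 : R) (1 : R) (fun s => (c s, x + X (c s)))
      (delta_mx 0 a, X_a a).
    apply: is_derive_pair => //; derivE; by rewrite add0r.
  apply: (is_derive_curve (f := coordD F (nseq k ex) i 0) _ Dg).
    by apply: (coordD_differentiable family_smooth_F); rewrite /OR /= c0.
  rewrite c0; have -> : (delta_mx 0 a, X_a a) = 1 *: ea a + X_a a *: ex.
    rewrite /ea /ex -[RHS]/(1 *: delta_mx 0 a + X_a a *: 0, 1 *: 0 + X_a a *: 1).
    by rewrite scale1r !scaler0 addr0 add0r [X_a a *: 1]mulr1.
  have := @is_derive_linear R _ (coordD F (nseq k ex) i 0) (p0, x + X p0) (ea a) ex
    1 (X_a a) (Va a k i (x + X p0)) (Vx k.+1 p0 i (x + X p0)).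
  rewrite mul1r; apply.
  - by apply: (coordD_differentiable family_smooth_F).
  - by apply: (coordD_is_derive family_smooth_F).
  - by apply: (coordD_is_derive family_smooth_F).
have Dv i : is_derive (0 : R) (1 : R) (fun s => Vx k (c s) i x) (Va a k i x).
  exact: is_derive_Va.
have Dcos : is_derive (0 : R) (1 : R) (fun s => cos (xi (c s))) (- sin (xi p0) * xi_a a).
  by apply: is_derive_fcomp Dxi; rewrite c0; exact: is_derive_cos.
have Dsin : is_derive (0 : R) (1 : R) (fun s => sin (xi (c s))) (cos (xi p0) * xi_a a).
  by apply: is_derive_fcomp Dxi; rewrite c0; exact: is_derive_sin.
have Dv0 := Dv 0; have Dv1 := Dv 1.
have E0 : is_derive (0 : R) (1 : R)
    (fun s => cos (xi (c s)) * Vx k (c s) 0 x + sin (xi (c s)) * Vx k (c s) 1 x)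
    (cos (xi p0) * (Va a k 0 x + xi_a a * Vx k p0 1 x)
     + sin (xi p0) * (Va a k 1 x - xi_a a * Vx k p0 0 x)).
  by derivE; rewrite /= c0; ring.
have E1 : is_derive (0 : R) (1 : R)
    (fun s => cos (xi (c s)) * Vx k (c s) 1 x - sin (xi (c s)) * Vx k (c s) 0 x)
    (cos (xi p0) * (Va a k 1 x - xi_a a * Vx k p0 0 x)
     - sin (xi p0) * (Va a k 0 x + xi_a a * Vx k p0 1 x)).
  by derivE; rewrite /= c0; ring.
have Z0 : \forall s \near (0 : R), Vx k (c s) 0 (x + X (c s)) =
    cos (xi (c s)) * Vx k (c s) 0 x + sin (xi (c s)) * Vx k (c s) 1 x.
  by apply: filterS (curve_in_O a) => s Os; have := congr1 fst (Vx_shift k x Os).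
have Z1 : \forall s \near (0 : R), Vx k (c s) 1 (x + X (c s)) =
    cos (xi (c s)) * Vx k (c s) 1 x - sin (xi (c s)) * Vx k (c s) 0 x.
  by apply: filterS (curve_in_O a) => s Os; have := congr1 snd (Vx_shift k x Os).
have H0 := is_derive_unique_near Z0 (D 0) E0.
have H1 := is_derive_unique_near Z1 (D 1) E1.
have S0 : Vx k.+1 p0 0 (x + X p0) = _ := congr1 fst (Vx_shift k.+1 x Op0).
have S1 : Vx k.+1 p0 1 (x + X p0) = _ := congr1 snd (Vx_shift k.+1 x Op0).
rewrite S0 /rot /= in H0; rewrite S1 /rot /= in H1.
by rewrite /Vap /rot /=; congr (_, _); [move: H0|move: H1];
  move: (Va _ _ _ _) (Vx _ _ _ _) => *; lra.
Qed.

End Family.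

Section RealContinuous.
Variables (R : realType) (T : topologicalType).
Implicit Types f h : T -> R.

Lemma continuous_fD f h : continuous f -> continuous h ->
  continuous (fun x => f x + h x).
Proof. by move=> cf ch x; apply: continuousD; [exact: cf|exact: ch]. Qed.

Lemma continuous_fB f h : continuous f -> continuous h ->
  continuous (fun x => f x - h x).
Proof. by move=> cf ch x; apply: continuousB; [exact: cf|exact: ch]. Qed.

Lemma continuous_fM f h : continuous f -> continuous h ->
  continuous (fun x => f x * h x).
Proof. by move=> cf ch x; apply: continuousM; [exact: cf|exact: ch]. Qed.

Lemma continuous_fN f : continuous f -> continuous (fun x => - f x).
Proof. by move=> cf x; apply: continuousN; exact: cf. Qed.

Lemma continuous_fcst (c : R) : continuous (fun _ : T => c).
Proof. by move=> x; exact: cst_continuous. Qed.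

Lemma continuous_fX f k : continuous f -> continuous (fun x => f x ^+ k).
Proof.
move=> cf; elim: k => [|k IH]; first exact: continuous_fcst.
by under eq_fun do rewrite exprS; exact: continuous_fM.
Qed.

End RealContinuous.

Lemma continuous_pair (T U V : topologicalType) (f : T -> U) (h : T -> V) x :
  {for x, continuous f} -> {for x, continuous h} ->
  {for x, continuous (fun y => (f y, h y))}.
Proof.
move=> cf ch.
exact: (@cvg_pair _ _ _ (nbhs x) (nbhs (f x)) (nbhs (h x)) _ _ _ f h cf ch).
Qed.

Section HalfProducts.
Variables (R : realType) (E : normedModType R) (f1 f2 f3 f4 : E -> R) (q v : E).
Variables (d1 d2 d3 d4 : R).
Hypotheses (D1 : is_derive q v f1 d1) (D2 : is_derive q v f2 d2).
Hypotheses (D3 : is_derive q v f3 d3) (D4 : is_derive q v f4 d4).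

Lemma is_derive_half_norm :
  is_derive q v (fun q => 2^-1 * (f1 q * f1 q + f2 q * f2 q))
    (f1 q * d1 + f2 q * d2).
Proof. by derivE; rewrite /=; field. Qed.

Lemma is_derive_half_det :
  is_derive q v (fun q => 2^-1 * (f2 q * f3 q - f1 q * f4 q))
    (2^-1 * (d2 * f3 q + f2 q * d3 - (d1 * f4 q + f1 q * d4))).
Proof. by derivE; rewrite /=; ring. Qed.

End HalfProducts.

(** * The rows of Sigma_t as integrals over one period *)

Section SigmaRows.
Local Opaque coordD.
Variables (R : realType) (n : nat) (kappa W g w : R -> R).
Hypothesis kappaE : forall r, 0 <= r -> kappa r = g r.
Variables (O : set 'rV[R]_4) (V : 'rV[R]_4 -> R -> 'cV[R]_2).
Variables (X xi : 'rV[R]_4 -> R) (p0 : 'rV[R]_4).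
Hypothesis fam : profile_family n kappa W O V X xi.
Hypothesis Op0 : O p0.
Local Notation leb := (@lebesgue_measure R).
Local Notation ex := ((0, 1) : 'rV[R]_4 * R).
Local Notation ea a := ((delta_mx 0 a, 0) : 'rV[R]_4 * R).
Local Notation F := (fun q : 'rV[R]_4 * R => V q.1 q.2).
Local Notation cD vs i := (coordD F vs i 0).
Local Notation OR := [set q : 'rV[R]_4 * R | O q.1].

Lemma leibniz_family a (phi phi1 : 'rV[R]_4 * R -> R) :
  (forall q, OR q -> is_derive q (ea a) phi (phi1 q)) ->
  (forall q, OR q -> {for q, continuous phi}) ->
  (forall q, OR q -> {for q, continuous phi1}) ->
  is_derive p0 (delta_mx 0 a) (fun p => Rintegral leb `[0, X p] (fun x => phi (p, x)))
    (Rintegral leb `[0, X p0] (fun x => phi1 (p0, x))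
     + X_a X p0 a * phi (p0, X p0)).
Proof.
move=> Dphi cphi cphi1.
pose c (s : R) : 'rV[R]_4 := s *: delta_mx 0 a + p0.
have c0 : c 0 = p0 by rewrite /c scale0r add0r.
have [oO wp _ sX _] := fam.
have cc : continuous c.
  move=> s; have := @line_continuous R _ p0 (delta_mx 0 a) s.
  by rewrite (_ : (fun h : R => _) = c)//; apply: funext => t; rewrite /c addrC.
have X0 : 0 < X p0 by have [_ _ X0 _ _ _ _] := wp _ Op0.
have nO : \forall s \near (0 : R), O (c s).
  apply: cc; rewrite c0; exact: open_nbhs_nbhs.
have [r /= r0 hr] := (nbhs_ballP _ _).1 nO.
have r20 : 0 < r / 2 by rewrite divr_gt0.
have Oc s : `|s| <= r / 2 -> O (c s).
  by move=> hs; apply: hr; rewrite -ball_normE /ball_ /= sub0r normrN; lra.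
have cpair (s x : R) : {for (s, x), continuous (fun q : R * R => (c q.1, q.2))}.
  apply: continuous_pair; last exact: cvg_snd.
  by apply: continuous_comp; [exact: cvg_fst|exact: cc].
(* The uniform bound required by [leibniz] comes from compactness of a box of parameters and
   positions. *)
have [M hM] : exists M : R, forall s x : R, `|s| <= r / 2 -> 0 <= x <= X p0 + 1 ->
    `|phi1 (c s, x)| <= M.
  pose A : set (R * R) := `[- (r / 2), r / 2] `*` `[0, X p0 + 1].
  have cA : compact A by apply: compact_setX; exact: segment_compact.
  have A0 : A !=set0.
    by exists (0, 0); split; rewrite /= in_itv /=; apply/andP; split; lra.
  have Ain (q : R * R) : A q -> OR (c q.1, q.2).
    move=> [/= h _]; rewrite in_itv /= in h; apply: Oc.
    by rewrite ler_norml.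
  have cf : {within A, continuous (fun q : R * R => `|phi1 (c q.1, q.2)|)}.
    apply: continuous_in_subspaceT => q /set_mem Aq.
    apply: continuous_comp; last exact: norm_continuous.
    apply: (continuous_comp (f := fun q : R * R => (c q.1, q.2))).
      by case: q Aq => s x _; exact: cpair.
    by apply: cphi1; exact: Ain.
  have [q Aq hq] := compact_EVT_max A0 cA cf.
  exists `|phi1 (c q.1, q.2)| => s x hs hx; apply: (hq (s, x)).
  by apply/mem_set; split; rewrite /= in_itv //= -ler_norml.
apply/is_derive_line.
have := @leibniz R (fun s x => phi (c s, x)) (fun s x => phi1 (c s, x))
  (fun s => X (c s)) (X_a X p0 a) (r / 2) M r20.
rewrite /= c0; apply => //.
- move=> s hs x; apply: (continuous_comp (f := fun x : R => (c s, x))).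
    by apply: continuous_pair; [exact: cst_continuous|exact: cvg_id].
  by apply: cphi; exact: Oc.
- move=> s x hs.
  have E (t : R) : (c t, x) = (p0, x) + t *: ea a :> _ * _.
    by rewrite -[RHS]/(p0 + t *: delta_mx 0 a, x + t *: 0) scaler0 addr0 addrC.
  rewrite (_ : (fun t => phi (c t, x)) = (fun t => phi ((p0, x) + t *: ea a))).
    by rewrite E; apply: is_derive_shift_line; rewrite -E; apply: Dphi; exact: Oc.
  by apply: funext => t; rewrite E.
- apply: (continuous_comp (f := fun q : R * R => (c q.1, q.2))).
    exact: cpair.
  by apply: cphi; rewrite /= c0.
- have := @is_derive_scalar_p R O p0 Op0 X a sX.
  by rewrite /c; under eq_fun do rewrite addrC.
Qed.

Lemma coordD_continuousM vs ws i j q : OR q ->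
  {for q, continuous (fun q => cD vs i q * cD ws j q)}.
Proof.
move=> Oq; have [_ _ sF _ _] := fam.
by apply: continuousM; apply: (coordD_continuous sF).
Qed.

Let Vp := Vp V.
Let Vap := Vap V p0.

Lemma Sigma_t0 a : Sigma_t V X xi p0 0 a = xi_a xi p0 a.
Proof. by rewrite mxE. Qed.

Lemma Sigma_t1 a : Sigma_t V X xi p0 1 a = X_a X p0 a.
Proof. by rewrite mxE. Qed.

Lemma Vap_continuous a k i : continuous (Va V p0 a k i).
Proof.
move=> x; apply: is_derive_continuous (is_derive_Va_x fam Op0 a k i x).
Qed.

Lemma Vx_continuous k i : continuous (Vx V k p0 i).
Proof.
move=> x; apply: is_derive_continuous (is_derive_Vx fam k i x Op0).
Qed.

Lemma profile_X_pos : 0 < X p0.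
Proof. by have [_ wp _ _ _] := fam; have [_ _ X0 _ _ _ _] := wp _ Op0. Qed.

Lemma rho_X : rho V p0 (X p0) = rho V p0 0.
Proof.
have := Vx_shift fam 0 0 Op0; rewrite add0r => -[e0 e1].
rewrite /rho e0 e1 /=; have := cos2Dsin2 (xi p0).
set C := cos _; set S := sin _; set p := Vx _ _ _ _ _; set q := Vx _ _ _ _ _ => cs.
by transitivity ((C ^+ 2 + S ^+ 2) * (p ^+ 2 + q ^+ 2)); [ring|rewrite cs mul1r].
Qed.

(** The endpoint contribution is evaluated at 0 instead of X because the squared norm of the profile
    has period X. *)
Lemma Sigma_t2 a P : (forall x : R, is_derive x (1 : R) P (vdot (Vp 0 p0 x) (Vap a 0 x))) ->
  Sigma_t V X xi p0 2 a = P (X p0) - P 0 + X_a X p0 a * (rho V p0 0 / 2).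
Proof.
move=> DP; have [_ _ sF _ _] := fam.
pose phi q := 2^-1 * (cD [::] 0 q * cD [::] 0 q + cD [::] 1 q * cD [::] 1 q).
pose phi1 q := cD [::] 0 q * cD [:: ea a] 0 q + cD [::] 1 q * cD [:: ea a] 1 q.
have D : is_derive p0 (delta_mx 0 a)
   (fun p => Rintegral leb `[0, X p] (fun x => phi (p, x)))
    (Rintegral leb `[0, X p0] (fun x => phi1 (p0, x))
     + X_a X p0 a * phi (p0, X p0)).
  apply: leibniz_family => q Oq.
  - have d0 := coordD_is_derive sF [::] 0 0 (ea a) Oq.
    have d1 := coordD_is_derive sF [::] 1 0 (ea a) Oq.
    exact: is_derive_half_norm.
  - apply: continuousM; first exact: cst_continuous.
    by apply: continuousD; exact: coordD_continuousM.
  - by apply: continuousD; exact: coordD_continuousM.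
have E : (fun p => nth 0 [:: xi p; X p; mass_integral (V p) (X p);
    Q1_integral (V p) (X p)] (nat_of_ord (2 : 'I_4))) =
    (fun p => Rintegral leb `[0, X p] (fun x => phi (p, x))).
  apply: funext => p /=; apply: eq_Rintegral => x _.
  by rewrite sqnormE !expr2.
rewrite mxE E (@derive_val _ _ _ _ _ _ _ D).
have cq : continuous (fun x => Vx V 0 p0 0 x * Va V p0 a 0 0 x
    + Vx V 0 p0 1 x * Va V p0 a 0 1 x).
  by apply: continuous_fD; apply: continuous_fM; (exact: Vx_continuous || exact: Vap_continuous).
rewrite (@Rintegral_antiderivative R _ P 0 (X p0) profile_X_pos cq DP).
congr (_ + _ * _); rewrite -rho_X /phi /rho !expr2.
by rewrite mulrC.
Qed.

Lemma Sigma_t3 a P : (forall x : R, is_derive x (1 : R) P (vdot (vJ (Vap a 0 x)) (Vp 1 p0 x))) ->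
  Sigma_t V X xi p0 3 a = P (X p0) - P 0 + xi_a xi p0 a * (rho V p0 0 / 2).
Proof.
move=> DP; have [_ _ sF _ _] := fam.
pose phi q := 2^-1 * (cD [::] 1 q * cD [:: ex] 0 q - cD [::] 0 q * cD [:: ex] 1 q).
pose phi1 q := 2^-1 * (cD [:: ea a] 1 q * cD [:: ex] 0 q + cD [::] 1 q * cD [:: ea a; ex] 0 q
  - (cD [:: ea a] 0 q * cD [:: ex] 1 q + cD [::] 0 q * cD [:: ea a; ex] 1 q)).
have D : is_derive p0 (delta_mx 0 a)
   (fun p => Rintegral leb `[0, X p] (fun x => phi (p, x)))
    (Rintegral leb `[0, X p0] (fun x => phi1 (p0, x))
     + X_a X p0 a * phi (p0, X p0)).
  apply: leibniz_family => q Oq.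
  - have d0 := coordD_is_derive sF [::] 0 0 (ea a) Oq.
    have d1 := coordD_is_derive sF [::] 1 0 (ea a) Oq.
    have d2 := coordD_is_derive sF [:: ex] 0 0 (ea a) Oq.
    have d3 := coordD_is_derive sF [:: ex] 1 0 (ea a) Oq.
    exact: is_derive_half_det.
  - apply: continuousM; first exact: cst_continuous.
    by apply: continuousB; exact: coordD_continuousM.
  - apply: continuousM; first exact: cst_continuous.
    by apply: continuousB; apply: continuousD; exact: coordD_continuousM.
have E : forall p, O p -> nth 0 [:: xi p; X p; mass_integral (V p) (X p);
    Q1_integral (V p) (X p)] (nat_of_ord (3 : 'I_4)) =
    Rintegral leb `[0, X p] (fun x => phi (p, x)).
  move=> p Op /=; apply: eq_Rintegral => x _.
  by rewrite dotE /vdot /pair_of /= Jmx0 Jmx1 !(derive1_V fam)// mulNr.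
have nO : \forall p \near p0, O p by have [oO _ _ _ _] := fam; exact: open_nbhs_nbhs.
rewrite mxE; rewrite (@near_eq_derive _ _ _ _
   (fun p => Rintegral leb `[0, X p] (fun x => phi (p, x)))); last first.
  by apply: filterS nO => p Op; exact: E.
rewrite (@derive_val _ _ _ _ _ _ _ D).
(* The term J V . d_x V_a of the differentiated density is integrated by parts into J V_a . V_x and
   a boundary term. By the jump of V_a, the boundary term gives xi_a |V|^2 / 2 and a multiple of X_a
   that cancels the contribution of the moving endpoint. *)
pose Q x := P x + 2^-1 * vdot (vJ (Vp 0 p0 x)) (Vap a 0 x).
have DQ (x : R) : is_derive x (1 : R) Q (phi1 (p0, x)).
  have v0 := is_derive_Vx fam 0 0 x Op0; have v1 := is_derive_Vx fam 0 1 x Op0.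
  have u0 := is_derive_Va_x fam Op0 a 0 0 x; have u1 := is_derive_Va_x fam Op0 a 0 1 x.
  have dp := DP x; rewrite /Q /vdot /vJ /=; derivE.
  have -> : phi1 (p0, x) = 2^-1 * (Va V p0 a 0 1 x * Vx V 1 p0 0 x
    + Vx V 0 p0 1 x * Va V p0 a 1 0 x
    - (Va V p0 a 0 0 x * Vx V 1 p0 1 x + Vx V 0 p0 0 x * Va V p0 a 1 1 x)) by [].
  rewrite /vdot /vJ /=.
  move: (Va V p0 a 0 0 x) (Va V p0 a 0 1 x) (Va V p0 a 1 0 x) (Va V p0 a 1 1 x).
  move: (Vx V 0 p0 0 x) (Vx V 0 p0 1 x) (Vx V 1 p0 0 x) (Vx V 1 p0 1 x) => *.
  by field.
have cq : continuous (fun x => 2^-1 * (Va V p0 a 0 1 x * Vx V 1 p0 0 x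
    + Vx V 0 p0 1 x * Va V p0 a 1 0 x
    - (Va V p0 a 0 0 x * Vx V 1 p0 1 x + Vx V 0 p0 0 x * Va V p0 a 1 1 x))).
  apply: continuous_fM; first exact: continuous_fcst.
  by apply: continuous_fB; apply: continuous_fD; apply: continuous_fM;
   (exact: Vx_continuous || exact: Vap_continuous).
rewrite (@Rintegral_antiderivative R _ Q 0 (X p0) profile_X_pos cq DQ).
have := Va_shift fam Op0 a 0 0; rewrite add0r => -[e0 e1].
have := Vx_shift fam 0 0 Op0; rewrite add0r => -[f0 f1].
have := Vx_shift fam 1 0 Op0; rewrite add0r => -[g0 g1].
rewrite /Q /vdot /vJ /Vap /Vp /= e0 e1 f0 f1 /phi.
rewrite -/(Vx V 0 p0 0 (X p0)) -/(Vx V 0 p0 1 (X p0)) -/(Vx V 1 p0 0 (X p0))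
  -/(Vx V 1 p0 1 (X p0)) f0 f1 g0 g1 /rho /=.
have := cos2Dsin2 (xi p0).
move: (cos _) (sin _) => C S cs.
move: (Vx V 0 p0 0 0) (Vx V 0 p0 1 0) (Vx V 1 p0 0 0) (Vx V 1 p0 1 0) => x0 x1 y0 y1.
move: (Va V p0 a 0 0 0) (Va V p0 a 0 1 0) (P (X p0)) (P 0) (xi_a _ _ _) (X_a _ _ _) => z0 z1 q q' xa Xa.
transitivity (q - q' + 2^-1 * ((C * C + S * S) * (x1 * (z0 + xa * x1 - Xa * y0) - x0 * (z1 - xa * x0 - Xa * y1))
   - (x1 * z0 - x0 * z1)) + Xa * (2^-1 * ((C * C + S * S) * (x1 * y0 - x0 * y1)))); first by field.
by rewrite -!expr2 cs; field.
Qed.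

End SigmaRows.

(** * Perturbation of solutions for a small parameter *)

Section BoundedContinuous.
Variable R : realType.
Implicit Types f h : R -> R.

(** The class of admissible coefficients for the linear systems; in the application they are
    periodic. *)
Definition bcont f : Prop := continuous f /\ exists M, forall x, `|f x| <= M.

Lemma bcont_cst (c : R) : bcont (fun=> c).
Proof. by split; [exact: continuous_fcst|exists `|c|]. Qed.

Lemma bcontD f h : bcont f -> bcont h -> bcont (fun x => f x + h x).
Proof.
move=> [cf [M hM]] [ch [N hN]]; split; first exact: continuous_fD.
by exists (M + N) => x; apply: le_trans (ler_normD _ _) (lerD (hM x) (hN x)).
Qed.

Lemma bcontM f h : bcont f -> bcont h -> bcont (fun x => f x * h x).
Proof.
move=> [cf [M hM]] [ch [N hN]]; split; first exact: continuous_fM.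
by exists (M * N) => x; rewrite normrM ler_pM.
Qed.

Lemma bcontN f : bcont f -> bcont (fun x => - f x).
Proof.
move=> [cf [M hM]]; split; first exact: continuous_fN.
by exists M => x; rewrite normrN.
Qed.

Lemma bcontV f (m : R) : 0 < m -> (forall x, m <= f x) -> continuous f ->
  bcont (fun x => (f x)^-1).
Proof.
move=> m0 hm cf; have f0 x : 0 < f x by exact: lt_le_trans (hm x).
split; first by move=> x; apply: continuousV; [rewrite gt_eqF|exact: cf].
by exists m^-1 => x; rewrite gtr0_norm ?invr_gt0// lef_pV2 ?posrE.
Qed.

Lemma periodic_nat f (X : R) : (forall x, f (x + X) = f x) ->
  forall (n : nat) x, f (x + X *+ n) = f x.
Proof.
move=> fX; elim=> [|n IH] x; first by rewrite mulr0n addr0.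
by rewrite mulrSr addrA fX IH.
Qed.

(** x is first moved to the right by enough periods to become nonnegative, then brought back into
    [0, X] by division. *)
Lemma periodic_reduce f (X : R) : 0 < X -> (forall x, f (x + X) = f x) ->
  forall x, exists2 y, 0 <= y <= X & f y = f x.
Proof.
move=> X0 fX x.
pose n := Num.truncn (`|x| / X).
have hn : `|x| / X < n.+1%:R by exact: truncnS_gt.
have nX : `|x| < X *+ n.+1 by rewrite -mulr_natr mulrC -ltr_pdivrMr.
have x1 : 0 <= x + X *+ n.+1.
  by have := ler_norm (- x); rewrite normrN; lra.
pose m := Num.truncn ((x + X *+ n.+1) / X).
have q0 : 0 <= (x + X *+ n.+1) / X by rewrite divr_ge0// ltW.
have /andP[m1 m2] := truncn_itv q0.
have XE : (x + X *+ n.+1) / X * X = x + X *+ n.+1 by rewrite divfK// gt_eqF.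
exists (x + X *+ n.+1 - X *+ m).
  have e1 : m%:R * X <= x + X *+ n.+1 by rewrite -XE ler_pM2r.
  have e2 : x + X *+ n.+1 < m.+1%:R * X by rewrite -{1}XE ltr_pM2r.
  have mX : X *+ m = m%:R * X by rewrite mulr_natl.
  have mX' : m.+1%:R * X = m%:R * X + X by rewrite -natr1 mulrDl mul1r.
  by apply/andP; split; lra.
rewrite -(periodic_nat fX m) subrK; exact: periodic_nat.
Qed.

Lemma bcont_periodic f (X : R) : 0 < X -> (forall x, f (x + X) = f x) ->
  continuous f -> bcont f.
Proof.
move=> X0 fX cf; split=> //.
have [C C0 hC] := continuous_bounded X0 cf.
exists C => x; have [y /andP[y0 yX] <-] := periodic_reduce X0 fX x.
by apply: hC; rewrite ger0_norm.
Qed.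

End BoundedContinuous.

Section BoundedLipschitz.
Variable R : realType.
Local Notation C := R[i].
Variables (D : set C) (B : R).
Hypothesis DB : forall z, D z -> normc z <= B.
Implicit Types h g : R -> C -> C.

(** The small parameter e ranges over (0, 1] and no limit is taken: all bounds are uniform in it.
    Lipschitz dependence on z plays the role of differentiability and matches what [newton_root]
    asks for. *)
Definition BL h : Prop := exists M : R, forall (e : R) z z',
  0 < e <= 1 -> D z -> D z' ->
  normc (h e z) <= M /\ normc (h e z - h e z') <= M * normc (z - z').

Lemma BL_bounded_cst (f : R -> C) (M : R) :
  (forall e, 0 < e <= 1 -> normc (f e) <= M) -> BL (fun e _ => f e).
Proof.
move=> hf; exists M => e z z' he Dz Dz'; split; first exact: hf.
by rewrite subrr normc0 mulr_ge0 ?normc_ge0// (le_trans _ (hf e he))// normc_ge0.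
Qed.

Lemma BL_cst (c : C) : BL (fun _ _ => c).
Proof. exact: (@BL_bounded_cst (fun=> c) (normc c)). Qed.

Lemma BL_id : BL (fun _ z => z).
Proof.
exists (Num.max B 1) => e z z' he Dz Dz'; split.
  by rewrite le_max DB.
by rewrite -[leLHS]mul1r ler_wpM2r ?normc_ge0// le_max lexx orbT.
Qed.

Lemma BL_real : BL (fun e _ => e%:C%C).
Proof.
apply: (@BL_bounded_cst _ 1) => e /andP[e0 e1].
by rewrite normc_real ger0_norm// ltW.
Qed.

Lemma BLD h g : BL h -> BL g -> BL (fun e z => h e z + g e z).
Proof.
move=> [M hM] [N hN]; exists (M + N) => e z z' he Dz Dz'.
have [m1 m2] := hM e z z' he Dz Dz'; have [n1 n2] := hN e z z' he Dz Dz'.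
split; first exact: le_trans (le_normcD _ _) (lerD m1 n1).
rewrite opprD addrACA mulrDl.
exact: le_trans (le_normcD _ _) (lerD m2 n2).
Qed.

Lemma BLM h g : BL h -> BL g -> BL (fun e z => h e z * g e z).
Proof.
move=> [M hM] [N hN]; exists (`|M * N| + (`|M * N| + `|M * N|)) => e z z' he Dz Dz'.
have [m1 m2] := hM e z z' he Dz Dz'; have [n1 n2] := hN e z z' he Dz Dz'.
have [m1' _] := hM e z' z' he Dz' Dz'.
have P1 : normc (h e z) * normc (g e z) <= `|M * N|.
  by apply: le_trans (ler_norm _); rewrite ler_pM// normc_ge0.
split; first by rewrite normcM; apply: le_trans P1 _; rewrite lerDl.
have -> : h e z * g e z - h e z' * g e z' =
  (h e z - h e z') * g e z + h e z' * (g e z - g e z') by ring.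
apply: le_trans (le_normcD _ _) _; rewrite !normcM.
have z0 := normc_ge0 (z - z').
have h1 : normc (h e z - h e z') * normc (g e z) <= M * N * normc (z - z').
  by rewrite -mulrA (mulrC N) mulrA ler_pM ?normc_ge0.
have h2 : normc (h e z') * normc (g e z - g e z') <= M * N * normc (z - z').
  by rewrite -mulrA ler_pM ?normc_ge0.
apply: le_trans (lerD h1 h2) _; rewrite -mulrDl ler_wpM2r//.
by have := ler_norm (M * N); have := normr_ge0 (M * N); lra.
Qed.

Lemma BLN h : BL h -> BL (fun e z => - h e z).
Proof.
move=> bh; have := BLM (BL_cst (- 1)) bh.
by congr BL; apply: funext => e; apply: funext => z; rewrite mulN1r.
Qed.

Lemma BL_sum (J : Type) (r : seq J) (h : J -> R -> C -> C) :
  (forall j, BL (h j)) -> BL (fun e z => \sum_(j <- r) h j e z).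
Proof.
move=> bh; elim: r => [|j r IH].
  by rewrite (_ : (fun e => _) = (fun _ _ => 0)); [exact: BL_cst|
    apply: funext => e; apply: funext => z; rewrite big_nil].
rewrite (_ : (fun e => _) = (fun e z => h j e z + \sum_(j <- r) h j e z)).
  exact: BLD.
by apply: funext => e; apply: funext => z; rewrite big_cons.
Qed.

Lemma BL_inv (m : R) : 0 < m -> (forall z, D z -> m <= normc z) ->
  BL (fun _ z => z^-1).
Proof.
move=> m0 hm; exists (m^-1 + m^-1 * m^-1) => e z z' he Dz Dz'.
have z0 : z != 0 by apply/eqP => z0; have := hm z Dz; rewrite z0 normc0; lra.
have z0' : z' != 0 by apply/eqP => z0'; have := hm z' Dz'; rewrite z0' normc0; lra.
have nz w : D w -> (normc w)^-1 <= m^-1.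
  by move=> Dw; rewrite lef_pV2 ?posrE ?hm// (lt_le_trans m0)// hm.
split.
  rewrite normcV; apply: le_trans (nz z Dz) _.
  by rewrite lerDl mulr_ge0// invr_ge0 ltW.
have -> : z^-1 - z'^-1 = z^-1 * z'^-1 * (z' - z).
  by field; rewrite z0 z0'.
rewrite !normcM !normcV -[z' - z]opprB normcN; apply: ler_wpM2r; first exact: normc_ge0.
apply: (@le_trans _ _ (m^-1 * m^-1)).
  by rewrite ler_pM ?invr_ge0 ?normc_ge0 ?nz.
by rewrite lerDr invr_ge0 ltW.
Qed.

Lemma BL_eq h g : (forall e z, 0 < e <= 1 -> D z -> h e z = g e z) -> BL h -> BL g.
Proof.
move=> hg [M hM]; exists M => e z z' he Dz Dz'.
by rewrite -!hg//; exact: hM.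
Qed.

(* Congruence modulo the small parameter e. *)
Definition congBL h h0 : Prop := BL h0 /\ exists2 g, BL g &
  forall (e : R) z, 0 < e <= 1 -> D z -> h e z = h0 e z + e%:C%C * g e z.

Lemma congBL_BL h h0 : congBL h h0 -> BL h.
Proof.
move=> [b0 [g bg E]]; have := BLD b0 (BLM BL_real bg).
by apply: BL_eq => e z he Dz; rewrite E.
Qed.

Lemma congBL_refl h : BL h -> congBL h h.
Proof.
move=> bh; split=> //; exists (fun _ _ => 0); first exact: BL_cst.
by move=> e z _ _; rewrite mulr0 addr0.
Qed.

Lemma congBL_small h0 g : BL h0 -> BL g ->
  congBL (fun e z => h0 e z + e%:C%C * g e z) h0.
Proof. by move=> b0 bg; split=> //; exists g. Qed.

Lemma congBLD h h0 g g0 : congBL h h0 -> congBL g g0 ->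
  congBL (fun e z => h e z + g e z) (fun e z => h0 e z + g0 e z).
Proof.
move=> [bh [a ba ha]] [bg [b bb hb]]; split; first exact: BLD.
exists (fun e z => a e z + b e z); first exact: BLD.
by move=> e z he Dz; rewrite ha// hb//; ring.
Qed.

Lemma congBLM h h0 g g0 : congBL h h0 -> congBL g g0 ->
  congBL (fun e z => h e z * g e z) (fun e z => h0 e z * g0 e z).
Proof.
move=> ch cg; have bh := congBL_BL ch; move: ch cg.
move=> [bh0 [a ba ha]] [bg [b bb hb]]; split; first exact: BLM.
exists (fun e z => a e z * g0 e z + h e z * b e z).
  by apply: BLD; apply: BLM.
by move=> e z he Dz; rewrite ha// hb//; ring.
Qed.

Lemma congBL_sum (J : Type) (r : seq J) (h h0 : J -> R -> C -> C) :
  (forall j, congBL (h j) (h0 j)) ->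
  congBL (fun e z => \sum_(j <- r) h j e z) (fun e z => \sum_(j <- r) h0 j e z).
Proof.
move=> ch; elim: r => [|j r IH].
  rewrite (_ : (fun e => _) = (fun _ _ => 0)); last first.
    by apply: funext => e; apply: funext => z; rewrite big_nil.
  rewrite [X in congBL _ X](_ : _ = (fun _ _ => 0)); last first.
    by apply: funext => e; apply: funext => z; rewrite big_nil.
  exact/congBL_refl/BL_cst.
rewrite (_ : (fun e => _) = (fun e z => h j e z + \sum_(j <- r) h j e z)); last first.
  by apply: funext => e; apply: funext => z; rewrite big_cons.
rewrite [X in congBL _ X](_ : _ = (fun e z => h0 j e z + \sum_(j <- r) h0 j e z)); last first.
  by apply: funext => e; apply: funext => z; rewrite big_cons.
exact: congBLD.
Qed.

Lemma congBL_prod (J : Type) (r : seq J) (h h0 : J -> R -> C -> C) :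
  (forall j, congBL (h j) (h0 j)) ->
  congBL (fun e z => \prod_(j <- r) h j e z) (fun e z => \prod_(j <- r) h0 j e z).
Proof.
move=> ch; elim: r => [|j r IH].
  rewrite (_ : (fun e => _) = (fun _ _ => 1)); last first.
    by apply: funext => e; apply: funext => z; rewrite big_nil.
  rewrite [X in congBL _ X](_ : _ = (fun _ _ => 1)); last first.
    by apply: funext => e; apply: funext => z; rewrite big_nil.
  exact/congBL_refl/BL_cst.
rewrite (_ : (fun e => _) = (fun e z => h j e z * \prod_(j <- r) h j e z)); last first.
  by apply: funext => e; apply: funext => z; rewrite big_cons.
rewrite [X in congBL _ X](_ : _ = (fun e z => h0 j e z * \prod_(j <- r) h0 j e z)); last first.
  by apply: funext => e; apply: funext => z; rewrite big_cons.
exact: congBLM.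
Qed.

Lemma congBL_det m (A A0 : R -> C -> 'M[C]_m) :
  (forall i j, congBL (fun e z => A e z i j) (fun e z => A0 e z i j)) ->
  congBL (fun e z => \det (A e z)) (fun e z => \det (A0 e z)).
Proof.
move=> cA; rewrite /determinant.
apply: congBL_sum => s; apply: congBLM; first exact/congBL_refl/BL_cst.
by apply: congBL_prod => i; exact: cA.
Qed.

End BoundedLipschitz.

Section FamilyOfSolutions.
Variables (R : realType) (I : finType).
Local Notation C := R[i].
Local Notation "x %:C" := (real_complex R x) : ring_scope.
Variables (a0 a1 a2 : I -> I -> R -> R) (s0 s1 s2 : I -> R -> R).
Hypotheses (ba0 : forall i j, bcont (a0 i j)) (ba1 : forall i j, bcont (a1 i j)).
Hypothesis ba2 : forall i j, bcont (a2 i j).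
Hypotheses (bs0 : forall i, bcont (s0 i)) (bs1 : forall i, bcont (s1 i)).
Hypothesis bs2 : forall i, bcont (s2 i).
Variables (D : set C) (B z2 X : R).
Hypotheses (DB : forall z, D z -> normc z <= B) (X0 : 0 < X).

Definition fam_mx (e : R) (z : C) i j x : C :=
  (a0 i j x)%:C + e%:C * z * (a1 i j x)%:C + (e ^+ 2 * z2)%:C * (a2 i j x)%:C.
Definition fam_src (e : R) (z : C) i x : C :=
  (s0 i x)%:C + e%:C * z * (s1 i x)%:C + z ^+ 2 * (s2 i x)%:C.

Lemma ccontinuous_real (f : R -> R) : continuous f -> ccontinuous (fun x => (f x)%:C).
Proof. by move=> cf; split => //=; exact: continuous_fcst. Qed.

Lemma ccontinuousD (f h : R -> C) : ccontinuous f -> ccontinuous h ->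
  ccontinuous (fun x => f x + h x).
Proof.
move=> [f1 f2] [h1 h2]; split.
- by under eq_fun do rewrite ReD; exact: continuous_fD.
- by under eq_fun do rewrite ImD; exact: continuous_fD.
Qed.

Lemma ccontinuous_scale (c : C) (f : R -> R) : continuous f ->
  ccontinuous (fun x => c * (f x)%:C).
Proof.
move=> cf; split.
- under eq_fun do rewrite ReM /= mulr0 subr0.
  by apply: continuous_fM => //; exact: continuous_fcst.
- under eq_fun do rewrite ImM /= mulr0 add0r.
  by apply: continuous_fM => //; exact: continuous_fcst.
Qed.

Lemma normc_affine_le (c0 c1 c2 : R) (u v : C) (M0 M1 M2 b1 b2 : R) :
  `|c0| <= M0 -> `|c1| <= M1 -> `|c2| <= M2 -> normc u <= b1 -> normc v <= b2 ->
  normc (c0%:C + u * c1%:C + v * c2%:C) <= M0 + b1 * M1 + b2 * M2.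
Proof.
move=> h0 h1 h2 hu hv; apply: le_trans (le_normcD _ _) _; apply: lerD.
  apply: le_trans (le_normcD _ _) _; apply: lerD; first by rewrite normc_real.
  by rewrite normcM normc_real ler_pM// normc_ge0.
by rewrite normcM normc_real ler_pM// normc_ge0.
Qed.

Lemma bound2 (J : finType) (f : J -> R -> R) : (forall j, bcont (f j)) ->
  exists2 M : R, 0 <= M & forall j x, `|f j x| <= M.
Proof.
move=> bf; have h j : exists M : R, forall x, `|f j x| <= M by have [] := bf j.
have [M hM] := choice h; exists (\sum_j `|M j|); first exact: sumr_ge0.
move=> j x; apply: le_trans (hM j x) _; apply: le_trans (ler_norm _) _.
by rewrite (bigD1 j)//= lerDl sumr_ge0.
Qed.

Lemma fam_bounds : exists2 M : R, 0 <= M & forall (e : R) z, 0 < e <= 1 -> D z ->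
  (forall i j x, normc (fam_mx e z i j x) <= M) /\
  (forall i x, normc (fam_src e z i x) <= M) /\
  (forall i j x, `|a1 i j x| <= M) /\ (forall i x, `|s1 i x| <= M) /\
  (forall i x, `|s2 i x| <= M).
Proof.
have [A0 A00 hA0] := @bound2 (I * I)%type (fun p => a0 p.1 p.2) (fun p => ba0 p.1 p.2).
have [A1 A10 hA1] := @bound2 (I * I)%type (fun p => a1 p.1 p.2) (fun p => ba1 p.1 p.2).
have [A2 A20 hA2] := @bound2 (I * I)%type (fun p => a2 p.1 p.2) (fun p => ba2 p.1 p.2).
have [S0 S00 hS0] := bound2 bs0; have [S1 S10 hS1] := bound2 bs1.
have [S2 S20 hS2] := bound2 bs2.
pose M1 := A0 + `|B| * A1 + `|z2| * A2.
pose M2 := S0 + `|B| * S1 + `|B| ^+ 2 * S2.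
have M10 : 0 <= M1 by rewrite !addr_ge0 ?mulr_ge0.
have M20 : 0 <= M2 by rewrite !addr_ge0 ?mulr_ge0 ?exprn_ge0.
exists (M1 + M2 + A1 + S1 + S2); first by lra.
move=> e z /andP[e0 e1] Dz.
have nez : normc (e%:C * z) <= `|B|.
  rewrite normcM normc_real ger0_norm ?(ltW e0)//.
  rewrite -[X in _ <= X]mul1r; apply: ler_pM; rewrite ?normc_ge0 ?(ltW e0)//.
  by rewrite (le_trans (DB Dz))// ler_norm.
split=> [i j x|]; last split=> [i x|].
- apply: (@le_trans _ _ M1); last by lra.
  apply: normc_affine_le => //; [exact: (hA0 (i, j))|exact: (hA1 (i, j))|exact: (hA2 (i, j))|].
  rewrite normc_real normrM ger0_norm ?sqr_ge0// -[leRHS]mul1r ler_pM ?sqr_ge0//.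
  by rewrite expr_le1// ltW.
- apply: (@le_trans _ _ M2); last by lra.
  apply: normc_affine_le => //.
  rewrite [z ^+ 2]expr2 normcM -expr2 lerXn2r ?nnegrE ?normc_ge0//.
  by rewrite (le_trans (DB Dz))// ler_norm.
- split=> [i j x|]; [|split=> i x].
  + by apply: le_trans (hA1 (i, j) x) _; lra.
  + by apply: le_trans (hS1 i x) _; lra.
  + by apply: le_trans (hS2 i x) _; lra.
Qed.

(** Gronwall's inequality is applied twice: to the solution, and to the difference of the solutions
    for z and z', which solves the same system with a source bounded by a multiple of |z - z'|. *)
Lemma fam_sol : exists q : R -> C -> I -> R -> C,
  (forall (e : R) z, 0 < e <= 1 -> D z -> (forall i, q e z i 0 = 0) /\
    forall i x, cderiv (q e z i) x
      (\sum_j fam_mx e z i j x * q e z j x + fam_src e z i x)) /\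
  exists M : R, forall i (e : R) z z' (x : R), 0 < e <= 1 -> D z -> D z' -> 0 <= x <= X ->
    normc (q e z i x) <= M /\
    normc (q e z i x - q e z' i x) <= M * normc (z - z').
Proof.
have [M M0 hM] := fam_bounds.
(* The zero function is the default outside the admissible parameters, so that one choice over all
   pairs (e, z) produces the family. *)
have ex (p : R * C) : exists q : I -> R -> C, 0 < p.1 <= 1 -> D p.2 ->
    (forall i, q i 0 = 0) /\ forall i x, cderiv (q i) x
      (\sum_j fam_mx p.1 p.2 i j x * q j x + fam_src p.1 p.2 i x).
  have [he|he] := boolP (0 < p.1 <= 1); last by exists (fun _ _ => 0).
  have [Dp|nD] := pselect (D p.2); last by exists (fun _ _ => 0).
  have [m1 [m2 _]] := hM _ _ he Dp.
  have [||q [q0 Dq]] := @code_exists R I (fam_mx p.1 p.2) (fam_src p.1 p.2)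
      (fun=> 0) M M0 _ _ m1.
  - move=> i j; apply: ccontinuousD; last by apply: ccontinuous_scale; have [] := ba2 i j.
    apply: ccontinuousD; last by apply: ccontinuous_scale; have [] := ba1 i j.
    by apply: ccontinuous_real; have [] := ba0 i j.
  - move=> i; apply: ccontinuousD; last by apply: ccontinuous_scale; have [] := bs2 i.
    apply: ccontinuousD; last by apply: ccontinuous_scale; have [] := bs1 i.
    by apply: ccontinuous_real; have [] := bs0 i.
  by exists q.
have [Q hQ] := choice ex; exists (fun e z => Q (e, z)); split.
  by move=> e z he Dz; have := hQ (e, z) he Dz.
have [G G0 hG] := cgronwall I M0 X0.
pose N : R := #|I|%:R.
pose L := N * (M * (G * M)) + (M + 2 * `|B| * M).
have L0 : 0 <= L by rewrite !addr_ge0 ?mulr_ge0.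
have bq i (e : R) z (x : R) : 0 < e <= 1 -> D z -> 0 <= x <= X -> normc (Q (e, z) i x) <= G * M.
  move=> he Dz hx; have [q0 Dq] := hQ (e, z) he Dz; have [m1 [m2 _]] := hM e z he Dz.
  by apply: (hG (fam_mx e z) (Q (e, z)) (fam_src e z) M).
exists (G * M + G * L) => i e z z' x he Dz Dz' hx; split.
  by apply: le_trans (bq i e z x he Dz hx) _; rewrite lerDl mulr_ge0.
have [q0 Dq] := hQ (e, z) he Dz; have [q0' Dq'] := hQ (e, z') he Dz'.
have [m1 [m2 [m3 [m4 m5]]]] := hM e z he Dz.
have Z0 := normc_ge0 (z - z').
have Bz w : D w -> normc w <= `|B|.
  by move=> Dw; rewrite (le_trans (DB Dw))// ler_norm.
have e1 : normc (e%:C : C) <= 1 by case/andP: he => e0 e1; rewrite normc_real ger0_norm// ltW.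
apply: (@le_trans _ _ (G * (L * normc (z - z')))).
  apply: (hG (fam_mx e z) (fun i x => Q (e, z) i x - Q (e, z') i x)
    (fun i x => \sum_j (e%:C * (z - z') * (a1 i j x)%:C) * Q (e, z') j x
      + (e%:C * (z - z') * (s1 i x)%:C + (z - z') * (z + z') * (s2 i x)%:C))) => //.
  - by move=> j; rewrite q0 q0' subrr.
  - move=> j t ht; apply: (cderiv_eq (cderivD (Dq j t) (cderivN (Dq' j t)))).
    rewrite /= opprD addrACA -sumrB.
    under [X in _ = X + _]eq_bigr do rewrite mulrBr.
    rewrite [RHS]addrA; congr (_ + _); last by rewrite /fam_src; ring.
    by rewrite -[RHS]big_split; apply: eq_bigr => k _; rewrite /fam_mx /=; ring.
  - move=> j t ht; apply: le_trans (le_normcD _ _) _.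
    rewrite /L [X in _ <= X]mulrDl; apply: lerD.
      apply: (@le_trans _ _ (\sum_(k : I) M * (G * M) * normc (z - z'))).
        elim: (index_enum I) => [|k r IH]; first by rewrite !big_nil normc0.
        rewrite !big_cons; apply: le_trans (le_normcD _ _) (lerD _ IH).
        rewrite !normcM mulrC (_ : M * _ * _ = G * M * (1 * normc (z - z') * M)); last by ring.
        have P := @normc_ge0 R; apply: ler_pM; [exact: P|by rewrite !mulr_ge0|exact: bq|].
        apply: ler_pM; [by rewrite !mulr_ge0|exact: P| |by rewrite normc_real].
        by rewrite ler_wpM2r.
      rewrite sumr_const -[_ *+ _]mulr_natl [#|xpredT|](_ : _ = #|I|)//.
      by rewrite -/N !mulrA.
    apply: le_trans (le_normcD _ _) _; rewrite [X in _ <= X]mulrDl; apply: lerD.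
      rewrite !normcM (_ : M * _ = 1 * normc (z - z') * M); last by ring.
      have P := @normc_ge0 R.
      apply: ler_pM; [by rewrite !mulr_ge0|exact: P| |by rewrite normc_real].
      by rewrite ler_wpM2r.
    rewrite !normcM -mulrA [X in _ <= X]mulrC ler_wpM2l//.
    apply: ler_pM; rewrite ?normc_ge0// ?normc_real//.
    apply: le_trans (le_normcD _ _) _.
    by have := Bz _ Dz; have := Bz _ Dz'; lra.
  - by rewrite mulr_ge0.
by rewrite mulrA ler_wpM2r// lerDr mulr_ge0.
Qed.

End FamilyOfSolutions.

Section TangentIdentities.
Variable T : comNzRingType.
Variables (k k1 k2 w1 w2 om c : T) (V V1 V2 : T * T).

(** The profile expression is equivariant under rotations; differentiating the equivariance at angle
    0 gives its linearization on the generator J V. *)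
Lemma hess_vJ : hess k k1 k2 w1 w2 om c V V1 V2 (vJ V) (vJ V1) (vJ V2) =
  vJ (prof k k1 w1 om c V V1 V2).
Proof. rewrite /hess /hess0 /prof /vdot /vJ /=; congr (_, _); ring. Qed.

Lemma dmuphi_vJ : dmuphi k k1 c V V1 (vJ V) (vJ V1) = 0.
Proof. rewrite /dmuphi /vdot /vJ /=; ring. Qed.

Lemma dmux_vJ : dmux k k1 w1 om V V1 (vJ V) (vJ V1) = 0.
Proof. rewrite /dmux /vdot /vJ /=; ring. Qed.

(** On solutions mu_phi is constant in x, so its differential vanishes on V_x; in general the
    x-derivative of mu_phi is the equation paired with - J V. *)
Lemma dmuphi_V1 :
  dmuphi k k1 c V V1 V1 V2 = - vdot (vJ V) (prof k k1 w1 om c V V1 V2).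
Proof. rewrite /dmuphi /prof /vdot /vJ /=; ring. Qed.

Lemma dmux_V1 :
  dmux k k1 w1 om V V1 V1 V2 = - vdot V1 (prof k k1 w1 om c V V1 V2).
Proof. rewrite /dmux /prof /vdot /vJ /=; ring. Qed.

Lemma dmuphi_rot co si v v1 : co ^+ 2 + si ^+ 2 = 1 ->
  dmuphi k k1 c (rot co si V) (rot co si V1) (rot co si v) (rot co si v1) =
  dmuphi k k1 c V V1 v v1.
Proof.
move=> cs.
have D x y : vdot (rot co si x) (rot co si y) = vdot x y.
  rewrite /vdot /rot /= -[RHS]mul1r -cs; ring.
have JE x : vJ (rot co si x) = rot co si (vJ x).
  by rewrite /vJ /rot /=; congr (_, _); ring.
by rewrite /dmuphi !JE !D.
Qed.

Lemma dmux_rot co si v v1 : co ^+ 2 + si ^+ 2 = 1 ->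
  dmux k k1 w1 om (rot co si V) (rot co si V1) (rot co si v) (rot co si v1) =
  dmux k k1 w1 om V V1 v v1.
Proof.
move=> cs.
have D x y : vdot (rot co si x) (rot co si y) = vdot x y.
  rewrite /vdot /rot /= -[RHS]mul1r -cs; ring.
by rewrite /dmux !D.
Qed.

Lemma hess0_rot co si v v1 : co ^+ 2 + si ^+ 2 = 1 ->
  hess0 k1 k2 w1 w2 om c (rot co si V) (rot co si V1) (rot co si V2)
    (rot co si v) (rot co si v1) =
  rot co si (hess0 k1 k2 w1 w2 om c V V1 V2 v v1).
Proof.
move=> cs.
have D x y : vdot (rot co si x) (rot co si y) = vdot x y.
  rewrite /vdot /rot /= -[RHS]mul1r -cs; ring.
have JE x : vJ (rot co si x) = rot co si (vJ x).
  by rewrite /vJ /rot /=; congr (_, _); ring.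
rewrite /hess0 !D !JE /rot /=; congr (_, _); ring.
Qed.

Lemma hess_opp v v1 v2 : hess k k1 k2 w1 w2 om c V V1 V2
    (- v.1, - v.2) (- v1.1, - v1.2) (- v2.1, - v2.2) =
  (- (hess k k1 k2 w1 w2 om c V V1 V2 v v1 v2).1,
   - (hess k k1 k2 w1 w2 om c V V1 V2 v v1 v2).2).
Proof. rewrite /hess /hess0 /vdot /vJ /=; congr (_, _); ring. Qed.

Lemma hess_zero : hess k k1 k2 w1 w2 om c V V1 V2 (0, 0) (0, 0) (0, 0) = (0, 0).
Proof. rewrite /hess /hess0 /vdot /vJ /=; congr (_, _); ring. Qed.

(** A state of the first order system: the two coordinates of the function, then those of its
    derivative. *)
Definition st4 (u v : T * T) (i : 'I_4) : T :=
  match val i with 0%N => u.1 | 1%N => u.2 | 2%N => v.1 | _ => v.2 end.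

Definition fst4 (y : 'I_4 -> T) : T * T := (y 0, y 1).
Definition snd4 (y : 'I_4 -> T) : T * T := (y 2, y 3).

Lemma st4K y : st4 (fst4 y) (snd4 y) =1 y.
Proof. by case=> -[|[|[|[|//]]]] h; rewrite /st4 /=; congr y; apply/val_inj. Qed.

Definition base4 (j : 'I_4) : (T * T) * (T * T) :=
  match val j with
  | 0%N => ((1, 0), (0, 0)) | 1%N => ((0, 1), (0, 0))
  | 2%N => ((0, 0), (1, 0)) | _ => ((0, 0), (0, 1))
  end.

Lemma hess0_sum y : hess0 k1 k2 w1 w2 om c V V1 V2 (fst4 y) (snd4 y) =
  (\sum_j (hess0 k1 k2 w1 w2 om c V V1 V2 (base4 j).1 (base4 j).2).1 * y j,
   \sum_j (hess0 k1 k2 w1 w2 om c V V1 V2 (base4 j).1 (base4 j).2).2 * y j).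
Proof.
have e0 : (0 : 'I_4) = ord0 by apply/val_inj.
have e1 : (1 : 'I_4) = lift ord0 ord0 by apply/val_inj.
have e2 : (2 : 'I_4) = lift ord0 (lift ord0 ord0) by apply/val_inj.
have e3 : (3 : 'I_4) = lift ord0 (lift ord0 (lift ord0 ord0)) by apply/val_inj.
rewrite !big_ord_recl !big_ord0 /fst4 /snd4 -e1 -e2 -e3 -e0.
rewrite /hess0 /vdot /vJ /=; congr (_, _); ring.
Qed.

Lemma dmuphi_sum y : dmuphi k k1 c V V1 (fst4 y) (snd4 y) =
  \sum_j dmuphi k k1 c V V1 (base4 j).1 (base4 j).2 * y j.
Proof.
have e0 : (0 : 'I_4) = ord0 by apply/val_inj.
have e1 : (1 : 'I_4) = lift ord0 ord0 by apply/val_inj.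
have e2 : (2 : 'I_4) = lift ord0 (lift ord0 ord0) by apply/val_inj.
have e3 : (3 : 'I_4) = lift ord0 (lift ord0 (lift ord0 ord0)) by apply/val_inj.
rewrite !big_ord_recl !big_ord0 /fst4 /snd4 -e1 -e2 -e3 -e0.
rewrite /dmuphi /vdot /vJ /=; ring.
Qed.

Lemma dmux_sum y : dmux k k1 w1 om V V1 (fst4 y) (snd4 y) =
  \sum_j dmux k k1 w1 om V V1 (base4 j).1 (base4 j).2 * y j.
Proof.
have e0 : (0 : 'I_4) = ord0 by apply/val_inj.
have e1 : (1 : 'I_4) = lift ord0 ord0 by apply/val_inj.
have e2 : (2 : 'I_4) = lift ord0 (lift ord0 ord0) by apply/val_inj.
have e3 : (3 : 'I_4) = lift ord0 (lift ord0 (lift ord0 ord0)) by apply/val_inj.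
rewrite !big_ord_recl !big_ord0 /fst4 /snd4 -e1 -e2 -e3 -e0.
rewrite /dmux /vdot /vJ /=; ring.
Qed.

End TangentIdentities.

Section Morphism.
Variables (T T' : comNzRingType) (f : {rmorphism T -> T'}).
Definition pmap2 (u : T * T) : T' * T' := (f u.1, f u.2).
Let fE := (rmorphD f, rmorphB f, rmorphN f, rmorphM f, rmorph_nat f).

Lemma vdot_morph u v : vdot (pmap2 u) (pmap2 v) = f (vdot u v).
Proof. by rewrite /vdot /= !fE. Qed.

Lemma hess0_morph k1 k2 w1 w2 om c V V1 V2 v v1 :
  hess0 (f k1) (f k2) (f w1) (f w2) (f om) (f c) (pmap2 V) (pmap2 V1) (pmap2 V2)
   (pmap2 v) (pmap2 v1) = pmap2 (hess0 k1 k2 w1 w2 om c V V1 V2 v v1).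
Proof. by rewrite /hess0 !vdot_morph /pmap2 /= !fE. Qed.

Lemma prof_morph k k1 w1 om c V V1 V2 :
  prof (f k) (f k1) (f w1) (f om) (f c) (pmap2 V) (pmap2 V1) (pmap2 V2) =
  pmap2 (prof k k1 w1 om c V V1 V2).
Proof. by rewrite /prof !vdot_morph /pmap2 /= !fE. Qed.

Lemma dmuphi_morph k k1 c V V1 v v1 :
  dmuphi (f k) (f k1) (f c) (pmap2 V) (pmap2 V1) (pmap2 v) (pmap2 v1) =
  f (dmuphi k k1 c V V1 v v1).
Proof.
have JE u : vJ (pmap2 u) = pmap2 (vJ u) by rewrite /vJ /pmap2 /= fE.
by rewrite /dmuphi !JE !vdot_morph !fE.
Qed.

Lemma dmux_morph k k1 w1 om V V1 v v1 :
  dmux (f k) (f k1) (f w1) (f om) (pmap2 V) (pmap2 V1) (pmap2 v) (pmap2 v1) =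
  f (dmux k k1 w1 om V V1 v v1).
Proof. by rewrite /dmux !vdot_morph !fE. Qed.

End Morphism.

Section UniformBounds.
Variables (R : realType) (D : set R[i]) (B X : R).
Hypothesis DB : forall z, D z -> normc z <= B.
Local Notation C := R[i].
Implicit Types h : R -> C -> R -> C.

Definition uBL h : Prop := exists M : R, forall (e : R) z z' (x : R),
  0 < e <= 1 -> D z -> D z' -> 0 <= x <= X ->
  normc (h e z x) <= M /\ normc (h e z x - h e z' x) <= M * normc (z - z').

Lemma uBL_sup h : uBL h -> forall x : R, 0 <= x <= X -> BL D (fun e z => h e z x).
Proof. by move=> [M hM] x hx; exists M => e z z' he Dz Dz'; exact: hM. Qed.

Lemma uBL_par (f : R -> C -> C) : BL D f -> uBL (fun e z _ => f e z).
Proof. by move=> [M hM]; exists M => e z z' x he Dz Dz' _; exact: hM. Qed.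

Lemma uBL_space (f : R -> R) (M : R) : (forall x : R, 0 <= x <= X -> `|f x| <= M) ->
  uBL (fun _ _ x => (f x)%:C%C).
Proof.
move=> hf; exists M => e z z' x he Dz Dz' hx; split; first by rewrite normc_real hf.
by rewrite subrr normc0 mulr_ge0 ?normc_ge0// (le_trans _ (hf x hx)).
Qed.

Lemma uBLD h g : uBL h -> uBL g -> uBL (fun e z x => h e z x + g e z x).
Proof.
move=> [M hM] [N hN]; exists (M + N) => e z z' x he Dz Dz' hx.
have [m1 m2] := hM e z z' x he Dz Dz' hx; have [n1 n2] := hN e z z' x he Dz Dz' hx.
split; first exact: le_trans (le_normcD _ _) (lerD m1 n1).
rewrite opprD addrACA mulrDl.
exact: le_trans (le_normcD _ _) (lerD m2 n2).
Qed.

Lemma uBLN h : uBL h -> uBL (fun e z x => - h e z x).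
Proof.
move=> [M hM]; exists M => e z z' x he Dz Dz' hx; rewrite -opprD !normcN.
exact: hM.
Qed.

Lemma uBLM h g : uBL h -> uBL g -> uBL (fun e z x => h e z x * g e z x).
Proof.
move=> [M hM] [N hN]; exists (`|M * N| + (`|M * N| + `|M * N|)) => e z z' x he Dz Dz' hx.
have [m1 m2] := hM e z z' x he Dz Dz' hx; have [n1 n2] := hN e z z' x he Dz Dz' hx.
have [m1' _] := hM e z' z' x he Dz' Dz' hx.
have P1 : normc (h e z x) * normc (g e z x) <= `|M * N|.
  by apply: le_trans (ler_norm _); rewrite ler_pM// normc_ge0.
split; first by rewrite normcM; apply: le_trans P1 _; rewrite lerDl.
have -> : h e z x * g e z x - h e z' x * g e z' x =
  (h e z x - h e z' x) * g e z x + h e z' x * (g e z x - g e z' x) by ring.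
apply: le_trans (le_normcD _ _) _; rewrite !normcM.
have M0 : 0 <= M by apply: le_trans m1; exact: normc_ge0.
have N0 : 0 <= N by apply: le_trans n1; exact: normc_ge0.
have Z0 := normc_ge0 (z - z').
rewrite mulrDl; apply: ler_wpDl; first by rewrite mulr_ge0.
rewrite mulrDl ger0_norm ?mulr_ge0//; apply: lerD.
  rewrite mulrAC; apply: ler_pM => //; exact: normc_ge0.
by rewrite -mulrA; apply: ler_pM => //; exact: normc_ge0.
Qed.

(* The division by e is harmless since the derivative has a factor e. *)
Lemma uBL_integral (f df : R -> C -> R -> C) : 0 < X -> uBL df ->
  (forall (e : R) z, 0 < e <= 1 -> D z -> f e z 0 = 0 /\
     forall x : R, 0 <= x <= X -> cderiv (f e z) x (e%:C%C * df e z x)) ->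
  BL D (fun e z => f e z X / e%:C%C).
Proof.
move=> X0 [M hM] Df; exists (2 * M * X) => e z z' he Dz Dz'.
have [f0 D1] := Df e z he Dz; have [f0' D1'] := Df e z' he Dz'.
have e0 : 0 < e by case/andP: he.
have XX : 0 <= X <= X by rewrite lexx ltW.
have ne : normc (e%:C%C : C) = e by rewrite normc_real gtr0_norm.
have dv (c : C) (m : R) : normc c <= 2 * (e * m) * (X - 0) -> normc (c / e%:C%C) <= 2 * m * X.
  move=> h; rewrite normcM normcV ne ler_pdivrMr//.
  by apply: le_trans h _; rewrite subr0 le_eqVlt; apply/orP; left; apply/eqP; ring.
split.
  apply: dv; rewrite -[f e z X]subr0 -f0; apply: (cmean_value (ltW X0) D1) => x hx.
  rewrite normcM ne ler_wpM2l ?(ltW e0)//; by have [] := hM e z z x he Dz Dz hx.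
rewrite -mulrBl (_ : 2 * M * X * _ = 2 * (M * normc (z - z')) * X); last by ring.
apply: dv; rewrite -[X in normc X]subr0 -[X in _ - X](subrr 0) -{1}f0 -f0'.
apply: (cmean_value (f := fun x => f e z x - f e z' x) (ltW X0)
   (df := fun x => e%:C%C * (df e z x - df e z' x))) => x hx.
  rewrite mulrBr; apply: cderivD; [exact: D1|apply: cderivN; exact: D1'].
rewrite normcM ne ler_wpM2l ?(ltW e0)//; by have [] := hM e z z' x he Dz Dz' hx.
Qed.

End UniformBounds.

Lemma mean_value_cst (R : realType) (F f : R -> R) (a b m : R) : a <= b ->
  (forall x : R, a <= x <= b -> is_derive x (1 : R) F (f x)) ->
  (forall x : R, a <= x <= b -> `|f x| <= m) -> `|F b - F a| <= m * (b - a).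
Proof.
move=> ab DF fm; rewrite mulrBr.
apply: (@mean_value_norm R F (fun x => m * x) f (fun=> m) a b ab DF) => // x _.
have D := is_derive_fM (is_derive_fcst m x (1 : R)) (is_derive_id x (1 : R)).
by apply: (is_derive_eq D); ring.
Qed.

Definition expi (R : realType) (e : R) : R[i] := Complex (cos e) (sin e).

(** The Taylor remainder of exp (i e), in the form that makes (1 - exp (i e)) / e congruent to - i
    modulo e. Both |cos e - 1| and |sin e - e| are at most e^2. *)
Lemma expi_bound (R : realType) (e : R) : 0 < e <= 1 ->
  normc (((1 - expi e) / e%:C%C + 'i%C) / e%:C%C) <= 2.
Proof.
move=> /andP[e0 e1].
have c1 (t : R) : 0 <= t -> `|cos t - 1| <= t.
  move=> t0; rewrite -cos0 -[X in _ <= X]mul1r -[X in _ <= _ * X]subr0.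
  apply: (@mean_value_cst R cos (fun x => - sin x) 0 t 1 t0) => x _.
  by rewrite normrN ler_norml sin_geN1 sin_le1.
have c2 : `|cos e - 1| <= e * e.
  rewrite -cos0 -[X in _ <= _ * X]subr0.
  apply: (@mean_value_cst R cos (fun x => - sin x) 0 e e (ltW e0)) => x /andP[x0 xe].
  rewrite normrN; apply: le_trans _ xe.
  rewrite -[sin x]subr0 -sin0 -[X in _ <= X]mul1r -[X in _ <= _ * X]subr0.
  apply: (@mean_value_cst R sin cos 0 x 1 x0) => y _.
  by rewrite ler_norml cos_geN1 cos_le1.
have c3 : `|sin e - e| <= e * e.
  rewrite -[sin e - e]subr0 -[X in _ - X]subr0 -[X in _ - (X - _)]sin0 -[X in _ <= _ * X]subr0.
  apply: (@mean_value_cst R (fun x => sin x - x) (fun x => cos x - 1) 0 e e (ltW e0)).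
  by move=> x /andP[x0 xe]; exact: le_trans (c1 x x0) xe.
have en : (e%:C%C : R[i]) != 0 by rewrite fmorph_eq0 gt_eqF.
have -> : ((1 - expi e) / e%:C%C + 'i%C) / e%:C%C = (1 - expi e + 'i%C * e%:C%C) / e%:C%C ^+ 2.
  by field.
rewrite normcM normcV -rmorphXn normc_real [`|_|]ger0_norm ?sqr_ge0//.
rewrite ler_pdivrMr ?exprn_gt0//; apply: le_trans (normc_le _) _.
rewrite /expi /=.
have -> : 1 + - cos e + (0 * e - 1 * 0) = - (cos e - 1) by ring.
have -> : 0 + - sin e + (0 * 0 + 1 * e) = - (sin e - e) by ring.
by rewrite !normrN expr2; lra.
Qed.

Ltac bcont_tac := repeat match goal with
  | |- bcont (fun x => GRing.add (@?f x) (@?h x)) => refine (@bcontD _ f h _ _)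
  | |- bcont (fun x => GRing.mul (@?f x) (@?h x)) => refine (@bcontM _ f h _ _)
  | |- bcont (fun x => GRing.opp (@?f x)) => refine (@bcontN _ f _)
  | |- bcont (fun x => ?d) => exact: bcont_cst
  | |- _ => assumption
  end.

(** * The Bloch determinant and its leading part *)

Section ProfileData.
Variable R : realType.
Local Notation C := R[i].
Local Notation "x %:C" := (real_complex R x) : ring_scope.
(** The profile enters through abstract data: K0, K1, K2 are kappa and its derivatives along the
    profile, W1 and W2 the derivatives of W; [P j] is the j-th x-derivative of V and [Q a j] that of
    its derivative along the a-th parameter; co and si are the cosine and sine of xi, and m is
    |V(0)|^2 / 2. I2 and I3 are primitives for the last rows of Sigma_t, S1, S2 and S3 for
    Sigma_y. *)
Variables (K0 K1 K2 W1 W2 : R -> R) (om c X co si m k0 : R).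
Variables (P : nat -> R -> R * R) (Q : 'I_4 -> nat -> R -> R * R) (xia Xa : 'I_4 -> R).
Variables (I2 I3 : 'I_4 -> R -> R) (S1 S2 S3 : R -> R).
Hypotheses (X0 : 0 < X) (k00 : 0 < k0) (K0_ge : forall x, k0 <= K0 x).
Hypothesis cs1 : co ^+ 2 + si ^+ 2 = 1.
Hypotheses (K0X : forall x, K0 (x + X) = K0 x) (K1X : forall x, K1 (x + X) = K1 x).
Hypotheses (K2X : forall x, K2 (x + X) = K2 x) (W1X : forall x, W1 (x + X) = W1 x).
Hypotheses (W2X : forall x, W2 (x + X) = W2 x).
Hypotheses (cK2 : continuous K2) (cW2 : continuous W2).
Hypothesis DP1 : forall j (x : R), is_derive x (1 : R) (fun t => (P j t).1) (P j.+1 x).1.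
Hypothesis DP2 : forall j (x : R), is_derive x (1 : R) (fun t => (P j t).2) (P j.+1 x).2.
Hypothesis DQ1 : forall a j (x : R), is_derive x (1 : R) (fun t => (Q a j t).1) (Q a j.+1 x).1.
Hypothesis DQ2 : forall a j (x : R), is_derive x (1 : R) (fun t => (Q a j t).2) (Q a j.+1 x).2.
Hypothesis DK0 : forall x : R, is_derive x (1 : R) K0 (K1 x * (2 * vdot (P 0 x) (P 1 x))).
Hypothesis DK1 : forall x : R, is_derive x (1 : R) K1 (K2 x * (2 * vdot (P 0 x) (P 1 x))).
Hypothesis DW1 : forall x : R, is_derive x (1 : R) W1 (W2 x * (2 * vdot (P 0 x) (P 1 x))).
Hypothesis PX : forall j x, P j (x + X) = rot co si (P j x).
Hypothesis QX : forall a j, Q a j X = rot co si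
  ((Q a j 0).1 + xia a * (P j 0).2 - Xa a * (P j.+1 0).1,
   (Q a j 0).2 - xia a * (P j 0).1 - Xa a * (P j.+1 0).2).
Hypothesis P_ode : forall x,
  prof (K0 x) (K1 x) (W1 x) om c (P 0 x) (P 1 x) (P 2 x) = (0, 0).
Local Notation hessx x := (hess (K0 x) (K1 x) (K2 x) (W1 x) (W2 x) om c (P 0 x) (P 1 x) (P 2 x)).
Hypothesis P_hess : forall x, hessx x (P 1 x) (P 2 x) (P 3 x) = (0, 0).
Hypothesis Q_hess : forall a x, hessx x (Q a 0 x) (Q a 1 x) (Q a 2 x) =
  ((a == 0)%:R * (P 0 x).1 + (a == 1)%:R * (P 1 x).2,
   (a == 0)%:R * (P 0 x).2 - (a == 1)%:R * (P 1 x).1).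
Hypothesis Q_dmuphi : forall a,
  dmuphi (K0 0) (K1 0) c (P 0 0) (P 1 0) (Q a 0 0) (Q a 1 0) = (a == 2)%:R - (a == 1)%:R * m.
Hypothesis Q_dmux : forall a,
  dmux (K0 0) (K1 0) (W1 0) om (P 0 0) (P 1 0) (Q a 0 0) (Q a 1 0) = (a == 3)%:R - (a == 0)%:R * m.
Hypothesis DI2 : forall a (x : R), is_derive x (1 : R) (I2 a) (vdot (P 0 x) (Q a 0 x)).
Hypothesis DI3 : forall a (x : R), is_derive x (1 : R) (I3 a) (vdot (vJ (Q a 0 x)) (P 1 x)).
Hypothesis DS1 : forall x : R, is_derive x (1 : R) S1 (K0 x * vdot (P 0 x) (P 0 x)).
Hypothesis DS2 : forall x : R, is_derive x (1 : R) S2 (K0 x * vdot (vJ (P 0 x)) (P 1 x)).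
Hypothesis DS3 : forall x : R, is_derive x (1 : R) S3 (K0 x * vdot (P 1 x) (P 1 x)).

Lemma P_continuous j : continuous (fun x => (P j x).1) /\ continuous (fun x => (P j x).2).
Proof. by split=> x; [exact: (@is_derive_continuous R _ (fun t => (P j.+1 t).1) x (DP1 j x))|exact: (@is_derive_continuous R _ (fun t => (P j.+1 t).2) x (DP2 j x))]. Qed.

Lemma P_bcont j : bcont (fun x => (P j x).1) /\ bcont (fun x => (P j x).2).
Proof.
have [c1 c2] := P_continuous j.
have [_ [M hM]] : bcont (fun x => (P j x).1 ^+ 2 + (P j x).2 ^+ 2).
  apply: (bcont_periodic X0).
    move=> x; rewrite PX /rot /=; set p := _.1; set q := _.2.
    by rewrite -[RHS]mul1r -cs1; ring.
  by apply: continuous_fD; exact: continuous_fX.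
have b (a b : R) x : a ^+ 2 + b ^+ 2 = (P j x).1 ^+ 2 + (P j x).2 ^+ 2 -> `|a| <= M + 1.
  move=> E; have := hM x; rewrite -E ger0_norm ?addr_ge0 ?sqr_ge0// => h.
  have a2 : `|a| ^+ 2 <= M by rewrite real_normK ?num_real//; have := sqr_ge0 b; lra.
  have [a1|a1] := leP `|a| 1; first by have := sqr_ge0 `|a|; lra.
  by apply: le_trans (_ : `|a| ^+ 2 <= _); [rewrite expr2; nra|lra].
split; split=> //; exists (M + 1) => x; first exact: (b _ (P j x).2 x).
by apply: (b _ (P j x).1 x); rewrite addrC.
Qed.

Lemma K_bcont : [/\ bcont K0, bcont K1, bcont K2, bcont W1 & bcont W2].
Proof.
split; apply: (bcont_periodic X0) => //.
- by move=> x; exact: (@is_derive_continuous R _ (fun x => K1 x * (2 * vdot (P 0 x) (P 1 x))) x (DK0 x)).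
- by move=> x; exact: (@is_derive_continuous R _ (fun x => K2 x * (2 * vdot (P 0 x) (P 1 x))) x (DK1 x)).
- by move=> x; exact: (@is_derive_continuous R _ (fun x => W2 x * (2 * vdot (P 0 x) (P 1 x))) x (DW1 x)).
Qed.

Lemma K0_neq0 x : K0 x != 0.
Proof. by rewrite gt_eqF// (lt_le_trans k00). Qed.

Definition hbase (j : 'I_4) x : R * R :=
  hess0 (K1 x) (K2 x) (W1 x) (W2 x) om c (P 0 x) (P 1 x) (P 2 x) (base4 R j).1 (base4 R j).2.

(* The linearized profile equation as a first order system: in [fam_mx] the
   spectral parameter is e * z and the squared transverse wave number e^2 * z2. *)
Definition A0 (i j : 'I_4) x : R := st4 (base4 R j).2
  ((K0 x)^-1 * (hbase j x).1, (K0 x)^-1 * (hbase j x).2) i.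
Definition A1 (i j : 'I_4) x : R := st4 (0, 0)
  ((K0 x)^-1 * (base4 R j).1.2, - ((K0 x)^-1 * (base4 R j).1.1)) i.
Definition A2 (i j : 'I_4) (x : R) : R := st4 (0, 0) (base4 R j).1 i.

Lemma bcont_st4 (u1 u2 v1 v2 : R -> R) i : bcont u1 -> bcont u2 -> bcont v1 -> bcont v2 ->
  bcont (fun x => st4 (u1 x, u2 x) (v1 x, v2 x) i).
Proof. by move=> *; case: i => -[|[|[|i]]] h. Qed.

Lemma K0V_bcont : bcont (fun x => (K0 x)^-1).
Proof.
by apply: (@bcontV R K0 k0) => // x; exact: (@is_derive_continuous R _ (fun x => K1 x * (2 * vdot (P 0 x) (P 1 x))) x (DK0 x)).
Qed.

Lemma A_bcont i j : [/\ bcont (A0 i j), bcont (A1 i j) & bcont (A2 i j)].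
Proof.
have kv := K0V_bcont; have [b0 b1 b2 b3 b4] := K_bcont.
have [p01 p02] := P_bcont 0; have [p11 p12] := P_bcont 1; have [p21 p22] := P_bcont 2.
have cb d : bcont (fun _ : R => d) := bcont_cst d.
split; apply: bcont_st4 => //.
- apply: bcontM => //; rewrite /hbase /hess0 /vdot /vJ /=.
  by bcont_tac.
- apply: bcontM => //; rewrite /hbase /hess0 /vdot /vJ /=.
  by bcont_tac.
- by apply: bcontM => //; exact: cb.
- by apply: bcontN; apply: bcontM => //; exact: cb.
Qed.

Local Notation pC := (pmap2 (real_complex R)).
Local Notation hess0C x := (hess0 (K1 x)%:C (K2 x)%:C (W1 x)%:C (W2 x)%:C om%:C c%:C
   (pC (P 0 x)) (pC (P 1 x)) (pC (P 2 x))).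
Local Notation hessC x := (hess (K0 x)%:C (K1 x)%:C (K2 x)%:C (W1 x)%:C (W2 x)%:C om%:C c%:C
   (pC (P 0 x)) (pC (P 1 x)) (pC (P 2 x))).

Lemma hess0C_sum x (y : 'I_4 -> C) : hess0C x (fst4 y) (snd4 y) =
  (\sum_j (hbase j x).1%:C * y j, \sum_j (hbase j x).2%:C * y j).
Proof.
rewrite hess0_sum.
have E j : hess0C x (base4 C j).1 (base4 C j).2 = pC (hbase j x).
  rewrite -hess0_morph; congr (hess0 _ _ _ _ _ _ _ _ _ _ _).
    by case: j => -[|[|[|[|//]]]] h; rewrite /base4 /pmap2 /= ?rmorph1 ?rmorph0.
  by case: j => -[|[|[|[|//]]]] h; rewrite /base4 /pmap2 /= ?rmorph1 ?rmorph0.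
by congr (_, _); apply: eq_bigr => j _; rewrite E.
Qed.

Definition sysmx z2 e z := fam_mx A0 A1 A2 z2 e z.

Lemma sysE z2 e z x (y : 'I_4 -> C) (i : 'I_4) :
  \sum_j sysmx z2 e z i j x * y j =
  st4 (snd4 y) (((hess0C x (fst4 y) (snd4 y)).1 + e%:C * z * y 1) / (K0 x)%:C
                  + (e ^+ 2 * z2)%:C * y 0,
                ((hess0C x (fst4 y) (snd4 y)).2 - e%:C * z * y 0) / (K0 x)%:C
                  + (e ^+ 2 * z2)%:C * y 1) i.
Proof.
have e0 : (0 : 'I_4) = ord0 by apply/val_inj.
have e1 : (1 : 'I_4) = lift ord0 ord0 by apply/val_inj.
have e2 : (2 : 'I_4) = lift ord0 (lift ord0 ord0) by apply/val_inj.
have e3 : (3 : 'I_4) = lift ord0 (lift ord0 (lift ord0 ord0)) by apply/val_inj.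
have kv : ((K0 x)^-1)%:C = (K0 x)%:C^-1 :> C by rewrite fmorphV.
have fD := rmorphD (real_complex R); have fM := rmorphM (real_complex R).
have fN := rmorphN (real_complex R); have f0 := rmorph0 (real_complex R).
have f1 := rmorph1 (real_complex R).
rewrite hess0C_sum /sysmx /fam_mx /A0 /A1 /A2 !big_ord_recl !big_ord0 /fst4 /snd4 e3 e2 e1 e0.
move: (y ord0) (y (lift _ _)) (y (lift _ (lift _ _))) (y (lift _ (lift _ (lift _ _)))).
move=> y0 y1 y2 y3; move: (hbase _ x) (hbase _ x) (hbase _ x) (hbase _ x) => h0 h1 h2 h3.
rewrite /base4 /=.
case: i => -[|[|[|[|//]]]] h; rewrite /st4 /= ?(mulr0, mulr1, oppr0) ?(fN, fM, f0, f1) ?fmorphV ?kv; ring.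
Qed.

(** If u satisfies the equation at e = 0 with right-hand side r, the system applied to its jet
    reproduces the derivative of the jet plus an explicit source. The ansatz below is checked with
    this on both [v0] and [Q]. *)
Lemma sys_real z2 e z x (u u1 u2 r : R * R) (i : 'I_4) :
  hessx x u u1 u2 = r ->
  \sum_j sysmx z2 e z i j x * (st4 u u1 j)%:C =
  (st4 u1 u2 i)%:C + st4 (0, 0)
    ((r.1%:C + e%:C * z * u.2%:C) / (K0 x)%:C + (e ^+ 2 * z2)%:C * u.1%:C,
     (r.2%:C - e%:C * z * u.1%:C) / (K0 x)%:C + (e ^+ 2 * z2)%:C * u.2%:C) i.
Proof.
move=> E; have [r1 r2] : (hessx x u u1 u2).1 = r.1 /\ (hessx x u u1 u2).2 = r.2 by rewrite E.
rewrite sysE.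
rewrite (_ : fst4 _ = pC u); last by [].
rewrite (_ : snd4 _ = pC u1); last by [].
rewrite hess0_morph.
have -> : hess0 (K1 x) (K2 x) (W1 x) (W2 x) om c (P 0 x) (P 1 x) (P 2 x) u u1 =
  (r.1 + K0 x * u2.1, r.2 + K0 x * u2.2).
  by rewrite [LHS]surjective_pairing -r1 -r2 /hess; cbn [fst snd]; rewrite !subrK.
have k0C : (K0 x)%:C != 0 :> C by rewrite fmorph_eq0 K0_neq0.
case: i => -[|[|[|[|//]]]] h; rewrite /st4 /= ?addr0// !rmorphD !rmorphM; by field.
Qed.

(** The modes at e = 0. The sign of - V_x and the zero values for the last two indices are chosen so
    that Hess Q_a = - J v0_a holds for every a. *)
Definition v0 (a : 'I_4) j x : R * R :=
  match val a with
  | 0%N => vJ (P j x)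
  | 1%N => (- (P j.+1 x).1, - (P j.+1 x).2)
  | _ => (0, 0)
  end.

Lemma v0_hess a x : hessx x (v0 a 0 x) (v0 a 1 x) (v0 a 2 x) = (0, 0).
Proof.
case: a => -[|[|[|[|//]]]] h; rewrite /v0 /= ?hess_zero//.
  by rewrite hess_vJ P_ode /vJ /= oppr0.
by rewrite hess_opp P_hess /= oppr0.
Qed.

(** This cancels the terms of order e in the expansion: Hess (z Q_a) compensates the spectral term z
    J v0_a. *)
Lemma Q_hess' a x : hessx x (Q a 0 x) (Q a 1 x) (Q a 2 x) =
  (- (v0 a 0 x).2, (v0 a 0 x).1).
Proof.
rewrite Q_hess; case: a => -[|[|[|[|//]]]] h; rewrite /v0 /vJ /=;
  congr (_, _); ring.
Qed.

Lemma v0_derive a j (x : R) :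
  is_derive x (1 : R) (fun t => (v0 a j t).1) (v0 a j.+1 x).1 /\
  is_derive x (1 : R) (fun t => (v0 a j t).2) (v0 a j.+1 x).2.
Proof.
case: a => -[|[|[|[|//]]]] h; rewrite /v0 /vJ /=; split; try exact: is_derive_fcst.
- exact: DP2.
- by apply: is_derive_fN; exact: DP1.
- by apply: is_derive_fN; exact: DP1.
- by apply: is_derive_fN; exact: DP2.
Qed.

Lemma v0_shift a j x : v0 a j (x + X) = rot co si (v0 a j x).
Proof.
case: a => -[|[|[|[|//]]]] h; rewrite /v0 ?PX /vJ /rot /=; congr (_, _); ring.
Qed.

(* The columns of a basis of initial data for the linearized equation in
   which [dmuphi] and [dmux] are the last two coordinates. *)
Definition fpair (a : 'I_4) : (R * R) * (R * R) :=
  match val a with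
  | 0%N | 1%N => (v0 a 0 0, v0 a 1 0) | _ => (Q a 0 0, Q a 1 0)
  end.
Definition fcol a : 'I_4 -> R := st4 (fpair a).1 (fpair a).2.

Definition Fmx : 'M[R]_4 := \matrix_(i, a) fcol a i.

Definition Lphi : 'rV[R]_4 := \row_j
  dmuphi (K0 0) (K1 0) c (P 0 0) (P 1 0) (base4 R j).1 (base4 R j).2.
Definition Lx : 'rV[R]_4 := \row_j
  dmux (K0 0) (K1 0) (W1 0) om (P 0 0) (P 1 0) (base4 R j).1 (base4 R j).2.

Lemma LphiE (y : 'I_4 -> R) : (Lphi *m \col_j y j) 0 0 =
  dmuphi (K0 0) (K1 0) c (P 0 0) (P 1 0) (fst4 y) (snd4 y).
Proof. by rewrite dmuphi_sum mxE; apply: eq_bigr => j _; rewrite !mxE. Qed.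

Lemma LxE (y : 'I_4 -> R) : (Lx *m \col_j y j) 0 0 =
  dmux (K0 0) (K1 0) (W1 0) om (P 0 0) (P 1 0) (fst4 y) (snd4 y).
Proof. by rewrite dmux_sum mxE; apply: eq_bigr => j _; rewrite !mxE. Qed.

Lemma fst4_st4 (T : comNzRingType) (u v : T * T) : fst4 (st4 u v) = u.
Proof. by case: u. Qed.
Lemma snd4_st4 (T : comNzRingType) (u v : T * T) : snd4 (st4 u v) = v.
Proof. by case: v. Qed.

Lemma dmuphi_fcol a : dmuphi (K0 0) (K1 0) c (P 0 0) (P 1 0) (fst4 (fcol a))
  (snd4 (fcol a)) = (a == 2)%:R.
Proof.
rewrite /fcol fst4_st4 snd4_st4.
case: a => -[|[|[|[|//]]]] h; rewrite /fpair /=.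
- by rewrite /v0 /= dmuphi_vJ.
- rewrite /v0 /=; have := dmuphi_V1 (K0 0) (K1 0) (W1 0) om c (P 0 0) (P 1 0) (P 2 0).
  rewrite P_ode /dmuphi /vdot /vJ /= => E.
  rewrite !mulr0 addr0 oppr0 in E; rewrite -[RHS]oppr0 -[in RHS]E; ring.
- by rewrite Q_dmuphi /= mul0r subr0.
- by rewrite Q_dmuphi /= mul0r subr0.
Qed.

Lemma dmux_fcol a : dmux (K0 0) (K1 0) (W1 0) om (P 0 0) (P 1 0) (fst4 (fcol a))
  (snd4 (fcol a)) = (a == 3)%:R.
Proof.
rewrite /fcol fst4_st4 snd4_st4.
case: a => -[|[|[|[|//]]]] h; rewrite /fpair /=.
- by rewrite /v0 /= dmux_vJ.
- rewrite /v0 /=; have := dmux_V1 (K0 0) (K1 0) (W1 0) om c (P 0 0) (P 1 0) (P 2 0).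
  rewrite P_ode /dmux /vdot /vJ /= => E.
  rewrite !mulr0 addr0 oppr0 in E; rewrite -[RHS]oppr0 -[in RHS]E; ring.
- by rewrite Q_dmux /= mul0r subr0.
- by rewrite Q_dmux /= mul0r subr0.
Qed.

Lemma L_Fmx : Lphi *m Fmx = delta_mx 0 2 /\ Lx *m Fmx = delta_mx 0 3.
Proof.
have E (L : 'rV[R]_4) (j : 'I_4) : (L *m Fmx) 0 j = (L *m \col_i fcol j i) 0 0.
  by rewrite !mxE; apply: eq_bigr => i _; rewrite !mxE.
split; apply/matrixP => k j; rewrite ord1 E.
- by rewrite LphiE dmuphi_fcol mxE.
- by rewrite LxE dmux_fcol mxE.
Qed.

Lemma big_ord4 (T : nmodType) (f : 'I_4 -> T) : \sum_i f i = f 0 + f 1 + f 2 + f 3.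
Proof.
rewrite !big_ord_recl big_ord0 addr0 !addrA.
by congr (f _ + f _ + f _ + f _); apply/val_inj.
Qed.

(** [dmuphi] and [dmux] kill the first two columns and are dual to the last two, so the last two
    coefficients of a null combination vanish. What remains is a relation between J V and V_x; it
    would make [dmuphi] and [dmux] dependent, which their values on the last two columns exclude. *)
Lemma Fmx_unit : Fmx \in unitmx.
Proof.
rewrite -unitmx_tr -row_free_unit; apply/inj_row_free => v vF.
have {}vF : Fmx *m v^T = 0 by rewrite -[LHS]trmxK trmx_mul trmxK vF trmx0.
have [Lp Lq] := L_Fmx.
have v2 : v 0 2 = 0.
  have := congr1 (fun M => (Lphi *m M) 0 0) vF.
  by rewrite mulmxA Lp mulmx0 mxE big_ord4 !mxE /= !mul0r mul1r !add0r addr0.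
have v3 : v 0 3 = 0.
  have := congr1 (fun M => (Lx *m M) 0 0) vF.
  by rewrite mulmxA Lq mulmx0 mxE big_ord4 !mxE /= !mul0r mul1r !add0r.
have row i : v 0 0 * fcol 0 i + v 0 1 * fcol 1 i = 0.
  have := congr1 (fun M : 'cV_4 => M i 0) vF.
  rewrite mxE big_ord4 !mxE v2 v3 !mulr0 !addr0 => <-.
  by rewrite mulrC [X in _ + X]mulrC.
(* The minus sign accounts for the second column being - V_x. *)
have D (w w1 : R * R) : v 0 0 * dmuphi (K0 0) (K1 0) c (P 0 0) (P 1 0) w w1
   + - v 0 1 * dmux (K0 0) (K1 0) (W1 0) om (P 0 0) (P 1 0) w w1 = 0.
  apply: (dmu_dependence _ _ (P_ode 0)).
  - have := row 0; rewrite /fcol /fpair /v0 /vJ /st4 /= => E; rewrite -[RHS]E; ring.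
  - have := row 1; rewrite /fcol /fpair /v0 /vJ /st4 /= => E; rewrite -[RHS]E; ring.
  - have := row 2; rewrite /fcol /fpair /v0 /vJ /st4 /= => E; rewrite -[RHS]E; ring.
  - have := row 3; rewrite /fcol /fpair /v0 /vJ /st4 /= => E; rewrite -[RHS]E; ring.
have v00 : v 0 0 = 0.
  by have := D (Q 2 0 0) (Q 2 1 0); rewrite Q_dmuphi Q_dmux /= !mul0r !subr0 mulr1 mulr0 addr0.
have v01 : v 0 1 = 0.
  have := D (Q 3 0 0) (Q 3 1 0); rewrite Q_dmuphi Q_dmux /= !mul0r !subr0 mulr1 mulr0 add0r.
  by move/eqP; rewrite oppr_eq0 => /eqP.
apply/rowP => i; rewrite mxE; case: i => -[|[|[|[|//]]]] h.
- by rewrite -[RHS]v00; congr (v _ _); apply/val_inj.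
- by rewrite -[RHS]v01; congr (v _ _); apply/val_inj.
- by rewrite -[RHS]v2; congr (v _ _); apply/val_inj.
- by rewrite -[RHS]v3; congr (v _ _); apply/val_inj.
Qed.

(** Primitives of kappa J V . v0_a and, for [Sx], of kappa V_x . v0_a. At X they give the last two
    rows of Sigma_y. *)
Definition Sphi (a : 'I_4) x : R :=
  match val a with 0%N => S1 x - S1 0 | 1%N => - (S2 x - S2 0) | _ => 0 end.
Definition Sx (a : 'I_4) x : R :=
  match val a with 0%N => S2 x - S2 0 | 1%N => - (S3 x - S3 0) | _ => 0 end.

Lemma Sphi_derive a (x : R) :
  is_derive x (1 : R) (Sphi a) (K0 x * vdot (vJ (P 0 x)) (v0 a 0 x)).
Proof.
rewrite /Sphi /v0; case: a => -[|[|[|[|//]]]] h; cbn [val isSub.val_subdef].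
- have D := is_derive_fB (DS1 x) (is_derive_fcst (S1 0) x (1 : R)).
  apply: (is_derive_eq D); rewrite /vdot /vJ /=; ring.
- have D := is_derive_fN (is_derive_fB (DS2 x) (is_derive_fcst (S2 0) x (1 : R))).
  apply: (is_derive_eq D); rewrite /vdot /vJ /=; ring.
- by rewrite /vdot /= !mulr0 addr0 mulr0; exact: is_derive_fcst.
- by rewrite /vdot /= !mulr0 addr0 mulr0; exact: is_derive_fcst.
Qed.

Lemma Sx_derive a (x : R) :
  is_derive x (1 : R) (Sx a) (K0 x * vdot (P 1 x) (v0 a 0 x)).
Proof.
rewrite /Sx /v0; case: a => -[|[|[|[|//]]]] h; cbn [val isSub.val_subdef].
- have D := is_derive_fB (DS2 x) (is_derive_fcst (S2 0) x (1 : R)).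
  apply: (is_derive_eq D); rewrite /vdot /vJ /=; ring.
- have D := is_derive_fN (is_derive_fB (DS3 x) (is_derive_fcst (S3 0) x (1 : R))).
  apply: (is_derive_eq D); rewrite /vdot /vJ /=; ring.
- by rewrite /vdot /= !mulr0 addr0 mulr0; exact: is_derive_fcst.
- by rewrite /vdot /= !mulr0 addr0 mulr0; exact: is_derive_fcst.
Qed.

Local Notation dphiC x := (dmuphi (K0 x)%:C (K1 x)%:C c%:C (pC (P 0 x)) (pC (P 1 x))).
Local Notation dxC x := (dmux (K0 x)%:C (K1 x)%:C (W1 x)%:C om%:C (pC (P 0 x)) (pC (P 1 x))).

Lemma cderiv_data (x : R) : let r := 2 * vdot (pC (P 0 x)) (pC (P 1 x)) in
  [/\ cderiv (fun t => (K0 t)%:C) x ((K1 x)%:C * r),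
      cderiv (fun t => (K1 t)%:C) x ((K2 x)%:C * r),
      cderiv (fun t => (W1 t)%:C) x ((W2 x)%:C * r) &
   forall j, cderiv (fun t => (P j t).1%:C) x (P j.+1 x).1%:C /\
     cderiv (fun t => (P j t).2%:C) x (P j.+1 x).2%:C].
Proof.
have e : 2 * vdot (pC (P 0 x)) (pC (P 1 x)) = (2 * vdot (P 0 x) (P 1 x))%:C.
  by rewrite vdot_morph rmorphM rmorph_nat.
split=> [||| j]; last by split; exact: cderiv_real.
- by rewrite /= e -rmorphM; exact: cderiv_real.
- by rewrite /= e -rmorphM; exact: cderiv_real.
- by rewrite /= e -rmorphM; exact: cderiv_real.
Qed.

Lemma cderivB (f h : R -> C) (x : R) d d' : cderiv f x d -> cderiv h x d' ->
  cderiv (fun t => f t - h t) x (d - d').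
Proof. by move=> Df Dh; apply: cderivD => //; exact: cderivN. Qed.

Ltac cderiv_tac := repeat match goal with
  | |- cderiv (fun x => GRing.add (@?f x) (@?h x)) _ _ => apply: (@cderivD _ f h)
  | |- cderiv (fun x => GRing.mul (@?f x) (@?h x)) _ _ => apply: (@cderivM _ f h)
  | |- cderiv (fun x => GRing.opp (@?f x)) _ _ => apply: (@cderivN _ f)
  | |- cderiv (fun x => ?d) _ _ => apply: cderiv_cst
  | |- _ => eassumption
  end.

Section FunctionalDerivative.
Variables (u0 u1 u2 u3 : R -> C) (x : R) (d2 d3 : C).
Hypotheses (Du0 : cderiv u0 x (u2 x)) (Du1 : cderiv u1 x (u3 x)).
Hypotheses (Du2 : cderiv u2 x d2) (Du3 : cderiv u3 x d3).
Let H := hessC x (u0 x, u1 x) (u2 x, u3 x) (d2, d3).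

(** The conservation law along an arbitrary curve: when the linearized equation holds with a source,
    [dmuphi] integrates that source against J V. *)
Lemma dmuphi_cderiv : cderiv (fun t => dphiC t (u0 t, u1 t) (u2 t, u3 t)) x
  (- vdot (vJ (pC (P 0 x))) H).
Proof.
have [DK DK' _ DPj] := cderiv_data x.
have [p0 p0'] := DPj 0; have [p1 p1'] := DPj 1.
have N : prof (K0 x)%:C (K1 x)%:C (W1 x)%:C om%:C c%:C (pC (P 0 x)) (pC (P 1 x)) (pC (P 2 x)) = (0, 0).
  by rewrite prof_morph P_ode /pmap2 /= rmorph0.
have := dmuphi_conservation (K0 x)%:C (K1 x)%:C (K2 x)%:C (W1 x)%:C (W2 x)%:C om%:C c%:C
  (pC (P 0 x)) (pC (P 1 x)) (pC (P 2 x)) (u0 x, u1 x) (u2 x, u3 x) (d2, d3).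
rewrite N -/H => E.
have -> : - vdot (vJ (pC (P 0 x))) H = dmuphi' (K0 x)%:C (K1 x)%:C (K2 x)%:C c%:C
  (pC (P 0 x)) (pC (P 1 x)) (pC (P 2 x)) (u0 x, u1 x) (u2 x, u3 x) (d2, d3).
  by rewrite E [X in _ = _ - X]/vdot /= !mulr0 addr0 subr0.
rewrite /dmuphi /vdot /vJ /pmap2 /=.
apply: cderiv_eq; first by cderiv_tac.
rewrite /dmuphi' /vdot /vJ /pmap2 /=; ring.
Qed.

Lemma dmux_cderiv : cderiv (fun t => dxC t (u0 t, u1 t) (u2 t, u3 t)) x
  (- vdot (pC (P 1 x)) H).
Proof.
have [DK DK' DW' DPj] := cderiv_data x.
have [p0 p0'] := DPj 0; have [p1 p1'] := DPj 1.
have N : prof (K0 x)%:C (K1 x)%:C (W1 x)%:C om%:C c%:C (pC (P 0 x)) (pC (P 1 x)) (pC (P 2 x)) = (0, 0).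
  by rewrite prof_morph P_ode /pmap2 /= rmorph0.
have := dmux_conservation (K0 x)%:C (K1 x)%:C (K2 x)%:C (W1 x)%:C (W2 x)%:C om%:C c%:C
  (pC (P 0 x)) (pC (P 1 x)) (pC (P 2 x)) (u0 x, u1 x) (u2 x, u3 x) (d2, d3).
rewrite N -/H => E.
have -> : - vdot (pC (P 1 x)) H = dmux' (K0 x)%:C (K1 x)%:C (K2 x)%:C (W1 x)%:C (W2 x)%:C om%:C
  (pC (P 0 x)) (pC (P 1 x)) (pC (P 2 x)) (u0 x, u1 x) (u2 x, u3 x) (d2, d3).
  by rewrite E [X in _ = _ - X]/vdot /= !mulr0 addr0 subr0.
rewrite /dmux /vdot /vJ /pmap2 /=.
apply: cderiv_eq; first by cderiv_tac.
rewrite /dmux' /vdot /vJ /pmap2 /=; ring.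
Qed.

End FunctionalDerivative.

Section Bloch.
Variables (D : set C) (B mz z2 : R).
Hypotheses (DB : forall z, D z -> normc z <= B) (mz0 : 0 < mz).
Hypothesis Dm : forall z, D z -> mz <= normc z.
Variable q : 'I_4 -> R -> C -> 'I_4 -> R -> C.

(** What remains, after division by e^2, when v0_a + e z Q_a is inserted in the system: the
    transverse term on v0_a, the transverse term on Q_a with one more factor e, and the spectral
    term on Q_a. *)
Definition src (e : R) (z : C) a i x : C := st4 (0, 0)
  (z2%:C * (v0 a 0 x).1%:C + e%:C * z * (z2%:C * (Q a 0 x).1%:C)
     + z ^+ 2 * ((Q a 0 x).2%:C / (K0 x)%:C),
   z2%:C * (v0 a 0 x).2%:C + e%:C * z * (z2%:C * (Q a 0 x).2%:C)
     - z ^+ 2 * ((Q a 0 x).1%:C / (K0 x)%:C)) i.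

Hypothesis q_0 : forall a (e : R) z i, 0 < e <= 1 -> D z -> q a e z i 0 = 0.
Hypothesis q_ode : forall a (e : R) z i (x : R), 0 < e <= 1 -> D z -> 0 <= x <= X ->
  cderiv (q a e z i) x (\sum_j sysmx z2 e z i j x * q a e z j x + src e z a i x).
Hypothesis q_BL : forall a i, uBL D X (fun e z x => q a e z i x).

Lemma D_neq0 z : D z -> z != 0.
Proof. by move=> /Dm h; apply/eqP => z0; move: h; rewrite z0 normc0 leNgt mz0. Qed.

Definition v0c a i x : C := (st4 (v0 a 0 x) (v0 a 1 x) i)%:C.
Definition Qc a i x : C := (st4 (Q a 0 x) (Q a 1 x) i)%:C.
(** The remainder [q] vanishes at 0, so the initial data of this exact solution are explicit. *)
Definition bloch a e z i x : C :=
  v0c a i x + e%:C * z * Qc a i x + e%:C ^+ 2 * q a e z i x.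

Lemma st4_derive (u v w : R -> R * R) (i : 'I_4) (x : R) :
  is_derive x (1 : R) (fun t => (u t).1) (v x).1 ->
  is_derive x (1 : R) (fun t => (u t).2) (v x).2 ->
  is_derive x (1 : R) (fun t => (v t).1) (w x).1 ->
  is_derive x (1 : R) (fun t => (v t).2) (w x).2 ->
  cderiv (fun t => (st4 (u t) (v t) i)%:C) x (st4 (v x) (w x) i)%:C.
Proof. by move=> *; apply: cderiv_real; case: i => -[|[|[|i]]] h. Qed.

Lemma bloch_ode a (e : R) z i (x : R) : 0 < e <= 1 -> D z -> 0 <= x <= X ->
  cderiv (bloch a e z i) x (\sum_j sysmx z2 e z i j x * bloch a e z j x).
Proof.
move=> he Dz hx; have [v1 v2] := v0_derive a 0 x; have [v3 v4] := v0_derive a 1 x.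
have Dv : cderiv (v0c a i) x (st4 (v0 a 1 x) (v0 a 2 x) i)%:C by apply: st4_derive.
have DQ : cderiv (Qc a i) x (st4 (Q a 1 x) (Q a 2 x) i)%:C by apply: st4_derive.
have Dq := q_ode a i he Dz hx.
apply: (cderiv_eq (cderivD (cderivD Dv (cderivM (cderiv_cst (e%:C * z) x) DQ))
  (cderivM (cderiv_cst (e%:C ^+ 2) x) Dq))).
rewrite /bloch.
under [RHS]eq_bigr => j _ do rewrite !mulrDr.
rewrite !big_split /=.
have -> : \sum_j sysmx z2 e z i j x * v0c a j x = _ := sys_real z2 e z i (v0_hess a x).
have -> : \sum_j sysmx z2 e z i j x * (e%:C * z * Qc a j x) =
    e%:C * z * (\sum_j sysmx z2 e z i j x * Qc a j x).
  by rewrite mulr_sumr; apply: eq_bigr => j _; rewrite mulrCA.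
have -> : \sum_j sysmx z2 e z i j x * Qc a j x = _ := sys_real z2 e z i (Q_hess' a x).
have -> : \sum_j sysmx z2 e z i j x * (e%:C ^+ 2 * q a e z j x) =
    e%:C ^+ 2 * (\sum_j sysmx z2 e z i j x * q a e z j x).
  by rewrite mulr_sumr; apply: eq_bigr => j _; rewrite mulrCA.
rewrite /src; move: (\sum_j _) => S.
have k0C : (K0 x)%:C != 0 :> C by rewrite fmorph_eq0 K0_neq0.
have ez : (e ^+ 2 * z2)%:C = e%:C ^+ 2 * z2%:C :> C by rewrite rmorphM rmorphXn.
rewrite ez; have f0 := rmorph0 (real_complex R); have fN := rmorphN (real_complex R).
by case: i {Dv DQ Dq} => -[|[|[|[|//]]]] h; rewrite /st4 /= ?f0 ?fN; field.
Qed.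

Definition GC : 'M[C]_4 := map_mx (real_complex R) (invmx Fmx).

Lemma GC_Fmx : GC *m map_mx (real_complex R) Fmx = 1%:M.
Proof. by rewrite -map_mxM mulVmx ?Fmx_unit// map_mx1. Qed.

Lemma GC_fcol a : GC *m \col_i (fcol a i)%:C = delta_mx a 0.
Proof.
have -> : \col_i (fcol a i)%:C = map_mx (real_complex R) Fmx *m (delta_mx a 0 : 'cV_4).
  by rewrite -colE; apply/colP => i; rewrite !mxE.
by rewrite mulmxA GC_Fmx mul1mx.
Qed.

Lemma GC_inj (y : 'cV[C]_4) : GC *m y = 0 -> y = 0.
Proof.
move=> h; have : map_mx (real_complex R) Fmx *m (GC *m y) = 0 by rewrite h mulmx0.
by rewrite mulmxA -map_mxM mulmxV ?Fmx_unit// map_mx1 mul1mx.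
Qed.

Lemma GC_row2 (y : 'I_4 -> C) : (GC *m \col_i y i) 2 0 = dphiC 0 (fst4 y) (snd4 y).
Proof.
have [Lp _] := L_Fmx.
have E : Lphi = row 2 (invmx Fmx).
  by rewrite rowE -Lp mulmxK// Fmx_unit.
rewrite dmuphi_sum mxE; apply: eq_bigr => j _; rewrite !mxE; congr (_ * _).
have -> : invmx Fmx 2 j = Lphi 0 j by rewrite E mxE.
rewrite mxE -dmuphi_morph; congr (dmuphi _ _ _ _ _ _ _);
  by case: j => -[|[|[|[|//]]]] h; rewrite /base4 /pmap2 /= ?rmorph1 ?rmorph0.
Qed.

Lemma GC_row3 (y : 'I_4 -> C) : (GC *m \col_i y i) 3 0 = dxC 0 (fst4 y) (snd4 y).
Proof.
have [_ Lp] := L_Fmx.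
have E : Lx = row 3 (invmx Fmx).
  by rewrite rowE -Lp mulmxK// Fmx_unit.
rewrite dmux_sum mxE; apply: eq_bigr => j _; rewrite !mxE; congr (_ * _).
have -> : invmx Fmx 3 j = Lx 0 j by rewrite E mxE.
rewrite mxE -dmux_morph; congr (dmux _ _ _ _ _ _ _ _);
  by case: j => -[|[|[|[|//]]]] h; rewrite /base4 /pmap2 /= ?rmorph1 ?rmorph0.
Qed.

(** Rotation of both halves of a state by the angle - xi, undoing the phase shift over a period. *)
Definition unrot (y : 'I_4 -> C) : 'I_4 -> C :=
  st4 (rot co%:C (- si%:C) (fst4 y)) (rot co%:C (- si%:C) (snd4 y)).

Definition defect a e z : 'cV[C]_4 :=
  \col_i (unrot (fun j => bloch a e z j X) i - expi e * bloch a e z i 0).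

Definition hcol a : 'cV[C]_4 := GC *m \col_i Qc a i 0.
Definition rcol a e z : 'cV[C]_4 := GC *m \col_i unrot (fun j => q a e z j X) i.

Lemma csC : co%:C ^+ 2 + si%:C ^+ 2 = 1 :> C.
Proof. by rewrite -!rmorphXn -rmorphD cs1 rmorph1. Qed.

Lemma unrotD y y' i : unrot (fun j => y j + y' j) i = unrot y i + unrot y' i.
Proof.
by rewrite /unrot; case: i => -[|[|[|[|//]]]] h; rewrite /st4 /fst4 /snd4 /=; ring.
Qed.

Lemma unrotZ k y i : unrot (fun j => k * y j) i = k * unrot y i.
Proof.
by rewrite /unrot; case: i => -[|[|[|[|//]]]] h; rewrite /st4 /fst4 /snd4 /=; ring.
Qed.

Lemma unrot_v0 a i : unrot (fun j => v0c a j X) i = v0c a i 0.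
Proof.
rewrite /unrot /v0c -[X in v0 a 0 X](add0r X) -[X in v0 a 1 X](add0r X) !v0_shift.
have := csC; move: (v0 a 0 0) (v0 a 1 0) => u v cs.
case: i => -[|[|[|[|//]]]] h; rewrite /st4 /fst4 /snd4 /= ?rmorphB ?rmorphD ?rmorphM -[RHS]mul1r -cs; ring.
Qed.

Lemma unrot_Q a i : unrot (fun j => Qc a j X) i =
  Qc a i 0 + ((xia a)%:C * (fcol 0 i)%:C + (Xa a)%:C * (fcol 1 i)%:C).
Proof.
rewrite /unrot /Qc !QX; have := csC.
rewrite /fcol /fpair /v0 /vJ /=.
move: (Q a 0 0) (Q a 1 0) (P 0 0) (P 1 0) (P 2 0) (xia a) (Xa a) => u v p p1 p2 xi Xi cs.
case: i => -[|[|[|[|//]]]] h; rewrite /st4 /fst4 /snd4 /= ?(rmorphB, rmorphD, rmorphM, rmorphN) -[RHS]mul1r -cs; ring.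
Qed.

(** v0_a is exactly quasi-periodic and contributes only through 1 - exp (i e). Q_a contributes
    moreover its jump, which is a combination of the first two basis vectors. The remainder enters
    with e^2. *)
Lemma GC_defect a (e : R) z : 0 < e <= 1 -> D z ->
  GC *m defect a e z = ((1 - expi e) * (a < 2)%N%:R) *: delta_mx a 0
    + ((1 - expi e) * (e%:C * z)) *: hcol a
    + (e%:C * z) *: ((xia a)%:C *: delta_mx 0 0 + (Xa a)%:C *: delta_mx 1 0)
    + e%:C ^+ 2 *: rcol a e z.
Proof.
move=> he Dz.
have -> : defect a e z = ((1 - expi e) * (a < 2)%N%:R) *: (\col_i (fcol a i)%:C)
    + ((1 - expi e) * (e%:C * z)) *: (\col_i Qc a i 0)
    + (e%:C * z) *: ((xia a)%:C *: (\col_i (fcol 0 i)%:C) + (Xa a)%:C *: (\col_i (fcol 1 i)%:C))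
    + e%:C ^+ 2 *: \col_i unrot (fun j => q a e z j X) i.
  apply/colP => i; rewrite !mxE /bloch q_0// mulr0 addr0 !unrotD !unrotZ unrot_v0 unrot_Q.
  have -> : v0c a i 0 = (a < 2)%N%:R * (fcol a i)%:C.
    rewrite /v0c /fcol /fpair /v0.
    case: a => -[|[|[|[|//]]]] h /=; rewrite ?mul1r// mul0r.
      by case: i => -[|[|[|[|//]]]] h'.
    by case: i => -[|[|[|[|//]]]] h'.
  ring.
by rewrite !mulmxDr -!scalemxAr mulmxDr -!scalemxAr !GC_fcol.
Qed.

(** The value of [dmuphi] on the remainder minus its leading part. The derivative of this difference
    has a factor e, so it disappears in the limit; [xr] does the same for [dmux]. *)
Definition phir a e z x : C := dphiC x (q a e z 0 x, q a e z 1 x) (q a e z 2 x, q a e z 3 x)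
  - z2%:C * (Sphi a x)%:C - z ^+ 2 * (I2 a x - I2 a 0)%:C.
Definition xr a e z x : C := dxC x (q a e z 0 x, q a e z 1 x) (q a e z 2 x, q a e z 3 x)
  - z2%:C * (Sx a x)%:C - z ^+ 2 * (I3 a x - I3 a 0)%:C.

Definition rsrc (e : R) (z : C) a x : C * C :=
  (z * q a e z 1 x + e%:C * (z2 * K0 x)%:C * q a e z 0 x + z * (z2 * K0 x)%:C * (Q a 0 x).1%:C,
   - (z * q a e z 0 x) + e%:C * (z2 * K0 x)%:C * q a e z 1 x + z * (z2 * K0 x)%:C * (Q a 0 x).2%:C).

Lemma q_hessC a (e : R) z (x : R) : 0 < e <= 1 -> D z ->
  let A i := \sum_j sysmx z2 e z i j x * q a e z j x + src e z a i x in
  hessC x (q a e z 0 x, q a e z 1 x) (q a e z 2 x, q a e z 3 x) (A 2, A 3) =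
  (- (e%:C * (rsrc e z a x).1 + z2%:C * (K0 x * (v0 a 0 x).1)%:C + z ^+ 2 * (Q a 0 x).2%:C),
   - (e%:C * (rsrc e z a x).2 + z2%:C * (K0 x * (v0 a 0 x).2)%:C - z ^+ 2 * (Q a 0 x).1%:C)).
Proof.
move=> he Dz A; have k0C : (K0 x)%:C != 0 :> C by rewrite fmorph_eq0 K0_neq0.
rewrite /A !sysE /hess -/(fst4 ((q a e z)^~ x)) -/(snd4 ((q a e z)^~ x)).
move: (hess0C x _ _) => [h1 h2]; rewrite /src /rsrc /st4 /fst4 /snd4 /=.
have ez : (e ^+ 2 * z2)%:C = e%:C ^+ 2 * z2%:C :> C by rewrite rmorphM rmorphXn.
by rewrite ez !rmorphM; congr (_, _); field.
Qed.

Lemma q_cderiv23 a (e : R) z (x : R) : 0 < e <= 1 -> D z -> 0 <= x <= X ->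
  let A i := \sum_j sysmx z2 e z i j x * q a e z j x + src e z a i x in
  [/\ cderiv (q a e z 0) x (q a e z 2 x), cderiv (q a e z 1) x (q a e z 3 x),
      cderiv (q a e z 2) x (A 2) & cderiv (q a e z 3) x (A 3)].
Proof.
move=> he Dz hx A; split; [| |exact: q_ode|exact: q_ode].
- by apply: cderiv_eq (q_ode a 0 he Dz hx) _; rewrite sysE /src /st4 /= addr0.
- by apply: cderiv_eq (q_ode a 1 he Dz hx) _; rewrite sysE /src /st4 /= addr0.
Qed.

Lemma phir_derive a (e : R) z (x : R) : 0 < e <= 1 -> D z -> 0 <= x <= X ->
  cderiv (phir a e z) x (e%:C * vdot (vJ (pC (P 0 x))) (rsrc e z a x)).
Proof.
move=> he Dz hx; have [d0 d1 d2 d3] := q_cderiv23 a he Dz hx.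
have Df := dmuphi_cderiv d0 d1 d2 d3.
have Ds := cderiv_real (Sphi_derive a x).
have Di := cderiv_real (is_derive_fB (DI2 a x) (is_derive_fcst (I2 a 0) x (1 : R))).
apply: (cderiv_eq (cderivB (cderivB Df (cderivM (cderiv_cst z2%:C x) Ds))
  (cderivM (cderiv_cst (z ^+ 2) x) Di))).
rewrite q_hessC// /vdot /vJ /pmap2 /= subr0 !(rmorphD, rmorphM, rmorphN).
by move: (rsrc e z a x) => [r1 r2] /=; ring.
Qed.

Lemma xr_derive a (e : R) z (x : R) : 0 < e <= 1 -> D z -> 0 <= x <= X ->
  cderiv (xr a e z) x (e%:C * vdot (pC (P 1 x)) (rsrc e z a x)).
Proof.
move=> he Dz hx; have [d0 d1 d2 d3] := q_cderiv23 a he Dz hx.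
have Df := dmux_cderiv d0 d1 d2 d3.
have Ds := cderiv_real (Sx_derive a x).
have Di := cderiv_real (is_derive_fB (DI3 a x) (is_derive_fcst (I3 a 0) x (1 : R))).
apply: (cderiv_eq (cderivB (cderivB Df (cderivM (cderiv_cst z2%:C x) Ds))
  (cderivM (cderiv_cst (z ^+ 2) x) Di))).
rewrite q_hessC// /vdot /vJ /pmap2 /= subr0 !(rmorphD, rmorphM, rmorphN).
by move: (rsrc e z a x) => [r1 r2] /=; ring.
Qed.

Lemma Q_bound a : exists M : R, forall x : R, 0 <= x <= X ->
  `|(Q a 0 x).1| <= M /\ `|(Q a 0 x).2| <= M.
Proof.
have c1 : continuous (fun x => (Q a 0 x).1).
  by move=> x; exact: (@is_derive_continuous R _ (fun t => (Q a 1 t).1) x (DQ1 a 0 x)).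
have c2 : continuous (fun x => (Q a 0 x).2).
  by move=> x; exact: (@is_derive_continuous R _ (fun t => (Q a 1 t).2) x (DQ2 a 0 x)).
have [M1 _ h1] := continuous_bounded X0 c1.
have [M2 _ h2] := continuous_bounded X0 c2.
exists (Num.max M1 M2) => x /andP[x0 xX]; have nx : `|x| <= X by rewrite ger0_norm.
by rewrite !le_max h1// h2// orbT.
Qed.

Lemma uBL_bcont (f : R -> R) : bcont f -> uBL D X (fun _ _ x => (f x)%:C).
Proof. by move=> [_ [M hM]]; apply: (@uBL_space _ _ _ f M) => x _. Qed.

Lemma rsrc_BL a : uBL D X (fun e z x => (rsrc e z a x).1) /\
  uBL D X (fun e z x => (rsrc e z a x).2).
Proof.
have [M hM] := Q_bound a.
have bz : uBL D X (fun e z _ => z) by apply: uBL_par; exact: BL_id DB.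
have be : uBL D X (fun e z _ => e%:C) by apply: uBL_par; exact: BL_real.
have bk : uBL D X (fun _ _ x => (z2 * K0 x)%:C).
  by apply: uBL_bcont; apply: bcontM; [exact: bcont_cst|have [] := K_bcont].
have b1 : uBL D X (fun _ _ x => (Q a 0 x).1%:C).
  by apply: (uBL_space _ (M := M)) => x /hM[].
have b2 : uBL D X (fun _ _ x => (Q a 0 x).2%:C).
  by apply: (uBL_space _ (M := M)) => x /hM[].
split; rewrite /rsrc /=.
- apply: uBLD; last by apply: uBLM => //; apply: uBLM.
  by apply: uBLD; apply: uBLM => //; apply: uBLM.
- apply: uBLD; last by apply: uBLM => //; apply: uBLM.
  apply: uBLD; last by apply: uBLM => //; apply: uBLM.
  by apply: uBLN; apply: uBLM.
Qed.

(** The leading part of the normalized matrix. In its last two rows, I2 and I3 stand where Sigma_t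
    has additional boundary terms; a row operation of determinant 1 ([shear]) accounts for the
    difference. *)
Definition target a r (z : C) : C :=
  match val r with
  | 0%N => z * (xia a)%:C - 'i%C * (r == a)%:R
  | 1%N => z * (Xa a)%:C - 'i%C * (r == a)%:R
  | 2%N => z * (I2 a X - I2 a 0)%:C + z^-1 * (z2 * Sphi a X)%:C
           - 'i%C * ((a == 2)%:R - (a == 1)%:R * m)%:C
  | _ => z * (I3 a X - I3 a 0)%:C + z^-1 * (z2 * Sx a X)%:C
           - 'i%C * ((a == 3)%:R - (a == 0)%:R * m)%:C
  end.

(** The first two rows of the defect start at order e. In the last two, neither v0_a nor the jump of
    Q_a has a component, so they start at order e^2; dividing by z as well normalizes the
    contribution of 1 - exp (i e). *)
Definition scale4 (e : R) (z : C) (r : 'I_4) : C :=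
  if (r < 2)%N then e%:C else e%:C ^+ 2 * z.

Definition Mat e z : 'M[C]_4 :=
  \matrix_(r, a) ((GC *m defect a e z) r 0 / scale4 e z r).

Lemma rcol_BL a r : BL D (fun e z => rcol a e z r 0).
Proof.
have h i : BL D (fun e z => q a e z i X).
  by apply: uBL_sup (q_BL a i) _ _; rewrite lexx ltW.
have bc (k : C) := BL_cst D k.
have u i : BL D (fun e z => unrot (fun j => q a e z j X) i).
  rewrite /unrot; case: i => -[|[|[|[|//]]]] h'; rewrite /st4 /fst4 /snd4 /=.
  - by apply: BLD; apply: BLM.
  - by apply: BLD; [apply: BLM|apply: BLN; apply: BLM].
  - by apply: BLD; apply: BLM.
  - by apply: BLD; [apply: BLM|apply: BLN; apply: BLM].
rewrite (_ : (fun e z => _) = (fun e z =>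
    \sum_i GC r i * unrot (fun j => q a e z j X) i)); last first.
  by apply: funext => e; apply: funext => z; rewrite mxE; apply: eq_bigr => i _; rewrite !mxE.
by apply: BL_sum => i; apply: BLM.
Qed.

Lemma hcol2 a : hcol a 2 0 = ((a == 2)%:R - (a == 1)%:R * m)%:C.
Proof. by rewrite /hcol (GC_row2 (Qc a ^~ 0)) -Q_dmuphi -dmuphi_morph. Qed.

Lemma hcol3 a : hcol a 3 0 = ((a == 3)%:R - (a == 0)%:R * m)%:C.
Proof. by rewrite /hcol (GC_row3 (Qc a ^~ 0)) -Q_dmux -dmux_morph. Qed.

Lemma P_unrot j : pC (P j 0) = rot co%:C (- si%:C) (pC (P j X)).
Proof.
have -> : P j X = rot co si (P j 0) by rewrite -PX add0r.
rewrite /pmap2 /rot /= !(rmorphD, rmorphB, rmorphM).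
have := csC; move: (P j 0) => p cs.
by congr (_, _); rewrite -[LHS]mul1r -cs; ring.
Qed.

Lemma rcol2 a (e : R) z : rcol a e z 2 0 =
  phir a e z X + z2%:C * (Sphi a X)%:C + z ^+ 2 * (I2 a X - I2 a 0)%:C.
Proof.
transitivity (dphiC X (q a e z 0 X, q a e z 1 X) (q a e z 2 X, q a e z 3 X)); last first.
  by rewrite /phir addrAC subrK subrK.
rewrite /rcol GC_row2 /unrot fst4_st4 snd4_st4 !P_unrot.
have -> : K0 0 = K0 X by rewrite -K0X add0r.
have -> : K1 0 = K1 X by rewrite -K1X add0r.
by rewrite dmuphi_rot// sqrrN csC.
Qed.

Lemma rcol3 a (e : R) z : rcol a e z 3 0 =
  xr a e z X + z2%:C * (Sx a X)%:C + z ^+ 2 * (I3 a X - I3 a 0)%:C.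
Proof.
transitivity (dxC X (q a e z 0 X, q a e z 1 X) (q a e z 2 X, q a e z 3 X)); last first.
  by rewrite /xr addrAC subrK subrK.
rewrite /rcol GC_row3 /unrot fst4_st4 snd4_st4 !P_unrot.
have -> : K0 0 = K0 X by rewrite -K0X add0r.
have -> : K1 0 = K1 X by rewrite -K1X add0r.
have -> : W1 0 = W1 X by rewrite -W1X add0r.
by rewrite dmux_rot// sqrrN csC.
Qed.

Lemma phir_BL a : BL D (fun e z => phir a e z X / e%:C).
Proof.
have [r1 r2] := rsrc_BL a; have [p1 p2] := P_bcont 0.
have := uBL_integral X0 (f := phir a) (df := fun e z x => vdot (vJ (pC (P 0 x))) (rsrc e z a x)).
apply=> [|e z he Dz].
  rewrite /vdot /vJ /pmap2 /=; apply: uBLD; apply: uBLM => //; first exact: uBL_bcont.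
  by apply: uBLN; exact: uBL_bcont.
split=> [|x hx]; last exact: phir_derive.
rewrite /phir !q_0// (_ : Sphi a 0 = 0) ?subrr; last first.
  by rewrite /Sphi; case: (a) => -[|[|[|[|//]]]] h /=; rewrite ?subrr ?oppr0.
by rewrite /dmuphi /vdot /vJ /= rmorph0 !(mulr0, mul0r, oppr0, subr0, addr0).
Qed.

Lemma xr_BL a : BL D (fun e z => xr a e z X / e%:C).
Proof.
have [r1 r2] := rsrc_BL a; have [p1 p2] := P_bcont 1.
have := uBL_integral X0 (f := xr a) (df := fun e z x => vdot (pC (P 1 x)) (rsrc e z a x)).
apply=> [|e z he Dz].
  by rewrite /vdot /vJ /pmap2 /=; apply: uBLD; apply: uBLM => //; exact: uBL_bcont.
split=> [|x hx]; last exact: xr_derive.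
rewrite /xr !q_0// (_ : Sx a 0 = 0) ?subrr; last first.
  by rewrite /Sx; case: (a) => -[|[|[|[|//]]]] h /=; rewrite ?subrr ?oppr0.
by rewrite /dmux /vdot /vJ /= rmorph0 !(mulr0, mul0r, oppr0, subr0, addr0).
Qed.

Lemma expi_cong : congBL D (fun e _ => (1 - expi e) / e%:C) (fun _ _ => - 'i%C).
Proof.
split; first exact: BL_cst.
exists (fun e _ => ((1 - expi e) / e%:C + 'i%C) / e%:C).
  exact: (BL_bounded_cst D (@expi_bound R)).
move=> e z /andP[e0 _] _; have en : (e%:C : C) != 0 by rewrite fmorph_eq0 gt_eqF.
by field.
Qed.

Lemma ord4P (r : 'I_4) : [\/ r = 0, r = 1, r = 2 | r = 3].
Proof.
case: r => -[|[|[|[|//]]]] h; [apply: Or41|apply: Or42|apply: Or43|apply: Or44];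
  exact/val_inj.
Qed.

Lemma GC_defect_row a r (e : R) z : 0 < e <= 1 -> D z ->
  (GC *m defect a e z) r 0 = (1 - expi e) * ((a < 2)%N%:R * (r == a)%:R)
    + (1 - expi e) * (e%:C * z) * hcol a r 0
    + e%:C * z * ((xia a)%:C * (r == 0)%:R + (Xa a)%:C * (r == 1)%:R)
    + e%:C ^+ 2 * rcol a e z r 0.
Proof.
move=> he Dz; rewrite GC_defect//.
by move: (hcol a) (rcol a e z) => u v; rewrite !mxE eqxx !andbT mulrA.
Qed.

Lemma Mat_cong r a : congBL D (fun e z => Mat e z r a) (fun _ z => target a r z).
Proof.
have bz := BL_id DB; have bzV := BL_inv mz0 Dm.
have bc (k : C) := BL_cst D k; have be := @BL_real R D.
have cE := expi_cong.
have small h : BL D h -> congBL D (fun e z => e%:C * h e z) (fun _ _ => 0).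
  move=> bh; have := congBL_small (bc 0) bh.
  congr (congBL _ _ _); apply: funext => e; apply: funext => z; exact: add0r.
have eq0 h h' h0 h0' : (forall (e : R) z, 0 < e <= 1 -> D z -> h e z = h' e z) ->
    (forall (e : R) z, 0 < e <= 1 -> D z -> h0 e z = h0' e z) -> congBL D h h0 -> congBL D h' h0'.
  move=> E E0 [b [g bg Eg]]; split; first exact: BL_eq E0 b.
  by exists g => // e z he Dz; rewrite -E// -E0// Eg.
have en (e : R) : 0 < e <= 1 -> (e%:C : C) != 0.
  by move=> /andP[e0 _]; rewrite fmorph_eq0 gt_eqF.
(* The common form of rows 0 and 1; [bot] below is that of rows 2 and 3, with f standing for [phir]
   or [xr]. *)
have top (l : C) (r' : 'I_4) : congBL D
    (fun e z => (1 - expi e) / e%:C * ((r' == a)%:R + e%:C * (z * hcol a r' 0)) +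
       z * l + e%:C * rcol a e z r' 0) (fun _ z => z * l - 'i%C * (r' == a)%:R).
  have c1 := congBLM cE (congBLD (congBL_refl (bc (r' == a)%:R)) (small _ (BLM bz (bc (hcol a r' 0))))).
  have c2 := congBLD (congBLD c1 (congBL_refl (BLM bz (bc l)))) (small _ (rcol_BL a r')).
  by apply: eq0 c2 => // e z _ _ /=; rewrite !addr0 mulNr addrC.
have bot (f : R -> C -> C) (r' : 'I_4) (s i : R) : BL D (fun e z => f e z / e%:C) ->
   congBL D (fun e z => (1 - expi e) / e%:C * hcol a r' 0 +
     z^-1 * (f e z + z2%:C * s%:C + z ^+ 2 * i%:C))
    (fun _ z => z * i%:C + z^-1 * (z2 * s)%:C - 'i%C * hcol a r' 0).
  move=> bf.
  have c1 := congBLM cE (congBL_refl (bc (hcol a r' 0))).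
  have c2 := congBLD (congBL_refl (BLM bzV (bc (z2 * s)%:C))) (congBL_refl (BLM bz (bc i%:C))).
  have c3 := congBLD (congBLD c1 c2) (small _ (BLM bzV bf)).
  apply: eq0 c3 => e z he Dz /=.
    have := en e he; have := D_neq0 Dz => zn e0; rewrite rmorphM; by field; rewrite zn.
  by rewrite addr0 mulNr; ring.
case: (ord4P r) => ->.
- apply: eq0 (top (xia a)%:C 0) => e z he Dz //; rewrite [RHS]mxE GC_defect_row//.
  have -> : (a < 2)%N%:R * (0 == a)%:R = (0 == a)%:R :> C.
    by case: eqP => [<-|_]; rewrite ?mul1r ?mulr0.
  by rewrite /scale4 /=; have := en e he => e0; field.
- apply: eq0 (top (Xa a)%:C 1) => e z he Dz //; rewrite [RHS]mxE GC_defect_row//.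
  have -> : (a < 2)%N%:R * (1 == a)%:R = (1 == a)%:R :> C.
    by case: eqP => [<-|_]; rewrite ?mul1r ?mulr0.
  by rewrite /scale4 /=; have := en e he => e0; field.
- apply: eq0 (bot _ 2 (Sphi a X) (I2 a X - I2 a 0) (phir_BL a)) => e z he Dz; last by rewrite /target /= hcol2.
  rewrite [RHS]mxE GC_defect_row// rcol2.
  have -> : (a < 2)%N%:R * (2 == a)%:R = 0 :> C.
    by case: eqP => [<-|_]; rewrite ?mul0r ?mulr0.
  by rewrite /scale4 /=; have := en e he; have := D_neq0 Dz => zn e0; field; rewrite zn.
- apply: eq0 (bot _ 3 (Sx a X) (I3 a X - I3 a 0) (xr_BL a)) => e z he Dz; last by rewrite /target /= hcol3.
  rewrite [RHS]mxE GC_defect_row// rcol3.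
  have -> : (a < 2)%N%:R * (3 == a)%:R = 0 :> C.
    by case: eqP => [<-|_]; rewrite ?mul0r ?mulr0.
  by rewrite /scale4 /=; have := en e he; have := D_neq0 Dz => zn e0; field; rewrite zn.
Qed.

Definition rotf (y : 'I_4 -> C) : 'I_4 -> C :=
  st4 (rot co%:C si%:C (fst4 y)) (rot co%:C si%:C (snd4 y)).

Lemma rotfK y i : rotf (unrot y) i = y i.
Proof.
rewrite -[RHS]st4K /rotf /unrot fst4_st4 snd4_st4.
have K (u : C * C) : rot co%:C si%:C (rot co%:C (- si%:C) u) = u.
  case: u => u1 u2; rewrite /rot /=; have cs := csC.
  by congr (_, _); rewrite -[RHS]mul1r -cs; ring.
by rewrite !K.
Qed.

Lemma P_rot j x : pC (P j (x + X)) = rot co%:C si%:C (pC (P j x)).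
Proof. by rewrite PX /pmap2 /rot /= !(rmorphD, rmorphN, rmorphM). Qed.

(** The coefficients at x + X are those at x conjugated by the rotation. This lets the Bloch
    relation propagate from one point to the whole line. *)
Lemma sysmx_rot e z x (y : 'I_4 -> C) i :
  \sum_j sysmx z2 e z i j (x + X) * rotf y j =
  rotf (fun i => \sum_j sysmx z2 e z i j x * y j) i.
Proof.
rewrite sysE K0X K1X K2X W1X W2X !P_rot {1 2 3 4}/rotf fst4_st4 snd4_st4 hess0_rot ?csC//.
have -> : rotf (fun i => \sum_j sysmx z2 e z i j x * y j) i =
  rotf (fun i => st4 (snd4 y) (((hess0C x (fst4 y) (snd4 y)).1 + e%:C * z * y 1) / (K0 x)%:C
                  + (e ^+ 2 * z2)%:C * y 0,
                ((hess0C x (fst4 y) (snd4 y)).2 - e%:C * z * y 0) / (K0 x)%:C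
                  + (e ^+ 2 * z2)%:C * y 1) i) i.
  by congr (rotf _ i); apply: funext => k; rewrite sysE.
rewrite /rotf fst4_st4 snd4_st4; move: (hess0C x _ _) (K0 x)%:C^-1 => [h1 h2] kv.
by case: i => -[|[|[|[|//]]]] h; rewrite /st4 /fst4 /snd4 /rot /=; ring.
Qed.

Lemma rotf_cderiv (v dv : 'I_4 -> C) (u : 'I_4 -> R -> C) (x : R) i :
  (forall j, cderiv (u j) x (dv j)) ->
  cderiv (fun t => rotf (fun j => u j t) i) x (rotf dv i).
Proof.
move=> Du.
have L (p r : C) j k : cderiv (fun t => p * u j t + r * u k t) x (p * dv j + r * dv k).
  have := cderivD (cderivM (cderiv_cst p x) (Du j)) (cderivM (cderiv_cst r x) (Du k)).
  by move/cderiv_eq; apply; ring.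
have L' (p r : C) j k : cderiv (fun t => p * u j t - r * u k t) x (p * dv j - r * dv k).
  have := cderivB (cderivM (cderiv_cst p x) (Du j)) (cderivM (cderiv_cst r x) (Du k)).
  by move/cderiv_eq; apply; ring.
case: i => -[|[|[|[|//]]]] h; rewrite /rotf /st4 /fst4 /snd4 /rot /=;
  by [exact: L|exact: L'].
Qed.

Lemma sysmx_bound (e : R) z : 0 < e <= 1 -> D z -> exists2 M : R, 0 <= M &
  forall i j x, normc (sysmx z2 e z i j x) <= M.
Proof.
move=> he Dz; have A i j := A_bcont i j; have b0 (i : 'I_4) := bcont_cst (0 : R).
have [M M0 hM] := @fam_bounds R 'I_4 A0 A1 A2 (fun _ _ => 0) (fun _ _ => 0) (fun _ _ => 0)
  (fun i j => let: And3 x _ _ := A i j in x) (fun i j => let: And3 _ x _ := A i j in x)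
  (fun i j => let: And3 _ _ x := A i j in x) b0 b0 b0 D B z2 DB.
by exists M => // i j x; have [] := hM e z he Dz.
Qed.

(** The ansatz solves the system on [0, X] only. The global solution with the same data agrees with
    it there, so it satisfies the Bloch relation at 0; uniqueness, applied to the difference of the
    two sides of the relation, gives it everywhere. *)
Lemma bloch_extend (e : R) z (c0 : 'I_4 -> C) : 0 < e <= 1 -> D z ->
  let y i x := \sum_a c0 a * bloch a e z i x in
  (forall i, unrot (fun j => y j X) i = expi e * y i 0) ->
  exists v : 'I_4 -> R -> C,
  [/\ forall i (x : R), cderiv (v i) x (\sum_j sysmx z2 e z i j x * v j x),
      forall i x, v i (x + X) = expi e * rotf (fun j => v j x) i &
      forall i, v i 0 = y i 0].
Proof.
move=> he Dz y yX; have [M M0 hM] := sysmx_bound he Dz.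
have A i j := A_bcont i j.
have [||v [v_0 Dv]] := @code_exists R 'I_4 (sysmx z2 e z) (fun _ _ => 0) (fun i => y i 0) M M0 _ _ hM.
- move=> i j; have [[c1 _] [c2 _] [c3 _]] := A i j.
  apply: ccontinuousD; last by apply: ccontinuous_scale.
  by apply: ccontinuousD; [exact: ccontinuous_real|exact: ccontinuous_scale].
- by move=> i; split=> /=; exact: continuous_fcst.
have {}Dv i (x : R) : cderiv (v i) x (\sum_j sysmx z2 e z i j x * v j x).
  by apply: cderiv_eq (Dv i x) _; rewrite addr0.
have Dy i (x : R) : 0 <= x <= X -> cderiv (y i) x (\sum_j sysmx z2 e z i j x * y j x).
  move=> hx; rewrite /y.
  have := cderiv_sum (index_enum 'I_4) (fun a => cderivM (cderiv_cst (c0 a) x) (bloch_ode a i he Dz hx)).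
  move/cderiv_eq; apply; under [RHS]eq_bigr do rewrite mulr_sumr.
  rewrite exchange_big; apply: eq_bigr => a _; rewrite mul0r add0r mulr_sumr.
  by apply: eq_bigr => j _; rewrite mulrCA.
have vy i : v i X = y i X.
  have [G G0 hG] := cgronwall 'I_4 M0 X0.
  suff : normc (v i X - y i X) <= G * 0.
    rewrite mulr0 => h; apply/eqP; rewrite -subr_eq0; apply/eqP/eq0_normc.
    by apply/le_anti; rewrite h normc_ge0.
  apply: (hG (sysmx z2 e z) (fun i x => v i x - y i x) (fun _ _ => 0) 0) => //.
  - by move=> j; rewrite v_0 subrr.
  - move=> j x hx; apply: (cderiv_eq (cderivB (Dv j x) (Dy j x hx))).
    by rewrite addr0 -sumrB; apply: eq_bigr => k _; rewrite mulrBr.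
  - by move=> j x _; rewrite normc0.
  - by rewrite lexx ltW.
exists v; split=> // i x.
pose u i x := v i (x + X) - expi e * rotf (fun j => v j x) i.
suff : u i x = 0 by move/eqP; rewrite subr_eq0 => /eqP.
apply: (@code_unique R 'I_4 (fun i j x => sysmx z2 e z i j (x + X)) M u M0) => //.
- move=> j; rewrite /u add0r vy (_ : y j X = rotf (unrot (fun k => y k X)) j); last by rewrite rotfK.
  rewrite (_ : rotf (unrot _) j = rotf (fun k => expi e * y k 0) j); last first.
    by congr (rotf _ j); apply: funext => k; rewrite yX.
  rewrite (_ : rotf (fun k => v k 0) j = rotf (fun k => y k 0) j); last first.
    by congr (rotf _ j); apply: funext => k; rewrite v_0.
  rewrite /rotf; case: j => -[|[|[|[|//]]]] h; rewrite /st4 /fst4 /snd4 /rot /=; ring.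
- move=> j t.
  have Ds : is_derive t (1 : R) (fun t => t + X) 1.
    by have := is_derive_fD (is_derive_id t (1 : R)) (is_derive_fcst X t (1 : R)); rewrite addr0.
  have D1 := @cderiv_comp R (v j) (fun t => t + X) t _ 1 (Dv j (t + X)) Ds.
  have D2 := cderivM (cderiv_cst (expi e) t) (rotf_cderiv (fun=> 0) j (Dv ^~ t)).
  apply: (cderiv_eq (cderivB D1 D2)).
  rewrite rmorph1 mulr1 mul0r add0r -sysmx_rot mulr_sumr -sumrB.
  by apply: eq_bigr => k _; rewrite /u mulrBr mulrCA.
Qed.

(** The initial data of the four ansatz solutions degenerate as e tends to 0, because two of the
    modes [v0] are zero, so independence is shown at each small e. The last two coordinates give c0
    2 = m c0 1 and c0 3 = m c0 0 exactly; the first two then bound the remaining coefficients by a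
    small multiple of themselves. *)
Lemma bloch_nontrivial : exists2 e0 : R, 0 < e0 & forall (e : R) z (c0 : 'I_4 -> C),
  0 < e <= 1 -> e < e0 -> D z ->
  (forall i, \sum_a c0 a * bloch a e z i 0 = 0) -> forall a, c0 a = 0.
Proof.
pose H := \sum_a \sum_r normc (hcol a r 0); pose B' := `|B|.
(* Contraction constant: B' bounds z, H the vectors [hcol], 1 + |m| accounts for the two eliminated
   coefficients and 2 for the two remaining ones. *)
pose L := 2 * (B' * (H * (1 + `|m|))).
have H0 : 0 <= H by apply: sumr_ge0 => a _; apply: sumr_ge0 => r _; exact: normc_ge0.
have hH a r : normc (hcol a r 0) <= H.
  rewrite /H (bigD1 a)//= (bigD1 r)//= -addrA lerDl addr_ge0//.
    by apply: sumr_ge0 => *; exact: normc_ge0.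
  by do 2 apply: sumr_ge0 => ? _; exact: normc_ge0.
have B'0 : 0 <= B' := normr_ge0 _.
have L0 : 0 <= L by rewrite /L; do 3 (apply: mulr_ge0 => //); rewrite addr_ge0.
exists (1 + L)^-1; first by rewrite invr_gt0; lra.
move=> e z c0 he ee0 Dz hy.
have e_gt0 : 0 < e by case/andP: he.
have en : (e%:C : C) != 0 by rewrite fmorph_eq0 gt_eqF.
have zn := D_neq0 Dz.
have G0 r : \sum_a c0 a * ((a < 2)%N%:R * (r == a)%:R + e%:C * z * hcol a r 0) = 0.
  have E : GC *m \sum_a c0 a *: (\col_i bloch a e z i 0) = 0.
    rewrite (_ : \sum_a _ = 0) ?mulmx0//; apply/colP => i; rewrite summxE mxE -[RHS](hy i).
    by apply: eq_bigr => a _; rewrite !mxE.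
  have := congr1 (fun M : 'cV_4 => M r 0) E; rewrite mulmx_sumr summxE mxE => h0; rewrite -[RHS]h0.
  apply: eq_bigr => a _; rewrite -scalemxAr [RHS]mxE; congr (_ * _).
  have -> : \col_i bloch a e z i 0 = (a < 2)%N%:R *: (\col_i (fcol a i)%:C) + (e%:C * z) *: \col_i Qc a i 0.
    apply/colP => i; rewrite !mxE /bloch q_0// mulr0 addr0; congr (_ + _).
    rewrite /v0c /fcol /fpair /v0.
    by case: (ord4P a) => ->; case: (ord4P i) => -> /=; rewrite ?mul1r ?mul0r.
  by rewrite mulmxDr -!scalemxAr GC_fcol !mxE eqxx andbT.
have ezn : e%:C * z != 0 by rewrite mulf_neq0.
have c2 : c0 2 = m%:C * c0 1.
  have := G0 2; rewrite big_ord4 !hcol2 /= !(rmorphD, rmorphN, rmorphM, rmorph1, rmorph0) => h.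
  apply: (mulfI ezn); apply/eqP; rewrite -subr_eq0 -[X in _ == X]h; apply/eqP; ring.
have c3 : c0 3 = m%:C * c0 0.
  have := G0 3; rewrite big_ord4 !hcol3 /= !(rmorphD, rmorphN, rmorphM, rmorph1, rmorph0) => h.
  apply: (mulfI ezn); apply/eqP; rewrite -subr_eq0 -[X in _ == X]h; apply/eqP; ring.
pose N := normc (c0 0) + normc (c0 1).
have N0 : 0 <= N by rewrite addr_ge0 ?normc_ge0.
have bnd (r : 'I_4) : (r < 2)%N -> normc (c0 r) <= e * (B' * (H * ((1 + `|m|) * N))).
  move=> r2.
  have -> : c0 r = - (e%:C * z * (c0 0 * (hcol 0 r 0 + m%:C * hcol 3 r 0)
      + c0 1 * (hcol 1 r 0 + m%:C * hcol 2 r 0))).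
    have := G0 r; rewrite big_ord4 c2 c3.
    case: (ord4P r) r2 => -> // _; rewrite /= !mul0r !mul1r !add0r => h;
      apply/eqP; rewrite -subr_eq0 opprK -[X in _ == X]h; apply/eqP; ring.
  have A a b : normc (hcol a r 0 + m%:C * hcol b r 0) <= H * (1 + `|m|).
    apply: le_trans (le_normcD _ _) _; rewrite mulrDr mulr1; apply: lerD => //.
    by rewrite normcM normc_real mulrC ler_wpM2r.
  rewrite normcN !normcM normc_real ger0_norm ?(ltW e_gt0)// -mulrA ler_wpM2l ?(ltW e_gt0)//.
  apply: ler_pM; rewrite ?normc_ge0//.
    by apply: le_trans (DB Dz) _; exact: ler_norm.
  apply: le_trans (le_normcD _ _) _; rewrite /N [X in _ <= X]mulrA [X in _ <= X]mulrDr; apply: lerD;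
    by rewrite normcM mulrC ler_wpM2r ?normc_ge0.
have NL : N <= e * L * N.
  have := lerD (bnd 0 isT) (bnd 1 isT); rewrite -/N => h.
  by apply: le_trans h _; rewrite le_eqVlt /L; apply/orP; left; apply/eqP; ring.
have eL : e * L < 1.
  have h : e * (1 + L) < 1 by rewrite -ltr_pdivlMr ?div1r//; lra.
  by lra.
have NN : N = 0.
  apply/le_anti; rewrite N0 andbT leNgt; apply/negP => Np.
  have : e * L * N < 1 * N by rewrite ltr_pM2r.
  by rewrite mul1r ltNge NL.
have [z0 z1] : c0 0 = 0 /\ c0 1 = 0.
  have a0 := normc_ge0 (c0 0); have a1 := normc_ge0 (c0 1); rewrite /N in NN.
  by split; apply: eq0_normc; lra.
by move=> a; case: (ord4P a) => ->; rewrite ?c2 ?c3 ?z0 ?z1 ?mulr0.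
Qed.

(** A null vector of the matrix combines the ansatz solutions into one without defect, since the row
    scalings do not vanish; [bloch_nontrivial] ensures that this combination is not zero. *)
Theorem bloch_solution : exists2 e0 : R, 0 < e0 & forall (e : R) z,
  0 < e <= 1 -> e < e0 -> D z -> \det (Mat e z) = 0 ->
  exists v : 'I_4 -> R -> C,
  [/\ forall i (x : R), cderiv (v i) x (\sum_j sysmx z2 e z i j x * v j x),
      forall i x, v i (x + X) = expi e * rotf (fun j => v j x) i &
      exists i, v i 0 != 0].
Proof.
have [e0 e00 he0] := bloch_nontrivial; exists e0 => // e z he ee0 Dz /eqP.
rewrite -det_tr => /det0P[c0 c0n c0M].
have e_gt0 : 0 < e by case/andP: he.
have en : (e%:C : C) != 0 by rewrite fmorph_eq0 gt_eqF.
have zn := D_neq0 Dz.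
have w0 : \sum_a c0 0 a *: defect a e z = 0.
  apply: GC_inj; rewrite mulmx_sumr; apply/colP => r; rewrite summxE mxE.
  have := congr1 (fun M : 'rV_4 => M 0 r) c0M; rewrite !mxE => h.
  have sn : scale4 e z r != 0 by rewrite /scale4; case: ifP => _; rewrite ?mulf_neq0// expf_neq0.
  apply: (mulIf (invr_neq0 sn)); rewrite mul0r -[RHS]h mulr_suml.
  by apply: eq_bigr => a _; rewrite -scalemxAr !mxE mulrA.
have yX i : unrot (fun j => \sum_a c0 0 a * bloch a e z j X) i =
    expi e * \sum_a c0 0 a * bloch a e z i 0.
  have := congr1 (fun M : 'cV_4 => M i 0) w0; rewrite summxE mxE => h.
  have -> : unrot (fun j => \sum_a c0 0 a * bloch a e z j X) i =
      \sum_a c0 0 a * unrot (fun j => bloch a e z j X) i.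
    elim: (index_enum 'I_4) => [|a s IH].
      rewrite big_nil -[RHS](mul0r (unrot (fun=> 0) i)) -unrotZ.
      by congr (unrot _ i); apply: funext => j; rewrite big_nil mul0r.
    rewrite big_cons -IH -unrotZ -unrotD; congr (unrot _ i).
    by apply: funext => j; rewrite big_cons.
  apply/eqP; rewrite -subr_eq0 -[X in _ == X]h mulr_sumr -sumrB; apply/eqP.
  by apply: eq_bigr => a _; rewrite !mxE mulrBr mulrCA.
have [v [Dv vX v_0]] := bloch_extend (c0 := fun a => c0 0 a) he Dz yX.
exists v; split=> //; apply: contrapT => nv; move/eqP: c0n; apply.
apply/rowP => a; rewrite mxE; apply: (he0 e z (fun a => c0 0 a) he ee0 Dz) => i.
by rewrite -v_0; apply/eqP; apply: contrapT => /negP h; apply: nv; exists i.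
Qed.

End Bloch.

(** The functions Q_a need not be bounded on the line, as their jump may accumulate from period to
    period. Freezing them outside [0, X] gives bounded sources and leaves the equation on the period
    unchanged. *)
Lemma bcont_clamp (f : R -> R) : continuous f -> bcont (fun x => f (Num.max 0 (Num.min x X))).
Proof.
move=> cf; split.
  move=> x; apply: continuous_comp; last exact: cf.
  apply: (@continuous_max R R (fun=> 0) (fun x => Num.min x X)); first exact: cvg_cst.
  by apply: (@continuous_min R R id (fun=> X)); [exact: cvg_id|exact: cvg_cst].
have [M _ hM] := continuous_bounded X0 cf; exists M => x; apply: hM.
by rewrite ger0_norm ?le_max ?lexx// ge_max (ltW X0)/= ge_min lexx orbT.
Qed.

(** The ansatz is hidden from here on. Only a scalar function h is kept, with its leading part and
    the meaning of its zeros. *)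
Theorem bloch_determinant (D : set C) (B mz z2 : R) :
  (forall z, D z -> normc z <= B) -> 0 < mz -> (forall z, D z -> mz <= normc z) ->
  exists2 h : R -> C -> C,
    congBL D h (fun _ z => \det (\matrix_(r, a) target z2 a r z)) &
    exists2 e0 : R, 0 < e0 & forall (e : R) z, 0 < e <= 1 -> e < e0 -> D z -> h e z = 0 ->
    exists v : 'I_4 -> R -> C,
    [/\ forall i (x : R), cderiv (v i) x (\sum_j sysmx z2 e z i j x * v j x),
        forall i x, v i (x + X) = expi e * rotf (fun j => v j x) i &
        exists i, v i 0 != 0].
Proof.
move=> DB mz0 Dm.
pose cl x : R := Num.max 0 (Num.min x X).
have clE (x : R) : 0 <= x <= X -> cl x = x.
  by move=> /andP[x0 xX]; rewrite /cl (min_idPl xX) (max_idPr x0).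
have cQ1 a : continuous (fun x => (Q a 0 x).1).
  by move=> x; exact: (@is_derive_continuous R _ (fun t => (Q a 1 t).1) x (DQ1 a 0 x)).
have cQ2 a : continuous (fun x => (Q a 0 x).2).
  by move=> x; exact: (@is_derive_continuous R _ (fun t => (Q a 1 t).2) x (DQ2 a 0 x)).
pose s0 a (i : 'I_4) x := st4 (0, 0) (z2 * (v0 a 0 x).1, z2 * (v0 a 0 x).2) i.
pose s1 a (i : 'I_4) x := st4 (0, 0) (z2 * (Q a 0 (cl x)).1, z2 * (Q a 0 (cl x)).2) i.
pose s2 a (i : 'I_4) x := st4 (0, 0) ((Q a 0 (cl x)).2 * (K0 x)^-1, - ((Q a 0 (cl x)).1 * (K0 x)^-1)) i.
have c0 : bcont (fun=> 0 : R) := bcont_cst 0.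
have kv := K0V_bcont.
have q1 a := bcont_clamp (cQ1 a); have q2 a := bcont_clamp (cQ2 a).
have bs0 a i : bcont (s0 a i).
  have [p01 p02] := P_bcont 0; have [p11 p12] := P_bcont 1.
  have [w1 w2] : bcont (fun x => (v0 a 0 x).1) /\ bcont (fun x => (v0 a 0 x).2).
    rewrite /v0; case: a => -[|[|[|[|//]]]] h; split => //=; exact: bcontN.
  by apply: bcont_st4 => //; apply: bcontM => //; exact: bcont_cst.
have bs1 a i : bcont (s1 a i).
  apply: bcont_st4 => //; apply: bcontM; [exact: bcont_cst|exact: q1|exact: bcont_cst|exact: q2].
have bs2 a i : bcont (s2 a i).
  apply: bcont_st4 => //; first by apply: bcontM; [exact: q2|exact: kv].
  by apply: bcontN; apply: bcontM; [exact: q1|exact: kv].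
have A i j := A_bcont i j.
have hq a := @fam_sol R 'I_4 A0 A1 A2 (s0 a) (s1 a) (s2 a)
  (fun i j => let: And3 x _ _ := A i j in x) (fun i j => let: And3 _ x _ := A i j in x)
  (fun i j => let: And3 _ _ x := A i j in x) (bs0 a) (bs1 a) (bs2 a) D B z2 X DB X0.
have [q {}hq] := choice hq.
have q_0 a (e : R) z i : 0 < e <= 1 -> D z -> q a e z i 0 = 0.
  by move=> he Dz; have [/(_ e z he Dz)[]] := hq a.
have q_ode a (e : R) z i (x : R) : 0 < e <= 1 -> D z -> 0 <= x <= X ->
  cderiv (q a e z i) x (\sum_j sysmx z2 e z i j x * q a e z j x + src z2 e z a i x).
  move=> he Dz hx; have [/(_ e z he Dz)[_ h] _] := hq a.
  apply: cderiv_eq (h i x) _; congr (_ + _).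
  rewrite /fam_src /s0 /s1 /s2 /src clE//.
  have kvE : ((K0 x)^-1)%:C = (K0 x)%:C^-1 :> C by rewrite fmorphV.
  case: i => -[|[|[|[|//]]]] h'; rewrite /st4 /= ?rmorph0 ?mulr0 ?addr0// ?(rmorphN, rmorphM) ?fmorphV.
    by [].
  by rewrite mulrN.
have q_BL a i : uBL D X (fun e z x => q a e z i x).
  by have [_ [M hM]] := hq a; exists M => e z z' x he Dz Dz' hx; exact: hM.
exists (fun e z => \det (Mat q e z)).
  apply: congBL_det => r a; have := Mat_cong DB mz0 Dm q_0 q_ode q_BL r a.
  congr (congBL _ _ _); apply: funext => e; apply: funext => z; by rewrite mxE.
exact: (bloch_solution DB mz0 Dm q_0 q_ode).
Qed.

End ProfileData.

(** * Persistence of unstable roots *)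

Section ComplexNewton.
Variable R : realType.
Local Notation C := R[i].

Lemma is_cvg_geometric_increments (a : nat -> R) (c q : R) : 0 <= q < 1 ->
  (forall n, `|a n.+1 - a n| <= c * q ^+ n) -> cvgn a.
Proof.
move=> /andP[q0 q1] ha.
have cs : cvgn (series (fun n => a n.+1 - a n)).
  apply: normed_cvg; apply: (@series_le_cvg R _ (geometric c q)) => // [n|n|].
  - by rewrite normr_ge0.
  - by apply: le_trans (ha n); exact: normr_ge0.
  by apply: is_cvg_geometric_series; rewrite ger0_norm.
have -> : a = (fun n => a 0 + series (fun n => a n.+1 - a n) n).
  by apply: funext => n; rewrite /series /= telescope_sumr// addrC subrK.
by apply: is_cvgD => //; exact: is_cvg_cst.
Qed.

(** Newton's iteration with the constant slope A: the first hypothesis makes z - f z / A a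
    contraction of factor 1/2, the second makes the first step at most r / 4, so the iterates stay
    within r / 2 of z0. *)
Lemma newton_root (f : C -> C) (z0 A : C) (r : R) : 0 < r -> A != 0 ->
  (forall z w, normc (z - z0) <= r -> normc (w - z0) <= r ->
     normc (f z - f w - A * (z - w)) <= 2^-1 * normc A * normc (z - w)) ->
  normc (f z0) <= 4^-1 * normc A * r ->
  exists2 z, normc (z - z0) <= r & f z = 0.
Proof.
move=> r0 A0 fL f0.
have nA : 0 < normc A by rewrite lt_neqAle normc_ge0 andbT eq_sym; apply: contraNneq A0 => /eq0_normc ->.
pose T z := z - f z / A.
have TL z w : normc (z - z0) <= r -> normc (w - z0) <= r ->
    normc (T z - T w) <= 2^-1 * normc (z - w).
  move=> hz hw; have -> : T z - T w = - ((f z - f w - A * (z - w)) / A) by rewrite /T; field.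
  rewrite normcN normcM normcV ler_pdivrMr// mulrAC; exact: fL.
pose u n := iter n T z0.
have z0r : normc (z0 - z0) <= r by rewrite subrr normc0 ltW.
have step0 : normc (u 1%N - u 0%N) <= 4^-1 * r.
  rewrite /u /= /T addrAC subrr add0r normcN normcM normcV ler_pdivrMr//.
  by rewrite mulrAC.
have hu n : normc (u n - z0) <= r /\ normc (u n.+1 - u n) <= 4^-1 * r * 2^-1 ^+ n.
  suff h m : (m <= n)%N -> normc (u m - z0) <= (1 - 2^-1 ^+ m) * (2^-1 * r) /\
      normc (u m.+1 - u m) <= 4^-1 * r * 2^-1 ^+ m.
    have [h1 h2] := h n (leqnn n); split=> //; apply: le_trans h1 _.
    have p0 : 0 <= 2^-1 ^+ n :> R by rewrite exprn_ge0 ?invr_ge0.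
    by nra.
  elim: m => [_|m IH mn].
    by rewrite expr0 mulr1 (subrr (1 : R)) mul0r [u 0%N - z0]subrr normc0.
  have [h1 h2] := IH (ltnW mn).
  have p0 : 0 <= 2^-1 ^+ m :> R by rewrite exprn_ge0 ?invr_ge0.
  have h3 : normc (u m.+1 - z0) <= (1 - 2^-1 ^+ m.+1) * (2^-1 * r).
    have -> : u m.+1 - z0 = (u m.+1 - u m) + (u m - z0) by ring.
    apply: le_trans (le_normcD _ _) _; apply: le_trans (lerD h2 h1) _.
    by rewrite exprS; nra.
  split=> //.
  have h1r : normc (u m - z0) <= r by apply: le_trans h1 _; nra.
  have h3r : normc (u m.+1 - z0) <= r.
    by apply: le_trans h3 _; rewrite exprS; nra.
  apply: le_trans (TL (u m.+1) (u m) h3r h1r) _.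
  by rewrite exprS; nra.
have q01 : 0 <= (2^-1 : R) < 1 by apply/andP; split; lra.
have cRe : cvgn (fun n => complex.Re (u n)).
  apply: (is_cvg_geometric_increments (c := 4^-1 * r) q01) => n; rewrite -ReN -ReD.
  by apply: le_trans (norm_Re_le _) _; have [_] := hu n.
have cIm : cvgn (fun n => complex.Im (u n)).
  apply: (is_cvg_geometric_increments (c := 4^-1 * r) q01) => n; rewrite -ImN -ImD.
  by apply: le_trans (norm_Im_le _) _; have [_] := hu n.
pose l := Complex (limn (fun n => complex.Re (u n))) (limn (fun n => complex.Im (u n))).
have cu (e : R) : 0 < e -> exists n, normc (u n - l) <= e /\ normc (u n.+1 - l) <= e.
  move=> e0; have e2 : 0 < 2^-1 * e by rewrite mulr_gt0 ?invr_gt0.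
  have /cvgrPdist_le/(_ _ e2)[n1 _ h1] := cRe.
  have /cvgrPdist_le/(_ _ e2)[n2 _ h2] := cIm.
  exists (maxn n1 n2); split; apply: le_trans (normc_le _) _; rewrite ReD ImD ReN ImN distrC [X in _ + X]distrC.
    by have := h1 _ (leq_maxl n1 n2); have := h2 _ (leq_maxr n1 n2); rewrite /l /=; lra.
  by have := h1 _ (leqW (leq_maxl n1 n2)); have := h2 _ (leqW (leq_maxr n1 n2)); rewrite /l /=; lra.
have lr : normc (l - z0) <= r.
  apply/ler_addgt0Pr => e e0; have [n [h1 _]] := cu e e0.
  have -> : l - z0 = (u n - z0) - (u n - l) by ring.
  by apply: le_trans (le_normcD _ _) _; rewrite normcN; have [h2 _] := hu n; lra.
exists l => //.
have Tl : T l = l.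
  apply/eqP; rewrite -subr_eq0; apply/eqP/eq0_normc/le_anti; rewrite normc_ge0 andbT.
  apply/ler_addgt0Pr => e e0; rewrite add0r.
  have e2 : 0 < 2^-1 * e by rewrite mulr_gt0 ?invr_gt0.
  have [n [h1 h2]] := cu _ e2; have [hn _] := hu n.
  have -> : T l - l = (T l - T (u n)) + (u n.+1 - l) by rewrite /u /=; ring.
  apply: le_trans (le_normcD _ _) _; have := TL l (u n) lr hn.
  by rewrite -[l - u n]opprB normcN; lra.
have : f l / A = 0 by have := Tl; rewrite /T => h; rewrite -[RHS](subrr l) -{3}h; ring.
by move/(congr1 ( *%R^~ A)); rewrite mul0r divfK.
Qed.

End ComplexNewton.

Section Roots.
Variable R : realType.
Local Notation C := R[i].
Local Notation "x %:C" := (real_complex R x) : ring_scope.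

Lemma expiX (t : R) n : expi t ^+ n = expi (t *+ n).
Proof.
elim: n => [|n IH]; first by rewrite expr0 mulr0n /expi cos0 sin0.
by rewrite exprS IH mulrS; apply: complex_eqP; rewrite /expi /= ?cosD// sinD addrC.
Qed.

Lemma real_root (x : R) n : (0 < n)%N -> 0 < x -> exists2 y : R, 0 < y & y ^+ n = x.
Proof.
move=> n0 x0; exists (x `^ n%:R^-1); first exact: powR_gt0.
rewrite -powR_mulrn ?powR_ge0// -powRrM mulVf ?powRr1 ?ltW//.
by rewrite pnatr_eq0 -lt0n.
Qed.

(** The argument of the root is - pi / r if x < 0 and - 2 pi / r if x > 0. The latter lies in (- pi,
    0) exactly when r >= 3, which is why r = 2 comes with a sign condition. *)
Lemma root_lower_half (x : R) r : (3 <= r)%N /\ x != 0 \/ r = 2%N /\ x < 0 ->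
  exists2 z : C, complex.Im z < 0 & z ^+ r = x%:C.
Proof.
move=> hr; have x0 : x != 0 by case: hr => [[]//|[_ x0]]; rewrite lt_eqF.
have r2 : (2 <= r)%N by case: hr => [[/ltnW//]|[-> _]].
have rp : 0 < r%:R :> R by rewrite ltr0n (leq_trans _ r2).
have [y y0 yr] : exists2 y : R, 0 < y & y ^+ r = `|x|.
  by apply: real_root; rewrite ?normr_gt0// (leq_trans _ r2).
have main (k t : R) : k * `|x| = x -> 0 < t -> t < pi -> expi (- t *+ r) = k%:C ->
    exists2 z : C, complex.Im z < 0 & z ^+ r = x%:C.
  move=> kx t0 tp Ek; exists (y%:C * expi (- t)).
    by rewrite ImM /= mul0r addr0 sinN mulrN oppr_lt0 mulr_gt0// sin_gt0_pi// t0 tp.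
  by rewrite exprMn expiX Ek -rmorphXn yr mulrC -rmorphM kx.
have [xn|xp] := ltP x 0.
  apply: (main (-1) (pi / r%:R)).
  - by rewrite ltr0_norm// mulN1r opprK.
  - by rewrite divr_gt0 ?pi_gt0.
  - rewrite ltr_pdivrMr// ltr_pMr ?pi_gt0// ltr1n; exact: r2.
  - rewrite -[- _ *+ r]mulr_natr mulNr divfK ?gt_eqF//; apply: complex_eqP; rewrite /expi /=.
      by rewrite cosN cospi.
    by rewrite sinN sinpi oppr0.
have {}xp : 0 < x by rewrite lt_neqAle eq_sym x0.
have r3 : (3 <= r)%N by case: hr => [[//]|[_]]; rewrite ltNge (ltW xp).
apply: (main 1 (pi *+ 2 / r%:R)).
- by rewrite mul1r gtr0_norm.
- by rewrite divr_gt0// pmulrn_lgt0 ?pi_gt0.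
- by rewrite ltr_pdivrMr// -[pi *+ 2]mulr_natr ltr_pM2l ?pi_gt0// ltr_nat.
- rewrite -[- _ *+ r]mulr_natr mulNr divfK ?gt_eqF//; apply: complex_eqP; rewrite /expi /=.
    by rewrite cosN cos2pi.
  by rewrite sinN sin2pi oppr0.
Qed.

(** A quantitative derivative of the power: on a disc of radius d around z0, the tangent map at z0
    approximates increments up to a Lipschitz constant of order d. *)
Lemma linearize_power (z0 : C) r : exists2 K : R, 0 <= K & forall (d : R) z w,
  d <= 1 -> normc (z - z0) <= d -> normc (w - z0) <= d ->
  normc (z ^+ r - w ^+ r - r%:R * z0 ^+ r.-1 * (z - w)) <= K * d * normc (z - w).
Proof.
elim: r => [|r [K K0 IH]].
  exists 0 => // d z w _ _ _; rewrite !expr0 subrr !mul0r subr0 normc0; lra.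
pose L := normc (r%:R * z0 ^+ r.-1); have L0 : 0 <= L := normc_ge0 _.
pose Z := normc z0 + 1; have Z0 : 0 <= normc z0 := normc_ge0 _.
exists (Z * K + L + (K + L)).
  by rewrite !addr_ge0// mulr_ge0 ?addr_ge0.
move=> d z w d1 hz hw.
have d0 : 0 <= d by apply: le_trans hz; exact: normc_ge0.
have hz0 : normc (z0 - z0) <= d by rewrite subrr normc0.
have U0 : 0 <= normc (z - w) := normc_ge0 _.
have -> : z ^+ r.+1 - w ^+ r.+1 - r.+1%:R * z0 ^+ r * (z - w) =
   z * (z ^+ r - w ^+ r - r%:R * z0 ^+ r.-1 * (z - w))
   + (z - z0) * (r%:R * z0 ^+ r.-1) * (z - w)
   + (w ^+ r - z0 ^+ r) * (z - w).
  have -> : r.+1%:R * z0 ^+ r = z0 * (r%:R * z0 ^+ r.-1) + z0 ^+ r :> C.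
    case: (r) => [|s]; first by rewrite !expr0 mul0r mulr0 add0r mulr1.
    by rewrite /= exprS -natr1; ring.
  by rewrite !exprS; ring.
have nz : normc z <= Z.
  have -> : z = z0 + (z - z0) by ring.
  apply: le_trans (le_normcD _ _) _; rewrite /Z; lra.
have hwr : normc (w ^+ r - z0 ^+ r) <= (K + L) * d.
  have -> : w ^+ r - z0 ^+ r = (w ^+ r - z0 ^+ r - r%:R * z0 ^+ r.-1 * (w - z0))
     + r%:R * z0 ^+ r.-1 * (w - z0) by ring.
  apply: le_trans (le_normcD _ _) _; rewrite normcM -/L.
  have h := IH d w z0 d1 hw hz0; have w0 : 0 <= normc (w - z0) := normc_ge0 _.
  have k1 : K * d * normc (w - z0) <= K * d * 1 by rewrite ler_wpM2l ?mulr_ge0// (le_trans hw).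
  have k2 : L * normc (w - z0) <= L * d by rewrite ler_wpM2l.
  by lra.
have t1 : normc (z * (z ^+ r - w ^+ r - r%:R * z0 ^+ r.-1 * (z - w))) <= Z * (K * d * normc (z - w)).
  by rewrite normcM; apply: ler_pM; rewrite ?normc_ge0// IH.
have t2 : normc ((z - z0) * (r%:R * z0 ^+ r.-1) * (z - w)) <= d * L * normc (z - w).
  by rewrite normcM ler_wpM2r// normcM ler_wpM2r.
have t3 : normc ((w ^+ r - z0 ^+ r) * (z - w)) <= (K + L) * d * normc (z - w).
  by rewrite normcM ler_wpM2r.
apply: le_trans (le_normcD _ _) _; apply: le_trans (lerD (le_normcD _ _) t3) _.
by have := lerD t1 t2; move: (normc (z - w)) => u; lra.
Qed.

Lemma horner_cong (D : set C) (B : R) (DB : forall z, D z -> normc z <= B)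
  (p : {poly R}) (w : R) :
  congBL D (fun e z => (map_poly (real_complex R) p).[w%:C + e%:C * z]) (fun _ _ => p.[w]%:C).
Proof.
elim/poly_ind: p => [|p k IH].
  rewrite rmorph0 (_ : (fun e => _) = (fun _ _ => 0)); last first.
    by apply: funext => e; apply: funext => z; rewrite horner0.
  by rewrite horner0 rmorph0; exact/congBL_refl/BL_cst.
have cX := congBL_small (BL_cst D w%:C) (BL_id DB).
have := congBLD (congBLM IH cX) (congBL_refl (BL_cst D k%:C)).
congr (congBL _ _ _); apply: funext => e; apply: funext => z.
  by rewrite rmorphD rmorphM /= map_polyX map_polyC hornerD hornerMX hornerC.
by rewrite hornerD hornerMX hornerC rmorphD rmorphM.
Qed.

(** The order of choices matters: d and rho depend only on the leading problem, p lives on the disc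
    of radius d, and the range of e comes after p. The bounds on d and rho keep Im z negative and w
    + rho z away from 0. *)
Lemma persistent_root (h q1 : {poly R}) (q2 w : R) (r : nat) (z0 : C) :
  w != 0 -> (0 < r)%N -> h.[w] != 0 -> q1.[w] != 0 -> h.[w]%:C * z0 ^+ r = q1.[w]%:C ->
  complex.Im z0 < 0 ->
  let Phi (rho : R) (z : C) := z ^+ r * (map_poly (real_complex R) h).[w%:C + rho%:C * z]
    - (map_poly (real_complex R) q1).[w%:C + rho%:C * z] + (rho ^+ r * q2)%:C in
  exists rho d : R, [/\ 0 < rho <= 1, 0 < d,
    rho * (normc z0 + d) <= 2^-1 * `|w|, d < - complex.Im z0 &
    forall p, BL [set z | normc (z - z0) <= d] p -> exists2 e1 : R, 0 < e1 &
      forall e : R, 0 < e <= 1 -> e <= e1 ->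
      exists2 z, normc (z - z0) <= d & Phi rho z + e%:C * p e z = 0].
Proof.
move=> w0 r0 a0 N0 az0 Im0 Phi.
have z00 : z0 != 0 by apply: contraTneq Im0 => ->; rewrite /= ltxx.
pose a := h.[w]; pose A : C := a%:C * (r%:R * z0 ^+ r.-1).
have A0 : A != 0.
  by rewrite /A !mulf_neq0 ?expf_neq0// ?fmorph_eq0// pnatr_eq0 -lt0n.
have nA : 0 < normc A by rewrite lt_neqAle normc_ge0 andbT eq_sym; apply: contraNneq A0 => /eq0_normc ->.
have [K K0 hK] := linearize_power z0 r.
(* The last term limits the error of linearizing the power to |A| / 8. Below, rho and e limit their
   contributions to |A| d / 8 each. Newton's method tolerates a Lipschitz defect |A| / 2 and an
   initial value |A| d / 4. *)
pose d := Num.min (Num.min 1 (- complex.Im z0 / 2)) (normc A / (8 * (`|a| * K + 1))).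
have aK0 : 0 <= `|a| * K by rewrite mulr_ge0.
have d0 : 0 < d.
  by rewrite !lt_min ltr01 !divr_gt0 ?oppr_gt0//; apply: mulr_gt0 => //; lra.
have d1 : d <= 1 by rewrite !ge_min lexx.
have dI : d < - complex.Im z0.
  apply: (@le_lt_trans _ _ (- complex.Im z0 / 2)); first by rewrite !ge_min lexx orbT.
  by lra.
have dA : `|a| * K * d <= 8^-1 * normc A.
  have : d <= normc A / (8 * (`|a| * K + 1)) by rewrite !ge_min lexx !orbT.
  by rewrite ler_pdivlMr; [nra|lra].
pose D := [set z : C | normc (z - z0) <= d].
have DB z : D z -> normc z <= normc z0 + d.
  move=> Dz; have -> : z = z0 + (z - z0) by ring.
  exact: le_trans (le_normcD _ _) (lerD (lexx _) Dz).
have bz := BL_id DB.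
have bX n : BL D (fun _ z => z ^+ n).
  elim: n => [|n IH]; first exact: BL_cst.
  by under eq_fun do under eq_fun do rewrite exprS; exact: BLM.
have bre n : BL D (fun rho _ => (rho ^+ n)%:C).
  elim: n => [|n IH]; first by under eq_fun do under eq_fun do rewrite expr0; exact: BL_cst.
  by under eq_fun do under eq_fun do rewrite exprS rmorphM; apply: BLM => //; exact: BL_real.
have [_ [psi [M hM] Epsi]] : congBL D Phi (fun _ z => z ^+ r * a%:C - q1.[w]%:C).
  have c1 := congBLM (congBL_refl (bX r)) (horner_cong DB h w).
  have c2 := congBLM (congBL_refl (BL_cst D (-1))) (horner_cong DB q1 w).
  have c3 := congBL_small (BL_cst D 0) (BLM (bre r.-1) (BL_cst D q2%:C)).
  have := congBLD (congBLD c1 c2) c3.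
  congr (congBL _ _ _); apply: funext => rho; apply: funext => z; rewrite mulN1r.
    by rewrite /Phi add0r; congr (_ + _); rewrite -!rmorphM mulrA -exprS prednK.
  by rewrite addr0.
pose M1 := `|M| + 1; have M10 : 0 < M1 by rewrite /M1; have := normr_ge0 M; lra.
have wn : 0 < `|w| by rewrite normr_gt0.
have z0n := normc_ge0 z0.
pose rho := Num.min (Num.min 1 (normc A * d / (8 * M1))) (2^-1 * `|w| / (normc z0 + d)).
have rho0 : 0 < rho.
  rewrite !lt_min ltr01 /=; apply/andP; split; apply: divr_gt0; rewrite ?mulr_gt0 ?invr_gt0//.
  by lra.
have rho1 : rho <= 1 by rewrite !ge_min lexx.
have rhoM : rho * M1 <= 8^-1 * (normc A * d).
  have : rho <= normc A * d / (8 * M1) by rewrite !ge_min lexx !orbT.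
  by rewrite ler_pdivlMr; [lra|rewrite mulr_gt0].
have Adl : normc A * d <= normc A by rewrite ler_piMr// ltW.
exists rho, d; split=> //; first by rewrite rho0 rho1.
  have : rho <= 2^-1 * `|w| / (normc z0 + d) by rewrite !ge_min lexx !orbT.
  by rewrite ler_pdivlMr//; lra.
move=> p [M' hM']; pose M1' := `|M'| + 1.
have M10' : 0 < M1' by rewrite /M1'; have := normr_ge0 M'; lra.
exists (normc A * d / (8 * M1')); first by rewrite divr_gt0 ?mulr_gt0.
move=> e he ee; have e0 : 0 < e by case/andP: he.
have eM : e * M1' <= 8^-1 * (normc A * d).
  by move: ee; rewrite ler_pdivlMr; [lra|rewrite mulr_gt0].
have hr : 0 < rho <= 1 by rewrite rho0 rho1.
have nr (x : R) : 0 < x -> normc (x%:C : C) = x by move=> x0; rewrite normc_real gtr0_norm.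
have MM : M <= M1 by rewrite /M1; have := ler_norm M; lra.
have MM' : M' <= M1' by rewrite /M1'; have := ler_norm M'; lra.
apply: (newton_root d0 A0 (f := fun z => Phi rho z + e%:C * p e z)).
- move=> z v hz hv; have U0 := normc_ge0 (z - v).
  rewrite !Epsi//.
  have -> : z ^+ r * a%:C - q1.[w]%:C + rho%:C * psi rho z + e%:C * p e z -
     (v ^+ r * a%:C - q1.[w]%:C + rho%:C * psi rho v + e%:C * p e v) - A * (z - v) =
     a%:C * (z ^+ r - v ^+ r - r%:R * z0 ^+ r.-1 * (z - v))
     + rho%:C * (psi rho z - psi rho v) + e%:C * (p e z - p e v).
    by rewrite /A; ring.
  have t1 : normc (a%:C * (z ^+ r - v ^+ r - r%:R * z0 ^+ r.-1 * (z - v))) <= 8^-1 * normc A * normc (z - v).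
    rewrite normcM normc_real; apply: (@le_trans _ _ (`|a| * (K * d * normc (z - v)))).
      by rewrite ler_wpM2l// hK.
    by rewrite !mulrA ler_wpM2r.
  have t2 : normc (rho%:C * (psi rho z - psi rho v)) <= 8^-1 * normc A * normc (z - v).
    rewrite normcM nr//; have [_ h2] := hM rho z v hr hz hv.
    apply: (@le_trans _ _ (rho * (M1 * normc (z - v)))).
      by rewrite ler_wpM2l ?(ltW rho0)//; apply: le_trans h2 _; rewrite ler_wpM2r.
    by rewrite mulrA ler_wpM2r//; lra.
  have t3 : normc (e%:C * (p e z - p e v)) <= 8^-1 * normc A * normc (z - v).
    rewrite normcM nr//; have [_ h2] := hM' e z v he hz hv.
    apply: (@le_trans _ _ (e * (M1' * normc (z - v)))).
      by rewrite ler_wpM2l ?(ltW e0)//; apply: le_trans h2 _; rewrite ler_wpM2r.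
    by rewrite mulrA ler_wpM2r//; lra.
  apply: le_trans (le_normcD _ _) _; apply: le_trans (lerD (le_normcD _ _) t3) _.
  by have := lerD t1 t2; have := mulr_ge0 (ltW nA) U0; lra.
- have Dz0 : D z0 by rewrite /D /= subrr normc0 ltW.
  rewrite Epsi// [z0 ^+ r * _]mulrC az0 subrr add0r.
  apply: le_trans (le_normcD _ _) _.
  rewrite [normc (rho%:C * _)]normcM [normc (e%:C * _)]normcM (nr rho)// (nr e)//.
  have [p1 _] := hM rho z0 z0 hr Dz0 Dz0; have [p2 _] := hM' e z0 z0 he Dz0 Dz0.
  have t1 : rho * normc (psi rho z0) <= rho * M1.
    by rewrite ler_wpM2l ?(ltW rho0)// (le_trans p1).
  have t2 : e * normc (p e z0) <= e * M1' by rewrite ler_wpM2l ?(ltW e0)// (le_trans p2).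
  by lra.
Qed.

End Roots.

Section CharacteristicPolynomial.
Variable R : realType.
Local Notation C := R[i].
Local Notation "x %:C" := (real_complex R x) : ring_scope.

Lemma poly_eq_seq (p q : {poly R}) (f : nat -> R) : injective f ->
  (forall n, p.[f n] = q.[f n]) -> p = q.
Proof.
move=> fi E; apply/eqP; rewrite -subr_eq0; apply/eqP.
apply: (@roots_geq_poly_eq0 _ _ [seq f n | n <- iota 0 (size (p - q)%R)]).
- by apply/allP => x /mapP[n _ ->]; rewrite rootE hornerD hornerN E subrr.
- by rewrite map_inj_uniq// iota_uniq.
- by rewrite size_map size_iota.
Qed.

Lemma horner_comb (T : comNzRingType) (a b : {poly T}) (c t x : T) :
  (a + t *: b + c%:P).[x] = a.[x] + t * b.[x] + c.
Proof. by rewrite !hornerD hornerZ hornerC. Qed.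

Lemma map_comb (a b : {poly R}) (e t : R) (mu : C) :
  (map_poly (real_complex R) ('X^4 * (a + t *: b + e%:P))).[mu] =
  mu ^+ 4 * ((map_poly (real_complex R) a).[mu]
    + t%:C * (map_poly (real_complex R) b).[mu] + e%:C).
Proof.
rewrite rmorphM !(rmorphD (map_poly _)) /= map_polyZ map_polyC map_polyXn.
by rewrite hornerM hornerXn horner_comb.
Qed.

Lemma horner_det (T : comNzRingType) n (M : 'M[{poly T}]_n) (x : T) :
  (\det M).[x] = \det (\matrix_(i, j) (M i j).[x]).
Proof.
rewrite -[LHS]/(horner_eval x (\det M)) -det_map_mx; congr (\det _).
by apply/matrixP => i j; rewrite !mxE.
Qed.

Variables (St Sy : 'M[R]_4) (delta : nat -> nat -> nat -> R).
Hypothesis hdelta : Delta0_coefficients St Sy delta.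

(** [d0] and [d1] are the coefficients of zeta^0 and zeta^2 in Delta_0 (lambda, 1, zeta), as
    polynomials in lambda. At omega0, [d1] is the expression in the hypotheses. *)
Definition d0 : {poly R} := \poly_(m < 5) delta m (4 - m) 0.
Definition d1 : {poly R} :=
  (delta 1 2 1)%:P + delta 2 1 1 *: 'X + delta 3 0 1 *: 'X^2.

Lemma Delta0E l z : Delta0 delta l 1 z =
  d0.[l] + z ^+ 2 * d1.[l] + z ^+ 4 * delta 2 0 2.
Proof.
have S5 (F : nat -> R) : \sum_(i < 5) F i = F 0 + F 1 + F 2 + F 3 + F 4.
  by rewrite !big_ord_recr big_ord0 /= add0r.
pose T m k p := if (m + k + p == 4)%N && (p <= m)%N
  then delta m k p * l ^+ (m - p) * 1 ^+ k * z ^+ (2 * p) else 0.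
pose H m k := \sum_(p < 5) T m k p; pose G m := \sum_(k < 5) H m k.
rewrite /d0 /d1 horner_poly (S5 (fun m => delta m (4 - m) 0 * l ^+ m)) !hornerE.
transitivity (\sum_(m < 5) G m).
  by apply: eq_bigr => m _; apply: eq_bigr => k _; rewrite big_mkcond.
rewrite S5 /G !(S5 (H _)) /H !(S5 (T _ _)) /T /= !expr1n !subn0 !subnn; ring.
Qed.

(** The defining identity covers t = zeta^2 >= 0. Both sides are polynomials in t, so it extends to
    negative t, the values produced by z = i mu. *)
Lemma det_real (mu t : R) : mu != 0 ->
  \det (mu *: St - 1%:M + (t / mu) *: Sy) = d0.[mu] + t * d1.[mu] + t ^+ 2 * delta 2 0 2.
Proof.
move=> mu0.
pose M : 'M[{poly R}]_4 := \matrix_(i, j) (((mu *: St - 1%:M) i j)%:P + (mu^-1 * Sy i j) *: 'X).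
pose P : {poly R} := d0.[mu]%:P + d1.[mu] *: 'X + delta 2 0 2 *: 'X^2.
have hM s : (\det M).[s] = \det (mu *: St - 1%:M + (s / mu) *: Sy).
  rewrite horner_det; congr (\det _); apply/matrixP => i j; rewrite !mxE !hornerE.
  by congr (_ + _); rewrite mulrC mulrA.
have hP s : P.[s] = d0.[mu] + s * d1.[mu] + s ^+ 2 * delta 2 0 2.
  rewrite /P; move: d0.[mu] d1.[mu] (delta 2 0 2) => a b e.
  by rewrite !hornerD !hornerZ hornerC hornerX hornerXn; ring.
rewrite -hM -hP; congr (_.[_]).
apply: (@poly_eq_seq _ _ (fun n => n%:R)) => [m n|n]; first exact: (mulrIn (oner_neq0 R)).
rewrite hM hP; have n0 : 0 <= n%:R :> R by [].
rewrite -[n%:R]sqr_sqrtr// -[_ ^+ 2 ^+ 2]exprM hdelta// Delta0E; ring.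
Qed.

(** Multiplied by mu^4, both sides become polynomials in mu with real coefficients. They agree at
    the positive integers, hence as polynomials, hence at complex points. *)
Lemma det_complex (mu : C) (t : R) : mu != 0 ->
  \det (mu *: map_mx (real_complex R) St - 1%:M + (t%:C / mu) *: map_mx (real_complex R) Sy) =
  (map_poly (real_complex R) d0).[mu] + t%:C * (map_poly (real_complex R) d1).[mu]
  + t%:C ^+ 2 * (delta 2 0 2)%:C.
Proof.
move=> mu0.
pose M : 'M[{poly R}]_4 := \matrix_(i, j) (St i j *: 'X^2 - (i == j)%:R *: 'X + (t * Sy i j)%:P).
have hM s : s != 0 -> (\det M).[s] = s ^+ 4 * \det (s *: St - 1%:M + (t / s) *: Sy).
  move=> s0; rewrite horner_det -detZ; congr (\det _); apply/matrixP => i j.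
  by rewrite !mxE !hornerD hornerN !hornerZ hornerX hornerXn hornerC; field.
have E : \det M = 'X^4 * (d0 + t *: d1 + (t ^+ 2 * delta 2 0 2)%:P).
  apply: (@poly_eq_seq _ _ (fun n => n.+1%:R)) => [m n /(mulrIn (oner_neq0 R))[]//|n].
  by rewrite hM ?pnatr_eq0// det_real ?pnatr_eq0// hornerM hornerXn horner_comb.
have := congr1 (fun p => (map_poly (real_complex R) p).[mu]) E.
rewrite -[map_poly _ (\det M)]det_map_mx horner_det => H.
apply: (mulfI (expf_neq0 4 mu0)).
transitivity ((map_poly (real_complex R) ('X^4 * (d0 + t *: d1 + (t ^+ 2 * delta 2 0 2)%:P))).[mu]).
  rewrite -H -detZ; congr (\det _); apply/matrixP => i j; rewrite !mxE.
  transitivity (((St i j)%:C *: 'X^2 - (i == j)%:R *: 'X + (t%:C * (Sy i j)%:C)%:P).[mu]); last first.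
    congr (_.[_]); apply/esym; rewrite /= rmorphD rmorphB /= !map_polyZ map_polyC map_polyX map_polyXn.
    by rewrite /= -rmorphM -[(i == j)%:R in RHS](rmorph_nat (real_complex R)).
  rewrite hornerD hornerD hornerN !hornerZ hornerX hornerXn hornerC.
  by field.
by rewrite map_comb -rmorphXn -rmorphM.
Qed.

Hypothesis uSt : St \in unitmx.

(** At zeta = 0 the determinant is that of lambda Sigma_t - I; factoring Sigma_t out leaves the
    characteristic polynomial of its inverse. *)
Lemma d0_char_poly : d0 = \det St *: char_poly (invmx St).
Proof.
apply: (@poly_eq_seq _ _ (fun n => n.+1%:R)) => [m n /(mulrIn (oner_neq0 R))[]//|n].
set x := n.+1%:R; have x0 : x != 0 by rewrite pnatr_eq0.
have := det_real 0 x0; rewrite !mul0r scale0r addr0 expr0n mul0r !addr0 => <-.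
rewrite hornerZ /char_poly horner_det -det_mulmx; congr (\det _).
have -> : \matrix_(i, j) ((char_poly_mx (invmx St)) i j).[x] = x%:M - invmx St.
  by apply/matrixP => i j; rewrite !mxE hornerD hornerN hornerC hornerMn hornerX.
by rewrite mulmxBr mulmxV// mul_mx_scalar.
Qed.

Variables (w : R) (r0 : nat).
Hypothesis heig : eigenvalue (invmx St) w.
Hypothesis hmult : mup w (char_poly (invmx St)) = r0.

Lemma eigenvalue_invmx_neq0 : w != 0.
Proof.
apply/eqP => w0; have /eigenvalueP[v vA /eqP] := heig; apply.
by rewrite -[v](mulmxKV uSt) vA w0 scale0r mul0mx.
Qed.

Lemma d0_factor : exists2 h : {poly R}, h.[w] != 0 & d0 = h * ('X - w%:P) ^+ r0.
Proof.
have [m [q]] := multiplicity_XsubC (char_poly (invmx St)) w.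
rewrite monic_neq0 ?char_poly_monic//= => rq E.
have mr : m = r0 by rewrite -hmult E mupMr// mup_XsubCX eqxx.
exists (\det St *: q); last by rewrite d0_char_poly E mr scalerAl.
by rewrite hornerZ mulf_neq0// -?rootE// -unitfE -unitmxE.
Qed.

Local Notation N := (delta 1 2 1 + delta 2 1 1 * w + delta 3 0 1 * w ^+ 2).
Hypothesis hcase : ((3 <= r0)%N /\ N != 0) \/
   (r0 = 2%N /\
    N / ((r0`!)%:R^-1 * derive1n r0 (fun l : R => Delta0 delta l 1 0) w) < 0).

Lemma d1E : d1.[w] = N.
Proof. by rewrite /d1 !hornerD !hornerZ hornerC hornerX hornerXn. Qed.

(** By Taylor's formula at the double root; this identifies the denominator in the hypothesis for r0
    = 2 with the leading coefficient of the root problem. *)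
Lemma second_coefficient (h : {poly R}) : d0 = h * ('X - w%:P) ^+ 2 ->
  (2`!)%:R^-1 * derive1n 2 (fun l : R => Delta0 delta l 1 0) w = h.[w].
Proof.
move=> E.
have -> : (fun l : R => Delta0 delta l 1 0) = horner d0.
  by apply: funext => l; rewrite Delta0E expr0n /= !mul0r !addr0 expr0n mul0r addr0.
rewrite /derive1n /= -derivE -derivE E; set Y := 'X - w%:P.
have -> : (h * Y ^+ 2)^`()^`() = h^`()^`() * Y ^+ 2 + 4%:R *: (h^`() * Y) + 2%:R *: h.
  have : Y^`() = 1 by rewrite /Y derivB derivX derivC subr0.
  move: Y => Y Y'; rewrite expr2 !(derivM, derivD) Y' -[1]/1%:P derivC.
  rewrite -!mul_polyC !rmorph_nat; ring.
have Y0 : Y.[w] = 0 by rewrite /Y hornerD hornerX hornerN hornerC subrr.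
rewrite !hornerD !hornerZ !hornerM !Y0 !mulr0 !add0r.
by rewrite mulrA mulVf ?mul1r// pnatr_eq0.
Qed.

(** The set D of candidates is fixed before h is known, because the congruence satisfied by h is
    itself relative to D. *)
Lemma unstable_root : exists (z2 : R) (D : set C) (B mz : R),
  [/\ 0 <= z2, 0 < mz, forall z, D z -> normc z <= B, forall z, D z -> mz <= normc z &
      forall z, D z -> 0 < complex.Re z] /\
  forall h : R -> C -> C,
    congBL D h (fun _ z => \det (z *: map_mx (real_complex R) St
      + (z2%:C / z) *: map_mx (real_complex R) Sy - 'i%C%:M)) ->
  exists2 e1 : R, 0 < e1 & forall e : R, 0 < e <= 1 -> e <= e1 ->
    exists2 z, D z & h e z = 0.
Proof.
have [g gw Eg] := d0_factor; have w0 := eigenvalue_invmx_neq0.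
have r2 : (2 <= r0)%N by case: hcase => [[/ltnW//]|[-> _]].
have hx : (3 <= r0)%N /\ d1.[w] / g.[w] != 0 \/ r0 = 2%N /\ d1.[w] / g.[w] < 0.
  case: hcase => [[r3 N0]|[re hc]]; [left|right]; split=> //.
    by rewrite d1E mulf_neq0// invr_eq0.
  rewrite d1E; move: hc; rewrite re (@second_coefficient g)//.
  by rewrite Eg re.
have N0 : d1.[w] != 0.
  by apply/eqP => d10; case: hx; rewrite d10 mul0r ?eqxx ?ltxx => -[].
have [z0 Im0 z0r] := root_lower_half hx.
have az0 : g.[w]%:C * z0 ^+ r0 = d1.[w]%:C by rewrite z0r -rmorphM mulrC divfK.
have [rho [d [/andP[rho0 rho1] dp hrho dI root]]] :=
  persistent_root (delta 2 0 2) w0 (ltnW r2) gw N0 az0 Im0.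
(* The real part of i (w + rho v) is - rho Im v, positive on the disc around a root with negative
   imaginary part. *)
pose Lam (v : C) : C := 'i%C * (w%:C + rho%:C * v).
pose Dv := [set v : C | normc (v - z0) <= d].
have ni : normc ('i%C : C) = 1 by rewrite /= expr0n add0r expr1n sqrtr1.
have nrv v : Dv v -> normc (rho%:C * v) <= 2^-1 * `|w|.
  move=> Dv_v; apply: le_trans hrho; rewrite normcM normc_real gtr0_norm//.
  rewrite ler_wpM2l ?(ltW rho0)//; have -> : v = z0 + (v - z0) by ring.
  exact: le_trans (le_normcD _ _) (lerD (lexx _) Dv_v).
(* z2 = rho^r0 balances the factor (rho v)^r0 of [d0] at w + rho v. The modulus bounds |w| / 2 and 2
   |w| follow from |rho v| <= |w| / 2. *)
exists (rho ^+ r0), [set z | exists2 v, Dv v & z = Lam v], (2 * `|w|), (2^-1 * `|w|); split.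
  have wn : 0 < `|w| by rewrite normr_gt0.
  split.
  - by rewrite exprn_ge0// ltW.
  - by rewrite mulr_gt0 ?invr_gt0.
  - move=> _ [v hv ->]; rewrite /Lam normcM ni mul1r.
    apply: le_trans (le_normcD _ _) _; rewrite normc_real; have := nrv v hv; lra.
  - move=> _ [v hv ->]; rewrite /Lam normcM ni mul1r.
    have := le_normcD (w%:C + rho%:C * v) (- (rho%:C * v)); rewrite addrK normc_real normcN.
    by have := nrv v hv; lra.
  - move=> _ [v hv ->]; rewrite /Lam ReM ReD ImD ReM ImM /=.
    have : complex.Im v < 0.
      have := le_trans (norm_Im_le (v - z0)) hv; rewrite ImD ImN => /ler_normlP[_ h].
      by lra.
    by nra.
move=> h [_ [p bp Ep]].
have bpv : BL Dv (fun e v => p e (Lam v) * (rho ^- r0)%:C).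
  apply: BLM; last exact: BL_cst.
  have [M hM] := bp; exists M => e v v' he hv hv'.
  have [||m1 m2] := hM e (Lam v) (Lam v') he; [by exists v|by exists v'|].
  split=> //; apply: le_trans m2 _.
  have M0 : 0 <= M by apply: le_trans m1; exact: normc_ge0.
  rewrite ler_wpM2l//; have -> : Lam v - Lam v' = 'i%C * (rho%:C * (v - v')) by rewrite /Lam; ring.
  by rewrite !normcM ni mul1r normc_real gtr0_norm// ler_piMl// normc_ge0.
have [e1 e10 he1] := root _ bpv; exists e1 => // e he ee1.
have [v hv Ev] := he1 e he ee1; exists (Lam v); first by exists v.
rewrite Ep//; last by exists v.
set mu := w%:C + rho%:C * v.
have mu0 : mu != 0.
  apply/eqP => mu0; have := nrv v hv.
  have -> : rho%:C * v = - w%:C by apply/eqP; rewrite -addr_eq0 addrC -/mu mu0.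
  rewrite normcN normc_real => h1; have h2 : 0 < `|w| by rewrite normr_gt0.
  have h3 : 2^-1 * `|w| < 1 * `|w| by rewrite ltr_pM2r// invf_lt1// ltr1n.
  by move: (le_lt_trans h1 h3); rewrite mul1r ltxx.
have i2 : 'i%C * 'i%C = -1 :> C by apply: complex_eqP; rewrite /=; ring.
(* Factoring i out of the 4 x 4 matrix contributes i^4 = 1 and, since 1 / i = - i, turns z2 into -
   z2. *)
have -> : \det (Lam v *: map_mx (real_complex R) St
      + ((rho ^+ r0)%:C / Lam v) *: map_mx (real_complex R) Sy - 'i%C%:M) =
    \det (mu *: map_mx (real_complex R) St - 1%:M
      + ((- rho ^+ r0)%:C / mu) *: map_mx (real_complex R) Sy).
  have -> : Lam v *: map_mx (real_complex R) St
      + ((rho ^+ r0)%:C / Lam v) *: map_mx (real_complex R) Sy - 'i%C%:M =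
     'i%C *: (mu *: map_mx (real_complex R) St - 1%:M
      + ((- rho ^+ r0)%:C / mu) *: map_mx (real_complex R) Sy).
    have iV : 'i%C^-1 = - 'i%C :> C.
      by apply: complex_eqP; rewrite /= expr0n expr1n /= add0r divr1 ?mul0r ?oppr0.
    have -> : (rho ^+ r0)%:C / Lam v = 'i%C * ((- rho ^+ r0)%:C / mu).
      by rewrite /Lam -/mu invfM iV rmorphN; ring.
    apply/matrixP => i j; rewrite !mxE; case: (i == j); rewrite ?mulr1n ?mulr0n /Lam -/mu; ring.
  by rewrite detZ (_ : 'i%C ^+ 4 = 1 :> C) ?mul1r// (exprM _ 2 2) [X in X ^+ 2]expr2 i2 sqrrN expr1n.
rewrite det_complex// Eg.
have -> : (map_poly (real_complex R) (g * ('X - w%:P) ^+ r0)).[mu] =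
   rho%:C ^+ r0 * (v ^+ r0 * (map_poly (real_complex R) g).[mu]).
  rewrite rmorphM rmorphXn /= rmorphB /= map_polyX map_polyC hornerM horner_exp hornerD hornerN hornerX hornerC.
  by rewrite /mu [w%:C + _]addrC addrK exprMn; ring.
have rn : rho%:C ^+ r0 != 0 :> C by rewrite expf_neq0// fmorph_eq0 gt_eqF.
apply: (mulfI (invr_neq0 rn)); rewrite mulr0 -[RHS]Ev rmorphN rmorphXn -/mu.
have -> : (rho ^- r0)%:C = (rho%:C ^+ r0)^-1 :> C by rewrite fmorphV rmorphXn.
by rewrite rmorphM rmorphXn; field.
Qed.

End CharacteristicPolynomial.

(** * Existence of an unstable Bloch wave for the profile family *)

Section BlochWave.
Variables (R : realType) (n : nat) (kappa W g w : R -> R).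
Hypothesis sg : smooth_on setT g.
Hypothesis sw : smooth_on setT w.
Hypothesis kappaE : forall r, 0 <= r -> kappa r = g r.
Hypothesis WE : forall r, 0 <= r -> W r = w r.
Hypothesis kappa_pos : exists2 k0 : R, 0 < k0 & forall r : R, 0 <= r -> k0 <= kappa r.
Variables (O : set 'rV[R]_4) (V : 'rV[R]_4 -> R -> 'cV[R]_2).
Variables (X xi : 'rV[R]_4 -> R) (p0 : 'rV[R]_4).
Hypothesis fam : profile_family n kappa W O V X xi.
Hypothesis Op0 : O p0.
Local Notation C := R[i].
Local Notation "x %:C" := (real_complex R x) : ring_scope.
Local Notation rh := (rho V p0).
Local Notation P := (fun j => Vp V j p0).
Local Notation Q := (Vap V p0).

Lemma rho_shift x : rh (x + X p0) = rh x.
Proof.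
have [e0 e1] := Vx_shift fam 0 x Op0.
rewrite /rho e0 e1 /=; have cs := cos2Dsin2 (xi p0).
by rewrite -[RHS]mul1r -cs; ring.
Qed.

Lemma rho_ge0 x : 0 <= rh x.
Proof. by rewrite /rho addr_ge0 ?sqr_ge0. Qed.

Lemma rho_comp_derive (f f1 : R -> R) (x : R) :
  (forall t : R, is_derive t (1 : R) f (f1 t)) ->
  is_derive x (1 : R) (fun t => f (rh t)) (f1 (rh x) * (2 * vdot (P 0 x) (P 1 x))).
Proof.
by move=> Df; apply: (is_derive_rho (is_derive_Vx fam 0 0 x Op0) (is_derive_Vx fam 0 1 x Op0)).
Qed.

Lemma rho_comp_continuous (f : R -> R) k :
  smooth_on setT f -> continuous (fun x => rD f k (rh x)).
Proof.
move=> sf x; exact: (@is_derive_continuous R _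
  (fun x => rD f k.+1 (rh x) * (2 * vdot (P 0 x) (P 1 x))) x (rho_comp_derive x (is_derive_rD sf k))).
Qed.

(** Translation invariance: the profile equation is differentiated in x, with constant
    parameters. *)
Lemma Vx_hess x : hess (rD g 0 (rh x)) (rD g 1 (rh x)) (rD g 2 (rh x)) (rD w 1 (rh x))
  (rD w 2 (rh x)) (p0 0 0) (p0 0 1) (P 0 x) (P 1 x) (P 2 x) (P 1 x) (P 2 x) (P 3 x) = (0, 0).
Proof.
have D k i := is_derive_Vx fam k i x Op0.
have [D1 D2] := is_derive_prof (is_derive_rD sg 0) (is_derive_rD sg 1) (is_derive_rD sw 1)
  (D 0 0) (D 0 1) (D 1 0) (D 1 1) (D 2 0) (D 2 1)
  (is_derive_fcst (p0 0 0) x (1 : R)) (is_derive_fcst (p0 0 1) x (1 : R)).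
have E t := profile_ode sg sw kappaE WE fam t Op0.
rewrite [LHS]surjective_pairing; congr (_, _).
  have := is_derive_unique _ D1 (is_derive_fcst 0 x (1 : R)); rewrite !mul0r !subr0; apply=> t.
  by have := congr1 fst (E t).
have := is_derive_unique _ D2 (is_derive_fcst 0 x (1 : R)); rewrite !mul0r subr0 addr0; apply=> t.
by have := congr1 snd (E t).
Qed.

Lemma sigma_phi (S : R -> R) (f : R -> R) (u : R -> R) :
  (forall x : R, is_derive x (1 : R) S (f x)) -> continuous f -> (forall x, u x = f x) ->
  Rintegral lebesgue_measure `[0, X p0] u = S (X p0) - S 0.
Proof.
move=> DS cf uf; rewrite -(Rintegral_antiderivative (profile_X_pos fam Op0) cf DS).
by congr (Rintegral _ _ _); apply: funext.
Qed.

Lemma derive1_pair x : pair_of (derive1 (V p0) x) = P 1 x.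
Proof. by rewrite /pair_of !(derive1_V fam). Qed.

Lemma sqnorm_V x : sqnorm (V p0 x) = rh x.
Proof. by rewrite sqnormE. Qed.

(** The densities whose integrals over a period are sigma_1, sigma_2 and sigma_3. *)
Definition sdens (j : nat) x : R := rD g 0 (rh x) *
  match j with 0%N => vdot (P 0 x) (P 0 x) | 1%N => vdot (vJ (P 0 x)) (P 1 x)
     | _ => vdot (P 1 x) (P 1 x) end.
Local Notation S j := (antider (sdens j)).

Lemma Vp_cont j i : continuous (fun x => Vx V j p0 i x).
Proof. exact: (Vx_continuous fam Op0). Qed.

Lemma vdot_cont (u v : R -> R * R) : continuous (fun x => (u x).1) -> continuous (fun x => (u x).2) ->
  continuous (fun x => (v x).1) -> continuous (fun x => (v x).2) -> continuous (fun x => vdot (u x) (v x)).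
Proof. by move=> *; apply: continuous_fD; exact: continuous_fM. Qed.

Lemma sdens_cont j : continuous (sdens j).
Proof.
rewrite /sdens; apply: continuous_fM; first exact: rho_comp_continuous.
case: j => [|[|j]]; apply: vdot_cont; rewrite /vJ /=; try exact: Vp_cont.
by apply: continuous_fN; exact: Vp_cont.
Qed.

Lemma Sigma_yE : Sigma_y kappa (V p0) (X p0) =
  seq_mx 4 4 [:: [:: 0; 0; 0; 0]; [:: 0; 0; 0; 0];
    [:: S 0 (X p0) - S 0 0; - (S 1 (X p0) - S 1 0); 0; 0];
    [:: S 1 (X p0) - S 1 0; - (S 2 (X p0) - S 2 0); 0; 0] ].
Proof.
have D j := (antiderP (@sdens_cont j)).2.
have kE x : kappa (sqnorm (V p0 x)) = rD g 0 (rh x) by rewrite sqnorm_V kappaE// rho_ge0.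
rewrite /Sigma_y (sigma_phi (D 0%N) (@sdens_cont 0)); last first.
  by move=> x; rewrite kE sqnorm_V /sdens /vdot /= -!expr2.
rewrite (sigma_phi (D 1%N) (@sdens_cont 1)); last by move=> x; rewrite kE /sdens dotE derive1_pair /pair_of Jmx0 Jmx1.
rewrite (sigma_phi (D 2%N) (@sdens_cont 2))// => x.
by rewrite kE /sdens sqnormE !(derive1_V fam)// /vdot /= -!expr2.
Qed.

Definition I2 a := antider (fun x => vdot (P 0 x) (Q a 0 x)).
Definition I3 a := antider (fun x => vdot (vJ (Q a 0 x)) (P 1 x)).

Lemma Q_cont a j i : continuous (Va V p0 a j i).
Proof. exact: (Vap_continuous fam Op0). Qed.

Lemma I2P a (x : R) : is_derive x (1 : R) (I2 a) (vdot (P 0 x) (Q a 0 x)).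
Proof.
have c : continuous (fun x => vdot (P 0 x) (Q a 0 x)).
  by apply: vdot_cont => /=; [exact: Vp_cont|exact: Vp_cont|exact: Q_cont|exact: Q_cont].
exact: (antiderP c).2.
Qed.

Lemma I3P a (x : R) : is_derive x (1 : R) (I3 a) (vdot (vJ (Q a 0 x)) (P 1 x)).
Proof.
have c : continuous (fun x => vdot (vJ (Q a 0 x)) (P 1 x)).
  apply: vdot_cont => /=; [exact: Q_cont| |exact: Vp_cont|exact: Vp_cont].
  by apply: continuous_fN; exact: Q_cont.
exact: (antiderP c).2.
Qed.

Local Notation St := (Sigma_t V X xi p0).
Local Notation Sy := (Sigma_y kappa (V p0) (X p0)).
Local Notation m := (rh 0 / 2).
Local Notation tgt z2 z := (\matrix_(r, a)
  target (X p0) m (fun a => xi_a xi p0 a) (fun a => X_a X p0 a) I2 I3 (S 0) (S 1) (S 2) z2 a r z).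

(** Rows 2 and 3 of Sigma_t contain the boundary terms X_a m and xi_a m, which are m times rows 1
    and 0. Subtracting those multiples removes them, and applied to the identity matrix the same
    operation produces the terms in m of [target]. *)
Definition shear : 'M[C]_4 :=
  \matrix_(i, j) ((i == j)%:R - (((i == 2) && (j == 1)) || ((i == 3) && (j == 0)))%:R * m%:C).

Lemma det_shear : \det shear = 1.
Proof.
rewrite det_trig; last first.
  apply/is_trig_mxP => i j; rewrite mxE.
  by case: (ord4P i) => ->; case: (ord4P j) => -> //= _; rewrite !mul0r subr0.
rewrite !big_ord_recl big_ord0 !mxE /=.
by rewrite !mul0r !subr0 !mulr1.
Qed.

Lemma Sigma_y_rows a : [/\ Sy 0 a = 0, Sy 1 a = 0, Sy 2 a = Sphi (S 0) (S 1) a (X p0)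
  & Sy 3 a = Sx (S 1) (S 2) a (X p0)].
Proof.
rewrite Sigma_yE; move: (S 0) (S 1) (S 2) (X p0) => s0 s1 s2 x.
by case: (ord4P a) => ->; split; rewrite mxE.
Qed.

(** One entry of [target_shear] with all data generalized to free variables, so that [ring] faces a
    small polynomial identity in each of the sixteen cases. *)
Lemma shear_row (z : C) (z2 x0 x1 j2 j3 u2 u3 mm : R) (r a : 'I_4) :
  match val r with
  | 0%N => z * x0%:C - 'i%C * (r == a)%:R
  | 1%N => z * x1%:C - 'i%C * (r == a)%:R
  | 2%N => z * j2%:C + z^-1 * (z2 * u2)%:C - 'i%C * ((a == 2)%:R - (a == 1)%:R * mm)%:C
  | _ => z * j3%:C + z^-1 * (z2 * u3)%:C - 'i%C * ((a == 3)%:R - (a == 0)%:R * mm)%:C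
  end =
  ((r == 0)%:R - (((r == 2) && (0 == 1 :> 'I_4)) || ((r == 3) && (0 == 0 :> 'I_4)))%:R * mm%:C)
    * (z * x0%:C + z2%:C / z * 0%:C - 'i%C *+ (0 == a)) +
  ((r == 1)%:R - (((r == 2) && (1 == 1 :> 'I_4)) || ((r == 3) && (1 == 0 :> 'I_4)))%:R * mm%:C)
    * (z * x1%:C + z2%:C / z * 0%:C - 'i%C *+ (1 == a)) +
  ((r == 2)%:R - (((r == 2) && (2 == 1 :> 'I_4)) || ((r == 3) && (2 == 0 :> 'I_4)))%:R * mm%:C)
    * (z * (j2 + x1 * mm)%:C + z2%:C / z * u2%:C - 'i%C *+ (2 == a)) +
  ((r == 3)%:R - (((r == 2) && (3 == 1 :> 'I_4)) || ((r == 3) && (3 == 0 :> 'I_4)))%:R * mm%:C)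
    * (z * (j3 + x0 * mm)%:C + z2%:C / z * u3%:C - 'i%C *+ (3 == a)).
Proof.
have fD := rmorphD (real_complex R); have fM := rmorphM (real_complex R).
have fB := rmorphB (real_complex R).
have f0 := rmorph0 (real_complex R); have f1 := rmorph1 (real_complex R).
rewrite !fD !fM f0.
case: (ord4P r) => -> /=; case: (ord4P a) => -> /=;
  rewrite ?mulr1n ?mulr0n ?fB ?fM ?f0 ?f1; ring.
Qed.

Lemma target_shear z2 z : tgt z2 z = shear *m
  (z *: map_mx (real_complex R) St + (z2%:C / z) *: map_mx (real_complex R) Sy - 'i%C%:M).
Proof.
apply/matrixP => r a.
have t0 : St 0 a = xi_a xi p0 a := Sigma_t0 _ _ _ _ _.
have t1 : St 1 a = X_a X p0 a := Sigma_t1 _ _ _ _ _.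
have t2 := Sigma_t2 fam Op0 (I2P a); have t3 := Sigma_t3 fam Op0 (I3P a).
have [s0 s1 s2 s3] := Sigma_y_rows a.
rewrite mxE /target; move: t0 t1 t2 t3 s0 s1 s2 s3; move: St Sy => A B t0 t1 t2 t3 s0 s1 s2 s3.
rewrite [RHS]mxE big_ord4 !mxE t0 t1 t2 t3 s0 s1 s2 s3.
exact: shear_row.
Qed.

Theorem bloch_wave (delta : nat -> nat -> nat -> R) (omega0 : R) (r0 : nat) :
  St \in unitmx -> Delta0_coefficients St Sy delta ->
  eigenvalue (invmx St) omega0 -> mup omega0 (char_poly (invmx St)) = r0 ->
  (let N := delta 1%N 2%N 1%N + delta 2%N 1%N 1%N * omega0 + delta 3%N 0%N 1%N * omega0 ^+ 2 in
   ((3 <= r0)%N /\ N != 0) \/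
   (r0 = 2%N /\ N / ((r0`!)%:R^-1
       * derive1n r0 (fun lambda : R => Delta0 delta lambda 1 0) omega0) < 0)) ->
  exists (z2 e : R) (z : C) (v : 'I_4 -> R -> C),
  [/\ 0 <= z2, 0 < e, 0 < complex.Re z,
      forall i (x : R), cderiv (v i) x (\sum_j
        sysmx (rD g 0 \o rh) (rD g 1 \o rh) (rD g 2 \o rh) (rD w 1 \o rh) (rD w 2 \o rh)
          (p0 0 0) (p0 0 1) P z2 e z i j x * v j x) &
      (forall i x, v i (x + X p0) = expi e * rotf (cos (xi p0)) (sin (xi p0)) (fun j => v j x) i)
      /\ exists i, v i 0 != 0].
Proof.
move=> uSt hdelta heig hmult hcase.
have [z2 [D [B [mz [[z20 mz0 DB Dm DRe] root]]]]] := unstable_root hdelta uSt heig hmult hcase.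
have [k0 k00 kk] := kappa_pos.
have K0_ge x : k0 <= (rD g 0 \o rh) x by rewrite -[(rD g 0 \o rh) x]/(g (rh x)) -kappaE ?rho_ge0// kk// rho_ge0.
have QX a j : Q a j (X p0) = rot (cos (xi p0)) (sin (xi p0))
  ((Q a j 0).1 + xi_a xi p0 a * (P j 0).2 - X_a X p0 a * (P j.+1 0).1,
   (Q a j 0).2 - xi_a xi p0 a * (P j 0).1 - X_a X p0 a * (P j.+1 0).2).
  by have := Va_shift fam Op0 a j 0; rewrite add0r.
have shiftE f k x : (rD f k \o rh) (x + X p0) = (rD f k \o rh) x by rewrite /= rho_shift.
have Qphi a : dmuphi ((rD g 0 \o rh) 0) ((rD g 1 \o rh) 0) (p0 0 1) (P 0 0) (P 1 0) (Q a 0 0) (Q a 1 0)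
    = (a == 2)%:R - (a == 1)%:R * m.
  by rewrite (Va_dmuphi sg kappaE fam Op0); ring.
have Qx a : dmux ((rD g 0 \o rh) 0) ((rD g 1 \o rh) 0) ((rD w 1 \o rh) 0) (p0 0 0) (P 0 0) (P 1 0) (Q a 0 0) (Q a 1 0)
    = (a == 3)%:R - (a == 0)%:R * m.
  by rewrite (Va_dmux sg sw kappaE WE fam Op0); ring.
have [h ch [e0 e00 sol]] := @bloch_determinant R (rD g 0 \o rh) (rD g 1 \o rh)
  (rD g 2 \o rh) (rD w 1 \o rh) (rD w 2 \o rh) (p0 0 0) (p0 0 1) (X p0) (cos (xi p0)) (sin (xi p0))
  m k0 P Q (fun a => xi_a xi p0 a) (fun a => X_a X p0 a) I2 I3 (S 0) (S 1) (S 2) (profile_X_pos fam Op0) k00 K0_ge (cos2Dsin2 (xi p0))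
  (shiftE g 0) (shiftE g 1) (shiftE g 2) (shiftE w 1) (shiftE w 2)
  (@rho_comp_continuous g 2 sg) (@rho_comp_continuous w 2 sw)
  (fun j x => is_derive_Vx fam j 0 x Op0) (fun j x => is_derive_Vx fam j 1 x Op0)
  (fun a j x => is_derive_Va_x fam Op0 a j 0 x) (fun a j x => is_derive_Va_x fam Op0 a j 1 x)
  (fun x => rho_comp_derive x (is_derive_rD sg 0)) (fun x => rho_comp_derive x (is_derive_rD sg 1))
  (fun x => rho_comp_derive x (is_derive_rD sw 1))
  (fun j x => Vx_shift fam j x Op0) QX
  (fun x => profile_ode sg sw kappaE WE fam x Op0) Vx_hess
  (fun a x => Va_hess sg sw kappaE WE fam Op0 a x) Qphi Qx I2P I3P
  (antiderP (@sdens_cont 0)).2 (antiderP (@sdens_cont 1)).2 (antiderP (@sdens_cont 2)).2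
  D B mz z2 DB mz0 Dm.
have [|e1 e10 he1] := root h.
  move: ch; congr (congBL _ _ _); apply: funext => e; apply: funext => z.
  by rewrite target_shear det_mulmx det_shear mul1r.
(* The factor 1/2 makes the inequality e < e0 strict. *)
pose e := Num.min (2^-1 * Num.min e0 1) (Num.min 1 e1).
have ep : 0 < e by rewrite /e !lt_min mulr_gt0 ?invr_gt0// ?lt_min ?e00 ?e10 ?ltr01.
have e_1 : 0 < e <= 1 by rewrite ep /e !ge_min lexx !orbT.
have ee0 : e < e0.
  apply: (@le_lt_trans _ _ (2^-1 * Num.min e0 1)); first by rewrite /e ge_min lexx.
  have : Num.min e0 1 <= e0 by rewrite ge_min lexx.
  lra.
have ee1 : e <= e1 by rewrite /e !ge_min lexx !orbT.
have [z Dz hz] := he1 e e_1 ee1.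
have [v [Dv vX vn]] := sol e z e_1 ee0 Dz hz.
by exists z2, e, z, v; split=> //; exact: DRe.
Qed.

End BlochWave.

(** * Compactly supported smooth fields *)

Section SmoothReal.
Variable R : realType.
Implicit Types f h : R -> R.

Definition Cinf f : Prop := exists F : nat -> R -> R, F 0%N = f /\
  forall k (x : R), is_derive x (1 : R) (F k) (F k.+1 x).

(** Coinduction: iterating a choice of derivative inside the class builds the whole sequence of
    derivatives. *)
Lemma Cinf_coind (S : (R -> R) -> Prop) :
  (forall f, S f -> exists2 f', S f' & forall x : R, is_derive x (1 : R) f (f' x)) ->
  forall f, S f -> Cinf f.
Proof.
move=> hS f Sf.
have nx h : exists h', S h -> S h' /\ forall x : R, is_derive x (1 : R) h (h' x).
  have [Sh|nSh] := pselect (S h); last by exists h.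
  by have [h' Sh' Dh'] := hS h Sh; exists h'.
have [d hd] := choice nx.
have Sk k : S (iter k d f) by elim: k => //= k IH; have [] := hd _ IH.
by exists (fun k => iter k d f); split=> // k x; have [_] := hd _ (Sk k).
Qed.

Lemma Cinf_derive f : Cinf f -> exists2 f', Cinf f' & forall x : R, is_derive x (1 : R) f (f' x).
Proof.
move=> [F [F0 DF]]; exists (F 1%N); last by rewrite -F0; exact: DF.
by exists (fun k => F k.+1); split.
Qed.

Lemma Cinf_continuous f : Cinf f -> continuous f.
Proof.
by move=> /Cinf_derive[f' _ Df] x; exact: (@is_derive_continuous R _ f' x (Df x)).
Qed.

(** The algebra generated by S. As soon as each generator has its derivative in this algebra, all
    its elements are smooth. Inverses, cos and sin, solutions of linear systems and compositions are
    treated in this way, each with its own S. *)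
Inductive ralg (S : (R -> R) -> Prop) : (R -> R) -> Prop :=
| ralg_base f of S f : ralg S f
| ralg_cst c : ralg S (fun=> c)
| ralg_add f h of ralg S f & ralg S h : ralg S (fun x => f x + h x)
| ralg_mul f h of ralg S f & ralg S h : ralg S (fun x => f x * h x).

Lemma ralg_Cinf (S : (R -> R) -> Prop) :
  (forall f, S f -> exists2 f', ralg S f' & forall x : R, is_derive x (1 : R) f (f' x)) ->
  forall f, ralg S f -> Cinf f.
Proof.
move=> hS; apply: Cinf_coind => f; elim=> {f} [//|c|f h _ [f' Sf' Df] _ [h' Sh' Dh]|
    f h Sf [f' Sf' Df] Sh [h' Sh' Dh]].
- by exists (fun=> 0) => [|x]; [exact: ralg_cst|exact: is_derive_fcst].
- by exists (fun x => f' x + h' x) => [|x]; [exact: ralg_add|exact: is_derive_fD].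
- exists (fun x => f' x * h x + f x * h' x) => [|x].
    by apply: ralg_add; exact: ralg_mul.
  by apply: (is_derive_eq (is_derive_fM (Df x) (Dh x))); ring.
Qed.

Lemma ralg_Cinf_id f : ralg Cinf f -> Cinf f.
Proof.
apply: ralg_Cinf => {}f /Cinf_derive[f' cf' Df]; exists f' => //; exact: ralg_base.
Qed.

Lemma Cinf_cst c : Cinf (fun=> c). Proof. exact/ralg_Cinf_id/ralg_cst. Qed.

Lemma CinfD f h : Cinf f -> Cinf h -> Cinf (fun x => f x + h x).
Proof. by move=> cf ch; apply/ralg_Cinf_id/ralg_add; exact: ralg_base. Qed.

Lemma CinfM f h : Cinf f -> Cinf h -> Cinf (fun x => f x * h x).
Proof. by move=> cf ch; apply/ralg_Cinf_id/ralg_mul; exact: ralg_base. Qed.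

Lemma CinfN f : Cinf f -> Cinf (fun x => - f x).
Proof.
move=> cf; rewrite (_ : (fun x => _) = (fun x => -1 * f x)).
  by apply: CinfM => //; exact: Cinf_cst.
by apply: funext => x; rewrite mulN1r.
Qed.

Lemma CinfV f : (forall x, f x != 0) -> Cinf f -> Cinf (fun x => (f x)^-1).
Proof.
move=> f0 cf; pose S h := Cinf h \/ h = (fun x => (f x)^-1).
apply: (@ralg_Cinf S) => [h|]; last by apply: ralg_base; right.
case=> [/Cinf_derive[h' ch' Dh]|->].
  by exists h' => //; apply: ralg_base; left.
have [f' cf' Df] := Cinf_derive cf.
exists (fun x => -1 * (f' x * ((f x)^-1 * (f x)^-1))) => [|x].
  apply: ralg_mul; first exact: ralg_cst.
  apply: ralg_mul; first by apply: ralg_base; left.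
  by apply: ralg_mul; apply: ralg_base; right.
have D := is_deriveV (f0 x) (Df x); apply: (is_derive_eq D).
by rewrite /GRing.scale /= -exprVn expr2; ring.
Qed.

Lemma Cinf_affine f (a b : R) : Cinf f -> Cinf (fun x => f (a * x + b)).
Proof.
move=> [F [F0 DF]]; exists (fun k x => a ^+ k * F k (a * x + b)); split.
  by apply: funext => x; rewrite expr0 mul1r F0.
move=> k x; have Da : is_derive x (1 : R) (fun x => a * x + b) a.
  have D := is_derive_fD (is_derive_fM (is_derive_fcst a x (1 : R)) (is_derive_id x (1 : R)))
    (is_derive_fcst b x (1 : R)).
  by apply: (is_derive_eq D); ring.
have D := is_derive_fM (is_derive_fcst (a ^+ k) x (1 : R)) 
  (@is_derive_fcomp R R (F k) (fun x => a * x + b) x 1 _ _ (DF k (a * x + b)) Da).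
by apply: (is_derive_eq D); rewrite exprS; ring.
Qed.

Lemma Cinf_cos_sin : Cinf (@cos R) /\ Cinf (@sin R).
Proof.
pose S f := f = @cos R \/ f = @sin R.
have hS f : S f -> Cinf f.
  move=> Sf; apply: (@ralg_Cinf S) => [h|]; last exact: ralg_base.
  case=> ->.
    exists (fun x => -1 * sin x) => [|x]; last first.
      by rewrite mulN1r; exact: is_derive_cos.
    by apply: ralg_mul; [exact: ralg_cst|apply: ralg_base; right].
  exists (@cos R) => [|x]; last exact: is_derive_sin.
  by apply: ralg_base; left.
by split; apply: hS; [left|right].
Qed.

Lemma Cinf_ode (I : finType) (A : I -> I -> R -> R) (y : I -> R -> R) :
  (forall i j, Cinf (A i j)) ->
  (forall i (x : R), is_derive x (1 : R) (y i) (\sum_j A i j x * y j x)) ->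
  forall i, Cinf (y i).
Proof.
move=> cA Dy i; pose S f := Cinf f \/ exists i, f = y i.
apply: (@ralg_Cinf S) => [h|]; last by apply: ralg_base; right; exists i.
case=> [/Cinf_derive[h' ch' Dh]|[j ->]].
  by exists h' => //; apply: ralg_base; left.
exists (fun x => \sum_k A j k x * y k x) => [|x]; last exact: Dy.
elim: (index_enum I) => [|k r IH].
  rewrite (_ : (fun x => _) = (fun=> 0)); first exact: ralg_cst.
  by apply: funext => x; rewrite big_nil.
rewrite (_ : (fun x => _) = (fun x => A j k x * y k x + \sum_(k <- r) A j k x * y k x)).
  apply: ralg_add => //; apply: ralg_mul; apply: ralg_base; first by left.
  by right; exists k.
by apply: funext => x; rewrite big_cons.
Qed.

Lemma Cinf_comp (f : nat -> R -> R) (h h' : R -> R) :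
  (forall k (x : R), is_derive x (1 : R) (f k) (f k.+1 x)) ->
  Cinf h' -> (forall x : R, is_derive x (1 : R) h (h' x)) ->
  forall k, Cinf (fun x => f k (h x)).
Proof.
move=> Df ch Dh k; pose S u := Cinf u \/ exists k, u = (fun x => f k (h x)).
apply: (@ralg_Cinf S) => [u|]; last by apply: ralg_base; right; exists k.
case=> [/Cinf_derive[u' cu' Du]|[j ->]].
  by exists u' => //; apply: ralg_base; left.
exists (fun x => f j.+1 (h x) * h' x) => [|x]; last exact: is_derive_fcomp (Df _ _) (Dh x).
by apply: ralg_mul; apply: ralg_base; [right; exists j.+1|left].
Qed.

End SmoothReal.

(** * A function flat at 0 *)

Section Cutoff.
Variable R : realType.

(** The classical exp (- 1 / x) together with all negative powers: differentiation only raises m, so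
    the family is closed under it up to linear combinations. *)
Definition flat (m : nat) (x : R) : R := if 0 < x then x ^- m * expR (- x^-1) else 0.

Lemma flat_ge0 m x : 0 <= flat m x.
Proof.
by rewrite /flat; case: ifP => // /ltW x0; rewrite mulr_ge0 ?expR_ge0// invr_ge0 exprn_ge0.
Qed.

Lemma flat_bounded m : exists M : R, forall x, flat m x <= M.
Proof.
exists (m%:R ^+ m) => x; rewrite /flat; case: ifP => x0; last by rewrite exprn_ge0.
case: m => [|m]; first by rewrite expr0 invr1 mul1r expr0 expR_le1 oppr_le0 invr_ge0 ltW.
have y0 : 0 <= x^-1 / m.+1%:R by rewrite divr_ge0// invr_ge0 ltW.
(* With y = 1 / x, the inequality exp (y / m) >= y / m raised to the power m compares y^m with exp
   y. *)
have h : (x^-1 / m.+1%:R) ^+ m.+1 <= expR x^-1.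
  rewrite -[X in expR X](@divfK _ m.+1%:R) ?pnatr_eq0// [X in expR X]mulrC expRM_natl.
  rewrite lerXn2r ?nnegrE ?expR_ge0//.
  by apply: le_trans (expR_ge1Dx _); rewrite lerDr.
rewrite expRN -exprVn ler_pdivrMr ?expR_gt0//.
by rewrite -[X in X <= _](@divfK _ (m.+1%:R ^+ m.+1)) ?expf_neq0 ?pnatr_eq0// mulrC ler_wpM2l// -expr_div_n.
Qed.

Lemma flat_derive m (x : R) :
  is_derive x (1 : R) (flat m) (flat m.+2 x + - m%:R * flat m.+1 x).
Proof.
have [x0|x0|x0] := ltgtP x 0.
- have E y : y < 0 -> flat m y = 0 by move=> y0; rewrite /flat ltNge ltW.
  rewrite /flat !ltNge !ltW//= mulr0 addr0.
  apply: (@is_derive_near R R (fun=> 0)).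
  by near=> y; rewrite -/(flat m y) E//; near: y; exact: lt_nbhsl.
- rewrite /flat x0.
  apply: (@is_derive_near R R (fun y => y ^- m * expR (- y^-1))).
    near=> y; rewrite (_ : 0 < y = true)//; near: y; exact: lt_nbhsr.
  have xn : x != 0 by rewrite gt_eqF.
  have DV := is_deriveV xn (is_derive_id x (1 : R)).
  have De := @is_derive_fcomp R R (@expR R) (fun y => - y^-1) x 1 _ _ (is_derive_expR (- x^-1)) (is_derive_fN DV).
  have DX := is_derive_fX m DV.
  rewrite (_ : (fun y : R => _) = (fun y => (y^-1) ^+ m * expR (- y^-1))); last first.
    by apply: funext => y; rewrite exprVn.
  have D := is_derive_fM DX De; apply: (is_derive_eq D).
  rewrite -!exprVn; set e := expR _; set y := x^-1; rewrite /GRing.scale /=.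
  case: m {D DX} => [|m]; rewrite ?mulr0n /= ?exprS ?expr0; ring.
- rewrite x0 {2 3}/flat ltxx mulr0 addr0.
  (* At 0 the difference quotient for h > 0 equals h times [flat m.+2 h], and the second factor is
     bounded. *)
  have [M hM] := flat_bounded m.+2.
  have M1 : 0 < `|M| + 1 by have := normr_ge0 M; lra.
  have c0 : h^-1 *: (flat m (h *: 1 + 0) - flat m 0) @[h --> (0 : R)^'] --> (0 : R).
    apply/cvgrPdist_le => e e0; near=> h.
    have h0 : h != 0 by near: h; exact: nbhs_dnbhs_neq.
    have he : `|h| <= e / (`|M| + 1).
      by near: h; apply: dnbhs0_le; rewrite divr_gt0.
    rewrite sub0r normrN /GRing.scale /= mulr1 addr0 [X in _ - X]/flat ltxx subr0.
    rewrite {1}/flat; case: ifP => hp; last by rewrite mulr0 normr0 ltW.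
    rewrite ger0_norm; last first.
      by rewrite !mulr_ge0 ?expR_ge0 ?invr_ge0 ?exprn_ge0// ltW.
    have -> : h^-1 * (h ^- m * expR (- h^-1)) = h * flat m.+2 h.
      by rewrite /flat hp -!exprVn !exprS !mulrA mulfV// mul1r.
    have : h * flat m.+2 h <= `|h| * (`|M| + 1).
      apply: ler_pM; [exact: ltW|exact: flat_ge0|exact: ler_norm|].
      by apply: le_trans (hM h) _; have := ler_norm M; lra.
    by move/le_trans; apply; rewrite -ler_pdivlMr.
  have E : (fun h : R => h^-1 *: ((flat m \o shift 0) (h *: 1) - flat m 0)) =
     (fun h : R => h^-1 *: (flat m (h *: 1 + 0) - flat m 0)) by [].
  split; first by apply/cvg_ex; exists 0; rewrite E.
  by rewrite /derive E; exact/cvg_lim.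
Unshelve. all: by end_near. Qed.

End Cutoff.

Section FieldAlgebra.
Variables (R : realType) (n : nat).
Local Notation space := 'rV[R]_n.+1.
Local Notation e j := (delta_mx 0 j : space).
Implicit Types f h : space -> R.

(** Polynomial expressions in smooth functions of one coordinate each. This class is stable under
    directional derivatives and contains the cutoffs, the profile and the Bloch waves, so smoothness
    on the space reduces to one variable. *)
Inductive falg : (space -> R) -> Prop :=
| falg_base u (j : 'I_n.+1) of Cinf u : falg (fun z => u (z 0 j))
| falg_add f h of falg f & falg h : falg (fun z => f z + h z)
| falg_mul f h of falg f & falg h : falg (fun z => f z * h z).

Lemma falg_cst c : falg (fun=> c).
Proof. exact: (@falg_base (fun=> c) 0 (Cinf_cst c)). Qed.

Lemma falg_opp f : falg f -> falg (fun z => - f z).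
Proof.
move=> ff; rewrite (_ : (fun z => _) = (fun z => -1 * f z)).
  by apply: falg_mul => //; exact: falg_cst.
by apply: funext => z; rewrite mulN1r.
Qed.

Lemma falg_sub f h : falg f -> falg h -> falg (fun z => f z - h z).
Proof. by move=> ff fh; apply: falg_add => //; exact: falg_opp. Qed.

Lemma falg_prod (J : Type) (r : seq J) (f : J -> space -> R) :
  (forall j, falg (f j)) -> falg (fun z => \prod_(j <- r) f j z).
Proof.
move=> ff; elim: r => [|j r IH].
  rewrite (_ : (fun z => _) = (fun=> 1)); first exact: falg_cst.
  by apply: funext => z; rewrite big_nil.
rewrite (_ : (fun z => _) = (fun z => f j z * \prod_(j <- r) f j z)).
  exact: falg_mul.
by apply: funext => z; rewrite big_cons.
Qed.

Lemma is_derive_entry j z (u : space) : is_derive z u (fun z : space => z 0 j) (u 0 j).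
Proof. by apply: is_derive_coord; exact: is_derive_id. Qed.

Lemma falg_derive f (u : space) : falg f ->
  exists2 f', falg f' & forall z, is_derive z u f (f' z).
Proof.
elim=> {f} [w j /Cinf_derive[w' cw' Dw]|f h _ [f' ff' Df] _ [h' fh' Dh]|
    f h ff [f' ff' Df] fh [h' fh' Dh]].
- exists (fun z => w' (z 0 j) * u 0 j) => [|z].
    by apply: falg_mul; [exact: falg_base|exact: falg_cst].
  exact: (@is_derive_fcomp R space w (fun z : space => z 0 j) z u _ _ (Dw (z 0 j)) (is_derive_entry j z u)).
- by exists (fun z => f' z + h' z) => [|z]; [exact: falg_add|exact: is_derive_fD].
- exists (fun z => f' z * h z + f z * h' z) => [|z].
    by apply: falg_add; exact: falg_mul.
  by apply: (is_derive_eq (is_derive_fM (Df z) (Dh z))); ring.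
Qed.

Lemma falg_differentiable f z : falg f -> differentiable f z.
Proof.
elim=> {f} [w j /Cinf_derive[w' _ Dw]|f h _ df _ dh|f h _ df _ dh].
- apply: (differentiable_comp (f := fun z : space => z 0 j)).
    exact: differentiable_coord.
  by apply/derivable1_diffP; have [] := Dw (z 0 j).
- exact: differentiableD.
- exact: differentiableM.
Qed.

Lemma falg_iterD (f : space -> 'cV[R]_2) : (forall i, falg (fun z => f z i 0)) ->
  forall vs i, falg (fun z => iterD vs f z i 0).
Proof.
move=> ff; elim=> [|u vs IH] i //.
have ex k : exists f', falg f' /\ forall z, is_derive z u (fun z => iterD vs f z k 0) (f' z).
  by have [f' h1 h2] := falg_derive u (IH k); exists f'.
have [f' hf'] := choice ex.
rewrite (_ : (fun z => _) = f' i); first by have [] := hf' i.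
apply: funext => z /=; rewrite -/(iterD vs f).
have D : is_derive z u (iterD vs f) (\col_k f' k z).
  by apply: is_derive_mx => k l; rewrite ord1 mxE; have [_] := hf' k.
by rewrite (@derive_val _ _ _ _ _ _ _ D) mxE.
Qed.

Lemma falg_smooth (f : space -> 'cV[R]_2) : (forall i, falg (fun z => f z i 0)) -> smooth_on setT f.
Proof.
move=> ff vs z _; rewrite -/(iterD vs f).
rewrite (_ : iterD vs f = fun z => iterD vs f z 0 0 *: (delta_mx 0 0 : 'cV[R]_2)
    + iterD vs f z 1 0 *: (delta_mx 1 0 : 'cV[R]_2)).
  by apply: differentiableD; apply: differentiableZl; apply: falg_differentiable; exact: falg_iterD.
apply: funext => w; apply/colP => i; rewrite !mxE.
by elim/ord2_ind: i; rewrite /= ?mulr1 ?mulr0 ?addr0 ?add0r.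
Qed.

End FieldAlgebra.

(** * Estimates of L2 norms and volumes of boxes *)

Section SquareNorm.
Context d (T : measurableType d) (R : realType) (mu : {measure set T -> \bar R}).
Variables (G : T -> R) (S : set T).
Hypotheses (mG : measurable_fun setT G) (mS : measurable S).

Lemma L2normE : Lnorm mu 2%:E (EFin \o G) =
  poweR (\int[mu]_x ((G x) ^+ 2)%:E)%E 2^-1.
Proof.
rewrite Lnorm.unlock /=; congr (poweR _ _); apply: eq_integral => x _.
by rewrite /= powR_mulrn// real_normK// num_real.
Qed.

Let mG2 : measurable_fun setT (fun x => ((G x) ^+ 2)%:E : \bar R).
Proof. by apply/measurable_EFinP; exact: measurable_funX. Qed.

Let mI (b : R) : measurable_fun setT (fun x => (b * \1_S x)%:E : \bar R).
Proof. by apply/measurable_EFinP; apply: measurable_funM => //; exact: measurable_indic. Qed.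

Let intI (b v : R) : 0 <= b -> mu S = v%:E -> (\int[mu]_x (b * \1_S x)%:E = (b * v)%:E)%E.
Proof.
move=> b0 Sv; under eq_integral do rewrite EFinM.
rewrite ge0_integralZl_EFin ?integral_indic ?setIT ?Sv//.
by apply/measurable_EFinP; exact: measurable_indic.
Qed.

Lemma L2norm_le (b v : R) : 0 <= v -> mu S = v%:E -> (forall x, S x -> `|G x| <= b) ->
  (forall x, ~ S x -> G x = 0) -> 0 <= b ->
  (Lnorm mu 2%:E (EFin \o G) <= (Num.sqrt (b ^+ 2 * v))%:E)%E.
Proof.
move=> v0 Sv Gb G0 b0; rewrite L2normE -powR12_sqrt ?mulr_ge0 ?sqr_ge0// -poweR_EFin.
apply: gt0_ler_poweR; rewrite ?in_itv/= ?leey ?andbT//.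
- by apply: integral_ge0 => x _; rewrite lee_fin sqr_ge0.
- by rewrite lee_fin mulr_ge0 ?sqr_ge0.
rewrite -(intI (sqr_ge0 b) Sv); apply: ge0_le_integral => // x _.
  by rewrite lee_fin sqr_ge0.
rewrite lee_fin indicE; case: (boolP (x \in S)) => [/set_mem xS|/negP xS].
  by rewrite mulr1 -[X in X <= _]real_normK ?num_real// lerXn2r ?nnegrE//; exact: Gb.
by rewrite mulr0 G0 ?expr0n// => xS'; apply: xS; rewrite inE.
Qed.

Lemma L2norm_ge (b v : R) : mu S = v%:E -> 0 <= v -> (forall x, S x -> b <= `|G x|) -> 0 <= b ->
  ((Num.sqrt (b ^+ 2 * v))%:E <= Lnorm mu 2%:E (EFin \o G))%E.
Proof.
move=> Sv v0 Gb b0; rewrite L2normE -powR12_sqrt ?mulr_ge0 ?sqr_ge0// -poweR_EFin.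
apply: gt0_ler_poweR; rewrite ?in_itv/= ?leey ?andbT//.
- by rewrite lee_fin mulr_ge0 ?sqr_ge0.
- by apply: integral_ge0 => x _; rewrite lee_fin sqr_ge0.
rewrite -(intI (sqr_ge0 b) Sv); apply: ge0_le_integral => // x _.
  by rewrite lee_fin mulr_ge0 ?sqr_ge0.
rewrite lee_fin indicE; case: (boolP (x \in S)) => [/set_mem xS|_].
  by rewrite mulr1 -[X in _ <= X]real_normK ?num_real// lerXn2r ?nnegrE//; exact: Gb.
by rewrite mulr0 sqr_ge0.
Qed.

End SquareNorm.

Section Boxes.
Variable R : realType.

Definition box n (M : R) : set (n.-tuple R) := [set t | forall j, `|tnth t j| <= M].

(** The first coordinate is singled out because the Bloch wave is bounded below only for x in
    certain intervals. *)
Definition cylinder n (A : set R) (M : R) : set (n.+1.-tuple R) :=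
  [set t | A (tnth t ord0) /\ forall j, `|tnth t (lift ord0 j)| <= M].

Lemma measurable_coordinate n (j : 'I_n) (A : set R) : measurable A ->
  measurable [set t : n.-tuple R | A (tnth t j)].
Proof.
move=> mA; rewrite -[X in measurable X]setTI.
exact: (@measurable_tnth _ R n j measurableT _ mA).
Qed.

Lemma measurable_forall n (J : finType) (A : J -> set (n.-tuple R)) :
  (forall j, measurable (A j)) -> measurable [set t | forall j, A j t].
Proof.
move=> mA; rewrite (_ : [set t | _] = \bigcap_(j in setT) A j); last first.
  by apply/seteqP; split=> t h j; [move=> _; exact: h|exact: (h j I)].
by apply: fin_bigcap_measurable.
Qed.

Lemma measurable_box n M : measurable (@box n M).
Proof.
apply: measurable_forall => j.
apply: (@measurable_coordinate n j [set x : R | `|x| <= M]).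
rewrite (_ : [set x | _] = `[- M, M]%classic).
  exact: measurable_itv.
by apply/seteqP; split=> x /=; rewrite in_itv/= ler_norml.
Qed.

Lemma lebesgue_step_cylinder n (A : set R) (M : R) : measurable A ->
  lebesgue_tuple R n.+1 (@cylinder n A M) =
  (lebesgue_measure A * lebesgue_tuple R n (@box n M))%E.
Proof.
move=> mA.
have -> : lebesgue_tuple R n.+1 (@cylinder n A M) =
  (@lebesgue_measure R \x^ lebesgue_tuple R n)%E (@Defs.cons_tuple R n @^-1` @cylinder n A M) by [].
(* The measure is the image of a product measure under [cons_tuple], and the preimage of a cylinder
   is a product set. *)
rewrite (_ : _ @^-1` _ = A `*` @box n M).
  by apply: product_measure2E => //; exact: measurable_box.
apply/seteqP; split=> -[x t] /= [h1 h2]; split=> /=.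
- by move: h1; rewrite /Defs.cons_tuple (tnth_nth 0).
- by move=> j; have := h2 j; rewrite /Defs.cons_tuple !(tnth_nth 0).
- by rewrite /Defs.cons_tuple (tnth_nth 0).
- by move=> j; have := h2 j; rewrite /Defs.cons_tuple !(tnth_nth 0).
Qed.

Lemma box_cylinder n M : @box n.+1 M = @cylinder n `[- M, M] M.
Proof.
apply/seteqP; split=> t /=.
  by move=> h; split=> [|j]; [rewrite /= in_itv/= -ler_norml; exact: h|exact: h].
move=> [/=]; rewrite in_itv/= -ler_norml => h0 h j.
by have [i ->|->] := unliftP ord0 j.
Qed.

Lemma lebesgue_box n (M : R) : 0 < M -> lebesgue_tuple R n (@box n M) = ((2 * M) ^+ n)%:E.
Proof.
move=> M0; elim: n => [|n IH].
  rewrite /= diracE expr0 (_ : _ \in _)//; by rewrite inE => -[].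
rewrite box_cylinder lebesgue_step_cylinder// IH lebesgue_measure_itv/= lte_fin.
rewrite (_ : - M < M = true); last by lra.
by rewrite -EFinD -EFinM exprS; congr (_ * _)%:E; ring.
Qed.

End Boxes.

(** * Weyl sequences *)

Section HessianLinearity.
Variable T : comNzRingType.
Variables (k k1 k2 w1 w2 om c : T) (V V1 V2 : T * T).
Local Notation H := (hess k k1 k2 w1 w2 om c V V1 V2).

Lemma hess_linear (p q : T) (u u1 u2 v v1 v2 : T * T) :
  H (p * u.1 + q * v.1, p * u.2 + q * v.2) (p * u1.1 + q * v1.1, p * u1.2 + q * v1.2)
    (p * u2.1 + q * v2.1, p * u2.2 + q * v2.2) =
  (p * (H u u1 u2).1 + q * (H v v1 v2).1, p * (H u u1 u2).2 + q * (H v v1 v2).2).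
Proof. by rewrite /hess /hess0 /vdot /vJ /=; congr (_, _); ring. Qed.

(** Leibniz's rule, p and q being the first and second derivatives of the multiplier x: the last two
    terms form the commutator of the linearized operator with multiplication by a cutoff. *)
Lemma hess_cutoff (x p q : T) (v v1 v2 : T * T) :
  H (x * v.1, x * v.2) (x * v1.1 + p * v.1, x * v1.2 + p * v.2)
    (x * v2.1 + 2 * p * v1.1 + q * v.1, x * v2.2 + 2 * p * v1.2 + q * v.2) =
  (x * (H v v1 v2).1 + p * (H (0, 0) v (2 * v1.1, 2 * v1.2)).1 + q * (H (0, 0) (0, 0) v).1,
   x * (H v v1 v2).2 + p * (H (0, 0) v (2 * v1.1, 2 * v1.2)).2 + q * (H (0, 0) (0, 0) v).2).
Proof. by rewrite /hess /hess0 /vdot /vJ /=; congr (_, _); ring. Qed.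

End HessianLinearity.

Lemma hess_morph (T T' : comNzRingType) (f : {rmorphism T -> T'})
  (k k1 k2 w1 w2 om c : T) (V V1 V2 v v1 v2 : T * T) :
  hess (f k) (f k1) (f k2) (f w1) (f w2) (f om) (f c) (pmap2 f V) (pmap2 f V1) (pmap2 f V2)
    (pmap2 f v) (pmap2 f v1) (pmap2 f v2) = pmap2 f (hess k k1 k2 w1 w2 om c V V1 V2 v v1 v2).
Proof. by rewrite /hess hess0_morph /pmap2 /= !rmorphB !rmorphM. Qed.

Section DirectionalDerivatives.
Variables (R : realType) (n : nat).
Local Notation space := 'rV[R]_n.+1.
Local Notation e j := (delta_mx 0 j : space).
Implicit Types (f : space -> 'cV[R]_2) (d : 'I_2 -> space -> R).

Lemma pdE f j d : (forall i z, is_derive z (e j) (fun w => f w i 0) (d i z)) ->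
  forall i z, pd f j i z = d i z.
Proof.
move=> Df i z; have D : is_derive z (e j) f (\col_k d k z).
  by apply: is_derive_mx => k l; rewrite ord1 mxE.
by rewrite /pd /coordD /= (@derive_val _ _ _ _ _ _ _ D) mxE.
Qed.

Lemma pddE f j d d2 : (forall i z, is_derive z (e j) (fun w => f w i 0) (d i z)) ->
  (forall i z, is_derive z (e j) (d i) (d2 i z)) ->
  forall i z, pdd f j i z = d2 i z.
Proof.
move=> Df Dd i z; have E : 'D_(e j) f = fun w => \col_k d k w.
  apply: funext => w; have D : is_derive w (e j) f (\col_k d k w).
    by apply: is_derive_mx => k l; rewrite ord1 mxE.
  exact: (@derive_val _ _ _ _ _ _ _ D).
rewrite /pdd /coordD /= E.
have D : is_derive z (e j) (fun w => \col_k d k w : 'cV[R]_2) (\col_k d2 k z).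
  apply: is_derive_mx => k l; rewrite ord1 mxE.
  by rewrite (_ : (fun w => _) = d k)//; apply: funext => w; rewrite mxE.
by rewrite (@derive_val _ _ _ _ _ _ _ D) mxE.
Qed.

Lemma pd_mulr (x : space -> R) f (x1 x2 : space -> R) j d d2 :
  (forall z, is_derive z (e j) x (x1 z)) -> (forall z, is_derive z (e j) x1 (x2 z)) ->
  (forall i z, is_derive z (e j) (fun w => f w i 0) (d i z)) ->
  (forall i z, is_derive z (e j) (d i) (d2 i z)) ->
  forall i z, pd (fun w => x w *: f w) j i z = x z * d i z + x1 z * f z i 0 /\
    pdd (fun w => x w *: f w) j i z = x z * d2 i z + 2 * x1 z * d i z + x2 z * f z i 0.
Proof.
move=> Dx Dx1 Df Dd.
have E1 i z : is_derive z (e j) (fun w => (x w *: f w) i 0) (x z * d i z + x1 z * f z i 0).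
  rewrite (_ : (fun w => _) = (fun w => x w * f w i 0)); last by apply: funext => w; rewrite mxE.
  by apply: (is_derive_eq (is_derive_fM (Dx z) (Df i z))); ring.
have E2 i z : is_derive z (e j) (fun w => x w * d i w + x1 w * f w i 0)
   (x z * d2 i z + 2 * x1 z * d i z + x2 z * f z i 0).
  apply: (is_derive_eq (is_derive_fD (is_derive_fM (Dx z) (Dd i z)) (is_derive_fM (Dx1 z) (Df i z)))).
  ring.
by move=> i z; split; [exact: (pdE E1)|exact: (pddE E1 E2)].
Qed.

End DirectionalDerivatives.

(** * Plane waves over Bloch solutions in the scaled frame *)

Section TravelingWave.
Variables (R : realType) (n : nat).
Local Notation space := 'rV[R]_n.+1.
Local Notation e j := (delta_mx 0 j : space).
Variables (X xi eta : R) (j1 : 'I_n.+1) (a b : nat -> R -> R * R).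
Hypothesis X0 : X != 0.
Hypothesis j10 : j1 != 0.

(** Inverts the relation between unscaled and scaled profiles, with x = X s. The twisted derivative
    of [trans f] is then [trans] of the derivative of f. *)
Definition trans (f : R -> R * R) s : R * R :=
  rot (cos (xi * s)) (- sin (xi * s)) (f (X * s)).

Lemma is_derive_trans (f f' : R -> R * R) :
  (forall x : R, is_derive x (1 : R) (fun t => (f t).1) (f' x).1) ->
  (forall x : R, is_derive x (1 : R) (fun t => (f t).2) (f' x).2) ->
  forall s : R,
  is_derive s (1 : R) (fun t => (trans f t).1) (X * (trans f' s).1 - xi * (trans f s).2) /\
  is_derive s (1 : R) (fun t => (trans f t).2) (X * (trans f' s).2 + xi * (trans f s).1).
Proof.
move=> D1 D2 s.
have lin (r : R) : is_derive s (1 : R) (fun t => r * t) r.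
  by apply: (is_derive_eq (is_derive_fM (is_derive_fcst r s (1 : R)) (is_derive_id s (1 : R)))); ring.
have Dc := @is_derive_fcomp R R (@cos R) (fun t => xi * t) s 1 _ _ (is_derive_cos _) (lin xi).
have Ds := @is_derive_fcomp R R (@sin R) (fun t => xi * t) s 1 _ _ (is_derive_sin _) (lin xi).
have E1 := @is_derive_fcomp R R (fun t => (f t).1) (fun t => X * t) s 1 _ _ (D1 _) (lin X).
have E2 := @is_derive_fcomp R R (fun t => (f t).2) (fun t => X * t) s 1 _ _ (D2 _) (lin X).
rewrite /trans /rot /=; split.
  apply: (is_derive_eq (is_derive_fD (is_derive_fM Dc E1) (is_derive_fM (is_derive_fN Ds) E2))).
  ring.
apply: (is_derive_eq (is_derive_fB (is_derive_fM Dc E2) (is_derive_fM (is_derive_fN Ds) E1))).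
ring.
Qed.

Lemma Cinf_trans (f : R -> R * R) : Cinf (fun x => (f x).1) -> Cinf (fun x => (f x).2) ->
  Cinf (fun s => (trans f s).1) /\ Cinf (fun s => (trans f s).2).
Proof.
move=> c1 c2; have [cc cs] := Cinf_cos_sin R.
have aff u (r : R) : Cinf u -> Cinf (fun s => u (r * s)).
  move=> cu; rewrite (_ : (fun s => _) = (fun s => u (r * s + 0))); first exact: Cinf_affine.
  by apply: funext => s; rewrite addr0.
have e1 := aff _ X c1; have e2 := aff _ X c2.
have ec := aff _ xi cc; have es := CinfN (aff _ xi cs).
rewrite /trans /rot /=; split; first exact: (CinfD (CinfM ec e1) (CinfM es e2)).
exact: (CinfD (CinfM ec e2) (CinfN (CinfM es e1))).
Qed.

Lemma trans_bcont (f : R -> R * R) : bcont (fun x => (f x).1) -> bcont (fun x => (f x).2) ->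
  bcont (fun s => (trans f s).1) /\ bcont (fun s => (trans f s).2).
Proof.
move=> [c1 [B1 h1]] [c2 [B2 h2]].
have aff (u : R -> R) (r : R) : continuous u -> continuous (fun s : R => u (r * s)).
  by move=> cu s; apply: (@continuous_comp _ _ _ (fun s : R => r * s)); [exact: mulrl_continuous|exact: cu].
have e1 : bcont (fun s => (f (X * s)).1) by split; [exact: (aff (fun x => (f x).1))|exists B1 => s; exact: h1].
have e2 : bcont (fun s => (f (X * s)).2) by split; [exact: (aff (fun x => (f x).2))|exists B2 => s; exact: h2].
have ec : bcont (fun s => cos (xi * s)).
  by split; [apply: aff; exact: continuous_cos|exists 1 => s; rewrite ler_norml cos_geN1 cos_le1].
have es : bcont (fun s => - sin (xi * s)).
  apply: bcontN; split; first by apply: aff; exact: continuous_sin.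
  by exists 1 => s; rewrite ler_norml sin_geN1 sin_le1.
rewrite /trans /rot /=; split; first exact: (bcontD (bcontM ec e1) (bcontM es e2)).
exact: (bcontD (bcontM ec e2) (bcontN (bcontM es e1))).
Qed.

Hypothesis Da : forall m (x : R), (m < 2)%N ->
  is_derive x (1 : R) (fun t => (a m t).1) (a m.+1 x).1 /\
  is_derive x (1 : R) (fun t => (a m t).2) (a m.+1 x).2.
Hypothesis Db : forall m (x : R), (m < 2)%N ->
  is_derive x (1 : R) (fun t => (b m t).1) (b m.+1 x).1 /\
  is_derive x (1 : R) (fun t => (b m t).2) (b m.+1 x).2.

(* The real ([r] true) and imaginary parts of e^(i eta z_1) (a + i b), twisted
   to the scaled frame; [m] counts the derivations k_x d_x + k_phi J. *)
Definition wave (r : bool) m (z : space) : R * R :=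
  let co := cos (eta * z 0 j1) in let si := sin (eta * z 0 j1) in
  let A := trans (a m) (z 0 0) in let B := trans (b m) (z 0 0) in
  if r then (co * A.1 - si * B.1, co * A.2 - si * B.2)
  else (co * B.1 + si * A.1, co * B.2 + si * A.2).

Definition wave_field r (z : space) : 'cV[R]_2 := \col_i sel i (wave r 0 z).

(** Along x, the relation between twisted and plain derivatives is solved for the plain one. Along
    the transverse direction j1, differentiating the plane wave exchanges real and imaginary
    parts. *)
Definition dwave r m (j : 'I_n.+1) i (z : space) : R :=
  if j == 0 then X * sel i (wave r m.+1 z) - xi * sel i (vJ (wave r m z))
  else (j == j1)%:R * (if r then - eta else eta) * sel i (wave (~~ r) m z).

Lemma is_derive_wave r m j i z : (m < 2)%N ->
  is_derive z (e j) (fun w => sel i (wave r m w)) (dwave r m j i z).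
Proof.
move=> m2.
have [A1 A2] := is_derive_trans (fun x => (Da x m2).1) (fun x => (Da x m2).2) (z 0 0).
have [B1 B2] := is_derive_trans (fun x => (Db x m2).1) (fun x => (Db x m2).2) (z 0 0).
have Dz k : is_derive z (e j) (fun w : space => w 0 k) (k == j)%:R.
  by apply: (is_derive_eq (is_derive_entry k z (e j))); rewrite mxE eqxx.
have Dl : is_derive z (e j) (fun w : space => eta * w 0 j1) (eta * (j1 == j)%:R).
  by apply: (is_derive_eq (is_derive_fM (is_derive_fcst eta z (e j)) (Dz j1))); ring.
have Dc := @is_derive_fcomp R _ (@cos R) (fun w : space => eta * w 0 j1) z (e j) _ _ (is_derive_cos _) Dl.
have Ds := @is_derive_fcomp R _ (@sin R) (fun w : space => eta * w 0 j1) z (e j) _ _ (is_derive_sin _) Dl.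
have EA1 := @is_derive_fcomp R _ (fun t => (trans (a m) t).1) (fun w : space => w 0 0) z (e j) _ _ A1 (Dz 0).
have EA2 := @is_derive_fcomp R _ (fun t => (trans (a m) t).2) (fun w : space => w 0 0) z (e j) _ _ A2 (Dz 0).
have EB1 := @is_derive_fcomp R _ (fun t => (trans (b m) t).1) (fun w : space => w 0 0) z (e j) _ _ B1 (Dz 0).
have EB2 := @is_derive_fcomp R _ (fun t => (trans (b m) t).2) (fun w : space => w 0 0) z (e j) _ _ B2 (Dz 0).
have key : (j == 0 /\ (j1 == j) = false) \/ (j == 0) = false.
  by case: (eqVneq j 0) => [->|_]; [left; rewrite (negPf j10)|right].
rewrite /dwave (eq_sym j j1) /vJ; case: r => /=; elim/ord2_ind: i; rewrite /sel /= /wave.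
- apply: (is_derive_eq (is_derive_fB (is_derive_fM Dc EA1) (is_derive_fM Ds EB1))).
  by case: key => [[/eqP-> ->]|j0]; rewrite ?eqxx ?j0 ?(eq_sym 0 j) ?j0 /=; ring.
- apply: (is_derive_eq (is_derive_fB (is_derive_fM Dc EA2) (is_derive_fM Ds EB2))).
  by case: key => [[/eqP-> ->]|j0]; rewrite ?eqxx ?j0 ?(eq_sym 0 j) ?j0 /=; ring.
- apply: (is_derive_eq (is_derive_fD (is_derive_fM Dc EB1) (is_derive_fM Ds EA1))).
  by case: key => [[/eqP-> ->]|j0]; rewrite ?eqxx ?j0 ?(eq_sym 0 j) ?j0 /=; ring.
- apply: (is_derive_eq (is_derive_fD (is_derive_fM Dc EB2) (is_derive_fM Ds EA2))).
  by case: key => [[/eqP-> ->]|j0]; rewrite ?eqxx ?j0 ?(eq_sym 0 j) ?j0 /=; ring.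
Qed.

Definition ddwave r (j : 'I_n.+1) i (z : space) : R :=
  if j == 0 then X * dwave r 1 j i z
    - xi * (if i == 0 then dwave r 0 j 1 z else - dwave r 0 j 0 z)
  else - ((j == j1)%:R * eta ^+ 2 * sel i (wave r 0 z)).

Lemma is_derive_dwave r j i z : is_derive z (e j) (dwave r 0 j i) (ddwave r j i z).
Proof.
rewrite /ddwave {1}/dwave; case: (eqVneq j 0) => [->|j0] /=.
  rewrite -/(dwave r 0 0 i); have D1 := @is_derive_wave r 1 0 i z isT.
  have D2 k := @is_derive_wave r 0 0 k z isT.
  have DJ : is_derive z (e 0) (fun w => sel i (vJ (wave r 0 w)))
      (if i == 0 then dwave r 0 0 1 z else - dwave r 0 0 0 z).
    by elim/ord2_ind: i {D1}; rewrite /sel /vJ /=; [exact: (D2 1)|exact: is_derive_fN (D2 0)].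
  rewrite /dwave eqxx -/(dwave r 1 0 i z) in D1 DJ *.
  apply: (is_derive_eq (is_derive_fB (is_derive_fM (is_derive_fcst X z (e 0)) D1)
    (is_derive_fM (is_derive_fcst xi z (e 0)) DJ))); ring.
set cc := _ * (if r then _ else _).
have D := @is_derive_wave (~~ r) 0 j i z isT.
apply: (is_derive_eq (is_derive_fM (is_derive_fcst cc z (e j)) D)).
rewrite /dwave (negPf j0) negbK mul0r add0r /cc mulrA; case: (j == j1) => /=; rewrite ?mul0r ?mul1r ?oppr0//.
by case: (r) => /=; ring.
Qed.

Lemma wave_fieldE r i z : wave_field r z i 0 = sel i (wave r 0 z).
Proof. by rewrite mxE. Qed.

Lemma is_derive_wave_field r j i z :
  is_derive z (e j) (fun w => wave_field r w i 0) (dwave r 0 j i z).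
Proof.
rewrite (_ : (fun w => _) = (fun w => sel i (wave r 0 w))); first exact: is_derive_wave.
by apply: funext => w; rewrite wave_fieldE.
Qed.

Lemma twd_wave r z : twd X^-1 (xi / X) (wave_field r) z = wave r 1 z.
Proof.
rewrite /twd !(pdE (@is_derive_wave_field r 0)) !wave_fieldE /dwave eqxx /sel /vJ /=.
by rewrite [RHS]surjective_pairing; congr (_, _); field.
Qed.

Lemma twdd_wave r z : twdd X^-1 (xi / X) (wave_field r) z = wave r 2 z.
Proof.
rewrite /twdd !(pdE (@is_derive_wave_field r 0)) !(pddE (@is_derive_wave_field r 0) (@is_derive_dwave r 0)).
rewrite !wave_fieldE /ddwave /dwave eqxx /sel /vJ /=.
by rewrite [RHS]surjective_pairing; congr (_, _); field.
Qed.

Lemma falg_wave r i : 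
  Cinf (fun x => (a 0 x).1) -> Cinf (fun x => (a 0 x).2) ->
  Cinf (fun x => (b 0 x).1) -> Cinf (fun x => (b 0 x).2) ->
  falg (fun z => wave_field r z i 0).
Proof.
move=> /Cinf_trans ca /ca[a1 a2] /Cinf_trans cb /cb[b1 b2].
have [cc cs] := Cinf_cos_sin R.
have aff u : Cinf u -> Cinf (fun s => u (eta * s)).
  move=> cu; rewrite (_ : (fun s => _) = (fun s => u (eta * s + 0))); first exact: Cinf_affine.
  by apply: funext => s; rewrite addr0.
have fc := falg_base j1 (aff _ cc); have fs := falg_base j1 (aff _ cs).
have fa1 := falg_base (0 : 'I_n.+1) a1; have fa2 := falg_base (0 : 'I_n.+1) a2.
have fb1 := falg_base (0 : 'I_n.+1) b1; have fb2 := falg_base (0 : 'I_n.+1) b2.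
rewrite (_ : (fun z => _) = (fun z => sel i (wave r 0 z))); last by apply: funext => z; rewrite mxE.
rewrite /sel /wave; case: r => /=; elim/ord2_ind: i => /=.
- exact: (falg_sub (falg_mul fc fa1) (falg_mul fs fb1)).
- exact: (falg_sub (falg_mul fc fa2) (falg_mul fs fb2)).
- exact: (falg_add (falg_mul fc fb1) (falg_mul fs fa1)).
- exact: (falg_add (falg_mul fc fb2) (falg_mul fs fa2)).
Qed.

End TravelingWave.

Section Cutoffs.
Variable R : realType.

Lemma Cinf_flat m : Cinf (@flat R m).
Proof.
apply: (@ralg_Cinf R (fun f => exists m, f = flat m)); last by apply: ralg_base; exists m.
move=> f [k ->]; exists (fun x => flat k.+2 x + - k%:R * flat k.+1 x) => [|x]; last exact: flat_derive.
by apply: ralg_add; [|apply: ralg_mul; first exact: ralg_cst]; apply: ralg_base; eexists.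
Qed.

(** The bump flat (2 - x) flat (2 + x). On [-1, 1] both arguments are at least 1, whence the lower
    bound exp (-1)^2; one bound B serves for the function and its first two derivatives. *)
Lemma cutoff_exists : exists (F : nat -> R -> R) (B c : R), [/\ 1 <= B, 0 < c,
  forall m (x : R), is_derive x (1 : R) (F m) (F m.+1 x),
  forall m x, (m <= 2)%N -> `|F m x| <= B &
  (forall m x, 2 < `|x| -> F m x = 0) /\ (forall x, `|x| <= 1 -> c <= F 0 x)].
Proof.
have cF : Cinf (fun x : R => flat 0 (-1 * x + 2) * flat 0 (1 * x + 2)).
  by apply: CinfM; apply: (Cinf_affine (f := flat 0)); exact: Cinf_flat.
have [F [F0 DF]] := cF.
have supp m x : 2 < `|x| -> F m x = 0.
  elim: m x => [|m IH] x hx.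
    rewrite F0 /flat; have [x0|x0] := leP 0 x.
      have x2 : 2 < x by rewrite ger0_norm in hx.
      by rewrite (_ : 0 < -1 * x + 2 = false) ?mul0r//; apply/negbTE; rewrite -leNgt; lra.
    have x2 : 2 < - x by rewrite ltr0_norm in hx.
    by rewrite (_ : 0 < 1 * x + 2 = false) ?mulr0//; apply/negbTE; rewrite -leNgt; lra.
  apply: (@is_derive_unique_near R R (F m) (fun=> 0) x 1 _ _ _ (DF m x) (is_derive_fcst 0 x (1 : R))).
  near=> y; apply: IH; near: y.
  have cn : {for x, continuous (fun y : R => `|y|)} by exact: norm_continuous.
  exact: (cvgr_gt _ cn).
have cont m : continuous (F m) by move=> x; exact: (@is_derive_continuous R _ (F m.+1) x (DF m x)).
have bd m : exists B : R, forall x, `|F m x| <= B.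
  have [B B0 hB] := @continuous_bounded R (F m) 2 (ltr0Sn R 1) (cont m).
  exists B => x; have [|x2] := leP `|x| 2; first exact: hB.
  by rewrite supp// normr0.
have [B0 h0] := bd 0%N; have [B1 h1] := bd 1%N; have [B2 h2] := bd 2%N.
exists F, (`|B0| + `|B1| + `|B2| + 1), (expR (-1) * expR (-1)); split=> //.
- by have := normr_ge0 B0; have := normr_ge0 B1; have := normr_ge0 B2; lra.
- have := normr_ge0 B0; have := normr_ge0 B1; have := normr_ge0 B2.
  have := ler_norm B0; have := ler_norm B1; have := ler_norm B2.
  by move=> ? ? ? ? ? ? [|[|[|//]]] x _; [have := h0 x|have := h1 x|have := h2 x]; lra.
split=> // x /ler_normlP[x1 x2].
have fl y : 1 <= y -> expR (-1) <= flat 0 y.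
  move=> y1; have y0 : 0 < y by lra.
  by rewrite /flat y0 expr0 invr1 mul1r ler_expR lerN2 invf_le1.
by rewrite F0; apply: ler_pM; rewrite ?expR_ge0//; apply: fl; lra.
Unshelve. all: by end_near. Qed.

End Cutoffs.

Section ProductCutoff.
Variables (R : realType) (n : nat).
Local Notation space := 'rV[R]_n.+1.
Local Notation e j := (delta_mx 0 j : space).
Variables (F : nat -> R -> R) (B c : R).
Hypothesis B1 : 1 <= B.
Hypothesis c0 : 0 < c.
Hypothesis DF : forall m (x : R), is_derive x (1 : R) (F m) (F m.+1 x).
Hypothesis FB : forall m x, (m <= 2)%N -> `|F m x| <= B.
Hypothesis F0 : forall m x, 2 < `|x| -> F m x = 0.
Hypothesis Fc : forall x, `|x| <= 1 -> c <= F 0 x.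
Variable k : R.
Hypothesis k1 : 1 <= k.

(** The m-th derivative along the coordinate j of the product cutoff of radius k; for m = 0 it is
    the same for all j. *)
Definition cut j m (z : space) : R :=
  k^-1 ^+ m * F m (k^-1 * z 0 j) * \prod_(l | l != j) F 0 (k^-1 * z 0 l).

Lemma cut0E j z : cut j 0 z = \prod_l F 0 (k^-1 * z 0 l).
Proof. by rewrite /cut expr0 mul1r [RHS](bigD1 j). Qed.

Lemma is_derive_cut j m z : is_derive z (e j) (cut j m) (cut j m.+1 z).
Proof.
have D l a : is_derive z (e j) (fun w : space => F a (k^-1 * w 0 l)) (F a.+1 (k^-1 * z 0 l) * (k^-1 * (l == j)%:R)).
  apply: (@is_derive_fcomp R _ (F a) (fun w : space => k^-1 * w 0 l) z (e j) _ _ (DF a _)).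
  apply: (is_derive_eq (is_derive_fM (is_derive_fcst k^-1 z (e j)) (is_derive_entry l z (e j)))).
  by rewrite mxE eqxx /=; ring.
have D0 : is_derive z (e j) (fun w : space => \prod_(l | l != j) F 0 (k^-1 * w 0 l)) 0.
  elim: (index_enum _) => [|l r IH].
    rewrite (_ : (fun w => _) = (fun=> 1)); first exact: is_derive_fcst.
    by apply: funext => w; rewrite big_nil.
  have [lj|lj] := eqVneq l j.
    rewrite (_ : (fun w => _) = (fun w : space => \prod_(l <- r | l != j) F 0 (k^-1 * w 0 l)))//.
    by apply: funext => w; rewrite big_cons lj eqxx.
  rewrite (_ : (fun w => _) = (fun w : space => F 0 (k^-1 * w 0 l) * \prod_(l <- r | l != j) F 0 (k^-1 * w 0 l))).
    by apply: (is_derive_eq (is_derive_fM (D l 0%N) IH)); rewrite (negPf lj) !mulr0 mul0r addr0.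
  by apply: funext => w; rewrite big_cons lj.
apply: (is_derive_eq (is_derive_fM (is_derive_fM (is_derive_fcst (k^-1 ^+ m) z (e j)) (D j m)) D0)).
by rewrite /cut eqxx exprS mul0r add0r !mulr0 addr0 mulr1 mulrA [_ * k^-1]mulrC mulrA.
Qed.

Let kp : 0 < k. Proof. exact: lt_le_trans k1. Qed.
Let ki : 0 <= k^-1 <= 1.
Proof. by rewrite invr_ge0 ltW//= invf_le1. Qed.

Lemma cut_out j m (z : space) l : 2 * k < `|z 0 l| -> cut j m z = 0.
Proof.
move=> hl; have h a : F a (k^-1 * z 0 l) = 0.
  by apply: F0; rewrite normrM gtr0_norm ?invr_gt0// mulrC ltr_pdivlMr.
rewrite /cut; have [<-|lj] := eqVneq l j; first by rewrite h mulr0 mul0r.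
by rewrite (bigD1 l)//= h mul0r mulr0.
Qed.

Lemma cut_bound j m (z : space) : (m <= 2)%N -> `|cut j m z| <= k^-1 ^+ m * B ^+ n.+1.
Proof.
move=> m2; rewrite /cut !normrM (ger0_norm (exprn_ge0 _ _)); last by case/andP: ki.
rewrite -mulrA ler_wpM2l ?exprn_ge0//; first by case/andP: ki.
rewrite exprS ler_pM ?FB//; rewrite normr_prod.
have : \prod_(l | l != j) `|F 0 (k^-1 * z 0 l)| <= \prod_(l | l != j) B.
  by apply: ler_prod => l _; rewrite normr_ge0 FB.
rewrite prodr_const; move/le_trans; apply.
suff -> : #|[pred l | l != j]| = n by [].
by have := cardC1 j; rewrite card_ord.
Qed.

Lemma cut_lower j (z : space) : (forall l, `|z 0 l| <= k) -> c ^+ n.+1 <= cut j 0 z.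
Proof.
move=> hz; rewrite cut0E -[n.+1 in X in X <= _]card_ord -prodr_const.
apply: ler_prod => l _; rewrite (ltW c0) Fc// normrM gtr0_norm ?invr_gt0//.
by rewrite mulrC ler_pdivrMr// mul1r.
Qed.

Lemma falg_cut j : falg (cut j 0).
Proof.
rewrite (_ : cut j 0 = fun z => \prod_l F 0 (k^-1 * z 0 l)); last by apply: funext => z; exact: cut0E.
apply: falg_prod => l; apply: (@falg_base R n (fun x => F 0 (k^-1 * x))).
rewrite (_ : (fun x => _) = (fun x => F 0 (k^-1 * x + 0))); last by apply: funext => x; rewrite addr0.
by apply: Cinf_affine; exists F.
Qed.

Lemma cut_continuous_measurable j m :
  measurable_fun setT (fun t => cut j m (@tuple_row R n t)).
Proof.
have mF a l : measurable_fun setT (fun t => F a (k^-1 * (@tuple_row R n t) 0 l)).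
  have cF : Cinf (fun x => F a (k^-1 * x + 0)).
    by apply: (@Cinf_affine R (F a)); exists (fun b => F (b + a)%N); split=> // b x; exact: DF.
  rewrite (_ : (fun t => _) = (fun x => F a (k^-1 * x + 0)) \o (fun t : n.+1.-tuple R => tnth t l)); last first.
    by apply: funext => t; rewrite /= mxE addr0.
  apply: measurableT_comp; last exact: measurable_tnth.
  by apply: continuous_measurable_fun => x; exact: Cinf_continuous.
rewrite /cut; apply: measurable_funM.
  by apply: measurable_funM => //; exact: measurable_cst.
elim: (index_enum _) => [|l r IH].
  by under eq_fun do rewrite big_nil; exact: measurable_cst.
have [lj|lj] := eqVneq l j.
  move: IH; congr (measurable_fun _ _); apply: funext => t.
  by rewrite big_cons lj eqxx.
by under eq_fun do rewrite big_cons lj; exact: measurable_funM.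
Qed.

End ProductCutoff.

(** * Bounded measurable fields and square integrability *)

Section BoundedMeasurable.
Variables (R : realType) (n : nat).
Local Notation space := 'rV[R]_n.+1.
Implicit Types f h : space -> R.

(** Measurability is asked on tuples, where the Lebesgue measure is built; [tuple_row] transports
    points to the space. *)
Definition bmeas f := measurable_fun setT (fun t => f (@tuple_row R n t)) /\
  exists B : R, forall z, `|f z| <= B.

Lemma bmeas_coord (u : R -> R) j : bcont u -> bmeas (fun z => u (z 0 j)).
Proof.
move=> [cu [B hB]]; split; last by exists B => z; exact: hB.
rewrite (_ : (fun t => _) = u \o (fun t => tnth t j)); last by apply: funext => t; rewrite /= mxE.
apply: measurableT_comp; last exact: measurable_tnth.
exact: continuous_measurable_fun.
Qed.

Lemma bmeas_cst r : bmeas (fun=> r).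
Proof. by split; [exact: measurable_cst|exists `|r|]. Qed.

Lemma bmeasD f h : bmeas f -> bmeas h -> bmeas (fun z => f z + h z).
Proof.
move=> [mf [A hA]] [mh [B hB]]; split; first exact: measurable_funD.
by exists (A + B) => z; apply: le_trans (ler_normD _ _) (lerD _ _).
Qed.

Lemma bmeasM f h : bmeas f -> bmeas h -> bmeas (fun z => f z * h z).
Proof.
move=> [mf [A hA]] [mh [B hB]]; split; first exact: measurable_funM.
by exists (A * B) => z; rewrite normrM ler_pM.
Qed.

Lemma bmeasN f : bmeas f -> bmeas (fun z => - f z).
Proof.
move=> [mf [A hA]]; split; last by exists A => z; rewrite normrN.
by rewrite (_ : (fun t => _) = (fun t => - (fun t => f (tuple_row t)) t)); first exact: measurable_funN.
Qed.

Lemma bmeasB f h : bmeas f -> bmeas h -> bmeas (fun z => f z - h z).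
Proof. by move=> bf bh; apply: bmeasD => //; exact: bmeasN. Qed.

Lemma bmeas_sum (J : Type) (r : seq J) (p : pred J) (f : J -> space -> R) :
  (forall j, bmeas (f j)) -> bmeas (fun z => \sum_(j <- r | p j) f j z).
Proof.
move=> bf; elim: r => [|j r IH].
  by under eq_fun do rewrite big_nil; exact: bmeas_cst.
case pj: (p j).
  by under eq_fun do rewrite big_cons pj; exact: bmeasD.
by under eq_fun do rewrite big_cons pj.
Qed.

Lemma bmeas_sel (i : 'I_2) (p : space -> R * R) :
  bmeas (fun z => (p z).1) -> bmeas (fun z => (p z).2) -> bmeas (fun z => sel i (p z)).
Proof. by rewrite /sel; case: (i == 0). Qed.

End BoundedMeasurable.

Ltac bmeas_tac := repeat first
  [ assumption | apply: bmeasB | apply: bmeasD | apply: bmeasM | apply: bmeasN | exact: bmeas_cst ].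

Section CompactlySupportedL2.
Variables (R : realType) (n : nat).
Local Notation space := 'rV[R]_n.+1.
Local Notation mu := (lebesgue_tuple R n.+1).
Local Notation C := R[i].

Lemma bmeas_Lfun (f : space -> R) (M : R) : 0 < M -> bmeas f ->
  (forall (z : space) l, M < `|z 0 l| -> f z = 0) -> (fun t => f (@tuple_row R n t)) \in Lfun mu 2%:E.
Proof.
move=> M0 [mf [B hB]] f0; rewrite inE; apply/andP; split; rewrite inE//=.
rewrite /finite_norm; apply: (@le_lt_trans _ _ ((Num.sqrt (B ^+ 2 * (2 * M) ^+ n.+1))%:E)); last exact: ltry.
apply: (@L2norm_le _ _ R mu _ (box M)) => //.
- exact: measurable_box.
- by rewrite exprn_ge0// mulr_ge0// ltW.
- exact: lebesgue_box.
- move=> t /existsNP[l /negP]; rewrite -ltNge => hl; apply: (f0 _ l).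
  by rewrite mxE.
- exact: le_trans (hB 0).
Qed.

Definition modulus (u : space -> 'cV[C]_2) z : R :=
  Num.sqrt (sqnorm (Re_field u z) + sqnorm (Im_field u z)).

Lemma modulusE (u : space -> 'cV[C]_2) z : modulus u z = Num.sqrt (complex.Re (u z 0 0) ^+ 2 + complex.Re (u z 1 0) ^+ 2
  + (complex.Im (u z 0 0) ^+ 2 + complex.Im (u z 1 0) ^+ 2)).
Proof. by rewrite /modulus !sqnormE !mxE. Qed.

Lemma modulus_measurable (u : space -> 'cV[C]_2) : (forall i, bmeas (fun z => complex.Re (u z i 0))) ->
  (forall i, bmeas (fun z => complex.Im (u z i 0))) ->
  measurable_fun setT (fun t => modulus u (@tuple_row R n t)).
Proof.
move=> bR bI; under eq_fun do rewrite modulusE.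
have m1 i : measurable_fun setT (fun t => complex.Re (u (@tuple_row R n t) i 0) ^+ 2).
  by apply: measurable_funX; have [] := bR i.
have m2 i : measurable_fun setT (fun t => complex.Im (u (@tuple_row R n t) i 0) ^+ 2).
  by apply: measurable_funX; have [] := bI i.
apply: (measurableT_comp (f := @Num.sqrt R)).
  by apply: continuous_measurable_fun; exact: sqrt_continuous.
by apply: measurable_funD; apply: measurable_funD.
Qed.

Lemma modulus_ge0 (u : space -> 'cV[C]_2) z : 0 <= modulus u z. Proof. exact: sqrtr_ge0. Qed.

Lemma modulus_le (u : space -> 'cV[C]_2) z (b : R) : 0 <= b -> (forall i, `|complex.Re (u z i 0)| <= b) ->
  (forall i, `|complex.Im (u z i 0)| <= b) -> modulus u z <= 2 * b.
Proof.
move=> b0 hR hI; rewrite modulusE -[2 * b]ger0_norm ?mulr_ge0// -sqrtr_sqr ler_wsqrtr//.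
have sq x : `|x| <= b -> x ^+ 2 <= b ^+ 2.
  by move=> xb; rewrite -[X in X <= _]real_normK ?num_real// lerXn2r ?nnegrE.
have := sq _ (hR 0); have := sq _ (hR 1); have := sq _ (hI 0); have := sq _ (hI 1).
by rewrite exprMn; lra.
Qed.

Lemma L2norm_modulus (u : space -> 'cV[C]_2) : L2norm u = Lnorm mu 2%:E (EFin \o (fun t => modulus u (@tuple_row R n t))).
Proof. by []. Qed.

Lemma L2norm_sub_self (u : space -> 'cV[C]_2) : L2norm (fun z => u z - u z) = 0%E.
Proof.
rewrite L2norm_modulus (_ : _ \o _ = fun=> 0%E); first by rewrite Lnorm0 ?pnatr_eq0.
by apply: funext => t /=; rewrite modulusE subrr !mxE /= expr0n !addr0 sqrtr0.
Qed.

End CompactlySupportedL2.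

Section BoundedMeasurableFamilies.
Variables (R : realType) (n : nat).
Local Notation space := 'rV[R]_n.+1.

Lemma bmeas_uniform (J : finType) (f : J -> space -> R) : (forall j, bmeas (f j)) ->
  exists2 G : R, 0 <= G & forall j z, `|f j z| <= G.
Proof.
move=> bf; have [g hg] := choice (fun j => (bf j).2).
exists (\sum_j `|g j|) => [|j z]; first by apply: sumr_ge0 => j _.
apply: le_trans (hg j z) _; apply: le_trans (ler_norm _) _.
by rewrite (bigD1 j)//= lerDl; apply: sumr_ge0 => l _.
Qed.

Lemma bmeas_hess (k k1 k2 w1 w2 : space -> R) (om c : R) (V V1 V2 v v1 v2 : space -> R * R) i :
  let bp p := bmeas (fun z => (p z : R * R).1) /\ bmeas (fun z => (p z : R * R).2) in
  [/\ bmeas k, bmeas k1, bmeas k2, bmeas w1 & bmeas w2] ->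
  [/\ bp V, bp V1, bp V2, bp v & bp v1] -> bp v2 ->
  bmeas (fun z => sel i (hess (k z) (k1 z) (k2 z) (w1 z) (w2 z) om c (V z) (V1 z) (V2 z) (v z) (v1 z) (v2 z))).
Proof.
move=> bp [b1 b2 b3 b4 b5] [[p1 p2] [p3 p4] [p5 p6] [p7 p8] [p9 p10]] [p11 p12].
by apply: bmeas_sel; rewrite /hess /hess0 /vdot /vJ /=; bmeas_tac.
Qed.

End BoundedMeasurableFamilies.

Section Strips.
Variable R : realType.

(** The modulus of the Bloch wave may vanish somewhere, but it is bounded below near one point and,
    having period 1 in the scaled variable, near all its integer translates. N of these carry the
    lower bound on the L2 norm, their total length being proportional to N. *)
Definition strips (s0 dl : R) N : set R :=
  [set s | exists2 m : nat, (m < N)%N & `|s - (s0 + m%:R)| < dl].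

Lemma strips_measure N (s0 dl : R) : 0 < dl -> 2 * dl <= 1 ->
  measurable (strips s0 dl N) /\ lebesgue_measure (strips s0 dl N) = (2 * dl * N%:R)%:E.
Proof.
move=> d0 d1; elim: N => [|N [mN lN]].
  rewrite (_ : strips s0 dl 0 = set0); first by rewrite measure0 mulr0; split.
  by apply/seteqP; split=> s // -[].
pose I : set R := `]s0 + N%:R - dl, s0 + N%:R + dl[%classic.
have IE s : I s <-> `|s - (s0 + N%:R)| < dl.
  by rewrite /I /= in_itv/= ltr_distl; split.
have mI : measurable I by exact: measurable_itv.
have E : strips s0 dl N.+1 = strips s0 dl N `|` I.
  apply/seteqP; split=> s.
    move=> [m]; rewrite ltnS leq_eqVlt => /orP[/eqP-> /IE|mN' hs]; first by right.
    by left; exists m.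
  move=> [[m mN' hs]|/IE hs]; first by exists m => //; exact: ltnW.
  by exists N.
have dis : strips s0 dl N `&` I = set0.
  apply/seteqP; split=> s // -[[m mN' hs] /IE].
  have : (m.+1%:R : R) <= N%:R by rewrite ler_nat.
  rewrite -natr1; move: hs; rewrite !ltr_distl => /andP[? ?] ? /andP[? ?]; lra.
rewrite E; split; first exact: measurableU.
transitivity (lebesgue_measure (strips s0 dl N) + lebesgue_measure I)%E; first exact: measureU.
rewrite lN lebesgue_measure_itv/= lte_fin (_ : _ < _ = true); last by lra.
by rewrite -EFinB -EFinD -natr1; congr (_%:E); ring.
Qed.

(** Keeps the strips inside the region |x| <= 2 N, where the cutoff of radius 2 N is bounded
    below. *)
Lemma strip_bound (s0 dl m N y : R) : 0 <= m -> m + 1 <= N -> 2 * dl <= 1 ->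
  `|s0| + 1 <= N -> s0 + m - dl < y -> y < s0 + m + dl -> `|y| <= 2 * N.
Proof.
move=> m0 mN dl1 hN y1 y2; have s00 := normr_ge0 s0.
have h1 := ler_norm s0; have := ler_norm (- s0); rewrite normrN => h2.
by rewrite ler_norml; apply/andP; split; lra.
Qed.

Lemma measurable_forall_lift n (M : R) :
  measurable [set t : n.+1.-tuple R | forall j, `|tnth t (lift ord0 j)| <= M].
Proof.
apply: measurable_forall => j.
apply: (@measurable_coordinate R n.+1 (lift ord0 j) [set x : R | `|x| <= M]).
rewrite (_ : [set x | _] = `[- M, M]%classic); first exact: measurable_itv.
by apply/seteqP; split=> x /=; rewrite in_itv/= ler_norml.
Qed.

End Strips.

Section WeylSequence.
Variables (R : realType) (n : nat).
Local Notation space := 'rV[R]_n.+1.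
Local Notation e j := (delta_mx 0 j : space).
Local Notation C := R[i].
Variables (K K1 K2 Wf W1 W2 : R -> R).
Hypothesis DK : forall x : R, is_derive x (1 : R) K (K1 x).
Hypothesis DK1 : forall x : R, is_derive x (1 : R) K1 (K2 x).
Hypothesis DW : forall x : R, is_derive x (1 : R) Wf (W1 x).
Hypothesis DW1 : forall x : R, is_derive x (1 : R) W1 (W2 x).
Variables (X xi eta om c l1 l2 : R) (j1 : 'I_n.+1) (P a b : nat -> R -> R * R).
Hypothesis X_gt0 : 0 < X.
Hypothesis j10 : j1 != 0.

Definition jet_derive (f : nat -> R -> R * R) := forall m (x : R), (m < 2)%N ->
  is_derive x (1 : R) (fun t => (f m t).1) (f m.+1 x).1 /\
  is_derive x (1 : R) (fun t => (f m t).2) (f m.+1 x).2.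
Hypotheses (DP : jet_derive P) (Da : jet_derive a) (Db : jet_derive b).

Definition pair_Cinf (f : R -> R * R) := Cinf (fun x => (f x).1) /\ Cinf (fun x => (f x).2).
Definition pair_bcont (f : R -> R * R) := bcont (fun x => (f x).1) /\ bcont (fun x => (f x).2).
Hypotheses (cP : pair_Cinf (P 0%N)) (ca : pair_Cinf (a 0%N)) (cb : pair_Cinf (b 0%N)).
Hypothesis bP : forall m, (m <= 2)%N -> pair_bcont (P m).
Hypotheses (ba : forall m, (m <= 1)%N -> pair_bcont (a m))
  (bb : forall m, (m <= 1)%N -> pair_bcont (b m)).

Local Notation rh x := ((P 0%N x).1 ^+ 2 + (P 0%N x).2 ^+ 2).
Hypotheses (bK : bcont (fun x => K (rh x))) (bK1 : bcont (fun x => K1 (rh x)))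
  (bK2 : bcont (fun x => K2 (rh x))) (bW1 : bcont (fun x => W1 (rh x)))
  (bW2 : bcont (fun x => W2 (rh x))).

Local Notation hessP x := (hess (K (rh x)) (K1 (rh x)) (K2 (rh x)) (W1 (rh x)) (W2 (rh x)) om c
  (P 0%N x) (P 1%N x) (P 2%N x)).
(** Together with [eqb]: the real and imaginary parts of Hess v + eta^2 kappa v = - lambda J v, for
    v = a + i b and lambda = l1 + i l2. *)
Hypothesis eqa : forall x, hessP x (a 0%N x) (a 1%N x) (a 2%N x) =
  (- (l1 * (a 0%N x).2 - l2 * (b 0%N x).2) - eta ^+ 2 * K (rh x) * (a 0%N x).1,
   l1 * (a 0%N x).1 - l2 * (b 0%N x).1 - eta ^+ 2 * K (rh x) * (a 0%N x).2).
Hypothesis eqb : forall x, hessP x (b 0%N x) (b 1%N x) (b 2%N x) =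
  (- (l1 * (b 0%N x).2 + l2 * (a 0%N x).2) - eta ^+ 2 * K (rh x) * (b 0%N x).1,
   l1 * (b 0%N x).1 + l2 * (a 0%N x).1 - eta ^+ 2 * K (rh x) * (b 0%N x).2).

Let X0 : X != 0. Proof. by rewrite gt_eqF. Qed.
Let Zero : nat -> R -> R * R := fun _ _ => (0, 0).
Let DZ : jet_derive Zero.
Proof. by move=> m x _; split; exact: is_derive_fcst. Qed.

(** The profile is treated as a wave with eta = 0 and zero imaginary part, so its derivatives are
    instances of those of waves. *)
Definition profile_field : space -> 'cV[R]_2 := wave_field X xi 0 j1 P Zero true.
Local Notation Vf := profile_field.
Local Notation A := (@scaled_density R n K Wf X^-1 (xi / X) om c).
Local Notation wv := (@wave R n X xi eta j1 a b).
Local Notation ph := (@wave_field R n X xi eta j1 a b).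
Local Notation dwv := (@dwave R n X xi eta j1 a b).
Local Notation tP m z := (trans X xi (P m) (z 0 0)).
Local Notation xx z := (X * z 0 0).
Local Notation hs z := (hess (K (rh (xx z))) (K1 (rh (xx z))) (K2 (rh (xx z)))
  (W1 (rh (xx z))) (W2 (rh (xx z))) om c (tP 0%N z) (tP 1%N z) (tP 2%N z)).

Lemma wave_profileE m (z : space) : wave X xi 0 j1 P Zero true m z = tP m z.
Proof.
rewrite /wave mul0r cos0 sin0 !mul1r !mul0r !subr0.
by rewrite -surjective_pairing.
Qed.

Lemma profile_pair (z : space) : pair_of (Vf z) = tP 0%N z.
Proof.
by rewrite [RHS]surjective_pairing; congr (_, _); rewrite wave_fieldE wave_profileE.
Qed.

Lemma profile_twd (z : space) : twd X^-1 (xi / X) Vf z = tP 1%N z.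
Proof. by rewrite (twd_wave xi 0 X0 j10 DP DZ) wave_profileE. Qed.

Lemma profile_twdd (z : space) : twdd X^-1 (xi / X) Vf z = tP 2%N z.
Proof. by rewrite (twdd_wave xi 0 X0 j10 DP DZ) wave_profileE. Qed.

Lemma profile_sqnorm (z : space) : Vf z 0 0 ^+ 2 + Vf z 1 0 ^+ 2 = rh (xx z).
Proof.
have [-> ->] : Vf z 0 0 = (tP 0%N z).1 /\ Vf z 1 0 = (tP 0%N z).2.
  by rewrite !wave_fieldE wave_profileE.
rewrite /trans /rot /=; have cs := cos2Dsin2 (xi * z 0 0).
by rewrite -[RHS]mul1r -cs; ring.
Qed.

Lemma profile_pd j k (z : space) : j != 0 -> pd Vf j k z = 0 /\ pdd Vf j k z = 0.
Proof.
move=> j0; rewrite (pdE (is_derive_wave_field X xi 0 j10 DP DZ true j)).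
rewrite (pddE (is_derive_wave_field X xi 0 j10 DP DZ true j) (is_derive_dwave X xi 0 j10 DP DZ true j)).
by rewrite /ddwave /dwave (negPf j0) oppr0 mulr0 mul0r expr0n /= mulr0 mul0r oppr0.
Qed.

Lemma profile_smooth_field : smooth_on setT Vf.
Proof.
have c0 : Cinf (fun _ : R => 0 : R) := Cinf_cst 0.
apply: falg_smooth => i; apply: falg_wave; [exact: cP.1|exact: cP.2|exact: c0|exact: c0].
Qed.

(** Equivariance of [hess] carries the equations for a and b to the scaled frame; linearity then
    combines them with the coefficients cos and sin of the plane wave. *)
Lemma wave_eigen (z : space) :
  hs z (wv true 0 z) (wv true 1 z) (wv true 2 z) =
  (- (l1 * (wv true 0 z).2 - l2 * (wv false 0 z).2) - eta ^+ 2 * K (rh (xx z)) * (wv true 0 z).1,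
   l1 * (wv true 0 z).1 - l2 * (wv false 0 z).1 - eta ^+ 2 * K (rh (xx z)) * (wv true 0 z).2) /\
  hs z (wv false 0 z) (wv false 1 z) (wv false 2 z) =
  (- (l1 * (wv false 0 z).2 + l2 * (wv true 0 z).2) - eta ^+ 2 * K (rh (xx z)) * (wv false 0 z).1,
   l1 * (wv false 0 z).1 + l2 * (wv true 0 z).1 - eta ^+ 2 * K (rh (xx z)) * (wv false 0 z).2).
Proof.
have cs : cos (xi * z 0 0) ^+ 2 + (- sin (xi * z 0 0)) ^+ 2 = 1 by rewrite sqrrN cos2Dsin2.
have Ha := hess_rot (K (rh (xx z))) (K1 (rh (xx z))) (K2 (rh (xx z))) (W1 (rh (xx z)))
  (W2 (rh (xx z))) om c (P 0%N (xx z)) (P 1%N (xx z)) (P 2%N (xx z))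
  (a 0%N (xx z)) (a 1%N (xx z)) (a 2%N (xx z)) cs.
have Hb := hess_rot (K (rh (xx z))) (K1 (rh (xx z))) (K2 (rh (xx z))) (W1 (rh (xx z)))
  (W2 (rh (xx z))) om c (P 0%N (xx z)) (P 1%N (xx z)) (P 2%N (xx z))
  (b 0%N (xx z)) (b 1%N (xx z)) (b 2%N (xx z)) cs.
rewrite eqa -!/(trans X xi _ (z 0 0)) in Ha; rewrite eqb -!/(trans X xi _ (z 0 0)) in Hb.
have L1 := hess_linear (K (rh (xx z))) (K1 (rh (xx z))) (K2 (rh (xx z))) (W1 (rh (xx z)))
  (W2 (rh (xx z))) om c (tP 0%N z) (tP 1%N z) (tP 2%N z) (cos (eta * z 0 j1)) (- sin (eta * z 0 j1))
  (trans X xi (a 0%N) (z 0 0)) (trans X xi (a 1%N) (z 0 0)) (trans X xi (a 2%N) (z 0 0))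
  (trans X xi (b 0%N) (z 0 0)) (trans X xi (b 1%N) (z 0 0)) (trans X xi (b 2%N) (z 0 0)).
have L2 := hess_linear (K (rh (xx z))) (K1 (rh (xx z))) (K2 (rh (xx z))) (W1 (rh (xx z)))
  (W2 (rh (xx z))) om c (tP 0%N z) (tP 1%N z) (tP 2%N z) (cos (eta * z 0 j1)) (sin (eta * z 0 j1))
  (trans X xi (b 0%N) (z 0 0)) (trans X xi (b 1%N) (z 0 0)) (trans X xi (b 2%N) (z 0 0))
  (trans X xi (a 0%N) (z 0 0)) (trans X xi (a 1%N) (z 0 0)) (trans X xi (a 2%N) (z 0 0)).
rewrite !mulNr in L1; rewrite Ha Hb in L1; rewrite Ha Hb in L2.
rewrite /wave L1 L2; move: (K (rh (xx z))) => Kz.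
by rewrite /trans /rot /=; split; congr (_, _); ring.
Qed.

(** [error1] and [error2] are the coefficients of the first and second derivatives of the cutoff in
    its commutator with the linearized operator. They do not involve the radius k. *)
Definition error1 r i (j : 'I_n.+1) (z : space) : R :=
  if j == 0 then X^-1 * sel i (hs z (0, 0) (wv r 0 z) (2 * (wv r 1 z).1, 2 * (wv r 1 z).2))
  else - (2 * (K (rh (xx z)) * dwv r 0 j i z)).
Definition error2 r i (j : 'I_n.+1) (z : space) : R :=
  if j == 0 then X^-1 ^+ 2 * sel i (hs z (0, 0) (0, 0) (wv r 0 z))
  else - (K (rh (xx z)) * sel i (wv r 0 z)).

Lemma bmeas_trans_coord (f : R -> R * R) : pair_bcont f ->
  bmeas (fun z : space => (trans X xi f (z 0 0)).1) /\ bmeas (fun z : space => (trans X xi f (z 0 0)).2).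
Proof.
move=> [c1 c2]; have [b1 b2] := trans_bcont X xi c1 c2.
by split; [exact: (bmeas_coord 0 b1)|exact: (bmeas_coord 0 b2)].
Qed.

Lemma bmeas_wave r m : (m <= 1)%N ->
  bmeas (fun z => (wv r m z).1) /\ bmeas (fun z => (wv r m z).2).
Proof.
move=> m1; have [a1 a2] := bmeas_trans_coord (ba m1); have [b1 b2] := bmeas_trans_coord (bb m1).
have lin : continuous (fun x : R => eta * x) by exact: mulrl_continuous.
have bc : bmeas (fun z : space => cos (eta * z 0 j1)).
  apply: (bmeas_coord j1 (u := fun x => cos (eta * x))); split.
    by move=> x; apply: (@continuous_comp _ _ _ (fun x : R => eta * x)); [exact: lin|exact: continuous_cos].
  by exists 1 => x; rewrite ler_norml cos_geN1 cos_le1.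
have bs : bmeas (fun z : space => sin (eta * z 0 j1)).
  apply: (bmeas_coord j1 (u := fun x => sin (eta * x))); split.
    by move=> x; apply: (@continuous_comp _ _ _ (fun x : R => eta * x)); [exact: lin|exact: continuous_sin].
  by exists 1 => x; rewrite ler_norml sin_geN1 sin_le1.
by rewrite /wave; case: r; split=> /=; bmeas_tac.
Qed.

Lemma bmeas_coef (f : R -> R) : bcont (fun x => f (rh x)) -> bmeas (fun z : space => f (rh (xx z))).
Proof.
move=> [cf [B hB]]; apply: (bmeas_coord 0 (u := fun x => f (rh (X * x)))); split; last by exists B => x; exact: hB.
move=> x; apply: (@continuous_comp _ _ _ (fun x : R => X * x) (fun x => f (rh x))); last exact: cf.
exact: mulrl_continuous.
Qed.

Lemma bmeas_error12 r i j : bmeas (error1 r i j) /\ bmeas (error2 r i j).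
Proof.
have [w1 w2] := @bmeas_wave r 0 isT; have [w3 w4] := @bmeas_wave r 1 isT.
have bK0 := bmeas_coef bK; have c0 x := @bmeas_cst R n x.
have [p1 p2] := (bmeas_trans_coord (bP (leq0n 2)), bmeas_trans_coord (@bP 1 isT)).
have p3 := bmeas_trans_coord (@bP 2 isT).
have cf := And5 bK0 (bmeas_coef bK1) (bmeas_coef bK2) (bmeas_coef bW1) (bmeas_coef bW2).
rewrite /error1 /error2; case: (j == 0); split.
- apply: bmeasM => //; apply: bmeas_hess => //=; last by split; apply: bmeasM.
- apply: bmeasM => //; apply: bmeas_hess => //=.
- apply/bmeasN/bmeasM => //; apply: bmeasM => //; rewrite /dwave.
  have s2 : bmeas (fun z => sel i (wv (~~ r) 0 z)) by have [] := @bmeas_wave (~~ r) 0 isT; exact: bmeas_sel.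
  case: (j == 0); last by apply: bmeasM.
  by apply: bmeasB; apply: bmeasM => //; apply: bmeas_sel => //=; exact: bmeasN.
- by apply/bmeasN/bmeasM => //; exact: bmeas_sel.
Qed.

Lemma error12_bound : exists2 G : R, 0 <= G &
  forall r i j z, `|error1 r i j z| <= G /\ `|error2 r i j z| <= G.
Proof.
have [G1 G10 h1] := bmeas_uniform (fun p : bool * 'I_2 * 'I_n.+1 => (bmeas_error12 p.1.1 p.1.2 p.2).1).
have [G2 G20 h2] := bmeas_uniform (fun p : bool * 'I_2 * 'I_n.+1 => (bmeas_error12 p.1.1 p.1.2 p.2).2).
exists (G1 + G2) => [|r i j z]; first exact: addr_ge0.
by split; [apply: le_trans (h1 (r, i, j) z) _|apply: le_trans (h2 (r, i, j) z) _]; lra.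
Qed.

Section Localization.
Variables (F : nat -> R -> R) (B cc k : R).
Hypothesis B1 : 1 <= B.
Hypothesis cc0 : 0 < cc.
Hypothesis DF : forall m (x : R), is_derive x (1 : R) (F m) (F m.+1 x).
Hypothesis FB : forall m x, (m <= 2)%N -> `|F m x| <= B.
Hypothesis F0 : forall m x, 2 < `|x| -> F m x = 0.
Hypothesis Fc : forall x, `|x| <= 1 -> cc <= F 0 x.
Hypothesis k1 : 1 <= k.
Local Notation ct := (@cut R n F k).

Definition error r i (z : space) : R :=
  \sum_j (ct j 1 z * error1 r i j z + ct j 2 z * error2 r i j z).

Lemma cutE j j' : ct j 0 = ct j' 0.
Proof. by apply: funext => z; rewrite !cut0E. Qed.

(** The transverse second derivatives of the plane wave give the term in eta^2 kappa; every term
    that differentiates the cutoff goes to [error]. *)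
Lemma Hess_cut r i (z : space) : Hess A Vf (fun w => ct 0 0 w *: ph r w) z i 0 =
  ct 0 0 z * (sel i (hs z (wv r 0 z) (wv r 1 z) (wv r 2 z)) + eta ^+ 2 * K (rh (xx z)) * sel i (wv r 0 z))
  + error r i z.
Proof.
have sh : smooth_on setT (fun w => ct 0 0 w *: ph r w).
  apply: falg_smooth => l; rewrite (_ : (fun z => _) = (fun z => ct 0 0 z * ph r z l 0)).
    apply: falg_mul; first exact: falg_cut.
    by apply: falg_wave; [exact: ca.1|exact: ca.2|exact: cb.1|exact: cb.2].
  by apply: funext => w; rewrite mxE.
have pdh j l w := @pd_mulr R n (ct 0 0) (ph r) (ct j 1) (ct j 2) j (dwv r 0 j) (ddwave X xi eta j1 a b r j)
  (fun z => eq_rect _ (fun f => is_derive z (e j) f (ct j 1 z)) (is_derive_cut DF k j 0 z) _ (cutE j 0))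
  (is_derive_cut DF k j 1) (is_derive_wave_field X xi eta j10 Da Db r j) (is_derive_dwave X xi eta j10 Da Db r j) l w.
rewrite (HessE DK DK1 DW DW1 X^-1 (xi / X) om c profile_smooth_field sh i
  (fun j l j0 => (profile_pd l z j0).1) (fun j l j0 => (profile_pd l z j0).2)) /=.
rewrite profile_pair profile_twd profile_twdd profile_sqnorm.
have hE l : (ct 0 0 z *: ph r z) l 0 = ct 0 0 z * sel l (wv r 0 z) by rewrite mxE wave_fieldE.
have pE : pair_of (ct 0 0 z *: ph r z) = (ct 0 0 z * (wv r 0 z).1, ct 0 0 z * (wv r 0 z).2).
  by rewrite /pair_of !hE.
have tE : twd X^-1 (xi / X) (fun w => ct 0 0 w *: ph r w) z =
   (ct 0 0 z * (wv r 1 z).1 + X^-1 * ct 0 1 z * (wv r 0 z).1,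
    ct 0 0 z * (wv r 1 z).2 + X^-1 * ct 0 1 z * (wv r 0 z).2).
  rewrite /twd !(pdh _ _ _).1 !hE !wave_fieldE /dwave eqxx /sel /vJ /=.
  by congr (_, _); field.
have ttE : twdd X^-1 (xi / X) (fun w => ct 0 0 w *: ph r w) z =
   (ct 0 0 z * (wv r 2 z).1 + 2 * (X^-1 * ct 0 1 z) * (wv r 1 z).1 + X^-1 ^+ 2 * ct 0 2 z * (wv r 0 z).1,
    ct 0 0 z * (wv r 2 z).2 + 2 * (X^-1 * ct 0 1 z) * (wv r 1 z).2 + X^-1 ^+ 2 * ct 0 2 z * (wv r 0 z).2).
  rewrite /twdd !(pdh _ _ _).2 !(pdh _ _ _).1 !hE !wave_fieldE /ddwave /dwave eqxx /sel /vJ /=.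
  by congr (_, _); field.
have errE : error r i z = ct 0 1 z * (X^-1 * sel i (hs z (0, 0) (wv r 0 z) (2 * (wv r 1 z).1, 2 * (wv r 1 z).2)))
    + ct 0 2 z * (X^-1 ^+ 2 * sel i (hs z (0, 0) (0, 0) (wv r 0 z)))
    + \sum_(j | j != 0) (ct j 1 z * error1 r i j z + ct j 2 z * error2 r i j z).
  by rewrite /error (bigD1 0).
have sumE : \sum_(j | j != 0) K (rh (xx z)) * pdd (fun w => ct 0 0 w *: ph r w) j i z =
   - (ct 0 0 z * (eta ^+ 2 * K (rh (xx z)) * sel i (wv r 0 z)))
   - \sum_(j | j != 0) (ct j 1 z * error1 r i j z + ct j 2 z * error2 r i j z).
  have E1 : \sum_(j | j != 0) (if j == j1 then - (ct 0 0 z * (eta ^+ 2 * K (rh (xx z)) * sel i (wv r 0 z))) else 0)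
      = - (ct 0 0 z * (eta ^+ 2 * K (rh (xx z)) * sel i (wv r 0 z))).
    by rewrite (bigD1 j1)//= eqxx big1 ?addr0// => j /andP[_ /negPf ->].
  rewrite -{}E1 -sumrB; apply: eq_bigr => j j0.
  rewrite (pdh _ _ _).2 wave_fieldE /ddwave /error1 /error2 (negPf j0).
  by case: (j == j1) => /=; ring.
rewrite pE tE ttE hess_cutoff errE sumE; move: (\sum_(j | j != 0) _) => S.
by rewrite /sel /=; case: (i == 0) => /=; ring.
Qed.

Lemma bmeas_cut j m : (m <= 2)%N -> bmeas (ct j m).
Proof.
move=> m2; split; first exact: (cut_continuous_measurable DF).
by exists (k^-1 ^+ m * B ^+ n.+1) => z; exact: (cut_bound FB k1).
Qed.

Lemma bmeas_error r i : bmeas (error r i).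
Proof.
apply: bmeas_sum => j; have [b1 b2] := bmeas_error12 r i j.
by apply: bmeasD; apply: bmeasM => //; exact: bmeas_cut.
Qed.

Lemma error_out r i (z : space) l : 2 * k < `|z 0 l| -> error r i z = 0.
Proof.
move=> hl; rewrite /error big1// => j _.
by rewrite !(cut_out F0 k1 _ _ hl) !mul0r addr0.
Qed.

(** Each derivative of the cutoff gains a factor 1 / k, and k^-2 <= k^-1 because k >= 1. *)
Lemma error_le (G : R) r i (z : space) : 0 <= G ->
  (forall r i j z, `|error1 r i j z| <= G /\ `|error2 r i j z| <= G) ->
  `|error r i z| <= k^-1 * (n.+1%:R * (2 * (B ^+ n.+1 * G))).
Proof.
move=> G0 hG; have k0 : 0 < k by exact: lt_le_trans k1.
have ki : 0 <= k^-1 <= 1 by rewrite invr_ge0 ltW//= invf_le1.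
have BG : 0 <= B ^+ n.+1 by rewrite exprn_ge0// (le_trans ler01).
apply: le_trans (ler_norm_sum _ _ _) _.
have -> : k^-1 * (n.+1%:R * (2 * (B ^+ n.+1 * G))) = \sum_(j < n.+1) k^-1 * (2 * (B ^+ n.+1 * G)).
  by rewrite sumr_const card_ord -[RHS]mulr_natl mulrCA.
apply: ler_sum => j _.
have [h1 h2] := hG r i j z.
have c1 := @cut_bound R n F B FB k k1 j 1 z isT; have c2 := @cut_bound R n F B FB k k1 j 2 z isT.
have e1 : `|ct j 1 z * error1 r i j z| <= k^-1 * (B ^+ n.+1 * G).
  by rewrite normrM mulrA ler_pM//; rewrite expr1 in c1.
have e2 : `|ct j 2 z * error2 r i j z| <= k^-1 * (B ^+ n.+1 * G).
  rewrite normrM mulrA ler_pM//; apply: le_trans c2 _; rewrite ler_wpM2r// expr2.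
  by rewrite ler_piMr//; case/andP: ki.
by apply: le_trans (ler_normD _ _) _; rewrite mulrCA; move: (k^-1 * _) e1 e2 => ?; lra.
Qed.

Definition packet (z : space) : 'cV[C]_2 :=
  \col_i Complex (ct 0 0 z * sel i (wv true 0 z)) (ct 0 0 z * sel i (wv false 0 z)).

Lemma Re_packet : Re_field packet = fun z => ct 0 0 z *: ph true z.
Proof. by apply: funext => z; apply/colP => i; rewrite !mxE. Qed.

Lemma Im_packet : Im_field packet = fun z => ct 0 0 z *: ph false z.
Proof. by apply: funext => z; apply/colP => i; rewrite !mxE. Qed.

Local Notation L := (linearized A Vf).

Lemma linearized_packet i (z : space) :
  complex.Re (L packet z i 0) = ct 0 0 z * (l1 * sel i (wv true 0 z) - l2 * sel i (wv false 0 z))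
    + (if i == 0 then error true 1 z else - error true 0 z) /\
  complex.Im (L packet z i 0) = ct 0 0 z * (l1 * sel i (wv false 0 z) + l2 * sel i (wv true 0 z))
    + (if i == 0 then error false 1 z else - error false 0 z).
Proof.
have [E1 E2] := wave_eigen z.
have HT l := Hess_cut true l z; have HF l := Hess_cut false l z.
rewrite E1 in HT; rewrite E2 in HF.
rewrite /linearized mxE Re_packet Im_packet.
move: (HT 0) (HT 1) (HF 0) (HF 1) => {HT HF E1 E2}.
move: (Hess A Vf (fun w => ct 0 0 w *: ph true w) z) (Hess A Vf (fun w => ct 0 0 w *: ph false w) z).
move: (error true 0 z) (error true 1 z) (error false 0 z) (error false 1 z) (ct 0 0 z) (K _).
move: (wv true 0 z) (wv false 0 z) => p q e0 e1 e2 e3 x Kz HT HF h0 h1 h2 h3.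
by elim/ord2_ind: i; rewrite ?Jmx0 ?Jmx1 ?h0 ?h1 ?h2 ?h3 /sel /=; split; ring.
Qed.

Lemma residual i (z : space) :
  complex.Re ((Complex l1 l2 *: packet z - L packet z) i 0) =
    - (if i == 0 then error true 1 z else - error true 0 z) /\
  complex.Im ((Complex l1 l2 *: packet z - L packet z) i 0) =
    - (if i == 0 then error false 1 z else - error false 0 z).
Proof.
have [E1 E2] := linearized_packet i z.
rewrite mxE [X in X + _]mxE [X in _ + X]mxE [packet z i 0]mxE ReD ImD ReN ImN E1 E2 /=.
by split; ring.
Qed.

End Localization.

(** The rotation and the plane wave factor are isometries, so the modulus is that of the Bloch
    solution. *)
Lemma wave_norm (z : space) : (wv true 0 z).1 ^+ 2 + (wv true 0 z).2 ^+ 2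
    + ((wv false 0 z).1 ^+ 2 + (wv false 0 z).2 ^+ 2) =
  (a 0%N (xx z)).1 ^+ 2 + (a 0%N (xx z)).2 ^+ 2 + ((b 0%N (xx z)).1 ^+ 2 + (b 0%N (xx z)).2 ^+ 2).
Proof.
have c1 := cos2Dsin2 (xi * z 0 0); have c2 := cos2Dsin2 (eta * z 0 j1).
rewrite /wave /trans /rot /=.
move: (a 0%N (xx z)) (b 0%N (xx z)) (cos (xi * z 0 0)) (sin (xi * z 0 0)) (cos (eta * z 0 j1)) (sin (eta * z 0 j1)) c1 c2 => p q C1 S1 C2 S2 c1 c2.
by rewrite -[RHS]mul1r -c1 -[RHS]mul1r -c2; ring.
Qed.

Variables (s0 dl c1 : R).
Hypotheses (dl0 : 0 < dl) (dl1 : 2 * dl <= 1) (c10 : 0 < c1).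
Hypothesis low : forall (m : nat) (s : R), `|s - (s0 + m%:R)| < dl ->
  c1 ^+ 2 <= (a 0%N (X * s)).1 ^+ 2 + (a 0%N (X * s)).2 ^+ 2
    + ((b 0%N (X * s)).1 ^+ 2 + (b 0%N (X * s)).2 ^+ 2).

Theorem weyl_spectrum : in_spectrum (linearized A Vf) (Complex l1 l2).
Proof.
move=> [[Kc hK] _].
have [F [B [cc [B1 cc0 DF FB [F0 Fc]]]]] := cutoff_exists R.
have [G G0 hG] := error12_bound.
(* D / k bounds the components of the residual, and c2 bounds the packet from below on the
   strips. *)
pose D := n.+1%:R * (2 * (B ^+ n.+1 * G)); pose c2 := cc ^+ n.+1 * c1.
have BG : 0 <= B ^+ n.+1 by rewrite exprn_ge0// (le_trans ler01).
have D0 : 0 <= D by rewrite /D !mulr_ge0.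
have c20 : 0 < c2 by rewrite mulr_gt0// exprn_gt0.
(* The resolvent estimate for the packet of radius k = 2 N, squared. On the left is c2^2 times the
   volume of the cylinder over N strips; on the right, the squared bound of the residual times the
   volume of the box of half-side 2 k that supports it. *)
have main (N : nat) : `|s0| + 1 <= N%:R -> let k := 2 * N%:R in
    c2 ^+ 2 * ((2 * dl * N%:R) * (2 * k) ^+ n) <=
    Kc ^+ 2 * ((2 * (k^-1 * D)) ^+ 2 * (2 * (2 * k)) ^+ n.+1).
  move=> hN /=; set k := 2 * N%:R; have s00 := normr_ge0 s0.
  have k1 : 1 <= k by rewrite /k; lra.
  have kp : 0 < k by exact: lt_le_trans k1.
  have ki : 0 <= k^-1 by rewrite invr_ge0 ltW.
  have k2 : 0 < 2 * k by lra.
  have kD : 0 <= k^-1 * D by rewrite mulr_ge0.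
  pose u := packet F k.
  have err r i z := error_le B1 FB k1 r i z G0 hG.
  have bct := bmeas_cut DF FB k1 (0 : 'I_n.+1) (leq0n 2).
  have bw r i : bmeas (fun z => sel i (wv r 0 z)).
    by have [] := @bmeas_wave r 0 isT; exact: bmeas_sel.
  have bR i : bmeas (fun z => complex.Re (u z i 0)).
    by under eq_fun do rewrite mxE /=; exact: (bmeasM bct (bw true i)).
  have bI i : bmeas (fun z => complex.Im (u z i 0)).
    by under eq_fun do rewrite mxE /=; exact: (bmeasM bct (bw false i)).
  have be r i := bmeas_error DF FB k1 r i.
  have LE i z := linearized_packet k DF i z.
  have bLR i : bmeas (fun z => complex.Re (linearized A Vf u z i 0)).
    under eq_fun do rewrite (LE _ _).1.
    apply: bmeasD; first by apply: bmeasM => //; apply: bmeasB; apply: bmeasM => //; exact: bmeas_cst.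
    by case: (i == 0) => //; exact: bmeasN.
  have bLI i : bmeas (fun z => complex.Im (linearized A Vf u z i 0)).
    under eq_fun do rewrite (LE _ _).2.
    apply: bmeasD; first by apply: bmeasM => //; apply: bmeasD; apply: bmeasM => //; exact: bmeas_cst.
    by case: (i == 0) => //; exact: bmeasN.
  have out j m (z : space) l : 2 * k < `|z 0 l| -> cut F k j m z = 0 by exact: (cut_out F0 k1).
  have eout r i (z : space) l : 2 * k < `|z 0 l| -> error F k r i z = 0 by exact: (error_out F0 k1).
  have inu : in_L2 u.
    move=> i; split; [apply: (bmeas_Lfun k2 (f := fun z => Re_field u z i 0))|
      apply: (bmeas_Lfun k2 (f := fun z => Im_field u z i 0))].
    - by move: (bR i); congr (bmeas _); apply: funext => z; rewrite [RHS]mxE.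
    - by move=> z l hl; rewrite !mxE /= (out _ _ _ _ hl) mul0r.
    - by move: (bI i); congr (bmeas _); apply: funext => z; rewrite [RHS]mxE.
    - by move=> z l hl; rewrite !mxE /= (out _ _ _ _ hl) mul0r.
  have inL : in_L2 (linearized A Vf u).
    move=> i; split; [apply: (bmeas_Lfun k2 (f := fun z => Re_field (linearized A Vf u) z i 0))|
      apply: (bmeas_Lfun k2 (f := fun z => Im_field (linearized A Vf u) z i 0))].
    - by move: (bLR i); congr (bmeas _); apply: funext => z; rewrite [RHS]mxE.
    - move=> z l hl; rewrite mxE (LE i z).1 (out _ _ _ _ hl) !(eout _ _ _ _ hl).
      by rewrite mul0r add0r oppr0 if_same.
    - by move: (bLI i); congr (bmeas _); apply: funext => z; rewrite [RHS]mxE.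
    - move=> z l hl; rewrite mxE (LE i z).2 (out _ _ _ _ hl) !(eout _ _ _ _ hl).
      by rewrite mul0r add0r oppr0 if_same.
  have sm r : smooth_on setT (fun z => cut F k 0 0 z *: ph r z).
    apply: falg_smooth => l; rewrite (_ : (fun z => _) = (fun z => cut F k 0 0 z * ph r z l 0)).
      apply: falg_mul; first exact: falg_cut.
      by apply: falg_wave; [exact: ca.1|exact: ca.2|exact: cb.1|exact: cb.2].
    by apply: funext => w; rewrite mxE.
  have gc : graph_closure (linearized A Vf) u (linearized A Vf u).
    (* The packet is itself a test field, so a constant sequence shows that it belongs to the
       graph. *)
    split=> //; exists (fun=> u); split.
    - move=> _; split; [by rewrite Re_packet|by rewrite Im_packet|exists (2 * k) => z hz].
      have [l hl] : exists l, 2 * k < `|z 0 l|.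
        apply: contrapT => /forallNP h; move: hz; rewrite ltNge => /negP; apply.
        rewrite /Num.norm /= mx_normrE; apply: bigmax_le => [|[i l] _ /=]; first exact: ltW.
        by rewrite ord1 leNgt; apply/negP; exact: h.
      apply/colP => i; rewrite !mxE (out _ _ _ _ hl) !mul0r; by [].
    - by under eq_fun do rewrite L2norm_sub_self; exact: cvg_cst.
    - by under eq_fun do rewrite L2norm_sub_self; exact: cvg_cst.
  have [mA lA] := strips_measure N s0 dl0 dl1.
  have lower : ((Num.sqrt (c2 ^+ 2 * ((2 * dl * N%:R) * (2 * k) ^+ n)))%:E <= L2norm u)%E.
    rewrite L2norm_modulus; apply: (L2norm_ge (S := cylinder (strips s0 dl N) k)).
    - exact: modulus_measurable.
    - by apply: measurableI; [exact: (measurable_coordinate ord0 mA)|exact: measurable_forall_lift].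
    - by rewrite lebesgue_step_cylinder// lA lebesgue_box.
    - by rewrite !mulr_ge0 ?exprn_ge0// ltW.
    - move=> t [[m mN ht] h]; set z := tuple_row t.
      have hz l : `|z 0 l| <= k.
        rewrite mxE; have [i ->|->] := unliftP ord0 l; first exact: h.
        have mN' : (m.+1%:R : R) <= N%:R by rewrite ler_nat.
        have aux (y : R) : s0 + m%:R - dl < y -> y < s0 + m%:R + dl -> `|y| <= k.
          by apply: (strip_bound _ _ dl1 hN); [|rewrite natr1].
        by move: ht; rewrite ltr_distl => /andP[]; exact: aux.
      have hn : c1 ^+ 2 <= (wv true 0 z).1 ^+ 2 + (wv true 0 z).2 ^+ 2
          + ((wv false 0 z).1 ^+ 2 + (wv false 0 z).2 ^+ 2).
        by rewrite wave_norm; apply: (low (m := m)); rewrite mxE.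
      have -> : c2 = Num.sqrt (c2 ^+ 2) by rewrite sqrtr_sqr ger0_norm// ltW.
      rewrite ger0_norm ?modulus_ge0// modulusE; apply: ler_wsqrtr.
      have ctl := cut_lower cc0 Fc k1 0 hz.
      rewrite !mxE /sel /=; move: (cut F k 0 0 z) ctl => x ctl.
      have x0 : 0 <= x by apply: le_trans ctl; rewrite exprn_ge0// ltW.
      rewrite !exprMn -!mulrDr ler_pM ?sqr_ge0//.
      by rewrite lerXn2r ?nnegrE// exprn_ge0// ltW.
    - exact: ltW.
  have upper : (L2norm (fun z => (Complex l1 l2 *: u z - linearized A Vf u z)%R) <=
      (Num.sqrt ((2 * (k^-1 * D)) ^+ 2 * (2 * (2 * k)) ^+ n.+1))%:E)%E.
    have RE i z := residual k DF i z.
    rewrite L2norm_modulus; apply: (L2norm_le (S := box (2 * k))).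
    - apply: modulus_measurable => i.
        under eq_fun do rewrite (RE _ _).1; apply: bmeasN.
        by case: (i == 0) => //; exact: bmeasN.
      under eq_fun do rewrite (RE _ _).2; apply: bmeasN.
      by case: (i == 0) => //; exact: bmeasN.
    - exact: measurable_box.
    - by rewrite exprn_ge0// mulr_ge0// ltW.
    - exact: lebesgue_box.
    - move=> t _; rewrite ger0_norm ?modulus_ge0//; apply: modulus_le => // i.
        by rewrite (RE i _).1 normrN; case: (i == 0); rewrite ?normrN err.
      by rewrite (RE i _).2 normrN; case: (i == 0); rewrite ?normrN err.
    - move=> t /existsNP[l /negP]; rewrite -ltNge => hl.
      have hz : 2 * k < `|(tuple_row t : space) 0 l| by rewrite mxE.
      rewrite modulusE !(RE _ _).1 !(RE _ _).2 !(eout _ _ _ _ hz).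
      by rewrite /= !oppr0 expr0n !addr0 sqrtr0.
    - by rewrite mulr_ge0.
  have nn : (0 <= L2norm (fun z => (Complex l1 l2 *: u z - linearized A Vf u z)%R))%E by exact: Lnorm_ge0.
  have := le_trans lower (hK _ _ gc).
  have Kn : (Kc%:E <= `|Kc|%:E)%E by rewrite lee_fin ler_norm.
  move/le_trans/(_ (lee_wpmul2r nn Kn)).
  have K0 : (0 <= `|Kc|%:E)%E by rewrite lee_fin.
  move/le_trans/(_ (lee_wpmul2l K0 upper)).
  rewrite -EFinM lee_fin -sqrtr_sqr -sqrtrM ?sqr_ge0// ler_psqrt//.
  - by rewrite nnegrE !mulr_ge0 ?sqr_ge0 ?exprn_ge0// ltW.
  - rewrite nnegrE; apply: mulr_ge0; first exact: sqr_ge0.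
    by apply: mulr_ge0; [exact: sqr_ge0|rewrite exprn_ge0// mulr_ge0// ltW].
(* After cancelling (2 k)^n the inequality reads q k <= M / k, which is false once N is large. *)
pose M := Kc ^+ 2 * D ^+ 2 * 16 * 2 ^+ n; pose q := c2 ^+ 2 * dl.
have q0 : 0 < q by rewrite mulr_gt0// exprn_gt0.
have M0 : 0 <= M.
  apply: mulr_ge0; last by rewrite exprn_ge0.
  by apply: mulr_ge0 => //; apply: mulr_ge0; exact: sqr_ge0.
have [N hN] : exists N : nat, `|s0| + 1 + M / q < N%:R.
  by exists (Num.bound (`|s0| + 1 + M / q)); apply: archi_boundP; rewrite !addr_ge0 ?divr_ge0// ltW.
have Mq : 0 <= M / q by rewrite divr_ge0// ltW.
have hN1 : `|s0| + 1 <= N%:R by lra.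
have := main N hN1; move=> /=; set k := 2 * N%:R.
have k1 : 1 <= k by have := normr_ge0 s0; rewrite /k; lra.
have kp : 0 < k by exact: lt_le_trans k1.
have -> : c2 ^+ 2 * (2 * dl * N%:R * (2 * k) ^+ n) = q * k * (2 * k) ^+ n by rewrite /q /k; ring.
have -> : Kc ^+ 2 * ((2 * (k^-1 * D)) ^+ 2 * (2 * (2 * k)) ^+ n.+1) = M * k^-1 * (2 * k) ^+ n.
  by rewrite [_ ^+ n.+1]exprS [(2 * (2 * k)) ^+ n]exprMn /M; field; rewrite gt_eqF.
rewrite ler_pM2r; last by rewrite exprn_gt0// mulr_gt0.
rewrite ler_pdivlMr// => h.
have : q * k <= M by apply: le_trans h; rewrite ler_peMr// mulr_ge0// ltW.
rewrite -ler_pdivlMl// mulrC => hk; move: hN; rewrite /k in hk.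
by have := normr_ge0 s0; have N0 : (0 : R) <= N%:R by []; lra.
Qed.

End WeylSequence.

Ltac Cinf_tac := repeat first
  [ assumption | exact: Cinf_cst | apply: CinfD | apply: CinfM | apply: CinfN ].

Section ComplexParts.
Variable R : realType.
Local Notation C := R[i].
Local Notation pC := (pmap2 (real_complex R)).

Definition pair_part (r : bool) (u : C * C) : R * R := (part r u.1, part r u.2).

(** The coefficients are real, so by linearity the operator commutes with taking real and imaginary
    parts. *)
Lemma hess_part r (k k1 k2 w1 w2 om c : R) (V V1 V2 : R * R) (y0 y1 y2 : C * C) :
  hess k k1 k2 w1 w2 om c V V1 V2 (pair_part r y0) (pair_part r y1) (pair_part r y2) =
  pair_part r (hess k%:C%C k1%:C%C k2%:C%C w1%:C%C w2%:C%C om%:C%C c%:C%C (pC V) (pC V1) (pC V2) y0 y1 y2).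
Proof.
have D (u : C * C) : u = (1 * (pC (pair_part true u)).1 + Complex 0 1 * (pC (pair_part false u)).1,
    1 * (pC (pair_part true u)).2 + Complex 0 1 * (pC (pair_part false u)).2).
  case: u => [[a1 b1] [a2 b2]]; rewrite /pmap2 /=.
  by congr (_, _); apply/eqP; rewrite eq_complex /=; apply/andP; split; apply/eqP; ring.
have HT := hess_morph (real_complex R) k k1 k2 w1 w2 om c V V1 V2 (pair_part true y0) (pair_part true y1) (pair_part true y2).
have HF := hess_morph (real_complex R) k k1 k2 w1 w2 om c V V1 V2 (pair_part false y0) (pair_part false y1) (pair_part false y2).
rewrite [in RHS](D y0) [in RHS](D y1) [in RHS](D y2) hess_linear HT HF.
case: r.
  move: (hess k k1 k2 w1 w2 om c V V1 V2 (pair_part true y0) (pair_part true y1) (pair_part true y2)) => p.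
  by rewrite [LHS]surjective_pairing /pair_part /pmap2 /part; congr (_, _) => /=; ring.
move: (hess k k1 k2 w1 w2 om c V V1 V2 (pair_part false y0) (pair_part false y1) (pair_part false y2)) => p.
by rewrite [LHS]surjective_pairing /pair_part /pmap2 /part; congr (_, _) => /=; ring.
Qed.

Lemma bcont_sq (f N : R -> R) (X : R) : 0 < X -> continuous f -> continuous N ->
  (forall x, N (x + X) = N x) -> (forall x, f x ^+ 2 <= N x) -> bcont f.
Proof.
move=> X0 cf cN NX fN; have [_ [M hM]] := bcont_periodic X0 NX cN.
split=> //; exists (M + 1) => x.
have h : `|f x| ^+ 2 <= M.
  by rewrite real_normK ?num_real//; apply: le_trans (fN x) (le_trans (ler_norm _) (hM x)).
have := normr_ge0 (f x); move: (`|f x|) h => t h t0; rewrite expr2 in h; nra.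
Qed.

End ComplexParts.

Section CoefficientSmoothness.
Variables (R : realType) (K0 K1 K2 W1 W2 : R -> R) (om c : R) (P : nat -> R -> R * R).

Lemma fam_Cinf i j : (forall x, K0 x != 0) ->
  [/\ Cinf K0, Cinf K1, Cinf K2, Cinf W1 & Cinf W2] -> (forall m, pair_Cinf (P m)) ->
  Cinf (A0 K0 K1 K2 W1 W2 om c P i j) /\ Cinf (A1 K0 i j).
Proof.
move=> K0n [k0 k1 k2 w1 w2] cP; have kv := CinfV K0n k0.
have [p00 p01] := cP 0%N; have [p10 p11] := cP 1%N; have [p20 p21] := cP 2%N.
have st (u1 u2 v1 v2 : R -> R) : Cinf u1 -> Cinf u2 -> Cinf v1 -> Cinf v2 ->
    Cinf (fun x => st4 (u1 x, u2 x) (v1 x, v2 x) i).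
  by move=> *; case: i => -[|[|[|[|//]]]] h.
have cst d : Cinf (fun _ : R => d) := Cinf_cst d.
split; apply: st => //.
- by apply: CinfM => //; rewrite /hbase /hess0 /vdot /vJ /=; Cinf_tac.
- by apply: CinfM => //; rewrite /hbase /hess0 /vdot /vJ /=; Cinf_tac.
- by apply: CinfM => //; exact: cst.
- by apply: CinfN; apply: CinfM => //; exact: cst.
Qed.

End CoefficientSmoothness.

(** * From the Bloch wave to the unstable spectrum *)

Section Instability.
Variables (R : realType) (n : nat) (kappa W g w : R -> R).
Hypothesis sg : smooth_on setT g.
Hypothesis sw : smooth_on setT w.
Hypothesis kappaE : forall r, 0 <= r -> kappa r = g r.
Hypothesis WE : forall r, 0 <= r -> W r = w r.
Hypothesis kappa_pos : exists2 k0 : R, 0 < k0 & forall r : R, 0 <= r -> k0 <= kappa r.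
Variables (O : set 'rV[R]_4) (V : 'rV[R]_4 -> R -> 'cV[R]_2).
Variables (X xi : 'rV[R]_4 -> R) (p0 : 'rV[R]_4).
Hypothesis fam : profile_family n.+1 kappa W O V X xi.
Hypothesis Op0 : O p0.
Variable U : R -> 'cV[R]_2.
Hypothesis hU : forall x, V p0 x = expJ (xi p0 / X p0 * x) *m U ((X p0)^-1 * x).
Local Notation C := R[i].
Local Notation "x %:C" := (real_complex R x) : ring_scope.
Local Notation rh := (rho V p0).
Local Notation P := (fun j => Vp V j p0).
Local Notation K k := (rD g k \o rh).
Local Notation Wd k := (rD w k \o rh).

Let Xp : 0 < X p0. Proof. exact: profile_X_pos fam Op0. Qed.

(** [lift ord0 ord0] is the first transverse coordinate y_1, available because space has dimension
    n.+2 here. The relation between V and U is solved for U by the inverse rotation. *)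
Lemma scaled_profileE : lift_x U = @profile_field R n.+1 (X p0) (xi p0) (lift ord0 ord0) P.
Proof.
apply: funext => z; apply/colP => i; rewrite wave_fieldE wave_profileE /trans /lift_x.
have Xn : X p0 != 0 by rewrite gt_eqF.
have E : Vp V 0 p0 (X p0 * z 0 0) = rot (cos (xi p0 * z 0 0)) (sin (xi p0 * z 0 0)) (pair_of (U (z 0 0))).
  rewrite -pair_of_expJ; have := hU (X p0 * z 0 0).
  rewrite mulKf// mulrA divfK// => <-; by [].
rewrite E /rot /pair_of /=; have cs := cos2Dsin2 (xi p0 * z 0 0).
by elim/ord2_ind: i; rewrite /sel /= -[LHS]mul1r -cs; ring.
Qed.

Lemma Vx_Cinf k i : Cinf (Vx V k p0 i).
Proof.
exists (fun m => Vx V (m + k)%N p0 i); split=> // m x; exact: (is_derive_Vx fam (m + k)%N i x Op0).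
Qed.

Lemma rho_Cinf (f : R -> R) k : smooth_on setT f -> Cinf (rD f k \o rh).
Proof.
move=> sf; apply: (@Cinf_comp R (rD f) rh (fun x => 2 * vdot (P 0%N x) (P 1%N x))).
- by move=> m x; exact: is_derive_rD.
- have c2 : Cinf (fun _ : R => 2 : R) := Cinf_cst 2.
  by apply: (CinfM c2); exact: (CinfD (CinfM (Vx_Cinf 0 0) (Vx_Cinf 1 0)) (CinfM (Vx_Cinf 0 1) (Vx_Cinf 1 1))).
- move=> x; have D := @is_derive_rho R _ _ x _ _ (is_derive_Vx fam 0 0 x Op0) (is_derive_Vx fam 0 1 x Op0)
    (fun y : R => y) (fun=> 1) (fun y => is_derive_id y (1 : R)).
  by apply: (is_derive_eq D); rewrite mul1r.
Qed.

Lemma profile_bcont m : pair_bcont (P m).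
Proof.
have cN : continuous (fun x => (P m x).1 ^+ 2 + (P m x).2 ^+ 2).
  have cN : Cinf (fun x => (P m x).1 * (P m x).1 + (P m x).2 * (P m x).2).
    exact: (CinfD (CinfM (Vx_Cinf m 0) (Vx_Cinf m 0)) (CinfM (Vx_Cinf m 1) (Vx_Cinf m 1))).
  by move=> x; exact: (Cinf_continuous cN).
have NX x : (P m (x + X p0)).1 ^+ 2 + (P m (x + X p0)).2 ^+ 2 = (P m x).1 ^+ 2 + (P m x).2 ^+ 2.
  rewrite (Vx_shift fam m x Op0) /rot /=; have cs := cos2Dsin2 (xi p0).
  by rewrite -[RHS]mul1r -cs; ring.
split; apply: (bcont_sq Xp _ cN NX) => [|x].
- by move=> x; exact: (Cinf_continuous (Vx_Cinf m 0)).
- by rewrite lerDl sqr_ge0.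
- by move=> x; exact: (Cinf_continuous (Vx_Cinf m 1)).
- by rewrite lerDr sqr_ge0.
Qed.

Lemma coef_bcont (f : R -> R) k : smooth_on setT f -> bcont (rD f k \o rh).
Proof.
move=> sf; apply: (bcont_periodic Xp) => [x|]; first by rewrite /= (rho_shift fam Op0).
by move=> x; exact: (Cinf_continuous (rho_Cinf k sf)).
Qed.

Lemma K_neq0 x : K 0 x != 0.
Proof.
have [k0 k00 kk] := kappa_pos; rewrite gt_eqF// (lt_le_trans k00)//.
by have := kk _ (rho_ge0 V p0 x); rewrite kappaE ?rho_ge0.
Qed.

Lemma A_Cinf i j :
  Cinf (A0 (K 0) (K 1) (K 2) (Wd 1) (Wd 2) (p0 0 0) (p0 0 1) P i j) /\
  Cinf (A1 (K 0) i j).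
Proof.
apply: fam_Cinf.
- exact: K_neq0.
- by split; [exact: rho_Cinf|exact: rho_Cinf|exact: rho_Cinf|exact: rho_Cinf|exact: rho_Cinf].
- by move=> m; split; exact: Vx_Cinf.
Qed.

Variables (z2 e : R) (z : C) (v : 'I_4 -> R -> C).
Hypothesis z20 : 0 <= z2.
Hypothesis e0 : 0 < e.
Hypothesis z0 : 0 < complex.Re z.
Local Notation sys := (sysmx (K 0) (K 1) (K 2) (Wd 1) (Wd 2) (p0 0 0) (p0 0 1) P z2 e z).
Definition bloch_derivative i x : C := \sum_j sys i j x * v j x.
Local Notation y := bloch_derivative.
Hypothesis Dv : forall i (x : R), cderiv (v i) x (y i x).
Hypothesis vX : forall i x, v i (x + X p0) =
  expi e * rotf (cos (xi p0)) (sin (xi p0)) (fun j => v j x) i.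
Hypothesis vn : exists i, v i 0 != 0.

Lemma is_derive_part r i (x : R) : is_derive x (1 : R) (fun t => part r (v i t)) (part r (y i x)).
Proof. by have [D1 D2] := Dv i x; case: r. Qed.

(** The coefficients of the system are smooth, so its solutions are; real and imaginary parts form a
    real system over ['I_4 * bool], to which [Cinf_ode] applies. *)
Lemma bloch_Cinf r i : Cinf (fun x => part r (v i x)).
Proof.
pose M (p q : 'I_4 * bool) x := part p.2 (sys p.1 q.1 x * unit_of R q.2).
apply: (@Cinf_ode R ('I_4 * bool)%type M (fun p x => part p.2 (v p.1 x)) _ _ (i, r)) => [p q|p x].
  have [c0 c1] := A_Cinf p.1 q.1.
  have E x : M p q x =
      A0 (K 0) (K 1) (K 2) (Wd 1) (Wd 2) (p0 0 0) (p0 0 1) P p.1 q.1 x * part p.2 (unit_of R q.2)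
      + A1 (K 0) p.1 q.1 x * part p.2 (e%:C * z * unit_of R q.2)
      + A2 p.1 q.1 x * part p.2 ((e ^+ 2 * z2)%:C * unit_of R q.2).
    have re (r0 : R) (u : C) b : part b (r0%:C * u) = r0 * part b u.
      by case: u => u1 u2; case: b => /=; ring.
    rewrite /M /sysmx /fam_mx -!re -!partD; congr part; ring.
  rewrite (funext E); have cst d : Cinf (fun _ : R => d) := Cinf_cst d.
  apply: CinfD; first by apply: CinfD; apply: CinfM => //; exact: cst.
  by apply: CinfM; [exact: cst|exact: cst].
apply: (is_derive_eq (is_derive_part p.2 p.1 x)).
rewrite /bloch_derivative -[X in part _ X]addr0 part_mulsum.
by rewrite [X in _ + X](_ : _ = 0) ?addr0//; case: (p.2).
Qed.

Definition bloch_part r (m : nat) x : R * R :=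
  match m with
  | 0%N => (part r (v 0 x), part r (v 1 x))
  | 1%N => (part r (v 2 x), part r (v 3 x))
  | _ => (part r (y 2 x), part r (y 3 x))
  end.

Lemma bloch_derivativeE x : [/\ y 0 x = v 2 x, y 1 x = v 3 x & True].
Proof. by split=> //; rewrite /y sysE. Qed.

Lemma bloch_jet r : jet_derive (bloch_part r).
Proof.
move=> [|[|//]] x _; split=> /=; try exact: is_derive_part.
  by have [<- _ _] := bloch_derivativeE x; exact: is_derive_part.
by have [_ <- _] := bloch_derivativeE x; exact: is_derive_part.
Qed.

(** v is quasi-periodic, but its squared modulus has period X, since exp (i e) and the rotation are
    isometries. Boundedness of v and the lower bound on the strips are both obtained through it. *)
Definition bloch_norm (m : nat) x : R :=
  (bloch_part true m x).1 ^+ 2 + (bloch_part true m x).2 ^+ 2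
  + ((bloch_part false m x).1 ^+ 2 + (bloch_part false m x).2 ^+ 2).

Lemma bloch_norm_shift m x : (m <= 1)%N -> bloch_norm m (x + X p0) = bloch_norm m x.
Proof.
have c1 := cos2Dsin2 (xi p0); have c2 := cos2Dsin2 e.
case: m => [|[|//]] _; rewrite /bloch_norm /= !vX /rotf /st4 /rot /fst4 /snd4 /expi /=.
  move: (v 0 x) (v 1 x) => [a1 b1] [a2 b2] /=.
  by rewrite -[RHS]mul1r -c1 -[RHS]mul1r -c2; ring.
move: (v 2 x) (v 3 x) => [a1 b1] [a2 b2] /=.
by rewrite -[RHS]mul1r -c1 -[RHS]mul1r -c2; ring.
Qed.

Lemma bloch_part_Cinf r m : (m <= 1)%N -> pair_Cinf (bloch_part r m).
Proof. by case: m => [|[|//]] _; split; exact: bloch_Cinf. Qed.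

Lemma bloch_norm_continuous m : (m <= 1)%N -> continuous (bloch_norm m).
Proof.
move=> m1; have [a1 a2] := bloch_part_Cinf true m1; have [b1 b2] := bloch_part_Cinf false m1.
have c : Cinf (bloch_norm m).
  exact: (CinfD (CinfD (CinfM a1 a1) (CinfM a2 a2)) (CinfD (CinfM b1 b1) (CinfM b2 b2))).
by move=> x; exact: (Cinf_continuous c).
Qed.

Lemma bloch_part_bcont r m : (m <= 1)%N -> pair_bcont (bloch_part r m).
Proof.
move=> m1; have [c1 c2] := bloch_part_Cinf r m1.
have NX x := bloch_norm_shift x m1; have cN := bloch_norm_continuous m1.
split; apply: (bcont_sq Xp _ cN NX) => [|x].
- by move=> x; exact: (Cinf_continuous c1).
- rewrite /bloch_norm; have := sqr_ge0 (bloch_part true m x).1; have := sqr_ge0 (bloch_part true m x).2.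
  have := sqr_ge0 (bloch_part false m x).1; have := sqr_ge0 (bloch_part false m x).2.
  by case: (r); lra.
- by move=> x; exact: (Cinf_continuous c2).
- rewrite /bloch_norm; have := sqr_ge0 (bloch_part true m x).1; have := sqr_ge0 (bloch_part true m x).2.
  have := sqr_ge0 (bloch_part false m x).1; have := sqr_ge0 (bloch_part false m x).2.
  by case: (r); lra.
Qed.

Local Notation lam := (e%:C * z).
Local Notation pC := (pmap2 (real_complex R)).

(** The first order system turned back into Hess v + lambda J v + eta^2 kappa v = 0, with lambda = e
    z and eta^2 = e^2 z2. *)
Lemma bloch_equation x : hess (K 0 x)%:C (K 1 x)%:C (K 2 x)%:C (Wd 1 x)%:C (Wd 2 x)%:C
    (p0 0 0)%:C (p0 0 1)%:C (pC (P 0%N x)) (pC (P 1%N x)) (pC (P 2%N x))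
    (v 0 x, v 1 x) (v 2 x, v 3 x) (y 2 x, y 3 x) =
  (- (lam * v 1 x) - ((e ^+ 2 * z2)%:C * (K 0 x)%:C) * v 0 x,
   lam * v 0 x - ((e ^+ 2 * z2)%:C * (K 0 x)%:C) * v 1 x).
Proof.
have kn : (K 0 x)%:C != 0 by rewrite fmorph_eq0 K_neq0.
pose H := hess0 (K 1 x)%:C (K 2 x)%:C (Wd 1 x)%:C (Wd 2 x)%:C (p0 0 0)%:C (p0 0 1)%:C
  (pC (P 0%N x)) (pC (P 1%N x)) (pC (P 2%N x)) (v 0 x, v 1 x) (v 2 x, v 3 x).
have E2 : y 2 x = (H.1 + lam * v 1 x) / (K 0 x)%:C + (e ^+ 2 * z2)%:C * v 0 x.
  by rewrite /bloch_derivative sysE.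
have E3 : y 3 x = (H.2 - lam * v 0 x) / (K 0 x)%:C + (e ^+ 2 * z2)%:C * v 1 x.
  by rewrite /bloch_derivative sysE.
transitivity (H.1 - (K 0 x)%:C * y 2 x, H.2 - (K 0 x)%:C * y 3 x); first by [].
rewrite E2 E3; clearbody H; move: (K 0 x)%:C kn => k kn.
by congr (_, _); field.
Qed.

Lemma bloch_real x :
  hess (K 0 x) (K 1 x) (K 2 x) (Wd 1 x) (Wd 2 x) (p0 0 0) (p0 0 1) (P 0%N x) (P 1%N x) (P 2%N x)
    (bloch_part true 0 x) (bloch_part true 1 x) (bloch_part true 2 x) =
  (- (complex.Re lam * (bloch_part true 0 x).2 - complex.Im lam * (bloch_part false 0 x).2)
     - e ^+ 2 * z2 * K 0 x * (bloch_part true 0 x).1,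
   complex.Re lam * (bloch_part true 0 x).1 - complex.Im lam * (bloch_part false 0 x).1
     - e ^+ 2 * z2 * K 0 x * (bloch_part true 0 x).2) /\
  hess (K 0 x) (K 1 x) (K 2 x) (Wd 1 x) (Wd 2 x) (p0 0 0) (p0 0 1) (P 0%N x) (P 1%N x) (P 2%N x)
    (bloch_part false 0 x) (bloch_part false 1 x) (bloch_part false 2 x) =
  (- (complex.Re lam * (bloch_part false 0 x).2 + complex.Im lam * (bloch_part true 0 x).2)
     - e ^+ 2 * z2 * K 0 x * (bloch_part false 0 x).1,
   complex.Re lam * (bloch_part false 0 x).1 + complex.Im lam * (bloch_part true 0 x).1
     - e ^+ 2 * z2 * K 0 x * (bloch_part false 0 x).2).
Proof.
have E r := hess_part r (K 0 x) (K 1 x) (K 2 x) (Wd 1 x) (Wd 2 x) (p0 0 0) (p0 0 1)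
  (P 0%N x) (P 1%N x) (P 2%N x) (v 0 x, v 1 x) (v 2 x, v 3 x) (y 2 x, y 3 x).
rewrite bloch_equation in E.
split; [apply: etrans (E true) _|apply: etrans (E false) _];
  rewrite /pair_part /part /bloch_part /=; move: lam (v 0 x) (v 1 x) (K 0 x) => [m1 m2] [a1 b1] [a2 b2] k /=;
  by congr (_, _); ring.
Qed.

(** If the first two coordinates vanished identically, so would their derivatives, which are the
    last two; but some coordinate is nonzero at 0. *)
Lemma bloch_norm_pos : exists x, 0 < bloch_norm 0 x.
Proof.
apply: contrapT => /forallNP h.
have N0 x : bloch_norm 0 x = 0.
  apply/le_anti/andP; split; first by rewrite leNgt; apply/negP/h.
  by rewrite /bloch_norm !addr_ge0 ?sqr_ge0.
have P0 r x : part r (v 0 x) = 0 /\ part r (v 1 x) = 0.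
  have := N0 x; rewrite /bloch_norm /= => E.
  have := sqr_ge0 (complex.Re (v 0 x)); have := sqr_ge0 (complex.Re (v 1 x)).
  have := sqr_ge0 (complex.Im (v 0 x)); have := sqr_ge0 (complex.Im (v 1 x)) => s1 s2 s3 s4.
  by case: r; split; apply/eqP; rewrite -sqrf_eq0 /=; apply/eqP; lra.
have P1 r x : part r (v 2 x) = 0 /\ part r (v 3 x) = 0.
  have [D1 D2] := @bloch_jet r 0 x isT; split.
    exact: (is_derive_unique (fun t => (P0 r t).1) D1 (is_derive_fcst 0 x (1 : R))).
  exact: (is_derive_unique (fun t => (P0 r t).2) D2 (is_derive_fcst 0 x (1 : R))).
have cz (u : C) : (forall r, part r u = 0) -> u = 0.
  by move=> hu; apply/eqP; rewrite eq_complex; apply/andP; split; apply/eqP; [exact: (hu true)|exact: (hu false)].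
have [i /eqP[]] := vn; apply: cz => r.
have [q0 q1] := P0 r 0; have [q2 q3] := P1 r 0.
case: i => -[|[|[|[|//]]]] hi.
- by rewrite (_ : Ordinal hi = 0)//; apply/val_inj.
- by rewrite (_ : Ordinal hi = 1)//; apply/val_inj.
- by rewrite (_ : Ordinal hi = 2)//; apply/val_inj.
- by rewrite (_ : Ordinal hi = 3)//; apply/val_inj.
Qed.

Lemma bloch_unstable :
  spectrally_unstable n.+1 kappa W (p0 0 0) (p0 0 1) (X p0) (xi p0) U.
Proof.
exists lam; first by rewrite ReM /= mul0r subr0 mulr_gt0.
rewrite (scaled_densityE _ kappaE WE) scaled_profileE.
have [x0 N0] := bloch_norm_pos.
have [d d0 hd] : exists2 d : R, 0 < d & forall x, `|x - x0| < d -> bloch_norm 0 x0 / 2 <= bloch_norm 0 x.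
  have cN := @bloch_norm_continuous 0 isT x0.
  have N2 : bloch_norm 0 x0 / 2 < bloch_norm 0 x0 by lra.
  have [d /= d0 hd] := (nbhs_ballP _ _).1 (cvgr_gt _ cN _ N2).
  exists d => // x hx; apply/ltW/hd; rewrite /ball /= distrC; exact: hx.
(* The radius d in x becomes d / X in the scaled variable, and the bound 1/2 keeps the strips
   disjoint. c1^2 is half of the squared modulus at x0. *)
pose dl := Num.min (2^-1) (d / X p0); pose c1 := Num.sqrt (bloch_norm 0 x0 / 2).
have dl0 : 0 < dl by rewrite /dl lt_min invr_gt0 ltr0n divr_gt0.
have dl1 : 2 * dl <= 1.
  have : dl <= 2^-1 by rewrite /dl ge_min lexx.
  by lra.
have c10 : 0 < c1 by rewrite sqrtr_gt0 divr_gt0.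
(* The transverse wave number is e times the square root of z2, real since z2 >= 0. *)
have etaE : (e * Num.sqrt z2) ^+ 2 = e ^+ 2 * z2 by rewrite exprMn sqr_sqrtr.
rewrite (_ : lam = Complex (complex.Re lam) (complex.Im lam)); last by case: (lam).
apply: (@weyl_spectrum R n.+1 (rD g 0) (rD g 1) (rD g 2) (rD w 0) (rD w 1) (rD w 2)
  (is_derive_rD sg 0) (is_derive_rD sg 1) (is_derive_rD sw 0) (is_derive_rD sw 1)
  (X p0) (xi p0) (e * Num.sqrt z2) (p0 0 0) (p0 0 1) (complex.Re lam) (complex.Im lam)
  (lift ord0 ord0) P (bloch_part true) (bloch_part false) Xp isT
  (fun m x _ => conj (is_derive_Vx fam m 0 x Op0) (is_derive_Vx fam m 1 x Op0))
  (@bloch_jet true) (@bloch_jet false)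
  (conj (Vx_Cinf 0 0) (Vx_Cinf 0 1)) (@bloch_part_Cinf true 0 isT) (@bloch_part_Cinf false 0 isT)
  (fun m _ => profile_bcont m) (@bloch_part_bcont true) (@bloch_part_bcont false)
  (coef_bcont 0 sg) (coef_bcont 1 sg) (coef_bcont 2 sg) (coef_bcont 1 sw) (coef_bcont 2 sw)
  _ _ (x0 / X p0) dl c1 dl0 dl1 c10).
- by move=> x; rewrite etaE; exact: (bloch_real x).1.
- by move=> x; rewrite etaE; exact: (bloch_real x).2.
(* Translation by m periods brings the point back near x0. *)
move=> m s hs; rewrite sqr_sqrtr; last by rewrite divr_ge0// ltW.
have NX x : bloch_norm 0 (x + X p0) = bloch_norm 0 x by exact: bloch_norm_shift.
have := periodic_nat NX m (X p0 * s - X p0 *+ m); rewrite subrK => NE.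
rewrite -/(bloch_norm 0 (X p0 * s)) NE; apply: hd.
have -> : X p0 * s - X p0 *+ m - x0 = X p0 * (s - (x0 / X p0 + m%:R)).
  by rewrite -[X p0 *+ m]mulr_natr; field; rewrite gt_eqF.
rewrite normrM gtr0_norm// mulrC -ltr_pdivlMr//; apply: lt_le_trans hs _.
by rewrite /dl ge_min lexx orbT.
Qed.

End Instability.

Theorem proposition5p4 (R : realType) (d : nat) (hd : (2 <= d)%N)
  (kappa W : R -> R)
  (hkappa : smooth_halfline kappa) (hW : smooth_halfline W)
  (hkappa_pos : exists2 k0 : R, 0 < k0 & forall r : R, 0 <= r -> k0 <= kappa r)
  (* smooth parametrization of the profiles near p0; V p0 is the wave *)
  (O : set 'rV[R]_4) (V : 'rV[R]_4 -> R -> 'cV[R]_2)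
  (X xi : 'rV[R]_4 -> R) (p0 : 'rV[R]_4)
  (hfamily : profile_family d.-1 kappa W O V X xi) (hp0 : O p0)
  (hvar : variable_modulus (V p0))
  (U : R -> 'cV[R]_2)
  (hU : forall x, V p0 x = expJ (xi p0 / X p0 * x) *m U ((X p0)^-1 * x))
  (hSigma : Sigma_t V X xi p0 \in unitmx)
  (delta : nat -> nat -> nat -> R)
  (hdelta : Delta0_coefficients (Sigma_t V X xi p0)
              (Sigma_y kappa (V p0) (X p0)) delta)
  (omega0 : R) (r0 : nat)
  (heig : eigenvalue (invmx (Sigma_t V X xi p0)) omega0)
  (hmult : mup omega0 (char_poly (invmx (Sigma_t V X xi p0))) = r0)
  (hcase :
     let N := delta 1%N 2%N 1%N + delta 2%N 1%N 1%N * omega0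
              + delta 3%N 0%N 1%N * omega0 ^+ 2 in
     ((3 <= r0)%N /\ N != 0) \/
     (r0 = 2%N /\
      N / ((r0`!)%:R^-1
           * derive1n r0 (fun lambda : R => Delta0 delta lambda 1 0) omega0)
      < 0)) :
  spectrally_unstable d.-1 kappa W (p0 0 0) (p0 0 1) (X p0) (xi p0) U.
Proof.
have [g sg kappaE] := hkappa; have [w sw WE] := hW.
have [z2 [e [z [v [z20 e0 z0 Dv [vX vn]]]]]] :=
  bloch_wave sg sw kappaE WE hkappa_pos hfamily hp0 hSigma hdelta heig hmult hcase.
(* The hypothesis d >= 2 leaves at least one transverse variable, along which the plane wave
   oscillates. *)
case: d hd hfamily => [|[|n]]// _ fam.
exact: (bloch_unstable sg sw kappaE WE hkappa_pos fam hp0 hU z20 e0 z0 Dv vX vn).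
Qed.
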